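(* Let $n$ be an integer with $n\geq 4$ and let $Q$ be the quiver of a cluster-tilted algebra of type $D_n$. Then $Q$ belongs to one of Type 1, Type 2, Type 3 or Type 4 (as defined in the context).
   Context: Fix a field $k$. Let $\mathbf{P}_n$ be the polygon with $n$ boundary vertices and one puncture in its center. For boundary vertices $a\ne b$, $\delta_{a,b}$ is the path along the boundary from $a$ to $b$ in counterclockwise direction not running through the same point twice, and $|\delta_{a,b}|$ is the number of vertices on it (including $a,b$). Two vertices are neighbors if $|\delta_{a,b}|\in\{2,n\}$; $b$ is the counterclockwise neighbor of $a$ if $|\delta_{a,b}|=2$. Tagged edges: $M_{a,b}$ for $a\neq b$ with $|\delta_{a,b}|\ge3$ (homotopy class of non-self-crossing paths in the interior of $\mathbf{P}_n$ from $a$ to $b$ homotopic to $\delta_{a,b}$), of length $|\delta_{a,b}|$; and $M_{a,a}^{\epsilon}$, $\epsilon=\pm1$ (drawn as a line from $a$ to the puncture, tagged if $\epsilon=-1$), of length $1$, called degenerate. The crossing number $e(M,N)$ is the minimal number of intersections of $M$ and $N$ in the interior of the punctured polygon, with $e(M,M)=0$ and $e(M_{a,a}^{\epsilon},M_{b,b}^{\epsilon'})=1$ if $a\neq b$ and $\epsilon\neq\epsilon'$, and $0$ otherwise. A triangulation is a maximal set of pairwise non-crossing tagged edges (it has $n$ elements). A double is a pair $\{M_{a,a}^1,M_{a,a}^{-1}\}$. The translation is $\tau M_{a,b}=M_{a',b'}$ $(a\ne b)$, $\tau M_{a,a}^\epsilon=M_{a',a'}^{-\epsilon}$, where $x'$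 is the clockwise neighbor of $x$. The category of tagged edges $\mathcal{C}$ is the $k$-linear additive category whose objects are direct sums of tagged edges, with morphisms spanned by sequences of elementary moves modulo mesh relations (for each tagged edge $M$, the sum of all compositions $\tau M\to X\to M$ of two elementary moves is zero); with $c,d$ the counterclockwise neighbors of $a,b$, the elementary moves are $M_{a,b}\to M_{a,d}$ if $3\le|\delta_{a,b}|\le n-1$; $M_{a,b}\to M_{c,b}$ if $4\le|\delta_{a,b}|\le n$; $M_{a,b}\to M_{a,a}^{\pm1}$ if $|\delta_{a,b}|=n$; $M_{a,a}^{\epsilon}\to M_{c,a}$. Let $H$ be a hereditary $k$-algebra of type $D_n$ and $\mathscr{C}_H=\mathscr{D}^b(\mathrm{mod}\,H)/\tau^{-1}[1]$ its cluster category; a cluster-tilted algebra of type $D_n$ is $\mathrm{End}_{\mathscr{C}_H}(T)^{\rm op}$ with $T$ a basic tilting object (direct sum of $n$ pairwise non-isomorphic indecomposables with $\mathrm{Ext}^1(T,T)=0$). There is (Schiffler) an equivalence $\varphi:\mathcal{C}\to\mathscr{C}_H$ compatible with $\tau$, sending triangulations $\Delta$ to basic tilting objects $\varphi(\Delta)$ (the direct sum of the images of the elements of $\Delta$). $Q_\Delta$ denotes the quiver of $\mathrm{End}_{\mathscr{C}_H}(\varphi(\Delta))^{\rm op}$ and $V_M$ its vertex corresponding to $M\in\Delta$. $\mathcal{M}^A$ denotes the union over $m\ge1$ of the mutation classes $\mathcal{M}^A_m$ of quivers of type $A_m$ (all quivers mutation equivalent to an orientation of the Dynkin diagram $A_m$).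 $Q$ belongs to one of the following types if $Q\cong Q_\Delta$ for a triangulation $\Delta$ of $\mathbf{P}_n$ as described, the quiver $Q_\Delta$ being of the described form: Type 1: $\Delta$ has a tagged edge $M=M_{a,b}$ with $|\delta_{a,b}|=n$. $Q_\Delta$ has two vertices $V_N,V_L$ (corresponding to the two degenerate edges $N,L$ of $\Delta$), each joined to $V_M$ by exactly one arrow (of either orientation) and incident with no other arrow, and $Q'=Q_\Delta\setminus\{V_N,V_L\}$ is in $\mathcal{M}^A$. Type 2: $\Delta$ has no tagged edge of length $n$ and has exactly two degenerate edges, forming a double $M_{a,a}^{1},M_{a,a}^{-1}$; there is $b\neq a$ with $M_{a,b},M_{b,a}\in\Delta$. $Q_\Delta$ consists of disjoint quivers $Q_1,Q_2\in\mathcal{M}^A$ with vertices $v_1\in Q_1$, $v_2\in Q_2$ (corresponding to $M_{a,b},M_{b,a}$ in some order), two further vertices $x,y$ (corresponding to the double), and additional arrows exactly $v_1\to x\to v_2$, $v_1\to y\to v_2$ and $v_2\to v_1$. Type 3: $\Delta$ has no tagged edge of length $n$ and has exactly two degenerate tagged edges, which are not a double; up to tags these are $M_{a,a}^1,M_{b,b}^1$ with $a,b$ not neighbors, and $M_{a,b},M_{b,a}\in\Delta$. $Q_\Delta$ consists of disjoint quivers $Q_1,Q_2\in\mathcal{M}^A$ with vertices $v_1\in Q_1$, $v_2\in Q_2$ (corresponding to $M_{a,b},M_{b,a}$ in some order), two further vertices $x,y$ (corresponding to the degenerate edges), and additional arrows exactly those of the oriented 4-cycle $v_1\to x\to v_2\to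 y\to v_1$. Type 4: $\Delta$ has exactly $t\ge3$ degenerate tagged edges. $Q_\Delta$ contains an oriented cycle $v_1\to v_2\to\cdots\to v_t\to v_1$ on the $t$ vertices corresponding to the degenerate edges; for each $i$ (indices mod $t$) either there is nothing further attached to the arrow $v_i\to v_{i+1}$ (when the boundary vertices belonging to $v_i,v_{i+1}$ are neighbors), or there is a quiver $Q_i\in\mathcal{M}^A$ with a vertex $v_{i,i+1}$ (corresponding to the tagged edge of $\Delta$ joining these two boundary vertices) and additional arrows $v_{i+1}\to v_{i,i+1}\to v_i$; the $Q_i$ are disjoint from each other and from the central cycle, and there are no other arrows. *)

(* Defs.v *)
From HB Require Import structures.
From mathcomp Require Import all_boot all_order all_algebra generic_quotient.
From mathcomp Require Import boolp classical_sets functions cardinality fsbigop.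
From mathcomp Require Import reals topology normedtype trigo.
From mathcomp Require Import zify.

Set Implicit Arguments.
Unset Strict Implicit.
Unset Printing Implicit Defensive.
Import Order.TTheory GRing.Theory Num.Theory.
Local Open Scope ring_scope.

Reserved Notation "g ** f" (at level 40, left associativity).

Record lincat (k : fieldType) := LinCat {
  ob :> Type;
  hom : ob -> ob -> lmodType k;
  idm : forall X, hom X X;
  cmp : forall X Y Z, hom Y Z -> hom X Y -> hom X Z;
  cmp1m : forall X Y (f : hom X Y), cmp (idm Y) f = f;
  cmpm1 : forall X Y (f : hom X Y), cmp f (idm X) = f;
  cmpA : forall X Y Z W (h : hom Z W) (g : hom Y Z) (f : hom X Y),
    cmp h (cmp g f) = cmp (cmp h g) f;
  cmpDl : forall X Y Z (g g' : hom Y Z) (f : hom X Y),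
    cmp (g + g') f = cmp g f + cmp g' f;
  cmpDr : forall X Y Z (g : hom Y Z) (f f' : hom X Y),
    cmp g (f + f') = cmp g f + cmp g f';
  cmpZl : forall X Y Z a (g : hom Y Z) (f : hom X Y),
    cmp (a *: g) f = a *: cmp g f;
  cmpZr : forall X Y Z a (g : hom Y Z) (f : hom X Y),
    cmp g (a *: f) = a *: cmp g f
}.
Arguments hom {k l} X Y.
Arguments idm {k l} X.
Arguments cmp {k l X Y Z} g f.

Notation "g ** f" := (cmp g f).

Section LinCatTheory.
Variables (k : fieldType) (C : lincat k).
Implicit Types X Y Z : C.

Lemma cmp0m X Y Z (f : hom X Y) : (0 : hom Y Z) ** f = 0.
Proof. by rewrite -(scale0r (0 : hom Y Z)) cmpZl scale0r. Qed.

Lemma cmpm0 X Y Z (g : hom Y Z) : g ** (0 : hom X Y) = 0.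
Proof. by rewrite -(scale0r (0 : hom X Y)) cmpZr scale0r. Qed.

Lemma cmp_suml X Y Z I (r : seq I) (P : pred I) (g : I -> hom Y Z)
    (f : hom X Y) :
  (\sum_(i <- r | P i) g i) ** f = \sum_(i <- r | P i) g i ** f.
Proof.
by elim/big_rec2: _ => [|i u v _ <-]; [exact: cmp0m | rewrite cmpDl].
Qed.

Lemma cmp_sumr X Y Z I (r : seq I) (P : pred I) (g : hom Y Z)
    (f : I -> hom X Y) :
  g ** (\sum_(i <- r | P i) f i) = \sum_(i <- r | P i) g ** f i.
Proof.
by elim/big_rec2: _ => [|i u v _ <-]; [exact: cmpm0 | rewrite cmpDr].
Qed.

Definition is_iso X Y (f : hom X Y) : Prop :=
  exists g : hom Y X, g ** f = idm X /\ f ** g = idm Y.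

Definition isomorphic X Y : Prop := exists f : hom X Y, is_iso f.

Definition is_direct_sum (X : C) (I : finType) (Y : I -> C) : Prop :=
  exists (inj : forall i, hom (Y i) X) (prj : forall i, hom X (Y i)),
    [/\ forall i, prj i ** inj i = idm (Y i),
        forall i j, i != j -> prj j ** inj i = 0
      & \sum_i inj i ** prj i = idm X].

Definition indecomposable X : Prop :=
  idm X <> 0 /\
  forall Y : bool -> C, is_direct_sum X Y ->
    idm (Y true) = 0 \/ idm (Y false) = 0.

End LinCatTheory.

Record functor (k : fieldType) (C D : lincat k) := Functor {
  fob :> C -> D;
  fmap : forall X Y : C, {linear hom X Y -> hom (fob X) (fob Y)};
  fmap1 : forall X : C, fmap X X (idm X) = idm (fob X);
  fmapM : forall (X Y Z : C) (g : hom Y Z) (f : hom X Y),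
    fmap X Z (g ** f) = fmap Y Z g ** fmap X Y f
}.
Arguments fmap {k C D} f0 {X Y}.

Section Functors.
Variable k : fieldType.
Implicit Types C D E : lincat k.

Definition id_functor C : functor C C :=
  @Functor _ C C id (fun X Y => idfun) (fun=> erefl)
    (fun X Y Z g f => erefl).

Section Composition.
Variables (C D E : lincat k) (G : functor D E) (F : functor C D).

Definition comp_fmap (X Y : C) : {linear hom X Y -> hom (G (F X)) (G (F Y))} :=
  @fmap _ _ _ G (F X) (F Y) \o @fmap _ _ _ F X Y.

Fact comp_fmap1 (X : C) : comp_fmap X X (idm X) = idm (G (F X)).
Proof. by rewrite /= !fmap1. Qed.

Fact comp_fmapM (X Y Z : C) (g : hom Y Z) (f : hom X Y) :
  comp_fmap X Z (g ** f) = comp_fmap Y Z g ** comp_fmap X Y f.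
Proof. by rewrite /= !fmapM. Qed.

Definition comp_functor : functor C E := Functor comp_fmap1 comp_fmapM.

End Composition.

Definition naturally_isomorphic C D (F G : functor C D) : Prop :=
  exists eta : forall X, hom (F X) (G X),
    (forall X, is_iso (eta X)) /\
    (forall X Y (f : hom X Y), eta Y ** fmap F f = fmap G f ** eta X).

Definition is_equivalence C D (F : functor C D) : Prop :=
  (forall X Y : C, bijective (@fmap _ _ _ F X Y)) /\
  (forall Y : D, exists X : C, isomorphic (F X) Y).

End Functors.

Section Families.
Variables (k : fieldType) (I : Type) (V : I -> lmodType k).

Definition vfam := forall i, V i.

HB.instance Definition _ := gen_eqMixin vfam.
HB.instance Definition _ := gen_choiceMixin vfam.

Definition vfam_add (u v : vfam) : vfam := fun i => u i + v i.
Definition vfam_opp (u : vfam) : vfam := fun i => - u i.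
Definition vfam_scale (a : k) (u : vfam) : vfam := fun i => a *: u i.

Fact vfam_addA : associative vfam_add.
Proof. by move=> u v w; apply: functional_extensionality_dep => i; apply: addrA. Qed.
Fact vfam_addC : commutative vfam_add.
Proof. by move=> u v; apply: functional_extensionality_dep => i; apply: addrC. Qed.
Fact vfam_add0 : left_id (fun=> 0) vfam_add.
Proof. by move=> u; apply: functional_extensionality_dep => i; apply: add0r. Qed.
Fact vfam_addN : left_inverse (fun=> 0) vfam_opp vfam_add.
Proof. by move=> u; apply: functional_extensionality_dep => i; apply: addNr. Qed.

HB.instance Definition _ := GRing.isZmodule.Build vfam
  vfam_addA vfam_addC vfam_add0 vfam_addN.

Fact vfam_scaleA a b (u : vfam) :
  vfam_scale a (vfam_scale b u) = vfam_scale (a * b) u.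
Proof. by apply: functional_extensionality_dep => i; apply: scalerA. Qed.
Fact vfam_scale1 : left_id 1 vfam_scale.
Proof. by move=> u; apply: functional_extensionality_dep => i; apply: scale1r. Qed.
Fact vfam_scaleDr : right_distributive vfam_scale +%R.
Proof. by move=> a u v; apply: functional_extensionality_dep => i; apply: scalerDr. Qed.
Fact vfam_scaleDl (u : vfam) : {morph vfam_scale^~ u : a b / a + b}.
Proof. by move=> a b; apply: functional_extensionality_dep => i; apply: scalerDl. Qed.

HB.instance Definition _ := GRing.Zmodule_isLmodule.Build k vfam
  vfam_scaleA vfam_scale1 vfam_scaleDr vfam_scaleDl.

Lemma vfamD (u v : vfam) i : (u + v) i = u i + v i.
Proof. by []. Qed.
Lemma vfamZ a (u : vfam) i : (a *: u) i = a *: u i.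
Proof. by []. Qed.
Lemma vfam0 i : (0 : vfam) i = 0.
Proof. by []. Qed.

Lemma vfamP (u v : vfam) : (forall i, u i = v i) -> u = v.
Proof. exact: functional_extensionality_dep. Qed.

End Families.

Section Terms.
Variables (k : fieldType) (V : Type) (gen : V -> V -> Type).

Inductive term : V -> V -> Type :=
| tid X : term X X
| tgen X Y : gen X Y -> term X Y
| tcmp X Y Z : term Y Z -> term X Y -> term X Z
| tzero X Y : term X Y
| tadd X Y : term X Y -> term X Y -> term X Y
| tscale X Y : k -> term X Y -> term X Y.

Definition tsum (I : Type) (s : seq I) X Y (F : I -> term X Y) : term X Y :=
  foldr (fun i => tadd (F i)) (tzero X Y) s.

Variable rel : forall X Y, term X Y -> term X Y -> Prop.

(* the least congruence that contains rel and for which terms modulo teq form a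
   k-linear category *)
Inductive teq : forall X Y, term X Y -> term X Y -> Prop :=
| teq_rel X Y (s t : term X Y) : rel s t -> teq s t
| teq_refl X Y (s : term X Y) : teq s s
| teq_sym X Y (s t : term X Y) : teq s t -> teq t s
| teq_trans X Y (s t u : term X Y) : teq s t -> teq t u -> teq s u
| teq_cmp X Y Z (s s' : term Y Z) (t t' : term X Y) :
    teq s s' -> teq t t' -> teq (tcmp s t) (tcmp s' t')
| teq_add X Y (s s' t t' : term X Y) :
    teq s s' -> teq t t' -> teq (tadd s t) (tadd s' t')
| teq_scale X Y a (s s' : term X Y) : teq s s' -> teq (tscale a s) (tscale a s')
| teq_cmp1t X Y (s : term X Y) : teq (tcmp (tid Y) s) s
| teq_cmpt1 X Y (s : term X Y) : teq (tcmp s (tid X)) s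
| teq_cmpA X Y Z W (s : term Z W) (t : term Y Z) (u : term X Y) :
    teq (tcmp s (tcmp t u)) (tcmp (tcmp s t) u)
| teq_cmpDl X Y Z (s s' : term Y Z) (t : term X Y) :
    teq (tcmp (tadd s s') t) (tadd (tcmp s t) (tcmp s' t))
| teq_cmpDr X Y Z (s : term Y Z) (t t' : term X Y) :
    teq (tcmp s (tadd t t')) (tadd (tcmp s t) (tcmp s t'))
| teq_cmpZl X Y Z a (s : term Y Z) (t : term X Y) :
    teq (tcmp (tscale a s) t) (tscale a (tcmp s t))
| teq_cmpZr X Y Z a (s : term Y Z) (t : term X Y) :
    teq (tcmp s (tscale a t)) (tscale a (tcmp s t))
| teq_addA X Y (s t u : term X Y) :
    teq (tadd s (tadd t u)) (tadd (tadd s t) u)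
| teq_addC X Y (s t : term X Y) : teq (tadd s t) (tadd t s)
| teq_add0 X Y (s : term X Y) : teq (tadd (tzero X Y) s) s
| teq_addN X Y (s : term X Y) : teq (tadd (tscale (-1) s) s) (tzero X Y)
| teq_scaleA X Y a b (s : term X Y) :
    teq (tscale a (tscale b s)) (tscale (a * b) s)
| teq_scale1 X Y (s : term X Y) : teq (tscale 1 s) s
| teq_scaleDr X Y a (s t : term X Y) :
    teq (tscale a (tadd s t)) (tadd (tscale a s) (tscale a t))
| teq_scaleDl X Y a b (s : term X Y) :
    teq (tscale (a + b) s) (tadd (tscale a s) (tscale b s)).

HB.instance Definition _ X Y := gen_eqMixin (term X Y).
HB.instance Definition _ X Y := gen_choiceMixin (term X Y).

Section Hom.
Variables X Y : V.

Definition teqb (s t : term X Y) : bool := `[< teq s t >].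

Fact teqb_refl : reflexive teqb.
Proof. by move=> s; apply/asboolP; apply: teq_refl. Qed.
Fact teqb_sym : symmetric teqb.
Proof. by move=> s t; apply/asboolP/asboolP; apply: teq_sym. Qed.
Fact teqb_trans : transitive teqb.
Proof. by move=> t s u /asboolP st /asboolP tu; apply/asboolP; apply: teq_trans tu. Qed.

Canonical teqb_equiv := EquivRel teqb teqb_refl teqb_sym teqb_trans.

Definition phom := {eq_quot teqb_equiv}%qT.
HB.instance Definition _ := Choice.on phom.

Definition tclass (t : term X Y) : phom := \pi_({eq_quot teqb_equiv})%qT t.
Definition trepr (f : phom) : term X Y := repr (f : {eq_quot teqb_equiv}%qT).

Lemma treprK f : tclass (trepr f) = f.
Proof. exact: reprK. Qed.

Lemma tclassP s t : tclass s = tclass t <-> teq s t.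
Proof.
split=> [e|e]; first by apply/asboolP; have /eqmodP := e.
by apply/eqmodP/asboolP.
Qed.

Lemma trepr_class t : teq (trepr (tclass t)) t.
Proof. by apply/tclassP; rewrite treprK. Qed.

Definition phom_zero : phom := tclass (tzero X Y).
Definition phom_add (f g : phom) : phom := tclass (tadd (trepr f) (trepr g)).
Definition phom_scale a (f : phom) : phom := tclass (tscale a (trepr f)).
Definition phom_opp (f : phom) : phom := phom_scale (-1) f.

Lemma phom_addE s t : phom_add (tclass s) (tclass t) = tclass (tadd s t).
Proof. by apply/tclassP; apply: teq_add; apply: trepr_class. Qed.
Lemma phom_scaleE a s : phom_scale a (tclass s) = tclass (tscale a s).
Proof. by apply/tclassP; apply: teq_scale; apply: trepr_class. Qed.

Fact phom_addA : associative phom_add.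
Proof.
move=> f g h; rewrite -(treprK f) -(treprK g) -(treprK h) !phom_addE.
exact/tclassP/teq_addA.
Qed.
Fact phom_addC : commutative phom_add.
Proof.
by move=> f g; rewrite -(treprK f) -(treprK g) !phom_addE; apply/tclassP/teq_addC.
Qed.
Fact phom_add0 : left_id phom_zero phom_add.
Proof. by move=> f; rewrite -(treprK f) phom_addE; apply/tclassP/teq_add0. Qed.
Fact phom_addN : left_inverse phom_zero phom_opp phom_add.
Proof.
move=> f; rewrite -(treprK f) /phom_opp phom_scaleE phom_addE.
exact/tclassP/teq_addN.
Qed.

HB.instance Definition _ := GRing.isZmodule.Build phom
  phom_addA phom_addC phom_add0 phom_addN.

Fact phom_scaleA a b f : phom_scale a (phom_scale b f) = phom_scale (a * b) f.
Proof. by rewrite -(treprK f) !phom_scaleE; apply/tclassP/teq_scaleA. Qed.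
Fact phom_scale1 : left_id 1 phom_scale.
Proof. by move=> f; rewrite -(treprK f) !phom_scaleE; apply/tclassP/teq_scale1. Qed.
Fact phom_scaleDr : right_distributive phom_scale +%R.
Proof.
move=> a f g; rewrite -(treprK f) -(treprK g).
rewrite [X in phom_scale a X]phom_addE !phom_scaleE [RHS]phom_addE.
exact/tclassP/teq_scaleDr.
Qed.
Fact phom_scaleDl f : {morph phom_scale^~ f : a b / a + b}.
Proof.
move=> a b /=; rewrite -(treprK f) !phom_scaleE [RHS]phom_addE.
exact/tclassP/teq_scaleDl.
Qed.

HB.instance Definition _ := GRing.Zmodule_isLmodule.Build k phom
  phom_scaleA phom_scale1 phom_scaleDr phom_scaleDl.

Lemma tclassD s t : tclass (tadd s t) = tclass s + tclass t.
Proof. by rewrite -phom_addE. Qed.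
Lemma tclassZ a s : tclass (tscale a s) = a *: tclass s.
Proof. by rewrite -phom_scaleE. Qed.
Lemma tclass0 : tclass (tzero X Y) = 0.
Proof. by []. Qed.

End Hom.

Definition phom_cmp X Y Z (g : phom Y Z) (f : phom X Y) : phom X Z :=
  tclass (tcmp (trepr g) (trepr f)).

Lemma phom_cmpE X Y Z (s : term Y Z) (t : term X Y) :
  phom_cmp (tclass s) (tclass t) = tclass (tcmp s t).
Proof. by apply/tclassP; apply: teq_cmp; apply: trepr_class. Qed.

Definition presented : lincat k.
Proof.
refine (@LinCat k V (fun X Y => phom X Y : lmodType k)
          (fun X => tclass (tid X)) phom_cmp _ _ _ _ _ _ _).
- by move=> X Y f; rewrite -(treprK f) phom_cmpE; apply/tclassP/teq_cmp1t.
- by move=> X Y f; rewrite -(treprK f) phom_cmpE; apply/tclassP/teq_cmpt1.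
- move=> X Y Z W h g f; rewrite -(treprK f) -(treprK g) -(treprK h) !phom_cmpE.
  exact/tclassP/teq_cmpA.
- move=> X Y Z g g' f; rewrite -(treprK f) -(treprK g) -(treprK g').
  by rewrite -tclassD !phom_cmpE -tclassD; apply/tclassP/teq_cmpDl.
- move=> X Y Z g f f'; rewrite -(treprK f) -(treprK g) -(treprK f').
  by rewrite -tclassD !phom_cmpE -tclassD; apply/tclassP/teq_cmpDr.
- move=> X Y Z a g f; rewrite -(treprK f) -(treprK g).
  by rewrite -tclassZ !phom_cmpE -tclassZ; apply/tclassP/teq_cmpZl.
- move=> X Y Z a g f; rewrite -(treprK f) -(treprK g).
  by rewrite -tclassZ !phom_cmpE -tclassZ; apply/tclassP/teq_cmpZr.
Defined.

Section Interpretation.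
Variables (D : lincat k) (F : V -> D).
Variable F1 : forall X Y, gen X Y -> hom (F X) (F Y).

Fixpoint interp X Y (t : term X Y) : hom (F X) (F Y) :=
  match t with
  | tid X => idm (F X)
  | tgen X Y u => F1 u
  | tcmp X Y Z s t => interp s ** interp t
  | tzero X Y => 0
  | tadd X Y s t => interp s + interp t
  | tscale X Y a s => a *: interp s
  end.

Hypothesis F1P : forall X Y (s t : term X Y), rel s t -> interp s = interp t.

Lemma interp_teq X Y (s t : term X Y) : teq s t -> interp s = interp t.
Proof.
elim=> {X Y s t} /=.
- exact: F1P.
- by [].
- by move=> X Y s t _ ->.
- by move=> X Y s t u _ -> _ ->.
- by move=> X Y Z s s' t t' _ -> _ ->.
- by move=> X Y s s' t t' _ -> _ ->.
- by move=> X Y a s s' _ ->.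
- by move=> X Y s; rewrite cmp1m.
- by move=> X Y s; rewrite cmpm1.
- by move=> *; rewrite cmpA.
- by move=> *; rewrite cmpDl.
- by move=> *; rewrite cmpDr.
- by move=> *; rewrite cmpZl.
- by move=> *; rewrite cmpZr.
- by move=> *; rewrite addrA.
- by move=> *; rewrite addrC.
- by move=> *; rewrite add0r.
- by move=> *; rewrite scaleN1r addNr.
- by move=> *; rewrite scalerA.
- by move=> *; rewrite scale1r.
- by move=> *; rewrite scalerDr.
- by move=> *; rewrite scalerDl.
Qed.

Definition interp_hom X Y (f : phom X Y) : hom (F X) (F Y) := interp (trepr f).

Lemma interp_homE X Y (t : term X Y) : interp_hom (tclass t) = interp t.
Proof. exact: interp_teq (trepr_class t). Qed.

Fact interp_hom_linear X Y : linear (@interp_hom X Y).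
Proof.
move=> a f g; rewrite -(treprK f) -(treprK g) -tclassZ -tclassD.
by rewrite !interp_homE.
Qed.

Definition presented_functor : functor presented D.
Proof.
pose m X Y : {linear phom X Y -> hom (F X) (F Y)} :=
  HB.pack (@interp_hom X Y)
    (GRing.isLinear.Build _ _ _ _ (@interp_hom X Y) (@interp_hom_linear X Y)).
apply: (@Functor _ presented D F m) => [X|X Y Z g f] /=.
  exact: interp_homE.
by rewrite -(treprK f) -(treprK g) phom_cmpE !interp_homE.
Defined.

End Interpretation.
End Terms.

Arguments tid {k V gen} X.
Arguments tgen {k V gen X Y} u.
Arguments tcmp {k V gen X Y Z} s t.
Arguments tzero {k V gen} X Y.
Arguments tadd {k V gen X Y} s t.
Arguments tscale {k V gen X Y} a s.

Section AdditiveHull.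
Variables (k : fieldType) (C : lincat k).

Record sumob := SumOb { sidx : finType; sterm : sidx -> C }.

Implicit Types X Y Z W : sumob.

Definition sumhom X Y : lmodType k :=
  vfam (fun i : sidx X => vfam (fun j : sidx Y => hom (sterm i) (sterm j))).

Definition diag_entry X (i j : sidx X) : hom (sterm i) (sterm j) :=
  match i =P j with
  | ReflectT e =>
      match e in _ = j' return hom (sterm i) (sterm j') with
      | erefl => idm (sterm i)
      end
  | ReflectF _ => 0
  end.

Definition sum_idm X : sumhom X X := fun i j => diag_entry i j.

Definition sum_cmp X Y Z (g : sumhom Y Z) (f : sumhom X Y) : sumhom X Z :=
  fun i l => \sum_j g j l ** f i j.

Lemma diag_entry_refl X (i : sidx X) : diag_entry i i = idm (sterm i).
Proof.
by rewrite /diag_entry; case: eqP => // e; rewrite (eq_irrelevance e erefl).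
Qed.

Lemma diag_entry_neq X (i j : sidx X) : i != j -> diag_entry i j = 0.
Proof. by rewrite /diag_entry; case: eqP. Qed.

Definition additive_hull : lincat k.
Proof.
refine (@LinCat k sumob sumhom sum_idm sum_cmp _ _ _ _ _ _ _).
- move=> X Y f; apply: vfamP => i; apply: vfamP => j; rewrite /sum_cmp /sum_idm /=.
  rewrite (bigD1 j) //= big1 => [|l lj].
    by rewrite addr0 diag_entry_refl cmp1m.
  by rewrite diag_entry_neq // cmp0m.
- move=> X Y f; apply: vfamP => i; apply: vfamP => j; rewrite /sum_cmp /sum_idm /=.
  rewrite (bigD1 i) //= big1 => [|l li].
    by rewrite addr0 diag_entry_refl cmpm1.
  by rewrite diag_entry_neq ?cmpm0 // eq_sym.
- move=> X Y Z W h g f; apply: vfamP => i; apply: vfamP => j; rewrite /sum_cmp /=.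
  under eq_bigr do rewrite cmp_sumr.
  rewrite exchange_big /=; apply: eq_bigr => l _; rewrite cmp_suml.
  by apply: eq_bigr => m _; rewrite cmpA.
- move=> X Y Z g g' f; apply: vfamP => i; apply: vfamP => j; rewrite !vfamD /sum_cmp /=.
  by rewrite -big_split; apply: eq_bigr => l _; rewrite !vfamD cmpDl.
- move=> X Y Z g f f'; apply: vfamP => i; apply: vfamP => j; rewrite !vfamD /sum_cmp /=.
  by rewrite -big_split; apply: eq_bigr => l _; rewrite !vfamD cmpDr.
- move=> X Y Z a g f; apply: vfamP => i; apply: vfamP => j; rewrite !vfamZ /sum_cmp /=.
  by rewrite scaler_sumr; apply: eq_bigr => l _; rewrite !vfamZ cmpZl.
- move=> X Y Z a g f; apply: vfamP => i; apply: vfamP => j; rewrite !vfamZ /sum_cmp /=.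
  by rewrite scaler_sumr; apply: eq_bigr => l _; rewrite !vfamZ cmpZr.
Defined.

Definition sum1 (M : C) : additive_hull := SumOb (fun _ : unit => M).

(* the projection of X to its summand of index i *)
Definition summand_idem (X : additive_hull) (i : sidx X) : hom X X :=
  ((fun j l => if j == i then diag_entry j l else 0) : sumhom X X).

End AdditiveHull.

(* The integral powers F^i of an autoequivalence F = F^1. As F need not be an
   automorphism, they satisfy F^i F^j = F^m for i + j = m and F^0 = 1 only up to
   coherent isomorphisms. The index m is kept separate from i + j so that no
   transport along equations between integers is needed. *)
Record powers (k : fieldType) (C : lincat k) := Powers {
  pw :> int -> functor C C;
  pw_mul : forall i j m : int, i + j = m ->
    forall X : C, hom (pw i (pw j X)) (pw m X);
  pw_unit : forall X : C, hom X (pw 0 X);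
  pw_mul_iso : forall i j m (e : i + j = m) X, is_iso (pw_mul e X);
  pw_unit_iso : forall X, is_iso (pw_unit X);
  pw_mul_nat : forall i j m (e : i + j = m) X Y (f : hom X Y),
    pw_mul e Y ** fmap (pw i) (fmap (pw j) f) = fmap (pw m) f ** pw_mul e X;
  pw_unit_nat : forall X Y (f : hom X Y),
    pw_unit Y ** f = fmap (pw 0) f ** pw_unit X;
  pw_mulA : forall i j l p q m (e1 : i + j = p) (e2 : p + l = m)
      (e3 : j + l = q) (e4 : i + q = m) X,
    pw_mul e2 X ** pw_mul e1 (pw l X) = pw_mul e4 X ** fmap (pw i) (pw_mul e3 X);
  pw_mul0l : forall i (e : 0 + i = i) X,
    pw_mul e X ** pw_unit (pw i X) = idm (pw i X);
  pw_mul0r : forall i (e : i + 0 = i) X,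
    pw_mul e X ** fmap (pw i) (pw_unit X) = idm (pw i X)
}.
Arguments pw_mul {k C} A {i j m} e X : rename.
Arguments pw_unit {k C} A X : rename.

Section Orbit.
Variables (k : fieldType) (C : lincat k) (A : powers C).
Implicit Types X Y Z W : C.

Definition gradedhom X Y : lmodType k := vfam (fun i : int => hom X (A i Y)).

Definition bounded_by X Y (N : nat) (f : gradedhom X Y) : Prop :=
  forall i : int, (N < `|i|)%N -> f i = 0.

Definition finsupp X Y : pred (gradedhom X Y) :=
  fun f => `[< exists N, bounded_by N f >].
Arguments finsupp : clear implicits.

Fact finsupp_submod X Y : submod_closed (finsupp X Y).
Proof.
split=> [|a f g /asboolP[N fN] /asboolP[M gM]]; apply/asboolP.
  by exists 0%N.
exists (maxn N M) => i; rewrite gtn_max => /andP[iN iM].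
by rewrite vfamD vfamZ fN // gM // scaler0 addr0.
Qed.

HB.instance Definition _ X Y :=
  GRing.isSubmodClosed.Build k (gradedhom X Y) (finsupp X Y)
    (@finsupp_submod X Y).

Record orbhom X Y := OrbHom {
  orbval : gradedhom X Y;
  orbvalP : finsupp X Y orbval
}.

HB.instance Definition _ X Y := [isSub for @orbval X Y].
HB.instance Definition _ X Y := [Choice of orbhom X Y by <:].
HB.instance Definition _ X Y :=
  [SubChoice_isSubLmodule of orbhom X Y by <:].

Lemma orbhomP X Y (f g : orbhom X Y) :
  (forall i, orbval f i = orbval g i) -> f = g.
Proof. by move=> fg; apply: val_inj; apply: vfamP. Qed.

Lemma orbvalD X Y (f g : orbhom X Y) i :
  orbval (f + g) i = orbval f i + orbval g i.
Proof. by []. Qed.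

Lemma orbvalZ X Y a (f : orbhom X Y) i : orbval (a *: f) i = a *: orbval f i.
Proof. by []. Qed.

Lemma orb_bounded X Y (f : orbhom X Y) : exists N, bounded_by N (orbval f).
Proof. exact/asboolP/(orbvalP f). Qed.

Definition window (N : nat) : seq int :=
  [seq (m%:Z - N%:Z)%R | m <- iota 0 (N + N).+1].

Lemma window_uniq N : uniq (window N).
Proof. by rewrite map_inj_uniq ?iota_uniq // => m m' /addIr []. Qed.

Lemma mem_window N (i : int) : (i \in window N) = (`|i| <= N)%N.
Proof.
apply/mapP/idP => [[m]|iN]; first by rewrite mem_iota => /= mN ->; lia.
exists `|(i + N%:Z)%R|%N; last by lia.
by rewrite mem_iota /=; lia.
Qed.

Lemma fsum_window (V : lmodType k) (F : int -> V) N :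
  (forall i, (N < `|i|)%N -> F i = 0) ->
  \sum_(i \in [set: int]) F i = \sum_(i <- window N) F i.
Proof.
move=> F0; rewrite (fsbigE (window N)) ?window_uniq // => [|i _].
  by apply: eq_bigl => i; rewrite in_setT.
by rewrite mem_window -ltnNge => /F0.
Qed.

(* the component of degree i + j of a composite *)
Definition orb_term X Y Z (g : gradedhom Y Z) (f : gradedhom X Y)
    (i j m : int) (e : i + j = m) : hom X (A m Z) :=
  pw_mul A e Z ** fmap (A i) (g j) ** f i.

Definition orb_cmp_val X Y Z (g : gradedhom Y Z) (f : gradedhom X Y) :
    gradedhom X Z :=
  fun m => \sum_(i \in [set: int]) orb_term g f (subrKC i m).

Lemma eq_orb_term X Y Z (g : gradedhom Y Z) (f : gradedhom X Y) i j j' m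
    (e : i + j = m) (e' : i + j' = m) : orb_term g f e = orb_term g f e'.
Proof.
have ej : j = j' by apply: (addrI i); rewrite e e'.
by move: e e'; rewrite ej => e e'; rewrite (Prop_irrelevance e e').
Qed.

Lemma orb_term0r X Y Z (g : gradedhom Y Z) (f : gradedhom X Y) i j m
  (e : i + j = m) : f i = 0 -> orb_term g f e = 0.
Proof. by rewrite /orb_term => ->; rewrite cmpm0. Qed.

Lemma orb_term0l X Y Z (g : gradedhom Y Z) (f : gradedhom X Y) i j m
  (e : i + j = m) : g j = 0 -> orb_term g f e = 0.
Proof. by rewrite /orb_term => ->; rewrite linear0 cmpm0 cmp0m. Qed.

Lemma orb_cmp_window X Y Z (g : gradedhom Y Z) (f : gradedhom X Y) N m :
  bounded_by N f ->
  orb_cmp_val g f m = \sum_(i <- window N) orb_term g f (subrKC i m).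
Proof. by move=> fN; apply: fsum_window => i /fN /orb_term0r ->. Qed.

Lemma orb_cmp_bounded X Y Z (g : gradedhom Y Z) (f : gradedhom X Y) N M :
  bounded_by M g -> bounded_by N f -> bounded_by (M + N) (orb_cmp_val g f).
Proof.
move=> gM fN m mMN; rewrite (orb_cmp_window _ _ fN) big1_seq // => i /andP[_].
by rewrite mem_window => iN; apply/orb_term0l/gM; lia.
Qed.

Fact orb_cmp_finsupp X Y Z (g : orbhom Y Z) (f : orbhom X Y) :
  finsupp X Z (orb_cmp_val (orbval g) (orbval f)).
Proof.
case: g f => [g /asboolP[M gM]] [f /asboolP[N fN]] /=.
by apply/asboolP; exists (M + N)%N; apply: orb_cmp_bounded.
Qed.

Definition orb_cmp X Y Z (g : orbhom Y Z) (f : orbhom X Y) : orbhom X Z :=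
  OrbHom (orb_cmp_finsupp g f).

(* the morphism f : X -> Y, in degree zero *)
Definition deg0_val X Y (f : hom X Y) : gradedhom X Y := fun i =>
  match 0 =P i with
  | ReflectT e =>
      match e in _ = i' return hom X (A i' Y) with
      | erefl => pw_unit A Y ** f
      end
  | ReflectF _ => 0
  end.

Lemma deg0_val0 X Y (f : hom X Y) : deg0_val f 0 = pw_unit A Y ** f.
Proof.
by rewrite /deg0_val; case: eqP => // e; rewrite (eq_irrelevance e erefl).
Qed.

Lemma deg0_valN X Y (f : hom X Y) i : i != 0 -> deg0_val f i = 0.
Proof. by rewrite eq_sym /deg0_val; case: eqP. Qed.

Lemma deg0_bounded X Y (f : hom X Y) : bounded_by 0 (deg0_val f).
Proof. by move=> i i0; apply: deg0_valN; rewrite -absz_gt0. Qed.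

Fact deg0_finsupp X Y (f : hom X Y) : finsupp X Y (deg0_val f).
Proof. by apply/asboolP; exists 0%N; apply: deg0_bounded. Qed.

Definition deg0 X Y (f : hom X Y) : orbhom X Y := OrbHom (deg0_finsupp f).

Fact orb_cmp1m X Y (f : orbhom X Y) : orb_cmp (deg0 (idm Y)) f = f.
Proof.
apply: orbhomP => m /=; case: f => f /= /asboolP[N fN].
rewrite (orb_cmp_window _ _ fN).
have term0 i : i != m ->
    orb_term (deg0_val (idm Y)) f (subrKC i m) = 0.
  by move=> im; apply/orb_term0l/deg0_valN; rewrite subr_eq0 eq_sym.
have [mN|mN] := boolP (m \in window N); last first.
  rewrite fN ?ltnNge -?mem_window // big1_seq // => i /andP[_ iN].
  by apply: term0; apply: contraNneq mN => <-.
rewrite (bigD1_seq m) ?window_uniq //= big1 => [|i /term0 //].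
rewrite addr0 (eq_orb_term _ _ _ (addr0 m)) /orb_term deg0_val0 cmpm1.
by rewrite pw_mul0r cmp1m.
Qed.

Fact orb_cmpm1 X Y (f : orbhom X Y) : orb_cmp f (deg0 (idm X)) = f.
Proof.
apply: orbhomP => m /=; rewrite (orb_cmp_window _ _ (@deg0_bounded _ _ _)).
rewrite (bigD1_seq 0) ?window_uniq ?mem_window //= big1 => [|i i0].
  rewrite addr0 (eq_orb_term _ _ _ (add0r m)) /orb_term deg0_val0 cmpm1.
  by rewrite -cmpA -pw_unit_nat cmpA pw_mul0l cmp1m.
by apply/orb_term0r/deg0_valN.
Qed.

Lemma orb_termA X Y Z W (h : gradedhom Z W) (g : gradedhom Y Z)
    (f : gradedhom X Y) i j l p q m (e1 : i + j = p) (e2 : p + l = m)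
    (e3 : j + l = q) (e4 : i + q = m) :
  pw_mul A e4 W ** fmap (A i) (orb_term h g e3) ** f i =
  pw_mul A e2 W ** fmap (A p) (h l) ** orb_term g f e1.
Proof.
rewrite /orb_term !fmapM !cmpA -(@pw_mulA _ _ A _ _ _ _ _ _ e1 e2 e3 e4).
rewrite -[_ ** _ ** fmap (A i) (fmap (A j) (h l))]cmpA pw_mul_nat.
by rewrite !cmpA.
Qed.

Fact orb_cmpA X Y Z W (h : orbhom Z W) (g : orbhom Y Z) (f : orbhom X Y) :
  orb_cmp h (orb_cmp g f) = orb_cmp (orb_cmp h g) f.
Proof.
apply: orbhomP => m /=.
have [[M gM] [N fN]] := (orb_bounded g, orb_bounded f).
case: h g f gM fN => h _ [g _] [f _] /= gM fN.
rewrite (orb_cmp_window _ _ (orb_cmp_bounded gM fN)) (orb_cmp_window _ _ fN).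
pose S i p := pw_mul A (subrKC p m) W ** fmap (A p) (h (m - p)) **
  orb_term g f (subrKC i p).
transitivity (\sum_(p <- window (M + N)) \sum_(i <- window N) S i p).
  by apply: eq_bigr => p _; rewrite /orb_term (orb_cmp_window _ _ fN) cmp_sumr.
rewrite exchange_big /=; apply: eq_big_seq => i; rewrite mem_window => iN.
rewrite -(@fsum_window _ (S i)) => [|p pMN]; last first.
  by rewrite /S orb_term0l ?cmpm0 //; apply: gM; lia.
rewrite (reindex_fsbigT (fun j => i + j) (S i)); last first.
  by exists (fun p => p - i) => j; rewrite ?[i + j]addrC ?addrK ?subrKC.
rewrite (@fsum_window _ _ M) => [|j jM]; last first.
  rewrite /S orb_term0l ?cmpm0 //; apply: gM; lia.
rewrite /orb_term (orb_cmp_window _ _ gM) linear_sum cmp_sumr cmp_suml.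
apply: eq_bigr => j _; rewrite /S.
rewrite (eq_orb_term _ _ (subrKC i (i + j)) (erefl _)).
have e3 : j + (m - (i + j)) = m - i by lia.
by rewrite -(orb_termA _ _ _ _ _ e3 (subrKC i m)) (eq_orb_term _ _ e3 (subrKC j _)).
Qed.

Fact orb_cmpDl X Y Z (g g' : orbhom Y Z) (f : orbhom X Y) :
  orb_cmp (g + g') f = orb_cmp g f + orb_cmp g' f.
Proof.
apply: orbhomP => m; rewrite orbvalD /=; case: f => f /= /asboolP[N fN].
rewrite !(orb_cmp_window _ _ fN) -big_split; apply: eq_bigr => i _ /=.
by rewrite /orb_term vfamD linearD cmpDr cmpDl.
Qed.

Fact orb_cmpDr X Y Z (g : orbhom Y Z) (f f' : orbhom X Y) :
  orb_cmp g (f + f') = orb_cmp g f + orb_cmp g f'.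
Proof.
apply: orbhomP => m; rewrite orbvalD /=.
case: f f' => f /= /asboolP[N fN] [f' /= /asboolP[N' fN']].
have fB : bounded_by (maxn N N') f.
  by move=> i; rewrite gtn_max => /andP[/fN].
have fB' : bounded_by (maxn N N') f'.
  by move=> i; rewrite gtn_max => /andP[_ /fN'].
have sB : bounded_by (maxn N N') (f + f').
  by move=> i iN; rewrite vfamD fB // fB' // addr0.
rewrite (orb_cmp_window _ _ fB) (orb_cmp_window _ _ fB') (orb_cmp_window _ _ sB).
by rewrite -big_split; apply: eq_bigr => i _ /=; rewrite /orb_term vfamD cmpDr.
Qed.

Fact orb_cmpZl X Y Z a (g : orbhom Y Z) (f : orbhom X Y) :
  orb_cmp (a *: g) f = a *: orb_cmp g f.
Proof.
apply: orbhomP => m; rewrite orbvalZ /=; case: f => f /= /asboolP[N fN].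
rewrite !(orb_cmp_window _ _ fN) scaler_sumr; apply: eq_bigr => i _ /=.
by rewrite /orb_term vfamZ linearZ cmpZr cmpZl.
Qed.

Fact orb_cmpZr X Y Z a (g : orbhom Y Z) (f : orbhom X Y) :
  orb_cmp g (a *: f) = a *: orb_cmp g f.
Proof.
apply: orbhomP => m; rewrite orbvalZ /=; case: f => f /= /asboolP[N fN].
have aN : bounded_by N (a *: f) by move=> i /fN; rewrite vfamZ => ->; rewrite scaler0.
rewrite (orb_cmp_window _ _ fN) (orb_cmp_window _ _ aN) scaler_sumr.
by apply: eq_bigr => i _ /=; rewrite /orb_term vfamZ cmpZr.
Qed.

(* C / F: the morphisms from X to Y are the direct sum over i of the spaces
   hom X (F^i Y), and g ** f is F^i(g) ** f for f of degree i *)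
Definition orbit_category : lincat k :=
  @LinCat k (ob C) (fun X Y => orbhom X Y : lmodType k)
    (fun X => deg0 (idm X)) orb_cmp orb_cmp1m orb_cmpm1 orb_cmpA
    orb_cmpDl orb_cmpDr orb_cmpZl orb_cmpZr.

End Orbit.

(* D_n consists of the chain 0 - 1 - ... - (n - 2) and of the edge
   (n - 3) - (n - 1). *)
Definition dynkinD_edge n (i j : 'I_n) : bool :=
  ((j == i.+1 :> nat) && (j.+1 < n)%N) || ((j.+1 == n) && (i.+3 == n)).

Definition orientation_of_dynkinD n (E : rel 'I_n) : Prop :=
  forall i j, [/\ E i j || E j i = dynkinD_edge i j || dynkinD_edge j i
                & ~~ (E i j && E j i)].

Section PathAlgebra.
Variables (k : fieldType) (H : algType k) (V : finType) (E : rel V).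

(* the paths of the quiver E: (x, p) is the path that starts in x and then runs
   through the vertices of p *)
Definition is_path (p : V * seq V) : bool := path E p.1 p.2.

Definition is_path_algebra : Prop :=
  exists b : V * seq V -> H,
    [/\ forall x p y q, is_path (x, p) -> is_path (y, q) ->
          b (x, p) * b (y, q) = if last x p == y then b (x, p ++ q) else 0,
        \sum_x b (x, [::]) = 1,
        forall (s : seq (V * seq V)) (c : V * seq V -> k),
          uniq s -> all is_path s -> \sum_(p <- s) c p *: b p = 0 ->
          {in s, forall p, c p = 0}
      & forall h : H, exists (s : seq (V * seq V)) (c : V * seq V -> k),
          all is_path s /\ h = \sum_(p <- s) c p *: b p].

End PathAlgebra.

(* the path algebras of the quivers with underlying graph D_n *)
Definition hereditary_of_type_D (n : nat) (k : fieldType) (H : algType k) :=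
  exists2 E : rel 'I_n, orientation_of_dynkinD E & is_path_algebra H E.

Section Derived.
Variables (k : fieldType) (H : algType k).

(* Finite-dimensional H-modules: H acts from the right, on row vectors. The
   choice of a side is immaterial, since the opposite of a hereditary algebra of
   type D_n is one as well. *)
Record hmod := HMod {
  mdim :> nat;
  mact : {linear H -> 'M[k]_mdim};
  mact1 : mact 1 = 1%:M;
  mactM : forall x y, mact (x * y) = mact x *m mact y
}.

Definition is_hlinear (M N : hmod) (f : 'M[k]_(M, N)) : Prop :=
  forall h, mact M h *m f = f *m mact N h.

Record complex := Complex {
  cterm :> int -> hmod;
  cdiff : forall i, 'M[k]_(cterm i, cterm (i + 1));
  cdiff_hlinear : forall i, is_hlinear (cdiff i);
  cdiff2 : forall i, cdiff i *m cdiff (i + 1) = 0;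
  cbounded : exists N : nat, forall i : int, (N < `|i|)%N -> mdim (cterm i) = 0%N
}.

Record chain_map (X Y : complex) := ChainMap {
  chmap :> forall i, 'M[k]_(X i, Y i);
  chmap_hlinear : forall i, is_hlinear (chmap i);
  chmap_comm : forall i, chmap i *m cdiff Y i = cdiff X i *m chmap (i + 1)
}.

Definition is_quasi_iso X Y (f : chain_map X Y) : Prop :=
  forall i : int,
    (forall y : 'rV[k]_(Y (i + 1)), y *m cdiff Y (i + 1) = 0 ->
       exists (x : 'rV[k]_(X (i + 1))) (z : 'rV[k]_(Y i)),
         x *m cdiff X (i + 1) = 0 /\ y = x *m f (i + 1) + z *m cdiff Y i) /\
    (forall x : 'rV[k]_(X (i + 1)), x *m cdiff X (i + 1) = 0 ->
       (exists z : 'rV[k]_(Y i), x *m f (i + 1) = z *m cdiff Y i) ->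
       exists w : 'rV[k]_(X i), x = w *m cdiff X i).

(* D^b(mod H) is the localization of the category of bounded complexes at the
   quasi-isomorphisms: it is generated by the chain maps and by formal inverses
   of the quasi-isomorphisms. Homotopic chain maps need no relation of their
   own, since they become equal in every such localization. *)
Definition dgen (X Y : complex) : Type :=
  (chain_map X Y + {s : chain_map Y X | is_quasi_iso s})%type.

Definition chain X Y (f : chain_map X Y) : term k dgen X Y := tgen (inl f).

Definition chainV X Y (s : chain_map Y X) (sq : is_quasi_iso s) :
  term k dgen X Y := tgen (inr (exist _ s sq)).

Inductive drel : forall X Y, term k dgen X Y -> term k dgen X Y -> Prop :=
| drel_id X (f : chain_map X X) :
    (forall i, f i = 1%:M) -> drel (chain f) (tid X)
| drel_cmp X Y Z (g : chain_map Y Z) (f : chain_map X Y) (h : chain_map X Z) :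
    (forall i, h i = f i *m g i) -> drel (chain h) (tcmp (chain g) (chain f))
| drel_add X Y (f g h : chain_map X Y) :
    (forall i, h i = f i + g i) -> drel (chain h) (tadd (chain f) (chain g))
| drel_scale X Y a (f h : chain_map X Y) :
    (forall i, h i = a *: f i) -> drel (chain h) (tscale a (chain f))
| drel_invl X Y (s : chain_map X Y) (sq : is_quasi_iso s) :
    drel (tcmp (chainV sq) (chain s)) (tid X)
| drel_invr X Y (s : chain_map X Y) (sq : is_quasi_iso s) :
    drel (tcmp (chain s) (chainV sq)) (tid Y).

Definition derived : lincat k := presented drel.

Section Shift.

Fact shift_diff_hlinear (X : complex) i : is_hlinear (- cdiff X (i + 1)).
Proof. by move=> h; rewrite mulmxN mulNmx cdiff_hlinear. Qed.

Fact shift_diff2 (X : complex) i :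
  (- cdiff X (i + 1)) *m (- cdiff X (i + 1 + 1)) = 0.
Proof. by rewrite mulmxN mulNmx opprK cdiff2. Qed.

Fact shift_bounded (X : complex) : exists N : nat, forall i : int,
  (N < `|i|)%N -> mdim (X (i + 1)) = 0%N.
Proof. by have [N XN] := cbounded X; exists N.+1 => i iN; apply: XN; lia. Qed.

Definition shift_complex (X : complex) : complex :=
  @Complex (fun i => X (i + 1)) (fun i => - cdiff X (i + 1))
    (@shift_diff_hlinear X) (@shift_diff2 X) (@shift_bounded X).

Fact shift_chain_comm X Y (f : chain_map X Y) (i : int) :
  f (i + 1) *m cdiff (shift_complex Y) i =
  cdiff (shift_complex X) i *m f (i + 1 + 1).
Proof. by rewrite /= mulmxN mulNmx chmap_comm. Qed.

Definition shift_chain X Y (f : chain_map X Y) :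
    chain_map (shift_complex X) (shift_complex Y) :=
  @ChainMap (shift_complex X) (shift_complex Y) (fun i => f (i + 1))
    (fun i => @chmap_hlinear _ _ f (i + 1)) (shift_chain_comm f).

Fact shift_quasi_iso X Y (f : chain_map X Y) :
  is_quasi_iso f -> is_quasi_iso (shift_chain f).
Proof.
move=> fq i; have [fsurj finj] := fq (i + 1); split=> [y|x] /=.
  rewrite mulmxN => /eqP; rewrite oppr_eq0 => /eqP /fsurj[x [z [x0 ->]]].
  by exists x, (- z); rewrite !mulmxN mulNmx x0 oppr0 opprK.
rewrite mulmxN => /eqP; rewrite oppr_eq0 => /eqP /finj xP [z xz].
have [|w ->] := xP; first by exists (- z); rewrite xz mulmxN mulNmx.
by exists (- w); rewrite mulmxN mulNmx opprK.
Qed.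

Definition shift_gen X Y (u : dgen X Y) :
    hom (shift_complex X : derived) (shift_complex Y) :=
  tclass drel match u with
    | inl f => chain (shift_chain f)
    | inr s => chainV (shift_quasi_iso (proj2_sig s))
    end.

Fact shift_rel X Y (s t : term k dgen X Y) :
  drel s t -> interp shift_gen s = interp shift_gen t.
Proof.
elim=> {X Y s t} /=.
- by move=> X f f1; apply/tclassP/teq_rel/drel_id => i; apply: f1.
- move=> X Y Z g f h hgf; rewrite [RHS]phom_cmpE.
  by apply/tclassP/teq_rel/drel_cmp => i; apply: hgf.
- move=> X Y f g h hfg; rewrite -[RHS]tclassD.
  by apply/tclassP/teq_rel/drel_add => i; apply: hfg.
- move=> X Y a f h hf; rewrite -[RHS]tclassZ.
  by apply/tclassP/teq_rel/drel_scale => i; apply: hf.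
- by move=> X Y s sq; rewrite [LHS]phom_cmpE; apply/tclassP/teq_rel/drel_invl.
- by move=> X Y s sq; rewrite [LHS]phom_cmpE; apply/tclassP/teq_rel/drel_invr.
Qed.

Definition shift : functor derived derived := presented_functor shift_rel.

End Shift.

(* The Auslander-Reiten translation of D^b(mod H) is the autoequivalence tau
   with Hom(Y, tau X) dual to Hom(X, Y[1]), naturally in X and Y. *)
Record ar_translation := ARTranslation {
  tau : functor derived derived;
  tauV : functor derived derived;
  tauVK : naturally_isomorphic (comp_functor tauV tau) (id_functor derived);
  tauKV : naturally_isomorphic (comp_functor tau tauV) (id_functor derived);
  ar_form : forall X Y : derived, hom Y (tau X) -> hom X (shift Y) -> k;
  ar_linearl : forall X Y (f : hom X (shift Y)),
    scalar (fun g : hom Y (tau X) => ar_form g f);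
  ar_linearr : forall X Y (g : hom Y (tau X)),
    scalar (fun f : hom X (shift Y) => ar_form g f);
  ar_natl : forall X X' Y (u : hom X X') (g : hom Y (tau X))
      (f : hom X' (shift Y)),
    ar_form (fmap tau u ** g) f = ar_form g (f ** u);
  ar_natr : forall X Y Y' (u : hom Y Y') (g : hom Y' (tau X))
      (f : hom X (shift Y)),
    ar_form (g ** u) f = ar_form g (fmap shift u ** f);
  ar_nondegl : forall X Y (g : hom Y (tau X)),
    (forall f : hom X (shift Y), ar_form g f = 0) -> g = 0;
  ar_nondegr : forall X Y (f : hom X (shift Y)),
    (forall g : hom Y (tau X), ar_form g f = 0) -> f = 0
}.

(* tau is determined up to natural isomorphism by ar_form, and the powers of
   tau^-1[1] up to coherent natural isomorphism: the cluster category is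
   determined up to equivalence. *)
Record cluster_data := ClusterData {
  cl_tau : ar_translation;
  cl_powers : powers derived;
  cl_powers1 : naturally_isomorphic (cl_powers 1)
                                    (comp_functor shift (tauV cl_tau))
}.

Definition cluster_category (c : cluster_data) : lincat k :=
  orbit_category (cl_powers c).

Section Cluster.
Variable c : cluster_data.
Local Notation CH := (cluster_category c).

Definition cl_shift (X : CH) : CH := shift (X : derived).
Definition cl_translate (X : CH) : CH := tau (cl_tau c) (X : derived).

Definition Ext1 (X Y : CH) : lmodType k := hom X (cl_shift Y).

Definition basic_tilting (n : nat) (T : CH) : Prop :=
  (exists S : 'I_n -> CH,
     [/\ forall i, indecomposable (S i),
         forall i j, i != j -> ~ isomorphic (S i) (S j)
       & is_direct_sum T S]) /\
  (forall f : Ext1 T T, f = 0).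

End Cluster.
End Derived.

Record quiver := Quiver {
  qvert :> finType;
  qarr : qvert -> qvert -> nat   (* the number of arrows *)
}.
Arguments qarr {Q} i j : rename.

Definition quiver_iso (Q Q' : quiver) : Prop :=
  exists2 f : Q -> Q', bijective f & forall i j, qarr (f i) (f j) = qarr i j.

Definition full_subquiver (Q : quiver) (S : {set Q}) : quiver :=
  @Quiver {v : Q | v \in S} (fun i j => qarr (val i) (val j)).

(* Fomin-Zelevinsky mutation at v of a quiver without loops and 2-cycles; the
   truncated subtraction removes the 2-cycles *)
Definition mutation (V : eqType) (q : V -> V -> nat) (v i j : V) : nat :=
  if (i == v) || (j == v) then q j i
  else ((q i j + q i v * q v j) - (q j i + q j v * q v i))%N.

Inductive mutation_equiv (V : eqType) (q : V -> V -> nat) :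
    (V -> V -> nat) -> Prop :=
| mutation_refl q' : (forall i j, q' i j = q i j) -> mutation_equiv q q'
| mutation_step q' q'' v : mutation_equiv q q' ->
    (forall i j, q'' i j = mutation q' v i j) -> mutation_equiv q q''.

Definition orientation_of_dynkinA m (q : 'I_m -> 'I_m -> nat) : Prop :=
  forall i j, (q i j + q j i)%N = ((j == i.+1 :> nat) || (i == j.+1 :> nat)).

(* the union of the mutation classes of type A_m for m >= 1 *)
Definition in_MA (Q : quiver) : Prop :=
  exists m (q0 q : 'I_m -> 'I_m -> nat),
    [/\ (0 < m)%N, orientation_of_dynkinA q0, mutation_equiv q0 q
      & quiver_iso Q (Quiver q)].

Section AlgebraQuiver.
Variables (k : fieldType) (A : lmodType k) (one : A) (mul : A -> A -> A).

Definition jacobson_radical (x : A) : Prop :=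
  forall a, exists b, mul b (one - mul a x) = one.

Definition jacobson_radical2 (x : A) : Prop :=
  exists m (y z : 'I_m -> A),
    [/\ forall i, jacobson_radical (y i), forall i, jacobson_radical (z i)
      & x = \sum_i mul (y i) (z i)].

Definition primitive_idempotent (e : A) : Prop :=
  [/\ mul e e = e, e <> 0
    & forall f g, mul f f = f -> mul g g = g -> mul f g = 0 -> mul g f = 0 ->
        e = f + g -> f = 0 \/ g = 0].

Definition basic_idempotents (I : finType) (e : I -> A) : Prop :=
  [/\ forall i, primitive_idempotent (e i),
      forall i j, i != j -> mul (e i) (e j) = 0,
      \sum_i e i = one
    & forall i j, i != j -> ~ exists x y, mul x y = e i /\ mul y x = e j].

Definition corner (e f : A) (P : A -> Prop) (x : A) : Prop :=
  P x /\ mul (mul e x) f = x.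

(* dim (U / W) = d, for subspaces W of U *)
Definition quotient_dim (U W : A -> Prop) (d : nat) : Prop :=
  exists u : 'I_d -> A, (forall i, U (u i)) /\
    (forall x, U x -> exists! c : {ffun 'I_d -> k},
       W (x - \sum_i c i *: u i)).

(* with paths composed from right to left: the number of arrows from i to j is
   dim e_j (r / r^2) e_i, for the radical r *)
Definition has_quiver_at (I : finType) (e : I -> A) (q : I -> I -> nat) : Prop :=
  basic_idempotents e /\
  forall i j, quotient_dim (corner (e j) (e i) jacobson_radical)
                           (corner (e j) (e i) jacobson_radical2) (q i j).

Definition has_quiver (Q : quiver) : Prop :=
  exists e : Q -> A, has_quiver_at e (@qarr Q).

End AlgebraQuiver.

Definition endop_mul (k : fieldType) (C : lincat k) (T : C) (f g : hom T T) :
  hom T T := g ** f.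

(* The boundary vertices are the elements of 'I_n in counterclockwise order;
   delta_len a b is |delta_{a,b}|. *)
Definition delta_len n (a b : 'I_n) : nat := ((b + n - a) %% n).+1.

Definition neighbors n (a b : 'I_n) : bool :=
  (delta_len a b == 2%N) || (delta_len a b == n).

(* Arc (a, b) is M_{a,b}; Deg a true is M_{a,a}^1 and Deg a false is
   M_{a,a}^{-1}. *)
Inductive tedge (n : nat) :=
| Arc of {p : 'I_n * 'I_n | (p.1 != p.2) && (3 <= delta_len p.1 p.2)%N}
| Deg of 'I_n & bool.

Section TaggedEdges.
Variable n : nat.
Local Notation edge := (tedge n).

Definition tedge_code (M : edge) :=
  match M with Arc p => inl p | Deg a e => inr (a, e) end.
Definition tedge_decode u : edge :=
  match u with inl p => Arc p | inr (a, e) => Deg a e end.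
Fact tedge_codeK : cancel tedge_code tedge_decode.
Proof. by case. Qed.

HB.instance Definition _ := Equality.copy edge (can_type tedge_codeK).
HB.instance Definition _ := Choice.copy edge (can_type tedge_codeK).
HB.instance Definition _ := Countable.copy edge (can_type tedge_codeK).
HB.instance Definition _ := Finite.copy edge (can_type tedge_codeK).

Definition is_arc (M : edge) (a b : 'I_n) : bool :=
  if M is Arc p then val p == (a, b) else false.

Definition degenerate (M : edge) : bool := if M is Deg _ _ then true else false.

Lemma delta_len_ord_pred (a b : 'I_n) :
  delta_len (ord_pred a) (ord_pred b) = delta_len a b.
Proof.
congr _.+1 => /=; have pred_mod (i : 'I_n) :
    ((i + n).-1 %% n)%N = if i == 0%N :> nat then n.-1 else i.-1.
  case: i => -[|i] ilt /=; first by rewrite add0n modn_small //; lia.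
  by rewrite modnDr modn_small //; lia.
rewrite !pred_mod; case: a b => [a alt] [b blt] /=.
case: (ltnP b a) => ba.
  rewrite [in RHS]modn_small; last by lia.
  case: ifP => /eqP b0; case: ifP => /eqP a0; try lia.
    rewrite (_ : (_ - _)%N = (n - a) + n)%N; last by lia.
    by rewrite modnDr modn_small; lia.
  by rewrite modn_small; lia.
rewrite (_ : (b + n - a)%N = (b - a) + n)%N; last by lia.
rewrite modnDr [in RHS]modn_small; last by lia.
case: ifP => /eqP b0; case: ifP => /eqP a0; try lia.
- by rewrite (_ : (_ - _)%N = (b - a) + n)%N ?modnDr ?modn_small; lia.
- by rewrite modn_small; lia.
- by rewrite (_ : (_ - _)%N = (b - a) + n)%N ?modnDr ?modn_small; lia.
Qed.

Fact arc_pred_subproof (p : 'I_n * 'I_n) :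
  (p.1 != p.2) && (3 <= delta_len p.1 p.2)%N ->
  (ord_pred p.1 != ord_pred p.2) &&
  (3 <= delta_len (ord_pred p.1) (ord_pred p.2))%N.
Proof. by rewrite delta_len_ord_pred (inj_eq (can_inj (@ord_predK n))). Qed.

Definition edge_translate (M : edge) : edge :=
  match M with
  | Arc p => Arc (exist _ (ord_pred (val p).1, ord_pred (val p).2)
                   (arc_pred_subproof (valP p)))
  | Deg a e => Deg (ord_pred a) (~~ e)
  end.

Definition elementary_move (M N : edge) : bool :=
  match M, N with
  | Arc p, Arc q =>
      let: (a, b) := val p in let: (a', b') := val q in
      [&& a' == a, b' == ordS b & (3 <= delta_len a b <= n.-1)%N] ||
      [&& a' == ordS a, b' == b & (4 <= delta_len a b <= n)%N]
  | Arc p, Deg a' _ =>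
      let: (a, b) := val p in (a' == a) && (delta_len a b == n)
  | Deg a _, Arc q => let: (a', b') := val q in (a' == ordS a) && (b' == a)
  | Deg _ _, Deg _ _ => false
  end.

Variable k : fieldType.

Definition move_gen (M N : edge) : Type := elementary_move M N.

(* the elementary move from M to N, or 0 if there is none *)
Definition move_term (M N : edge) : term k move_gen M N :=
  match @idP (elementary_move M N) with
  | ReflectT u => tgen u
  | ReflectF _ => tzero M N
  end.

Inductive mesh_rel : forall M N, term k move_gen M N -> term k move_gen M N -> Prop :=
| mesh M : mesh_rel
    (tsum (enum {: edge}) (fun X => tcmp (move_term X M) (move_term (edge_translate M) X)))
    (tzero (edge_translate M) M).

Definition tagged_edges : lincat k := additive_hull (presented mesh_rel).

Definition edge_object (M : edge) : tagged_edges :=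
  sum1 (M : presented mesh_rel).

Definition elements (Delta : {set edge}) : finType := {M : edge | M \in Delta}.

Definition edges_object (Delta : {set edge}) : tagged_edges :=
  @SumOb _ (presented mesh_rel) (elements Delta) (fun M => val M).

End TaggedEdges.

Section Geometry.
Import numFieldNormedType.Exports.
Local Open Scope classical_set_scope.
Variables (R : realType) (n : nat).
Local Notation plane := (R * R)%type.

(* P_n, realized as the closed unit disc punctured in 0, the boundary vertices
   being the n-th roots of unity *)
Definition punctured_polygon : set plane :=
  [set z | 0 < z.1 ^+ 2 + z.2 ^+ 2 <= 1].
Definition polygon_interior : set plane :=
  [set z | 0 < z.1 ^+ 2 + z.2 ^+ 2 < 1].

(* the boundary point that is x steps counterclockwise from the vertex 0 *)
Definition boundary_point (x : R) : plane :=
  (cos (2 * pi * x / n%:R), sin (2 * pi * x / n%:R)).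

Definition vertex_point (a : 'I_n) : plane := boundary_point a%:R.

Definition delta_path (a b : 'I_n) (t : R) : plane :=
  boundary_point (a%:R + t * (delta_len a b).-1%:R).

Definition path_homotopic (f g : R -> plane) : Prop :=
  exists h : plane -> plane,
    [/\ {within `[0, 1] `*` `[0, 1], continuous h},
        forall s t, s \in `[0, 1] -> t \in `[0, 1] ->
          punctured_polygon (h (s, t)),
        forall t, t \in `[0, 1] -> h (0, t) = f t /\ h (1, t) = g t
      & forall s, s \in `[0, 1] -> h (s, 0) = f 0 /\ h (s, 1) = f 1].

(* f is a path in the homotopy class M_{a,b} *)
Definition represents_arc (a b : 'I_n) (f : R -> plane) : Prop :=
  [/\ {within `[0, 1], continuous f},
      f 0 = vertex_point a /\ f 1 = vertex_point b,
      {in `[0, 1] &, injective f},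
      forall t, t \in `]0, 1[ -> polygon_interior (f t)
    & path_homotopic f (delta_path a b)].

(* the line from a to the puncture *)
Definition puncture_line (a : 'I_n) (t : R) : plane :=
  ((1 - t) * (vertex_point a).1, (1 - t) * (vertex_point a).2).

(* the interiors of the paths that represent M *)
Definition strands (M : tedge n) : set (set plane) :=
  match M with
  | Arc p =>
      [set f @` `]0, 1[ | f in represents_arc (val p).1 (val p).2]
  | Deg a _ => [set puncture_line a @` `]0, 1[]
  end.

Definition min_intersections (M N : tedge n) (m : nat) : Prop :=
  (exists S T, [/\ strands M S, strands N T & ((S `&` T) #= `I_m)%card]) /\
  (forall S T m', strands M S -> strands N T -> ((S `&` T) #= `I_m')%card ->
     (m <= m')%N).

(* e(M, N) = m *)
Definition crossing_number (M N : tedge n) (m : nat) : Prop :=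
  if M == N then m = 0%N else
  match M, N with
  | Deg a e, Deg b e' => m = ((a != b) && (e != e'))
  | _, _ => min_intersections M N m
  end.

Definition noncrossing_set (Delta : {set tedge n}) : Prop :=
  {in Delta &, forall M N, crossing_number M N 0}.

Definition triangulation (Delta : {set tedge n}) : Prop :=
  noncrossing_set Delta /\
  forall Delta' : {set tedge n},
    noncrossing_set Delta' -> Delta \subset Delta' -> Delta' = Delta.

End Geometry.

Section Schiffler.
Variables (R : realType) (k : fieldType) (n : nat) (H : algType k).
Variables (c : cluster_data H).
Variable phi : functor (tagged_edges n k) (cluster_category c).

Definition is_schiffler_equivalence : Prop :=
  [/\ is_equivalence phi,
      forall M : tedge n,
        isomorphic (phi (edge_object k (edge_translate M)))
                   (cl_translate (phi (edge_object k M)))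
    & forall Delta : {set tedge n}, triangulation R Delta ->
        basic_tilting n (phi (edges_object k Delta))].

(* q is the quiver of End(phi(Delta))^op, the vertex V_M of M in Delta being
   the projection to the summand phi(M) *)
Definition is_quiver_of_triangulation (Delta : {set tedge n})
    (q : elements Delta -> elements Delta -> nat) : Prop :=
  has_quiver_at (idm (phi (edges_object k Delta))) (@endop_mul _ _ _)
    (fun M : elements Delta =>
       fmap phi (summand_idem (X := edges_object k Delta) M)) q.

End Schiffler.

Section Types.
Variables (n : nat) (Delta : {set tedge n}).
Variable q : elements Delta -> elements Delta -> nat.
Local Notation vertex := (elements Delta).
Local Notation Q := (Quiver q).

Definition no_edge_of_length_n : Prop :=
  forall (M : vertex) a b, is_arc (val M) a b -> delta_len a b != n.

Definition degenerate_edges_are (N L : vertex) : Prop :=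
  N != L /\ forall M : vertex, degenerate (val M) = (M == N) || (M == L).

(* q has no arrows from i to j, except one if (i, j) is in s, unless both i and
   j are in S1 or both are in S2 *)
Definition additional_arrows (S1 S2 : {set vertex}) (s : seq (vertex * vertex)) :
    Prop :=
  forall i j, ~~ ((i \in S1) && (j \in S1)) -> ~~ ((i \in S2) && (j \in S2)) ->
    q i j = ((i, j) \in s).

Definition vertex_partition (S1 S2 : {set vertex}) (x y : vertex) : Prop :=
  [/\ S1 :|: S2 :|: [set x; y] = [set: vertex],
      [disjoint S1 & S2], [disjoint S1 & [set x; y]]
    & [disjoint S2 & [set x; y]]].

Definition type1 : Prop :=
  exists (M N L : vertex),
    [/\ exists a b, is_arc (val M) a b /\ delta_len a b = n,
        degenerate_edges_are N L,
        forall v, v \in [:: N; L] -> (q v M + q M v = 1)%N,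
        forall v w, v \in [:: N; L] -> w != M -> q v w = 0%N /\ q w v = 0%N
      & in_MA (@full_subquiver Q (~: [set N; L]))].

Definition type2 : Prop :=
  no_edge_of_length_n /\
  exists (a b : 'I_n) (S1 S2 : {set vertex}) (v1 v2 x y : vertex),
    [/\ a != b,
        [/\ val x = Deg a true, val y = Deg a false & degenerate_edges_are x y],
        is_arc (val v1) a b /\ is_arc (val v2) b a \/
        is_arc (val v1) b a /\ is_arc (val v2) a b,
        [/\ vertex_partition S1 S2 x y, v1 \in S1, v2 \in S2,
            in_MA (@full_subquiver Q S1) & in_MA (@full_subquiver Q S2)]
      & additional_arrows S1 S2
          [:: (v1, x); (x, v2); (v1, y); (y, v2); (v2, v1)]].

Definition type3 : Prop :=
  no_edge_of_length_n /\
  exists (a b : 'I_n) (e : bool) (S1 S2 : {set vertex}) (v1 v2 x y : vertex),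
    [/\ a != b /\ ~~ neighbors a b,
        [/\ val x = Deg a e, val y = Deg b e & degenerate_edges_are x y],
        is_arc (val v1) a b /\ is_arc (val v2) b a \/
        is_arc (val v1) b a /\ is_arc (val v2) a b,
        [/\ vertex_partition S1 S2 x y, v1 \in S1, v2 \in S2,
            in_MA (@full_subquiver Q S1) & in_MA (@full_subquiver Q S2)]
      & additional_arrows S1 S2 [:: (v1, x); (x, v2); (v2, y); (y, v1)]].

(* In type 4, v i is the i-th vertex of the central cycle, p i its boundary
   vertex, S i the set of vertices of Q_i (empty if nothing is attached to the
   arrow v i -> v (i + 1)), and w i the vertex of Q_i that is joined to v i and
   v (i + 1). *)
Definition attached t (v : 'I_t -> vertex) (p : 'I_t -> 'I_n)
    (S : 'I_t -> {set vertex}) (i : 'I_t) (w : vertex) : Prop :=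
  [/\ w \in S i, in_MA (@full_subquiver Q (S i)),
      is_arc (val w) (p i) (p (ordS i)) \/ is_arc (val w) (p (ordS i)) (p i)
    & forall u j, u \in S i ->
        q u (v j) = ((u == w) && (j == i)) /\
        q (v j) u = ((u == w) && (j == ordS i))].

Definition type4 : Prop :=
  exists t (v : 'I_t -> vertex) (p : 'I_t -> 'I_n) (S : 'I_t -> {set vertex}),
    [/\ (3 <= t)%N /\ injective v,
        [/\ forall i, exists e, val (v i) = Deg (p i) e,
            forall M : vertex, degenerate (val M) -> exists i, M = v i
          & forall i j, q (v i) (v j) = (j == ordS i)],
        [/\ forall i j, i != j -> [disjoint S i & S j],
            forall i j, v j \notin S i
          & forall M : vertex, (exists i, M = v i) \/ (exists i, M \in S i)],
        forall i, if neighbors (p i) (p (ordS i)) then S i = finset.set0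
                  else exists w, attached v p S i w
      & forall i j u w, i != j -> u \in S i -> w \in S j -> q u w = 0%N].

End Types.

Definition belongs_to (n : nat)
    (type : forall Delta : {set tedge n},
       (elements Delta -> elements Delta -> nat) -> Prop)
    (R : realType) (k : fieldType) (H : algType k) (c : cluster_data H)
    (phi : functor (tagged_edges n k) (cluster_category c)) (Q : quiver) : Prop :=
  exists (Delta : {set tedge n}) (q : elements Delta -> elements Delta -> nat),
    [/\ triangulation R Delta, is_quiver_of_triangulation phi q,
        quiver_iso Q (Quiver q) & type Delta q].

(* Main.v *)
(* A tagged edge is recorded by its start and its length. The mesh relations
   determine the morphisms of the category of tagged edges: between two
   non-crossing edges they form a space of dimension at most 1, with a degree rot
   that adds up along non-zero compositions, and two crossing edges M, N have a
   non-zero morphism M -> tau N or N -> tau M. By Serre duality in the cluster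
   category the latter means that Ext^1 does not vanish. Hence a basic tilting
   object is the image of a set of n pairwise non-crossing edges. Explicit curves
   show that these do not cross in the punctured polygon, and since every
   triangulation has n elements the set is a triangulation. Its quiver has one
   arrow for each morphism between two of its edges that does not factor through
   a third one. An arc cuts off a triangulated polygon, whose quiver consists of
   two smaller ones of the same kind glued along a 3-cycle; mutations inside the
   pieces make it linear with the arc at one end, so it is of type A. The four
   types are the possible configurations of the degenerate edges. *)
From HB Require Import structures.
From mathcomp Require Import all_boot all_order all_algebra reals.
From mathcomp Require Import boolp.
From mathcomp Require classical_sets functions cardinality fsbigop topology normedtype trigo.
From mathcomp Require Import zify ring lra.
Require Import Defs.

Set Implicit Arguments.
Unset Strict Implicit.
Unset Printing Implicit Defensive.
Import Order.TTheory GRing.Theory Num.Theory.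
Local Open Scope ring_scope.

Arguments cmp {k l X Y Z} g f : simpl never.
Arguments hom {k l} X Y : simpl never.

(** * Tagged edges in coordinates *)

(** The size of a triangulation is never read off from curves. A non-crossing set extends to a
    triangulation, whose image under the given equivalence is a tilting object and so has n
    summands. This bounds every non-crossing set by n, which makes n pairwise compatible edges a
    maximal set. Geometry enters only through disjoint representatives of compatible edges.

    The category of tagged edges is given by generators and relations. Upper bounds for its morphism
    spaces come from normal forms of words in rises and falls, which anticommute away from the
    degenerate edges. Lower bounds come from solutions of the mesh relations in k: these are
    functors to k, and they detect non-zero words. The degree counts elementary moves.

    In the orbit category tau is available on objects only, so the vanishing of Ext^1 passes to
    summands by Serre duality in the derived category. For this tau has to commute with the shift,
    which follows from the uniqueness of Serre forms.

    The definition of the quiver of an algebra leaves the idempotents free; that the result does not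
    depend on them is a separate step. *)

Definition off n (a b : 'I_n) : nat := ((b + n - a) %% n)%N.

Lemma offE n (a b : 'I_n) : off a b = if (a <= b)%N then (b - a)%N else (b + n - a)%N.
Proof.
rewrite /off; case: a b => [a ha] [b hb] /=; case: leqP => h.
  by rewrite -addnBAC // addnC modnDl modn_small //; lia.
by rewrite modn_small //; lia.
Qed.

Lemma delta_lenE n (a b : 'I_n) : delta_len a b = (off a b).+1.
Proof. by []. Qed.

Lemma ordSE n (a : 'I_n) : (ordS a : nat) = if (a.+1 == n)%N then 0%N else a.+1.
Proof.
case: a => a ha /=; case: eqP => [->|h]; first by rewrite modnn.
by rewrite modn_small //; lia.
Qed.

Lemma ord_predE n (a : 'I_n) : (ord_pred a : nat) = if (a == 0 :> nat)%N then n.-1 else a.-1.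
Proof.
case: a => -[|a] ha /=; first by rewrite add0n modn_small //; lia.
by rewrite modnDr modn_small //; lia.
Qed.

Lemma ord_eqE n (a b : 'I_n) : (a == b) = (a == b :> nat).
Proof. by []. Qed.

Section Combinatorics.
Variable n : nat.
Local Notation edge := (tedge n).
Implicit Types M N L : edge.

Definition start M : 'I_n := match M with Arc p => (val p).1 | Deg a _ => a end.

(** A degenerate edge gets length [n.+1]. It then continues the arcs with the same start, and every
    elementary move changes the length by exactly one, see [elementary_moveE]. *)
Definition elen M : nat :=
  match M with Arc p => delta_len (val p).1 (val p).2 | Deg _ _ => n.+1 end.

(** Arcs carry the tag [true] by convention, so that start, length and tag together determine an
    edge. *)
Definition tag M : bool := if M is Deg _ e then e else true.

Definition rises M N : bool := (start N == start M) && (elen N == (elen M).+1).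
Definition falls M N : bool := (start N == ordS (start M)) && ((elen N).+1 == elen M).

Lemma elen_arc M : degenerate M = false -> (3 <= elen M <= n)%N.
Proof.
case: M => [[[a b] /= /andP[_ h]]|a e] //= _.
by move: h; rewrite delta_lenE offE; case: a b => [a ha] [b hb] /=; case: ifP; lia.
Qed.

Lemma elen_deg M : degenerate M -> elen M = n.+1.
Proof. by case: M. Qed.

Lemma degenerateE M : degenerate M = (elen M == n.+1).
Proof.
case: M => [p|a e] /=; last by rewrite eqxx.
have := @elen_arc (Arc p) erefl; rewrite /=; lia.
Qed.

Lemma edge_inj M N : start M = start N -> elen M = elen N -> tag M = tag N -> M = N.
Proof.
case: M N => [[[a b] /= h]|a e] [[[c d] /= h']|c e'] //=.
- move=> ac; subst c; rewrite !delta_lenE => -[] bd _.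
  suff E : b = d by subst d; congr Arc; congr exist; apply: bool_irrelevance.
  apply: val_inj; move: bd; rewrite !offE.
  by case: a b d {h h'} => [a ha] [b hb] [d hd] /=; do 2 case: ifP; lia.
- have /= := @elen_arc (Arc (exist _ (a, b) h)) erefl; lia.
- have /= := @elen_arc (Arc (exist _ (c, d) h')) erefl; lia.
- by move=> -> _ ->.
Qed.

Lemma elementary_moveE M N : elementary_move M N = rises M N || falls M N.
Proof.
rewrite /rises /falls.
case: M N => [[[a b] /= h]|a e] [[[c d] /= h']|c e'] /=.
- move: h h'; rewrite !delta_lenE !offE !ord_eqE !ordSE.
  case: a b c d => [a ha] [b hb] [c hc] [d hd] /=.
  by repeat case: ifP; lia.
- move: h; rewrite !delta_lenE !offE !ord_eqE ?ordSE.
  case: a b c => [a ha] [b hb] [c hc] /=.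
  by repeat case: ifP; lia.
- move: h'; rewrite !delta_lenE !offE !ord_eqE ?ordSE.
  case: a d c => [a ha] [d hd] [c hc] /=.
  by repeat case: ifP; lia.
- by lia.
Qed.

(* compatibility is the combinatorial form of e(M, N) = 0: arcs are nested or
   have disjoint interiors, seen as arcs of the boundary circle *)
Definition compat M N : bool :=
  let o := off (start M) (start N) in let o' := off (start N) (start M) in
  match degenerate M, degenerate N with
  | true, true => (o == 0)%N || (tag M == tag N)
  | false, true => (o == 0)%N || (elen M <= o.+1)%N
  | true, false => (o' == 0)%N || (elen N <= o'.+1)%N
  | false, false => [|| o + elen N <= elen M, o' + elen M <= elen N
                      | (elen M <= o.+1) && (o + elen N <= n.+1)]%N
  end.

(* the degree of the non-zero morphisms M -> N, for M and N compatible, and 0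
   if there are none or if M = N *)
Definition rot M N : nat :=
  let o := off (start M) (start N) in
  if degenerate M && degenerate N then
    if (tag M == tag N) && (o <= n - 2)%N then o.*2 else 0%N
  else if o == 0%N then (elen N - elen M)%N
  else if (o + elen N == elen M)%N then (elen M - elen N)%N
  else if (o + elen N == n.+1)%N then ((n.+1).*2 - elen M - elen N)%N
  else 0%N.

Lemma offxx (a : 'I_n) : off a a = 0%N.
Proof. by rewrite offE leqnn subnn. Qed.

Lemma off_lt (a b : 'I_n) : (off a b < n)%N.
Proof. by rewrite offE; case: a b => [a ha] [b hb] /=; case: ifP; lia. Qed.

Lemma off_eq0 (a b : 'I_n) : (off a b == 0%N) = (a == b).
Proof. by rewrite offE ord_eqE; case: a b => [a ha] [b hb] /=; case: ifP; lia. Qed.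

Lemma off_sym (a b : 'I_n) : off b a = if off a b == 0%N then 0%N else (n - off a b)%N.
Proof. by rewrite !offE; case: a b => [a ha] [b hb] /=; repeat case: ifP; lia. Qed.

Lemma off_triangle (a b c : 'I_n) :
  off a c = if (off a b + off b c < n)%N then (off a b + off b c)%N
            else (off a b + off b c - n)%N.
Proof.
by rewrite !offE; case: a b c => [a ha] [b hb] [c hc] /=; repeat case: ifP; lia.
Qed.

Lemma off_inj (a b c : 'I_n) : off a b = off a c -> b = c.
Proof.
move=> E; apply: val_inj; move: E; rewrite !offE.
by case: a b c => [a ha] [b hb] [c hc] /=; repeat case: ifP; lia.
Qed.

Lemma off_ordS (a b : 'I_n) :
  off a (ordS b) = if ((off a b).+1 == n)%N then 0%N else (off a b).+1.
Proof.
by rewrite !offE ordSE; case: a b => [a ha] [b hb] /=; repeat case: ifP; lia.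
Qed.

Lemma off_pred (a b : 'I_n) :
  off a (ord_pred b) = if off a b == 0%N then n.-1 else (off a b).-1.
Proof.
by rewrite !offE ord_predE; case: a b => [a ha] [b hb] /=; repeat case: ifP; lia.
Qed.

Lemma compat_sym M N : compat M N = compat N M.
Proof.
rewrite /compat off_sym; have := off_lt (start N) (start M).
case: (boolP (degenerate M)) => dM; case: (boolP (degenerate N)) => dN //=.
  rewrite [tag M == _]eq_sym; case: ifP => /=; lia.
move: (elen_arc (negbTE dM)) (elen_arc (negbTE dN)); case: ifP => /=; lia.
Qed.

Lemma compatMM M : compat M M.
Proof. by rewrite /compat offxx !eqxx; case: degenerate => //=; rewrite leqnn. Qed.

Lemma rotMM M : rot M M = 0%N.
Proof. by rewrite /rot offxx eqxx subnn /=; case: ifP => //; case: ifP. Qed.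

End Combinatorics.

(** * Linear categories *)

Section Iso.
Variables (k : fieldType) (C : lincat k).
Implicit Types X Y Z : C.

Lemma isomorphicP X Y : isomorphic X Y <->
  exists (f : hom X Y) (g : hom Y X), g ** f = idm X /\ f ** g = idm Y.
Proof. by split=> [[f [g h]]|[f [g h]]]; exists f => //; exists g. Qed.

Lemma iso_refl X : isomorphic X X.
Proof. by apply/isomorphicP; exists (idm X), (idm X); rewrite cmp1m. Qed.

Lemma iso_sym X Y : isomorphic X Y -> isomorphic Y X.
Proof. by move=> /isomorphicP[f [g [h1 h2]]]; apply/isomorphicP; exists g, f. Qed.

Lemma iso_trans Y X Z : isomorphic X Y -> isomorphic Y Z -> isomorphic X Z.
Proof.
move=> /isomorphicP[f [f' [h1 h2]]] /isomorphicP[g [g' [h3 h4]]].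
apply/isomorphicP; exists (g ** f), (f' ** g'); split.
  by rewrite -cmpA (cmpA g') h3 cmp1m.
by rewrite -cmpA (cmpA f) h2 cmp1m.
Qed.

Lemma is_iso_iso X Y (f : hom X Y) : is_iso f -> isomorphic X Y.
Proof. by exists f. Qed.

Definition hom0 X Y := forall f : hom X Y, f = 0.

Lemma hom0_iso X Y X' Y' : isomorphic X X' -> isomorphic Y Y' -> hom0 X Y -> hom0 X' Y'.
Proof.
move=> /isomorphicP[u [u' [h1 h2]]] /isomorphicP[v [v' [h3 h4]]] h f.
have := h (v' ** (f ** u)) => E.
have : v ** (v' ** (f ** u)) ** u' = 0 by rewrite E cmpm0 cmp0m.
by rewrite cmpA h4 cmp1m -cmpA h2 cmpm1.
Qed.

Definition retract X Y := exists (f : hom X Y) (g : hom Y X), g ** f = idm X.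

Lemma hom0_retractl X X' Y : retract X X' -> hom0 X' Y -> hom0 X Y.
Proof.
move=> [u [v uv]] h f; have := h (f ** v) => E.
by rewrite -[f]cmpm1 -uv cmpA E cmp0m.
Qed.

Lemma iso_retract X Y Z : isomorphic X Y -> retract Y Z -> retract X Z.
Proof.
move=> /isomorphicP[u [u' [h1 h2]]] [f [g h]]; exists (f ** u), (u' ** g).
by rewrite -cmpA (cmpA g) h cmp1m.
Qed.

Lemma sum_retract X (I : finType) (Y : I -> C) i : is_direct_sum X Y -> retract (Y i) X.
Proof. by move=> [inj [prj [h _ _]]]; exists (inj i), (prj i). Qed.

Lemma iso_cancell X Y Z (f : hom X Y) (u v : hom Y Z) : is_iso f -> u ** f = v ** f -> u = v.
Proof. by move=> [g [_ fg]] E; rewrite -[u]cmpm1 -[v]cmpm1 -fg !cmpA E. Qed.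

Lemma iso_cancelr X Y Z (f : hom Y Z) (u v : hom X Y) : is_iso f -> f ** u = f ** v -> u = v.
Proof. by move=> [g [gf _]] E; rewrite -[u]cmp1m -[v]cmp1m -gf -!cmpA E. Qed.

End Iso.

Section FunctorIso.
Variables (k : fieldType).
Implicit Types C D E : lincat k.

Lemma fmap_iso C D (F : functor C D) X Y : isomorphic X Y -> isomorphic (F X) (F Y).
Proof.
move=> /isomorphicP[f [g [h1 h2]]]; apply/isomorphicP; exists (fmap F f), (fmap F g).
by rewrite -!fmapM h1 h2 !fmap1.
Qed.

Lemma fmap_is_iso C D (F : functor C D) X Y (f : hom X Y) : is_iso f -> is_iso (fmap F f).
Proof. by move=> [g [h1 h2]]; exists (fmap F g); rewrite -!fmapM h1 h2 !fmap1. Qed.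

Lemma natiso_ob C D (F G : functor C D) X : naturally_isomorphic F G -> isomorphic (F X) (G X).
Proof. by move=> [eta [h _]]; exists (eta X). Qed.

Definition full_faithful C D (F : functor C D) := forall X Y : C, bijective (@fmap _ _ _ F X Y).

Definition faithful C D (F : functor C D) := forall (X Y : C) (f : hom X Y), fmap F f = 0 -> f = 0.

Lemma faithful_inj C D (F : functor C D) X Y : faithful F -> injective (@fmap _ _ _ F X Y).
Proof.
by move=> h f g E; apply/eqP; rewrite -subr_eq0; apply/eqP/h; rewrite linearB E subrr.
Qed.

Lemma inj_surj_bij (A B : Type) (f : A -> B) : injective f -> (forall y, exists x, f x = y) -> bijective f.
Proof.
move=> fi /choice[g fg]; exists g => // x; apply: fi; exact: fg.
Qed.

Lemma natiso_faithful C D (F G : functor C D) : naturally_isomorphic F G -> faithful F -> faithful G.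
Proof.
move=> [eta [ei en]] h X Y f E; apply: h.
by apply: (iso_cancelr (ei Y)); rewrite en E cmp0m cmpm0.
Qed.

Lemma natiso_full C D (F G : functor C D) X Y : naturally_isomorphic F G ->
  (forall h : hom (F X) (F Y), exists f, fmap F f = h) ->
  forall h : hom (G X) (G Y), exists f, fmap G f = h.
Proof.
move=> [eta [ei en]] hF h; have [e' [h1 h2]] := ei Y.
have [f fE] := hF (e' ** (h ** eta X)); exists f.
by apply: (iso_cancell (ei X)); rewrite -en fE cmpA h2 cmp1m.
Qed.

Lemma natiso_ff C D (F G : functor C D) :
  naturally_isomorphic F G -> full_faithful F -> full_faithful G.
Proof.
move=> FG h X Y; apply: inj_surj_bij.
  apply/faithful_inj/(natiso_faithful FG) => X' Y' f E.
  by apply: (bij_inj (h X' Y')); rewrite linear0.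
apply: (natiso_full FG) => g; have [r _ rK] := h X Y.
by exists (r g); rewrite rK.
Qed.

Lemma quasi_inverse_faithful C D (F : functor C D) (G : functor D C) :
  naturally_isomorphic (comp_functor G F) (id_functor C) -> faithful F.
Proof.
move=> [eta [ei en]] X Y f E; apply: (iso_cancell (ei X)).
by rewrite -[f]/(fmap (id_functor C) f) -en /= E linear0 cmpm0 cmp0m.
Qed.

(** Fullness: a preimage of [h] is [fmap G h] conjugated by the isomorphisms of GF with the
    identity. That F sends it to [h] is checked after applying G, which is faithful because FG is
    isomorphic to the identity. *)
Lemma quasi_inverse_ff C D (F : functor C D) (G : functor D C) :
  naturally_isomorphic (comp_functor G F) (id_functor C) ->
  naturally_isomorphic (comp_functor F G) (id_functor D) -> full_faithful F.
Proof.
move=> GF FG X Y; apply: inj_surj_bij; first exact/faithful_inj/(quasi_inverse_faithful GF).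
move=> h; have Gf := quasi_inverse_faithful FG; have [eta [ei en]] := GF.
have [e' [h1 h2]] := ei X; exists (eta Y ** (fmap G h ** e')).
apply: (faithful_inj Gf); apply: (iso_cancelr (ei Y)).
rewrite -[fmap G (fmap F _)]/(fmap (comp_functor G F) _) en /=.
by rewrite -!cmpA h1 cmpm1.
Qed.

Lemma comp_ff C D E (F : functor C D) (G : functor D E) :
  full_faithful F -> full_faithful G -> full_faithful (comp_functor G F).
Proof. by move=> hF hG X Y; apply: (bij_comp (hG _ _) (hF _ _)). Qed.

Lemma natiso_sym C D (F G : functor C D) : naturally_isomorphic F G -> naturally_isomorphic G F.
Proof.
move=> [eta [ei en]].
pose e X := projT1 (cid (ei X)); have he X := projT2 (cid (ei X)).
exists e; split=> [X|X Y f].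
  by exists (eta X); have [] := he X.
have [h1 h2] := he Y; have [h3 h4] := he X.
by rewrite -[LHS]cmpm1 -h4 cmpA -[e Y ** _ ** _]cmpA -en cmpA h1 cmp1m.
Qed.

Lemma natiso_trans C D (G F H : functor C D) : naturally_isomorphic F G ->
  naturally_isomorphic G H -> naturally_isomorphic F H.
Proof.
move=> [a [ai an]] [b [bi bn]]; exists (fun X => b X ** a X); split=> [X|X Y f].
  have [a' [h1 h2]] := ai X; have [b' [h3 h4]] := bi X; exists (a' ** b'); split.
    by rewrite -cmpA (cmpA b') h3 cmp1m.
  by rewrite -cmpA (cmpA (a X)) h2 cmp1m.
by rewrite -cmpA an cmpA bn cmpA.
Qed.

Lemma natiso_whiskerl C D E (F G : functor C D) (K : functor D E) :
  naturally_isomorphic F G -> naturally_isomorphic (comp_functor K F) (comp_functor K G).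
Proof.
move=> [a [ai an]]; exists (fun X => fmap K (a X)); split=> [X|X Y f /=].
  exact: (fmap_is_iso K (ai X)).
by rewrite -!fmapM an.
Qed.

Lemma natiso_whiskerr C D E (F G : functor D E) (K : functor C D) :
  naturally_isomorphic F G -> naturally_isomorphic (comp_functor F K) (comp_functor G K).
Proof.
move=> [a [ai an]]; exists (fun X => a (K X)); split=> [X|X Y f]; first exact: ai.
exact: (an _ _ (fmap K f)).
Qed.

End FunctorIso.

(** * Bounds for dimensions and representation of functionals *)

Section FiniteRank.
Variables (k : fieldType).

(** Dimension at most [d], stated by linear dependence: in this form it passes along injective maps
    without a choice of bases. *)
Definition rank_le (V : lmodType k) (d : nat) := forall v : 'I_d.+1 -> V,
  exists c : 'rV[k]_d.+1, c != 0 /\ \sum_i c 0 i *: v i = 0.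

Lemma rank_le_inj (V W : lmodType k) (f : {linear V -> W}) d :
  (forall v, f v = 0 -> v = 0) -> rank_le W d -> rank_le V d.
Proof.
move=> fi h v; have [c [c0 E]] := h (f \o v); exists c; split=> //; apply: fi.
by rewrite linear_sum -[RHS]E; apply: eq_bigr => i _; rewrite linearZ.
Qed.

(** The coefficients of [d.+1] vectors form a matrix with more rows than columns, whose left kernel
    is non-zero. *)
Lemma span_rank (V : lmodType k) d (b : 'I_d -> V) :
  (forall v, exists c : 'I_d -> k, v = \sum_i c i *: b i) -> rank_le V d.
Proof.
move=> h v; have /choice[c cE] : forall i, exists c : 'I_d -> k, v i = \sum_j c j *: b j.
  by move=> i; apply: h.
pose M := (\matrix_(i < d.+1, j < d) c i j).
have : kermx M != 0.
  by rewrite kermx_eq0 /row_free; apply/eqP => E; have := rank_leq_col M; rewrite E ltnn.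
case/rowV0Pn => r /sub_kermxP rM r0; exists r; split=> //.
transitivity (\sum_j (r *m M) 0 j *: b j); last first.
  by rewrite rM big1 // => j _; rewrite mxE scale0r.
under eq_bigr do rewrite cE scaler_sumr.
rewrite exchange_big; apply: eq_bigr => j _ /=; rewrite mxE scaler_suml.
by apply: eq_bigr => i _; rewrite mxE scalerA.
Qed.

(* The representing vector comes from a maximal invertible minor of p. *)
Lemma functional_repr (U W : lmodType k) (p : U -> W -> k) (d : nat) (la : W -> k) :
  (forall w, scalar (fun u => p u w)) -> (forall u, scalar (p u)) -> scalar la ->
  (forall w, (forall u, p u w = 0) -> w = 0) -> rank_le W d ->
  exists u, forall w, p u w = la w.
Proof.
move=> pl pr lal nd rk.
have pD u w w' : p u (w + w') = p u w + p u w' by have := pr u 1 w w'; rewrite scale1r mul1r.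
have p0 u : p u 0 = 0 by apply: (addrI (p u 0)); rewrite -pD !addr0.
have pZ a u w : p u (a *: w) = a * p u w by have := pr u a w 0; rewrite addr0 p0 addr0.
have qD u u' w : p (u + u') w = p u w + p u' w by have := pl w 1 u u'; rewrite scale1r mul1r.
have q0 w : p 0 w = 0 by apply: (addrI (p 0 w)); rewrite -qD !addr0.
have qZ a u w : p (a *: u) w = a * p u w by have := pl w a u 0; rewrite addr0 q0 addr0.
have lD w w' : la (w + w') = la w + la w' by have := lal 1 w w'; rewrite scale1r mul1r.
have l0 : la 0 = 0 by apply: (addrI (la 0)); rewrite -lD !addr0.
have lZ a w : la (a *: w) = a * la w by have := lal a w 0; rewrite addr0 l0 addr0.
have pS (I : finType) u (c : I -> k) (w : I -> W) : p u (\sum_i c i *: w i) = \sum_i c i * p u (w i).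
  by elim/big_ind2: _ => [|x1 x2 y1 y2|i _]; [exact: p0 | rewrite pD => -> -> | rewrite pZ].
have qS (I : finType) w (c : I -> k) (u : I -> U) : p (\sum_i c i *: u i) w = \sum_i c i * p (u i) w.
  by elim/big_ind2: _ => [|x1 x2 y1 y2|i _]; [exact: q0 | rewrite qD => -> -> | rewrite qZ].
have lS (I : finType) (c : I -> k) (w : I -> W) : la (\sum_i c i *: w i) = \sum_i c i * la (w i).
  by elim/big_ind2: _ => [|x1 x2 y1 y2|i _]; [exact: l0 | rewrite lD => -> -> | rewrite lZ].
pose good m := `[< exists (u : 'I_m -> U) (w : 'I_m -> W), (\matrix_(i, j) p (u i) (w j)) \in unitmx >].
have good0 : good 0%N.
  by apply/asboolP; exists (fun=> 0), (fun=> 0); rewrite unitmxE det_mx00 unitr1.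
have bnd m : good m -> (m <= d)%N.
  (* A relation between [d.+1] of the vectors [w j] would give a non-zero vector in the kernel of an
     invertible matrix. *)
  move=> /asboolP[u [w uw]]; rewrite leqNgt; apply/negP => dm.
  have [c [c0 E]] := rk (fun i => w (widen_ord dm i)).
  pose c' : 'cV[k]_m := \col_j (if insub (val j) is Some i then c 0 i else 0).
  have wE : \sum_j c' j 0 *: w j = 0.
    rewrite -[RHS]E (bigID (fun j : 'I_m => (j < d.+1)%N)) /= addrC big1 ?add0r => [|j jd]; last first.
      by rewrite mxE insubF ?scale0r //; apply: negbTE.
    rewrite (reindex_onto (widen_ord dm) (fun j => inord j)) /=; last first.
      by move=> j jd; apply: val_inj; rewrite /= inordK.
    apply: eq_big => [i|i _]; first by rewrite ltn_ord inord_val eqxx.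
    by rewrite mxE /= insubT //= => h; congr (c 0 _ *: _); apply: val_inj.
  have : (\matrix_(i, j) p (u i) (w j)) *m c' = 0.
    apply/matrixP => i j; rewrite ord1 !mxE -[RHS](p0 (u i)) -wE pS.
    by apply: eq_bigr => l _; rewrite mxE mulrC.
  move/(congr1 (mulmx (invmx (\matrix_(i, j) p (u i) (w j))))); rewrite mulKmx // mulmx0 => c'0.
  case/eqP: c0; apply/matrixP => x i; rewrite ord1 !mxE.
  have := congr1 (fun v : 'cV_m => v (widen_ord dm i) 0) c'0; rewrite !mxE /= insubT //= => h.
  by rewrite -[RHS]/0 => <-; congr (c 0 _); apply: val_inj.
case: (ex_maxnP (ex_intro _ 0%N good0) bnd) => m /asboolP[u [w uw]] mmax.
set M := \matrix_(i, j) p (u i) (w j) in uw.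
pose l : 'rV[k]_m := \row_j la (w j).
pose a := l *m invmx M.
exists (\sum_i a 0 i *: u i) => x.
pose r : 'cV[k]_m := \col_i p (u i) x.
pose cx := invmx M *m r.
(* The part of [x] on which all [u i] vanish. It is zero: a [u'] with [p u' x'] non-zero would
   enlarge the minor to a block triangular invertible matrix of size [m.+1]. *)
pose x' := x - \sum_j cx j 0 *: w j.
have ux' i : p (u i) x' = 0.
  rewrite /x' -scaleN1r pD pZ pS mulN1r; apply/eqP; rewrite subr_eq0; apply/eqP.
  have -> : p (u i) x = (M *m cx) i 0 by rewrite /cx mulKVmx // mxE.
  by rewrite mxE; apply: eq_bigr => j _; rewrite mxE mulrC.
have x'0 : x' = 0.
  apply: nd => u'; apply/eqP; apply: contraT => nz.
  suff : (m.+1 <= m)%N by rewrite ltnn.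
  apply: mmax; apply/asboolP.
  exists (fun i => if unlift ord0 i is Some j then u j else u'),
    (fun i => if unlift ord0 i is Some j then w j else x').
  have -> : (\matrix_(i, j) p (if unlift ord0 i is Some j then u j else u')
       (if unlift ord0 j is Some j then w j else x')) =
     block_mx (p u' x')%:M (\row_j p u' (w j)) 0 M :> 'M_(1 + m).
    have rs i : lift ord0 i = rshift 1 i :> 'I_(1 + m) by apply: val_inj.
    have l0s : ord0 = lshift m ord0 :> 'I_(1 + m) by apply: val_inj.
    apply/matrixP => i j; rewrite mxE.
    case: (unliftP ord0 i) => [i'|] ->; case: (unliftP ord0 j) => [j'|] ->.
    - by rewrite !rs block_mxEdr mxE.
    - by rewrite rs l0s block_mxEdl mxE ux'.
    - by rewrite rs l0s block_mxEur mxE.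
    - by rewrite l0s block_mxEul mxE eqxx mulr1n.
  rewrite unitmxE [\det _](det_ublock (p u' x')%:M (\row_j p u' (w j)) M).
  by rewrite unitrM det_scalar1 unitfE nz -unitmxE uw.
have xE : x = \sum_j cx j 0 *: w j by apply/eqP; rewrite -subr_eq0; apply/eqP.
have aw j : p (\sum_i a 0 i *: u i) (w j) = la (w j).
  rewrite qS; have -> : la (w j) = (a *m M) 0 j by rewrite /a mulmxKV // mxE.
  by rewrite [RHS]mxE; apply: eq_bigr => i _; congr (_ * _); rewrite [RHS]mxE.
by rewrite [in LHS]xE pS [in RHS]xE lS; apply: eq_bigr => j _; rewrite aw.
Qed.

End FiniteRank.

(** * Serre duality and extensions in the cluster category *)

Section Serre.
Variables (k : fieldType) (D : lincat k) (S : functor D D).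

(* t : hom X (S R) -> k is the trace form of a Serre pairing between
   hom Y R and hom X (S Y) *)
Definition serre_form (X R : D) (t : hom X (S R) -> k) : Prop :=
  [/\ scalar t,
      forall Y (g : hom Y R), (forall f : hom X (S Y), t (fmap S g ** f) = 0) -> g = 0
    & forall Y (f : hom X (S Y)), (forall g : hom Y R, t (fmap S g ** f) = 0) -> f = 0].

(** Both [R] and [R'] represent the dual of the functor Y |-> hom X (S Y), and the argument is that
    of Yoneda's lemma. Finite dimension is used to realize the trace form of one object by a
    morphism into the other. *)
Lemma serre_unique X R R' t t' :
  (forall Y, exists d, rank_le (hom X (S Y)) d) ->
  @serre_form X R t -> @serre_form X R' t' -> isomorphic R R'.
Proof.
move=> fd [tl tn tm] [tl' tn' tm'].
have rep (R1 R2 : D) t1 t2 : @serre_form X R1 t1 -> @serre_form X R2 t2 ->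
    exists g : hom R2 R1, forall f, t1 (fmap S g ** f) = t2 f.
  move=> [l1 n1 m1] [l2 n2 m2]; have [d rk] := fd R2.
  apply: (functional_repr (p := fun (g : hom R2 R1) (f : hom X (S R2)) => t1 (fmap S g ** f))
    _ _ l2 _ rk) => //.
  - by move=> f a u v; rewrite linearP cmpDl cmpZl l1.
  - by move=> g a u v; rewrite cmpDr cmpZr l1.
  - by move=> w h; apply: m1.
have F1 : serre_form t by [].
have F2 : serre_form t' by [].
have [g hg] := rep _ _ _ _ F1 F2; have [g' hg'] := rep _ _ _ _ F2 F1.
have sub (tt : forall R1, hom X (S R1) -> k) : True by [].
apply/isomorphicP; exists g', g; split.
  apply/eqP; rewrite -subr_eq0; apply/eqP; apply: tn => f.
  have tB u v : t (u - v) = t u - t v.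
    by have := tl (-1) v u; rewrite !scaleN1r mulN1r ![- _ + _]addrC.
  by rewrite linearB /= fmapM fmap1 cmpDl -scaleN1r cmpZl scaleN1r cmp1m tB -cmpA hg hg' subrr.
apply/eqP; rewrite -subr_eq0; apply/eqP; apply: tn' => f.
have tB u v : t' (u - v) = t' u - t' v.
  by have := tl' (-1) v u; rewrite !scaleN1r mulN1r ![- _ + _]addrC.
by rewrite linearB /= fmapM fmap1 cmpDl -scaleN1r cmpZl scaleN1r cmp1m tB -cmpA hg' hg subrr.
Qed.

(* S commutes with the Serre functor S o tau *)
Lemma serre_shift X R t :
  full_faithful S -> (forall Y, exists Y', isomorphic (S Y') Y) ->
  @serre_form X R t -> exists t', @serre_form (S X) (S R) t'.
Proof.
move=> ff es [tl tn tm].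
have sI (Y Z : D) : injective (@fmap _ _ _ S Y Z) by apply: bij_inj.
have sS (Y Z : D) (h : hom (S Y) (S Z)) : exists f, fmap S f = h.
  by have [r _ rK] := ff Y Z; exists (r h).
have /choice[r rK] := @sS X (S R).
have rS f : r (fmap S f) = f by apply: sI.
exists (t \o r); split=> [a u v|Y g h|Y f h] /=.
- by rewrite -tl; congr (t _); apply: sI; rewrite rK linearP /= !rK.
- have [Y' /isomorphicP[v [w [wv vw]]]] := es Y.
  have [g0 g0E] := sS _ _ (g ** v).
  suff g00 : g0 = 0 by rewrite -[g]cmpm1 -vw cmpA -g0E g00 linear0 cmp0m.
  apply: tn => f; have /= := h (fmap S v ** fmap S f).
  by rewrite cmpA -(fmapM S g v) -g0E -(fmapM S) rS.
- have [Y' /isomorphicP[v [w [wv vw]]]] := es Y.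
  have [f0 f0E] := sS _ _ (fmap S w ** f).
  suff f00 : f0 = 0.
    have E : fmap S v ** (fmap S w ** f) = f by rewrite cmpA -fmapM vw fmap1 cmp1m.
    by rewrite -E -f0E f00 linear0 cmpm0.
  apply: tm => g; have /= := h (fmap S g ** w).
  by rewrite fmapM -cmpA -f0E -(fmapM S) rS.
Qed.

End Serre.

(** * Powers of an autoequivalence and the orbit category *)

Section Powers.
Variables (k : fieldType) (C : lincat k) (A : powers C).
Implicit Types X Y : C.

Lemma pw0_iso X : isomorphic X (A 0 X).
Proof. by apply: is_iso_iso (pw_unit_iso A X). Qed.

Lemma pw_add_iso i j m X : i + j = m -> isomorphic (A i (A j X)) (A m X).
Proof. by move=> e; apply: is_iso_iso (pw_mul_iso A e X). Qed.

Lemma pw_inv_iso i X : isomorphic (A (- i) (A i X)) X.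
Proof. exact: iso_trans (pw_add_iso X (addNr i)) (iso_sym (pw0_iso X)). Qed.

Lemma pw_natinv i j (e : i + j = 0) : naturally_isomorphic (comp_functor (A i) (A j)) (id_functor C).
Proof.
apply: (@natiso_trans _ _ _ (A 0)).
  exists (fun X => pw_mul A e X); split=> [X|X Y f]; first exact: pw_mul_iso.
  exact: pw_mul_nat.
apply: natiso_sym; exists (fun X => pw_unit A X); split=> [X|X Y f]; first exact: pw_unit_iso.
exact: pw_unit_nat.
Qed.

Lemma pw_ff i : full_faithful (A i).
Proof. exact: quasi_inverse_ff (pw_natinv (addNr i)) (pw_natinv (addrN i)). Qed.

Lemma hom0_ff (B : lincat k) (F : functor C B) X Y : full_faithful F -> (hom0 (F X) (F Y) <-> hom0 X Y).
Proof.
move=> ff; split=> h f.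
  by apply: (bij_inj (ff X Y)); rewrite linear0; apply: h.
by have [r _ rK] := ff X Y; rewrite -(rK f) (h (r f)) linear0.
Qed.

Lemma hom0_pw i X Y : hom0 (A i X) Y <-> hom0 X (A (- i) Y).
Proof.
apply: iff_trans (iff_sym (hom0_ff (A i X) Y (@pw_ff (- i)))) _.
split; apply: hom0_iso; try exact: iso_refl; first exact: pw_inv_iso.
exact/iso_sym/pw_inv_iso.
Qed.

Section Orbit.
Local Notation O := (orbit_category A).

Definition degm_val X Y (m : int) (f : hom X (A m Y)) : gradedhom A X Y := fun i =>
  match m =P i with
  | ReflectT e => match e in _ = i' return hom X (A i' Y) with erefl => f end
  | ReflectF _ => 0
  end.

Lemma degm_valm X Y m (f : hom X (A m Y)) : degm_val f m = f.
Proof. by rewrite /degm_val; case: eqP => // e; rewrite (eq_irrelevance e erefl). Qed.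

Lemma degm_finsupp X Y m (f : hom X (A m Y)) : finsupp (degm_val f).
Proof.
apply/asboolP; exists `|m|%N => i im; rewrite /degm_val; case: eqP => // E.
by exfalso; move: im; rewrite E ltnn.
Qed.

Lemma hom0_orbit X Y : hom0 (X : O) (Y : O) <-> forall m, hom0 X (A m Y).
Proof.
split=> [h m f|h f]; last by apply: orbhomP => i; apply: h.
have := h (OrbHom (degm_finsupp f)) => /(congr1 (fun g => orbval g m)) /=.
by rewrite degm_valm.
Qed.

Lemma deg0_inj X Y (f : hom X Y) : deg0 A f = 0 -> f = 0.
Proof.
move=> /(congr1 (fun g => orbval g 0)) /=; rewrite deg0_val0 => E.
by apply: (iso_cancelr (pw_unit_iso A Y)); rewrite E cmpm0.
Qed.

Lemma deg0_linear X Y : linear (@deg0 _ _ A X Y).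
Proof.
move=> a f g; apply: orbhomP => i; rewrite orbvalD orbvalZ /=.
have [->|i0] := eqVneq i 0; last by rewrite !deg0_valN // scaler0 addr0.
by rewrite !deg0_val0 cmpDr cmpZr.
Qed.

End Orbit.
End Powers.

(** * Extensions in the cluster category *)

Section ClusterExt.
Variables (k : fieldType) (H : algType k) (c : cluster_data H).
Local Notation D := (derived H).
Local Notation S := (shift H).
Local Notation T := (tau (cl_tau c)).
Local Notation TV := (tauV (cl_tau c)).
Local Notation A := (cl_powers c).
Local Notation CH := (cluster_category c).
Implicit Types X Y Z : D.

(** [A 1] is the shift after the inverse of tau, so composing it with tau leaves the shift. In the
    orbit category, where [A 1] becomes trivial, this identifies the shift with tau. *)
Lemma shift_nat : naturally_isomorphic (comp_functor (A 1) T) S.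
Proof.
apply: (@natiso_trans _ _ _ (comp_functor (comp_functor S TV) T)).
  exact: natiso_whiskerr (cl_powers1 c).
have [eta [ei en]] := natiso_whiskerl S (tauVK (cl_tau c)).
by exists eta; split=> // X Y f; apply: en.
Qed.

Lemma shiftE X : isomorphic (S X) (A 1 (T X)).
Proof. exact/iso_sym/(natiso_ob X shift_nat). Qed.

Lemma tau_ff : full_faithful T.
Proof. exact: quasi_inverse_ff (tauVK _) (tauKV _). Qed.

Lemma shift_ff : full_faithful S.
Proof. exact: natiso_ff shift_nat (comp_ff tau_ff (pw_ff _ _)). Qed.

Lemma tauKV_iso X : isomorphic (T (TV X)) X.
Proof. exact: (natiso_ob X (tauKV (cl_tau c))). Qed.

Lemma shift_es Y : exists Y', isomorphic (S Y') Y.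
Proof.
exists (TV (A (- 1) Y)); apply: iso_trans (shiftE _) _.
apply: (@iso_trans _ _ (A 1 (A (- 1) Y))); first exact/fmap_iso/tauKV_iso.
exact: iso_trans (pw_add_iso _ _ (addrN 1)) (iso_sym (pw0_iso _ _)).
Qed.

(** For the cluster category at hand this is [cluster_finite_dim], obtained through the equivalence
    with the tagged edges. *)
Hypothesis fd : forall X Y : CH, exists d, rank_le (hom X Y) d.

Lemma derived_fd X Y : exists d, rank_le (hom X Y) d.
Proof.
have [d rk] := fd (X : CH) (Y : CH); exists d.
pose F : {linear hom X Y -> orbhom A X Y} := HB.pack (@deg0 _ _ A X Y)
  (GRing.isLinear.Build _ _ _ _ (@deg0 _ _ A X Y) (@deg0_linear _ _ A X Y)).
by apply: (rank_le_inj (f := F)) rk => v; apply: deg0_inj.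
Qed.

Lemma tau_serre X : @serre_form _ _ S X (T X) (fun f => ar_form (idm (T X)) f).
Proof.
have E Y (g : hom Y (T X)) f : ar_form (idm (T X)) (fmap S g ** f) = ar_form g f.
  by rewrite -ar_natr cmp1m.
split=> [|Y g h|Y f h].
- exact: ar_linearr.
- by apply: ar_nondegl => f; have := h f; rewrite E.
- by apply: ar_nondegr => g; have := h g; rewrite E.
Qed.

(** Both objects carry a Serre form for [S X]: the first from the Auslander-Reiten form itself, the
    second by shifting the form for [X]. *)
Lemma tau_shift X : isomorphic (T (S X)) (S (T X)).
Proof.
have [t ht] := serre_shift shift_ff shift_es (tau_serre X).
exact: serre_unique (fun Y => derived_fd _ _) (tau_serre (S X)) ht.
Qed.

Lemma tau_pw1 X : isomorphic (T (A 1 X)) (A 1 (T X)).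
Proof.
apply: (@iso_trans _ _ (T (S (TV X)))); first exact/fmap_iso/(natiso_ob X (cl_powers1 c)).
apply: iso_trans (tau_shift _) _.
apply: iso_trans (fmap_iso S (tauKV_iso X)) _; exact: shiftE.
Qed.

Lemma tau_pw_nat (m : nat) X : isomorphic (T (A m%:Z X)) (A m%:Z (T X)).
Proof.
elim: m X => [|m IH] X.
  apply: iso_trans (iso_sym (fmap_iso T (pw0_iso A X))) _; exact: pw0_iso.
have e : 1 + m%:Z = m.+1%:Z by lia.
apply: iso_trans (iso_sym (fmap_iso T (pw_add_iso A X e))) _.
apply: iso_trans (tau_pw1 _) _.
apply: iso_trans (fmap_iso (A 1) (IH X)) _; exact: pw_add_iso.
Qed.

Lemma tau_pw (m : int) X : isomorphic (T (A m X)) (A m (T X)).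
Proof.
case: m => m; first exact: tau_pw_nat.
rewrite NegzE; set j := m.+1%:Z.
apply: iso_trans (iso_sym (pw_inv_iso A j _)) _; apply: fmap_iso.
apply: iso_trans (iso_sym (tau_pw_nat m.+1 _)) _; apply: fmap_iso.
exact: iso_trans (pw_add_iso _ _ (addrN j)) (iso_sym (pw0_iso _ _)).
Qed.

Lemma hom0_serre X Y : hom0 X (S Y) <-> hom0 Y (T X).
Proof.
have s0 (V : lmodType k) (phi : V -> k) : scalar phi -> phi 0 = 0.
  by move=> h; have := h (-1) 0 0; rewrite scaler0 addr0 mulN1r addNr.
split=> h f.
  by apply: (ar_nondegl (a := cl_tau c)) => g; rewrite (h g); apply: s0 (ar_linearr f).
by apply: (ar_nondegr (a := cl_tau c)) => g; rewrite (h g); apply: s0 (ar_linearl f).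
Qed.

(** A summand can be taken directly only in the left argument, because [cl_translate] acts on
    objects and not on the two morphisms of a retraction. So [V] is taken on the left, Serre duality
    moves it to the right, where tau and the powers commute up to isomorphism, and then [V'] is
    taken on the left. *)
Lemma ext_summands (U V V' : CH) : hom0 U (cl_shift U) -> retract V U -> retract V' U ->
  hom0 V' (cl_translate V).
Proof.
move=> UU VU V'U; apply: hom0_retractl V'U _.
have := hom0_retractl VU UU; rewrite !hom0_orbit => h m.
have {}h j : hom0 (V : D) (A j (T U)).
  have := h (j - 1); apply: hom0_iso; first exact: iso_refl.
  apply: iso_trans (fmap_iso _ (shiftE _)) _; apply: pw_add_iso; exact: subrK.
have {}h j : hom0 (U : D) (S (A j V)).
  by apply/hom0_serre/hom0_pw.
have := h (m - 1); apply: hom0_iso; first exact: iso_refl.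
apply: iso_trans (shiftE _) _.
apply: iso_trans (fmap_iso _ (tau_pw _ _)) _; apply: pw_add_iso; lia.
Qed.

End ClusterExt.

(** * Morphisms between tagged edges *)

Section Mesh.
Variables (k : fieldType) (n : nat).
Hypothesis hn : (4 <= n)%N.
Local Notation edge := (tedge n).
Local Notation C0 := (presented (@mesh_rel n k)).
Local Notation TE := (tagged_edges n k).
Local Notation hom0 := (@hom _ C0).
Implicit Types L M N : edge.

Definition mv M N : hom0 M N := tclass (@mesh_rel n k) (move_term k M N).

Lemma mv0 M N : ~~ elementary_move M N -> mv M N = 0.
Proof.
move=> h; rewrite /mv /move_term; case: {-}_ / idP => [u|_]; last exact: tclass0.
by rewrite u in h.
Qed.

Lemma tclass_tsum M N (F : edge -> term k (@move_gen n) M N) (s : seq edge) :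
  tclass (@mesh_rel n k) (tsum s F) = \sum_(X <- s) (tclass (@mesh_rel n k) (F X) : hom0 M N).
Proof.
elim: s => [|X s IH]; first by rewrite big_nil /= tclass0.
by rewrite big_cons -IH -tclassD.
Qed.

Lemma mesh_sum M : \sum_X mv X M ** mv (edge_translate M) X = 0.
Proof.
have /tclassP := teq_rel (mesh k M).
rewrite tclass_tsum tclass0 => E; rewrite -[RHS]E big_enum /=.
by apply: eq_bigr => X _; rewrite /cmp /= phom_cmpE.
Qed.

Lemma start_translate M : start (edge_translate M) = ord_pred (start M).
Proof. by case: M. Qed.

Lemma elen_translate M : elen (edge_translate M) = elen M.
Proof. by case: M => //= p; rewrite delta_len_ord_pred. Qed.

Lemma degenerate_translate M : degenerate (edge_translate M) = degenerate M.
Proof. by case: M. Qed.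

Lemma tag_translate M : degenerate M -> tag (edge_translate M) = ~~ tag M.
Proof. by case: M. Qed.

Lemma tag_arc M : degenerate M = false -> tag M = true.
Proof. by case: M. Qed.

(** The sum of all tagged edges. A morphism from a fixed edge into it is a row indexed by target
    edges, and all elementary moves act on such rows at once, as two endomorphisms of this
    object. *)
Definition Xall : TE := @SumOb _ C0 edge (fun M => M).

(* The mesh relations say that Up and Dn anticommute, apart from the two tags of the degenerate
   edges. *)
Definition Up : hom Xall Xall := fun M N => if rises M N then mv M N else 0.
Definition Dn : hom Xall Xall := fun M N => if falls M N then mv M N else 0.

Lemma all_cmpE (A B : hom Xall Xall) M N :
  (A ** B) M N = \sum_X (A X N : hom0 X N) ** (B M X : hom0 M X).
Proof. by []. Qed.

Section Rows.
Variable M0 : edge.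
Local Notation Row := (hom (edge_object k M0) Xall).
Implicit Types v : Row.

Definition unit_row : Row := fun _ N => @diag_entry _ C0 Xall M0 N.

Definition entry v N : hom0 M0 N := v tt N.

Lemma rowP v v' : (forall N, entry v N = entry v' N) -> v = v'.
Proof. by move=> h; apply: vfamP => -[]; apply: vfamP => N; apply: h. Qed.

Lemma entry0 N : entry 0 N = 0. Proof. by []. Qed.
Lemma entryD v v' N : entry (v + v') N = entry v N + entry v' N. Proof. by []. Qed.
Lemma entryZ a v N : entry (a *: v) N = a *: entry v N. Proof. by []. Qed.
Lemma entryN v N : entry (- v) N = - entry v N. Proof. by []. Qed.

Lemma entry_cmp (A : hom Xall Xall) v N : entry (A ** v) N = \sum_L A L N ** entry v L.
Proof. by []. Qed.

Lemma unit_rowE : entry unit_row M0 = idm (M0 : C0).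
Proof. exact: (@diag_entry_refl _ C0 Xall M0). Qed.

Lemma unit_row0 N : N != M0 -> entry unit_row N = 0.
Proof. by move=> h; apply: (@diag_entry_neq _ C0 Xall); rewrite eq_sym. Qed.

Definition supp v (P : pred edge) := forall N, ~~ P N -> entry v N = 0.

Lemma supp_imp v (P P' : pred edge) : (forall N, P N -> P' N) -> supp v P -> supp v P'.
Proof. by move=> PP vP N nP'; apply: vP; apply: contra nP' => /PP. Qed.

Lemma supp0 v : supp v pred0 -> v = 0.
Proof. by move=> h; apply: rowP => N; rewrite h. Qed.

Lemma supp_up v (P P' : pred edge) :
  supp v P -> (forall L N, P L -> rises L N -> P' N) -> supp (Up ** v) P'.
Proof.
move=> vP h N nP'; rewrite entry_cmp big1 // => L _; rewrite /Up.
case: ifP => LN; last exact: cmp0m.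
by rewrite vP ?cmpm0 //; apply: contra nP' => PL; apply: h LN.
Qed.

Lemma supp_dn v (P P' : pred edge) :
  supp v P -> (forall L N, P L -> falls L N -> P' N) -> supp (Dn ** v) P'.
Proof.
move=> vP h N nP'; rewrite entry_cmp big1 // => L _; rewrite /Dn.
case: ifP => LN; last exact: cmp0m.
by rewrite vP ?cmpm0 //; apply: contra nP' => PL; apply: h LN.
Qed.

Definition arc_row v := supp v (fun N => ~~ degenerate N).

(** The entry of [Up ** Dn + Dn ** Up] from an arc L to N is empty unless L is the translate of N,
    and then it is the sum over the mesh that ends in N. *)
Lemma up_dn v : arc_row v -> Up ** (Dn ** v) = - (Dn ** (Up ** v)).
Proof.
move=> va; apply/eqP; rewrite -addr_eq0; apply/eqP; apply: rowP => N.
rewrite !cmpA -cmpDl entry_cmp entry0 big1 // => L _.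
have [dL|dL] := boolP (degenerate L); first by rewrite va ?negbK // cmpm0.
suff -> : (Up ** Dn + Dn ** Up) L N = 0 by rewrite cmp0m.
rewrite !vfamD !all_cmpE -big_split /=.
have [E|E] := eqVneq L (edge_translate N); last first.
  apply: big1 => X _; rewrite /Up /Dn.
  suff h : ~~ (falls L X && rises X N) /\ ~~ (rises L X && falls X N).
    by case: h; do 4 case: ifP => _; rewrite ?cmp0m ?cmpm0 ?addr0.
  suff h : (start N == ordS (start L)) && (elen N == elen L) -> L = edge_translate N.
    split; apply/negP => /andP[/andP[/eqP a /eqP b] /andP[/eqP c /eqP d]];
      move/eqP: E; apply; apply: h; rewrite c a eqxx /=; lia.
  case/andP=> /eqP sN /eqP lN; apply: edge_inj.
  - by rewrite start_translate sN ordSK.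
  - by rewrite elen_translate lN.
  - rewrite !tag_arc //; first by rewrite degenerate_translate degenerateE lN -degenerateE; exact/negbTE.
    exact/negbTE.
rewrite E -[RHS](mesh_sum N); apply: eq_bigr => X _; rewrite -E /Up /Dn.
have [dN sN] : degenerate N = false /\ elen L = elen N.
  by rewrite E elen_translate; split => //; rewrite -degenerate_translate -E; apply/negbTE.
have h : rises L X -> falls L X = false.
  by rewrite /rises /falls => /andP[_ /eqP ->]; apply/negbTE; rewrite negb_and; apply/orP; right; lia.
have h' : rises X N -> falls X N = false.
  by rewrite /rises /falls => /andP[_ /eqP ->]; apply/negbTE; rewrite negb_and; apply/orP; right; lia.
have h2 : rises L X -> rises X N = false.
  by rewrite /rises => /andP[_ /eqP e]; apply/negbTE; rewrite negb_and; apply/orP; right; lia.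
have h3 : falls L X -> falls X N = false.
  by rewrite /falls => /andP[_ /eqP e]; apply/negbTE; rewrite negb_and; apply/orP; right; lia.
have [m1|m1] := boolP (elementary_move L X); last first.
  rewrite (mv0 m1) !cmpm0; move: m1; rewrite elementary_moveE negb_or => /andP[/negbTE -> /negbTE ->].
  by rewrite !cmpm0 addr0.
have [m2|m2] := boolP (elementary_move X N); last first.
  rewrite (mv0 m2) !cmp0m; move: m2; rewrite elementary_moveE negb_or => /andP[/negbTE -> /negbTE ->].
  by rewrite !cmp0m addr0.
move: m1 m2; rewrite !elementary_moveE => /orP[a|a] /orP[b|b].
- by rewrite (h2 a) in b.
- by rewrite a b (h a) !cmpm0 add0r.
- by rewrite a b (h' b) !cmp0m addr0.
- by rewrite (h3 a) in b.
Qed.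

Definition Zt (e : bool) v : Row := fun _ N => if degenerate N && (tag N == e) then entry v N else 0.

Lemma entryZt e v N : entry (Zt e v) N = if degenerate N && (tag N == e) then entry v N else 0.
Proof. by []. Qed.

Lemma Zt_supp e v P : supp v P -> supp (Zt e v) (fun N => [&& P N, degenerate N & tag N == e]).
Proof.
move=> h N nP; rewrite entryZt; case: ifP => // /andP[d t].
by apply: h; move: nP; rewrite d t !andbT.
Qed.

Lemma ZtD e v v' : Zt e (v + v') = Zt e v + Zt e v'.
Proof. by apply: rowP => N; rewrite entryD !entryZt entryD; case: ifP => //; rewrite addr0. Qed.

Lemma Zt_sum v : supp v (@degenerate n) -> v = Zt true v + Zt false v.
Proof.
move=> h; apply: rowP => N; rewrite entryD !entryZt.
case: (boolP (degenerate N)) => d; last by rewrite h //= addr0.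
by case: (tag N); rewrite /= ?addr0 ?add0r.
Qed.

(** The mesh that ends in a degenerate edge N has a single middle term. Hence the composition into N
    from its translate, which carries the other tag, is zero, and only the step that keeps the tag
    survives. *)
Lemma tag_up_dn e v : supp v (fun N => degenerate N && (tag N == e)) ->
  supp (Up ** (Dn ** v)) (fun N => degenerate N && (tag N == e)).
Proof.
move=> va N nN; rewrite cmpA entry_cmp big1 // => L _.
have [/andP[dL tL]|nL] := boolP (degenerate L && (tag L == e)); last by rewrite va // cmpm0.
suff -> : (Up ** Dn) L N = 0 by rewrite cmp0m.
rewrite all_cmpE.
have [E|E] := eqVneq L (edge_translate N); last first.
  apply: big1 => X _; rewrite /Up /Dn; case: ifP => a; last by rewrite cmp0m.
  case: ifP => b; last by rewrite cmpm0.
  move/eqP: E; case.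
  move: a b => /andP[/eqP a /eqP a'] /andP[/eqP b /eqP b'].
  have eL : elen L = elen N by lia.
  have dN : degenerate N by rewrite degenerateE -eL -degenerateE.
  apply: edge_inj; first by rewrite start_translate a b ordSK.
    by rewrite elen_translate.
  by rewrite tag_translate //; move: nN; rewrite dN /= (eqP tL); case: (tag N) e {tL va} => -[].
rewrite E -[RHS](mesh_sum N); apply: eq_bigr => X _; rewrite -E /Up /Dn.
have h : rises L X = false.
  apply/negP => /andP[_ /eqP]; rewrite (elen_deg dL) => e1.
  have [d|d] := boolP (degenerate X); first by move: (elen_deg d); lia.
  by move: (elen_arc (negbTE d)); lia.
have h' : falls X N = false.
  have dN : degenerate N by rewrite degenerateE -(elen_translate N) -E -degenerateE.
  apply/negP => /andP[_ /eqP]; rewrite (elen_deg dN) => e1.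
  have [d|d] := boolP (degenerate X); first by move: (elen_deg d); lia.
  by move: (elen_arc (negbTE d)); lia.
case: ifP => a; last by rewrite cmp0m (@mv0 X N) ?cmp0m // elementary_moveE a h'.
by case: ifP => // b; rewrite cmpm0 (@mv0 L X) ?cmpm0 // elementary_moveE b h.
Qed.

End Rows.
End Mesh.

(** * Words in rises and falls *)

Section Words.
Variables (k : fieldType) (n : nat).
Hypothesis hn : (4 <= n)%N.
Local Notation edge := (tedge n).
Local Notation C0 := (presented (@mesh_rel n k)).
Local Notation hom0 := (@hom _ C0).
Local Notation Up := (@Up k n).
Local Notation Dn := (@Dn k n).
Local Notation mv := (@mv k n).
Implicit Types L M N : edge.

Section PlusMinus.
Variables (C : lincat k) (X Y Z : C).
Implicit Types u v w : hom X Y.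

(** Reordering a word by anticommutation produces signs. They do not affect spans or supports, so
    words are compared up to sign only. *)
Definition pm u v := exists b : bool, u = (-1) ^+ b *: v.

Lemma pm_refl u : pm u u.
Proof. by exists false; rewrite scale1r. Qed.

Lemma pm_sym u v : pm u v -> pm v u.
Proof. by case=> b ->; exists b; rewrite scalerA -signr_addb addbb scale1r. Qed.

Lemma pm_trans v u w : pm u v -> pm v w -> pm u w.
Proof. by case=> b -> [c ->]; exists (b (+) c); rewrite scalerA signr_addb. Qed.

Lemma pm0 u : pm u 0 -> u = 0.
Proof. by case=> b ->; rewrite scaler0. Qed.

End PlusMinus.

Lemma pm_cmp (C : lincat k) (X Y Z : C) (A : hom Y Z) (u v : hom X Y) :
  pm u v -> pm (A ** u) (A ** v).
Proof. by case=> b ->; exists b; rewrite cmpZr. Qed.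

Section Source.
Variable M0 : edge.
Local Notation Row := (hom (edge_object k M0) (Xall k n)).
Local Notation e := (@unit_row k n M0).
Local Notation i0 := (start M0).
Local Notation l0 := (elen M0).
Implicit Types v q : Row.

Local Notation ups f v := (iter f (cmp Up) v).
Local Notation dns f v := (iter f (cmp Dn) v).

Lemma pm_supp v v' P : pm v v' -> supp v P -> supp v' P.
Proof. by move=> /pm_sym[b ->] h N /h; rewrite entryZ => ->; rewrite scaler0. Qed.

Lemma ups0 f : ups f (0 : Row) = 0.
Proof. by elim: f => //= f ->; rewrite cmpm0. Qed.

Lemma dns0 f : dns f (0 : Row) = 0.
Proof. by elim: f => //= f ->; rewrite cmpm0. Qed.

Lemma pm_up_dn v : arc_row v -> pm (Up ** (Dn ** v)) (Dn ** (Up ** v)).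
Proof. by move=> h; exists true; rewrite expr1 scaleN1r (up_dn hn h). Qed.

Lemma dn_ups f v : (forall j, (j < f)%N -> arc_row (ups j v : Row)) ->
  pm (Dn ** ups f v) (ups f (Dn ** v)).
Proof.
elim: f => [|f IH] h /=; first exact: pm_refl.
apply: pm_trans (pm_cmp _ (IH _)); last by move=> j jf; apply: h; lia.
by apply/pm_sym/pm_up_dn/h.
Qed.

Definition onl (s l : nat) : pred edge := fun N => (off i0 (start N) == s) && (elen N == l).

Lemma elen_max N : (3 <= elen N <= n.+1)%N.
Proof.
by case: (boolP (degenerate N)) => [/elen_deg ->|/negbTE/elen_arc]; lia.
Qed.

Lemma onl_nil s l v : ~~ (3 <= l <= n.+1)%N -> supp v (onl s l) -> v = 0.
Proof.
move=> h vs; apply: supp0; apply: supp_imp vs => N /andP[_ /eqP E].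
by move: h; rewrite -E elen_max.
Qed.

Lemma onl_up s l v : supp v (onl s l) -> supp (Up ** v) (onl s l.+1).
Proof.
move=> h; apply: (supp_up h) => L N /andP[a /eqP b] /andP[/eqP c /eqP d].
by rewrite /onl c a d b eqxx.
Qed.

Lemma onl_ups s l f v : supp v (onl s l) -> supp (ups f v : Row) (onl s (l + f)).
Proof. by move=> h; elim: f => [|f IH] /=; rewrite ?addn0 // addnS; apply: onl_up. Qed.

Lemma onl_dn s l v : (s.+1 < n)%N -> supp v (onl s l) -> supp (Dn ** v) (onl s.+1 l.-1).
Proof.
move=> sn h; apply: (supp_dn h) => L N /andP[/eqP a /eqP b] /andP[/eqP c /eqP d].
rewrite /onl c off_ordS a -b -d eqxx andbT.
by case: (altP (s.+1 =P n)) => h2; lia.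
Qed.

Lemma onl_dns s l f v : (s + f < n)%N -> supp v (onl s l) -> supp (dns f v : Row) (onl (s + f) (l - f)).
Proof.
move=> + h; elim: f => [|f IH] /= sn; first by rewrite addn0 subn0.
by rewrite addnS subnS; apply: onl_dn; [lia | apply: IH; lia].
Qed.

Lemma onl_arc s l v : (l <= n)%N -> supp v (onl s l) -> arc_row v.
Proof.
move=> ln; apply: supp_imp => N /andP[_ /eqP E].
by rewrite degenerateE E; apply/eqP; lia.
Qed.

Lemma unit_supp : supp e (pred1 M0).
Proof. by move=> N /unit_row0. Qed.

Lemma unit_onl : supp e (onl 0 l0).
Proof. by apply: supp_imp unit_supp => N /eqP ->; rewrite /onl offxx !eqxx. Qed.

Section Pi.
Variables (q : Row) (t : bool).
Hypothesis qs : supp q (fun N => onl 0 n.+1 N && (tag N == t)).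

(** A word that leaves a degenerate edge at the start of [M0]. After [g] falls and [f] rises its
    length is [n.+1 - g + f], so that only [f <= g] matters. *)
Definition pi_word f g : Row := ups f (dns g q).

Lemma q_onl : supp q (onl 0 n.+1).
Proof. by apply: supp_imp qs => N /andP[]. Qed.

Lemma dnq_supp g : (g <= n - 2)%N -> supp (dns g q : Row) (onl g (n.+1 - g)).
Proof. by move=> h; apply: (onl_dns (s := 0)) q_onl; lia. Qed.

Lemma dnq0 g : (n - 2 < g)%N -> dns g q = 0.
Proof.
move=> h; have -> : g = ((g - (n - 1)) + (n - 1))%N by lia.
rewrite iterD (_ : iter (n - 1) _ q = 0) ?dns0 //.
have := @onl_dns 0 n.+1 (n - 1) q; move/(_ _ q_onl) => h2.
by apply: onl_nil (h2 _); lia.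
Qed.

Lemma pi_supp f g : (g <= n - 2)%N -> supp (pi_word f g) (onl g (n.+1 - g + f)).
Proof. by move=> h; apply/onl_ups/dnq_supp. Qed.

Lemma pi0 f g : (n - 2 < g)%N -> pi_word f g = 0.
Proof. by move=> h; rewrite /pi_word dnq0 // ups0. Qed.

Lemma pi_dn f g : (f <= g)%N -> pm (Dn ** pi_word f g) (pi_word f g.+1).
Proof.
move=> fg; have [h|h] := leqP g (n - 2); last first.
  by rewrite !pi0 ?cmpm0; [apply: pm_refl | lia | lia].
apply: dn_ups => j jf; apply: (@onl_arc g (n.+1 - g + j)); first by lia.
exact: pi_supp.
Qed.

(** A diagonal word is a sequence of steps fall, rise along the degenerate edges, and each step
    keeps the tag by [tag_up_dn]. *)
Lemma pi_diag g : supp (pi_word g g) (fun N => onl g n.+1 N && (tag N == t)).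
Proof.
elim: g => [|g IH]; first exact: qs.
have [h|h] := leqP g.+1 (n - 2); last by rewrite pi0.
have h1 : pm (Up ** (Dn ** pi_word g g)) (pi_word g.+1 g.+1).
  by apply: (pm_cmp Up); apply: pi_dn.
apply: pm_supp h1 _.
have s1 : supp (Up ** (Dn ** pi_word g g)) (fun N => degenerate N && (tag N == t)).
  apply: (tag_up_dn hn); apply: supp_imp IH => N /andP[/andP[_ /eqP E] ->].
  by rewrite degenerateE E eqxx.
have s2 : supp (Up ** (Dn ** pi_word g g)) (onl g.+1 n.+1).
  have E : n.+1 = n.+1.-1.+1 by lia.
  rewrite E; apply: onl_up; apply: onl_dn; first by lia.
  by apply: supp_imp IH => N /andP[].
move=> N; rewrite negb_and => /orP[/s2 //|nt]; apply: s1.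
by rewrite negb_and nt orbT.
Qed.

Lemma pi_top g : Up ** pi_word g g = 0.
Proof.
have [h|h] := leqP g (n - 2); last by rewrite pi0 ?cmpm0.
apply: (@onl_nil g (n.+1 - g + g).+1); first by lia.
by apply/onl_up/pi_supp.
Qed.

End Pi.

Section Arc.
Hypothesis arc0 : degenerate M0 = false.

Definition p_word a b : Row := ups a (dns b e).

Lemma p_supp a b : (b <= l0 - 3)%N -> supp (p_word a b) (onl b (l0 - b + a)).
Proof.
move=> h; apply/onl_ups; apply: (onl_dns (s := 0)) unit_onl.
by have := elen_arc arc0; lia.
Qed.

Lemma p0 a b : (l0 - 3 < b)%N -> p_word a b = 0.
Proof.
have la := elen_arc arc0.
move=> h; rewrite /p_word (_ : dns b e = 0) ?ups0 //.
have -> : b = ((b - (l0 - 2)) + (l0 - 2))%N by lia.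
rewrite iterD (_ : iter (l0 - 2) _ e = 0) ?dns0 //.
have h2 := @onl_dns 0 l0 (l0 - 2) e.
by apply: (onl_nil _ (h2 _ unit_onl)); lia.
Qed.

Lemma p_dn a b : (l0 + a <= n.+1 + b)%N -> pm (Dn ** p_word a b) (p_word a b.+1).
Proof.
move=> ab; have [h|h] := leqP b (l0 - 3); last first.
  by rewrite !p0 ?cmpm0; [apply: pm_refl | lia | lia].
apply: dn_ups => j jf; apply: (@onl_arc b (l0 - b + j)); last exact: p_supp.
by have := elen_arc arc0; lia.
Qed.

(** The word that climbs from the arc [M0] to the degenerate edges at its start, cut down to one
    tag. The other tag needs no family of its own: its part is the difference with the whole
    word. *)
Definition q0 : Row := Zt true (p_word (n.+1 - l0) 0).

Lemma q0_supp : supp q0 (fun N => onl 0 n.+1 N && (tag N == true)).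
Proof.
have la := elen_arc arc0.
have := Zt_supp (e := true) (@p_supp (n.+1 - l0) 0 isT).
apply: supp_imp => N /and3P[a _ ->]; move: a.
by rewrite (_ : l0 - 0 + (n.+1 - l0) = n.+1)%N ?andbT //; lia.
Qed.

Lemma p_deg b : supp (p_word (n.+1 - l0 + b) b) (@degenerate n).
Proof.
have la := elen_arc arc0.
have [h|h] := leqP b (l0 - 3); last by rewrite p0.
apply: supp_imp (p_supp h) => N /andP[_ /eqP E].
by rewrite degenerateE E; apply/eqP; lia.
Qed.

Lemma pm_Zt t v v' : pm v v' -> pm (Zt t v) (Zt t v').
Proof.
case=> b ->; exists b; apply: rowP => N; rewrite entryZ !entryZt entryZ.
by case: ifP => //; rewrite scaler0.
Qed.

Lemma Zt_id t v : supp v (fun N => degenerate N && (tag N == t)) -> Zt t v = v.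
Proof. by move=> h; apply: rowP => N; rewrite entryZt; case: ifP => // /negbT/h. Qed.

Lemma Zt_other t v : supp v (fun N => degenerate N && (tag N == ~~ t)) -> Zt t v = 0.
Proof.
move=> h; apply: rowP => N; rewrite entryZt; case: ifP => // /andP[d /eqP s].
by rewrite h // s d /=; case: t {h s}.
Qed.

Lemma Zt_up_dn t v : supp v (@degenerate n) ->
  Zt t (Up ** (Dn ** v)) = Up ** (Dn ** Zt t v).
Proof.
move=> h; have hs b : supp (Zt b v) (fun N => degenerate N && (tag N == b)).
  by apply: supp_imp (Zt_supp (e := b) h) => N /and3P[_ -> ->].
rewrite {1}(Zt_sum h) !cmpDr ZtD.
case: t.
  rewrite (Zt_id (tag_up_dn hn (hs true))).
  by rewrite (@Zt_other true _ (tag_up_dn hn (hs false))) addr0.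
rewrite (Zt_id (tag_up_dn hn (hs false))).
by rewrite (@Zt_other false _ (tag_up_dn hn (hs true))) add0r.
Qed.

(* on the degenerate level a word from an arc splits into its two tags *)
Lemma p_Zt b : pm (Zt true (p_word (n.+1 - l0 + b) b)) (pi_word q0 b b).
Proof.
have la := elen_arc arc0.
elim: b => [|b IH]; first by rewrite addn0; apply: pm_refl.
rewrite addnS.
apply: (@pm_trans _ _ _ (Zt true (Up ** (Dn ** p_word (n.+1 - l0 + b) b)))).
  by apply: pm_Zt; apply: (pm_cmp Up); apply/pm_sym/p_dn; lia.
rewrite Zt_up_dn; last exact: p_deg.
apply: pm_trans (pm_cmp _ (pm_cmp _ IH)) _.
by apply: (pm_cmp Up); apply: (pi_dn q0_supp).
Qed.

(** By [p_Zt] the diagonal word with [f] falls is, up to sign, a component of a word from [M0] with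
    [f] falls, and an arc of length [l0] can fall at most [l0 - 3] times. *)
Lemma pi_q0_0 f g : (f <= g)%N -> (l0 - 3 < f)%N -> pi_word q0 f g = 0.
Proof.
move=> fg lf; have [h|h] := leqP g (n - 2); last by rewrite (pi0 q0_supp).
have -> : g = ((g - f) + f)%N by lia.
have E : pi_word q0 f f = 0.
  apply: pm0; apply: pm_trans (pm_sym (p_Zt f)) _.
  rewrite p0 // (_ : Zt true 0 = 0); first exact: pm_refl.
  by apply: rowP => N; rewrite entryZt if_same.
elim: (g - f)%N => [|j IH] //; apply: pm0; rewrite addSn.
by apply: pm_trans (pm_sym (pi_dn q0_supp _)) _; [lia | rewrite IH cmpm0; apply: pm_refl].
Qed.

End Arc.
End Source.
End Words.

(** * Normal forms span all morphisms *)

Section Span.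
Variables (k : fieldType) (n : nat).
Hypothesis hn : (4 <= n)%N.
Local Notation edge := (tedge n).
Local Notation C0 := (presented (@mesh_rel n k)).
Local Notation hom0 := (@hom _ C0).
Local Notation Up := (@Up k n).
Local Notation Dn := (@Dn k n).
Local Notation mv := (@mv k n).
Local Notation unit_row M := (@unit_row k n M).
Implicit Types L M N : edge.

(** [Up] and [Dn] sum over all sources. A single move is recovered from them only on a row with one
    non-zero entry, which is why words are cut down to one edge before a move is applied. *)
Lemma mv_unit L M N (v : hom (edge_object k M) (Xall k n)) :
  supp v (pred1 L) ->
  mv L N ** entry v L = entry (Up ** v) N + entry (Dn ** v) N.
Proof.
move=> vL; rewrite !entry_cmp (bigD1 L) //= big1 ?addr0 => [|X XL]; last first.
  by rewrite (vL X) // cmpm0.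
rewrite (bigD1 L) //= [X in _ + (_ + X)]big1 ?addr0 => [|X XL]; last first.
  by rewrite (vL X) // cmpm0.
rewrite /Up /Dn; case: ifP => a; case: ifP => b; rewrite ?cmp0m ?addr0 ?add0r //.
  by move: a b => /andP[_ /eqP a] /andP[_ /eqP b]; lia.
by rewrite mv0 ?cmp0m // elementary_moveE a b.
Qed.

Section Source.
Variable M0 : edge.
Local Notation Row := (hom (edge_object k M0) (Xall k n)).
Local Notation e := (unit_row M0).
Local Notation i0 := (start M0).
Local Notation l0 := (elen M0).
Local Notation q0 := (@q0 k n M0).
Local Notation p_word := (@p_word k n M0).
Local Notation ups f v := (iter f (cmp Up) v).
Local Notation dns f v := (iter f (cmp Dn) v).
Implicit Types v q : Row.

Definition qrow : Row := if degenerate M0 then e else q0.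

Lemma qrow_supp : supp qrow (fun N => onl M0 0 n.+1 N && (tag N == tag M0)).
Proof.
rewrite /qrow; case: (boolP (degenerate M0)) => d.
  apply: supp_imp (@unit_supp _ _ _) => N /eqP ->.
  by rewrite /onl offxx (elen_deg d) !eqxx.
by rewrite (tag_arc (negbTE d)); apply/q0_supp/negbTE.
Qed.

(* Normal forms of degree d: p_word stays among the arcs, pi_word passes through the degenerate
   edges at the start of M0. *)
Inductive gen (d : nat) : Row -> Prop :=
| genP a b : degenerate M0 = false -> (l0 + a <= n.+1 + b)%N -> d = (a + b)%N ->
    gen d (p_word a b)
| genPi f g : (f <= g)%N -> d = (n.+1 - l0 + f + g)%N -> gen d (pi_word qrow f g).

Inductive Sp (d : nat) (N : edge) : hom0 M0 N -> Prop :=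
| Sp_gen v : gen d v -> Sp d (entry v N)
| Sp0 : Sp d 0
| SpD f g : Sp d f -> Sp d g -> Sp d (f + g)
| SpZ c f : Sp d f -> Sp d (c *: f).

Definition SpRow d v := forall N, Sp d (entry v N).

Lemma SpRow_gen d v : gen d v -> SpRow d v.
Proof. by move=> h N; apply: Sp_gen. Qed.

Lemma SpRow_pm d u v : pm u v -> SpRow d v -> SpRow d u.
Proof. by case=> b -> h N; rewrite entryZ; apply/SpZ/h. Qed.

Lemma SpRow0 d : SpRow d 0.
Proof. by move=> N; rewrite entry0; apply: Sp0. Qed.

Lemma SpRowB d u v : SpRow d u -> SpRow d v -> SpRow d (u - v).
Proof.
move=> hu hv N; rewrite entryD entryN; apply: SpD; first exact: hu.
by rewrite -scaleN1r; apply/SpZ/hv.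
Qed.

Lemma mv_single d v L N : supp v (pred1 L) ->
  SpRow d (Up ** v) -> SpRow d (Dn ** v) -> Sp d (mv L N ** entry v L).
Proof. by move=> vL hu hd; rewrite mv_unit //; apply: SpD. Qed.

(** For [f < g] the word is concentrated in one arc, and for [f = g] in one degenerate edge, because
    the tag is kept. In the second case only a fall can follow. *)
Lemma Pi_mv d f g L N : (f <= g)%N -> d = (n.+1 - l0 + f + g)%N ->
  Sp d.+1 (mv L N ** entry (pi_word qrow f g) L).
Proof.
move=> fg ->; have [h|h] := leqP g (n - 2); last first.
  by rewrite (pi0 hn qrow_supp) // entry0 cmpm0; apply: Sp0.
have hd : SpRow (n.+1 - l0 + f + g).+1 (Dn ** pi_word qrow f g).
  apply: SpRow_pm (pi_dn hn qrow_supp fg) _; apply: SpRow_gen; apply: genPi; lia.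
have [E|nfg] := eqVneq f g.
  subst g; have ps := pi_diag hn qrow_supp (g := f).
  have [hL|hL] := boolP (onl M0 f n.+1 L && (tag L == tag M0)); last first.
    by rewrite ps // cmpm0; apply: Sp0.
  apply: mv_single => //; last by rewrite (pi_top hn qrow_supp); apply: SpRow0.
  apply: supp_imp ps => N' /andP[/andP[/eqP a /eqP b] /eqP c].
  move: hL => /andP[/andP[/eqP a' /eqP b'] /eqP c'].
  by apply/eqP/edge_inj; rewrite ?b ?b' ?c ?c' //; apply: (@off_inj _ i0); rewrite a a'.
have ps := pi_supp hn qrow_supp (f := f) h.
have [hL|hL] := boolP (onl M0 g (n.+1 - g + f) L); last first.
  by rewrite ps // cmpm0; apply: Sp0.
apply: mv_single => //.
  apply: supp_imp ps => N' /andP[/eqP a /eqP b].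
  move: hL => /andP[/eqP a' /eqP b'].
  apply/eqP/edge_inj; rewrite ?b ?b' //; first by apply: (@off_inj _ i0); rewrite a a'.
  by rewrite !tag_arc // degenerateE ?b ?b'; apply/eqP; lia.
apply: SpRow_gen; rewrite -[cmp Up _]/(pi_word qrow f.+1 g); apply: genPi; lia.
Qed.

Lemma SpRow_q d b : degenerate M0 = false -> d = (n.+1 - l0 + b + b)%N ->
  SpRow d.+1 (Dn ** Zt true (p_word (n.+1 - l0 + b) b)).
Proof.
move=> arc0 ->; apply: SpRow_pm (pm_cmp Dn (p_Zt k hn arc0 b)) _.
have qE : q0 = qrow by rewrite /qrow arc0.
rewrite qE; apply: SpRow_pm (pi_dn hn qrow_supp (leqnn b)) _.
by apply: SpRow_gen; apply: genPi; lia.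
Qed.

Lemma Zt_false v : supp v (@degenerate n) -> Zt false v = v - Zt true v.
Proof. by move=> h; apply/eqP; rewrite eq_sym subr_eq addrC; apply/eqP/Zt_sum. Qed.

Lemma P_mv d a b L N : degenerate M0 = false -> (l0 + a <= n.+1 + b)%N -> d = (a + b)%N ->
  Sp d.+1 (mv L N ** entry (p_word a b) L).
Proof.
move=> arc0 ab ->; have la := elen_arc arc0.
have [h|h] := leqP b (l0 - 3); last first.
  by rewrite (p0 k hn arc0) // entry0 cmpm0; apply: Sp0.
have hd : SpRow (a + b).+1 (Dn ** p_word a b).
  apply: SpRow_pm (p_dn k hn arc0 ab) _; apply: SpRow_gen; apply: genP => //; lia.
have ps := p_supp k hn arc0 (a := a) h.
have [hL|hL] := boolP (onl M0 b (l0 - b + a) L); last first.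
  by rewrite ps // cmpm0; apply: Sp0.
move: hL => /andP[/eqP a' /eqP b'].
have [lt|ge] := ltnP (l0 + a) (n.+1 + b).
  apply: mv_single => //.
    apply: supp_imp ps => N' /andP[/eqP a2 /eqP b2].
    apply/eqP/edge_inj; rewrite ?b2 ?b' //; first by apply: (@off_inj _ i0); rewrite a2 a'.
    by rewrite !tag_arc // degenerateE ?b2 ?b'; apply/eqP; lia.
  apply: SpRow_gen; rewrite -[cmp Up _]/(p_word a.+1 b); apply: genP => //; lia.
(* The word has reached the degenerate edges, where its row has two entries, one for each tag. After
   a fall the part with tag [true] becomes a word from [q0], and the other part is handled as the
   difference. *)
have aE : a = (n.+1 - l0 + b)%N by lia.
have dL : degenerate L by rewrite degenerateE b'; apply/eqP; lia.
have -> : entry (p_word a b) L = entry (Zt (tag L) (p_word a b)) L.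
  by rewrite entryZt dL eqxx.
have zs := Zt_supp (e := tag L) ps.
apply: mv_single => //.
- apply: supp_imp zs => N' /and3P[/andP[/eqP a2 /eqP b2] _ /eqP c].
  by apply/eqP/edge_inj; rewrite ?b2 ?b' ?c //; apply: (@off_inj _ i0); rewrite a2 a'.
- rewrite (_ : cmp Up _ = 0); first exact: SpRow0.
  apply: (@onl_nil _ _ hn _ b (l0 - b + a).+1); first by lia.
  by apply: onl_up; apply: supp_imp zs => N' /andP[].
have hq : SpRow (a + b).+1 (Dn ** Zt true (p_word a b)).
  by rewrite aE; apply: SpRow_q; lia.
case: (tag L) => //.
have dp : supp (p_word a b) (@degenerate n) by rewrite aE; apply: (p_deg k hn arc0).
rewrite (Zt_false dp) cmpDr -scaleN1r cmpZr scaleN1r; exact: SpRowB.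
Qed.

Lemma Sp_mv d L N f : Sp d f -> Sp d.+1 (mv L N ** (f : hom0 M0 L)).
Proof.
elim=> {f} [v [a b|f g]||f g _ hf _ hg|c f _ hf].
- exact: P_mv.
- exact: Pi_mv.
- by rewrite cmpm0; apply: Sp0.
- by rewrite cmpDr; apply: SpD.
- by rewrite cmpZr; apply: SpZ.
Qed.

Lemma Sp_id : Sp 0 (idm (M0 : C0)).
Proof.
rewrite -unit_rowE; apply: Sp_gen.
have [d|d] := boolP (degenerate M0).
  have -> : e = pi_word qrow 0 0 by rewrite /qrow d.
  by apply: genPi; rewrite ?elen_deg //; lia.
apply: (@genP _ 0 0); [exact/negbTE | have := elen_max hn M0; lia | by []].
Qed.

(** The normal form that ends in [N], by the same cases as in [rot]. The last case passes through a
    degenerate edge at the start of [M0]. *)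
Definition wrow N : Row :=
  let o := off i0 (start N) in
  if degenerate M0 then if degenerate N then ups o (dns o e) else dns o e
  else if o == 0%N then ups (elen N - l0)%N e
  else if (o + elen N == l0)%N then dns o e else dns o q0.

Definition basic N : hom0 M0 N := entry (wrow N) N.

Definition basic_degree d N := (d == rot M0 N) && ((M0 == N) || (0 < rot M0 N)%N).

(** The end of a normal form determines its exponents. If the end is compatible with [M0], then all
    normal forms except the one in [wrow] are zero at [N] or have the same entry there, and the
    exponents fix the degree. *)
Lemma Sp_basic d N f : compat M0 N -> Sp d f ->
  f = 0 \/ basic_degree d N /\ exists c, f = c *: basic N.
Proof.
move=> MN; elim=> {f} [v||f g _ hf _ hg|c f _ hf]; last 2 first.
- case: hf hg => [->|[hd [c ->]]]; first by rewrite add0r.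
  case=> [->|[_ [c' ->]]]; first by rewrite addr0; right; split => //; exists c.
  by right; split => //; exists (c + c'); rewrite scalerDl.
- case: hf => [->|[hd [c' ->]]]; first by left; rewrite scaler0.
  by right; split => //; exists (c * c'); rewrite scalerA.
- have lN := elen_max hn N; have oN := off_lt i0 (start N).
  have sN : N = M0 \/ (off i0 (start N) != 0%N) \/ elen N <> l0 \/ degenerate N /\ tag N <> tag M0.
    have [o0|] := eqVneq (off i0 (start N)) 0%N; last by right; left.
    have [l1|] := eqVneq (elen N) l0; last by move/eqP; right; right; left.
    have [t|t] := eqVneq (tag N) (tag M0).
      left; apply: edge_inj => //; apply/esym/eqP; rewrite -off_eq0 o0 //.
    right; right; right; split; last exact/eqP.
    apply: contraNT t => dN; rewrite !tag_arc ?eqxx //.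
      by rewrite degenerateE -l1 -degenerateE (negbTE dN).
    exact/negbTE.
  case=> [a b arc0 ab ->|f g fg ->].
    have la := elen_arc arc0.
    have [h|h] := leqP b (l0 - 3); last by left; rewrite (p0 k hn arc0).
    have [/andP[/eqP a' /eqP b']|hL] := boolP (onl M0 b (l0 - b + a) N); last first.
      by left; apply: (p_supp k hn arc0 h).
    right; move: MN; rewrite /compat /basic_degree /rot arc0 (off_sym i0 (start N)) a' /basic /wrow arc0 a' b' /=.
    case: (boolP (degenerate N)) => dN.
      have {}dN := elen_deg dN; rewrite b' in dN.
      have [b0 _|b0] := eqVneq b 0%N; last by rewrite /=; lia.
      move: a' b' dN ab h; rewrite b0 => a' b' dN ab h; split; first by lia.
      exists 1; rewrite scale1r /p_word /= (_ : (_ - l0)%N = a) //; lia.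
    have {}dN := elen_arc (negbTE dN); rewrite b' in dN.
    have [b0 _|b0] := eqVneq b 0%N.
      move: a' b' dN ab h; rewrite b0 => a' b' dN ab h; split; last by exists 1; rewrite scale1r /p_word /= (_ : (_ - l0)%N = a) //; lia.
      apply/andP; split; first by apply/eqP; lia.
      have [a0|a0] := eqVneq a 0%N; last by apply/orP; right; lia.
      apply/orP; left; rewrite eq_sym; apply/eqP; case: sN => //; case; first by rewrite a' eqxx.
      by case; [rewrite b'; lia | case; rewrite degenerateE b'; lia].
    move=> cMN; have a0 : a = 0%N by lia.
    subst a; rewrite (_ : (b + (l0 - b + 0) == l0)%N); last by apply/eqP; lia.
    by split; [lia | exists 1; rewrite scale1r].
  have [h|h] := leqP g (n - 2); last by left; rewrite (pi0 hn qrow_supp).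
  have [/andP[/eqP a' /eqP b']|hL] := boolP (onl M0 g (n.+1 - g + f) N); last first.
    by left; apply: (pi_supp hn qrow_supp h).
  have [tN|hL] := boolP ((f == g) ==> (tag N == tag M0)); last first.
    move: hL; rewrite negb_imply => /andP[/eqP E nt].
    by left; rewrite -E (pi_diag hn qrow_supp) // negb_and nt orbT.
  move: MN; rewrite /compat /basic_degree /rot (off_sym i0 (start N)) a' /basic /wrow a' b' /=.
  have [d0|d0] := boolP (degenerate M0).
    have {}dM := elen_deg d0.
    case: (boolP (degenerate N)) => dN /=.
      have E : f = g by have := elen_deg dN; rewrite b'; lia.
      have {}tN := eqP (implyP tN (introT eqP E)); move=> _; right.
      move: (a') (b') h fg; rewrite -E => {}a' {}b' h _; rewrite tN eqxx h dM /=; split; last first.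
        by exists 1; rewrite scale1r /qrow d0.
      apply/andP; split; first by apply/eqP; lia.
      have [f0|f0] := eqVneq f 0%N; last by apply/orP; right; lia.
      apply/orP; left; apply/eqP/edge_inj => //; last by rewrite (elen_deg dN).
      by apply/eqP; rewrite -off_eq0 a' f0.
    have {}dN := elen_arc (negbTE dN); rewrite b' in dN.
    rewrite dM; case: (eqVneq g 0%N) => g0 /=; first by lia.
    move=> cMN; have f0 : f = 0%N by lia.
    right; subst f; rewrite (_ : (g + (n.+1 - g + 0) == n.+1)%N); last by apply/eqP; lia.
    by split; [lia | exists 1; rewrite scale1r /qrow d0].
  have {}dM := elen_arc (negbTE d0).
  have [lf|lf] := leqP f (l0 - 3); last first.
    by move=> _; left; rewrite /qrow (negbTE d0) (pi_q0_0 k hn (negbTE d0)).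
  case: (boolP (degenerate N)) => dN /=.
    have E : f = g by have := elen_deg dN; rewrite b'; lia.
    have [f0 _|f0] := eqVneq f 0%N; last by move: E f0 => <-; rewrite /=; lia.
    right; rewrite -E f0 /=; split; first by lia.
    exists 1; rewrite scale1r /qrow (negbTE d0) /pi_word /= entryZt dN /=.
    rewrite (eqP (implyP tN (introT eqP E))) (tag_arc (negbTE d0)) /=.
    by rewrite /p_word /= ?addn0 ?subn0.
  have {}dN := elen_arc (negbTE dN); rewrite b' in dN.
  have [g0 _|g0] := eqVneq g 0%N; first by lia.
  move=> cMN; have f0 : f = 0%N by lia.
  right; subst f; rewrite (_ : (g + (n.+1 - g + 0) == l0)%N = false); last by lia.
  rewrite (_ : (g + (n.+1 - g + 0) == n.+1)%N); last by apply/eqP; lia.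
  by split; [lia | exists 1; rewrite scale1r /qrow (negbTE d0)].
- by left.
Qed.

End Source.
End Span.

(** * The grading by the number of moves *)

Section Graded.
Variables (k : fieldType) (n : nat).
Hypothesis hn : (4 <= n)%N.
Local Notation edge := (tedge n).
Local Notation C0 := (presented (@mesh_rel n k)).
Local Notation hom0 := (@hom _ C0).
Local Notation Up := (@Up k n).
Local Notation Dn := (@Dn k n).
Local Notation mv := (@mv k n).
Local Notation unit_row M := (@unit_row k n M).
Local Notation ups f v := (iter f (cmp Up) v).
Local Notation dns f v := (iter f (cmp Dn) v).
Implicit Types L M N : edge.

(* the morphisms that are sums of compositions of d elementary moves *)
Inductive Hd M : nat -> forall N, hom0 M N -> Prop :=
| Hd_id : Hd 0 (idm (M : C0))
| Hd_mv d L N (f : hom0 M L) : Hd d f -> Hd d.+1 (mv L N ** f)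
| Hd0 d N : Hd d (0 : hom0 M N)
| HdD d N (f g : hom0 M N) : Hd d f -> Hd d g -> Hd d (f + g)
| HdZ d N c (f : hom0 M N) : Hd d f -> Hd d (c *: f).

Lemma Hd_Sp M d N (f : hom0 M N) : Hd d f -> Sp d f.
Proof.
elim=> {d N f} [|d L N f _|d N|d N f g _ hf _|d N c f _].
- exact: Sp_id.
- exact: Sp_mv.
- exact: Sp0.
- exact: SpD.
- exact: SpZ.
Qed.

Lemma Hd_comp M L d d' N (f : hom0 M L) (g : hom0 L N) :
  Hd d f -> Hd d' g -> Hd (d' + d) (g ** f).
Proof.
move=> hf; elim=> {d' N g} [|d' L' N g _ h|d' N|d' N g g' _ h _ h'|d' N c g _ h].
- by rewrite cmp1m.
- by rewrite -cmpA addSn; apply: Hd_mv.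
- by rewrite cmp0m; apply: Hd0.
- by rewrite cmpDl; apply: HdD.
- by rewrite cmpZl; apply: HdZ.
Qed.

Definition Hd_row M d (v : hom (edge_object k M) (Xall k n)) := forall N, Hd d (entry v N).

Lemma Hd_sum M d N (I : finType) (F : I -> hom0 M N) :
  (forall i, Hd d (F i)) -> Hd d (\sum_i F i).
Proof. by move=> h; elim/big_ind: _ => //; [apply: Hd0 | apply: HdD]. Qed.

Lemma Hd_unit M : Hd_row 0 (unit_row M).
Proof.
move=> N; have [->|/unit_row0 ->] := eqVneq N M; last exact: Hd0.
by rewrite unit_rowE; apply: Hd_id.
Qed.

Lemma Hd_up M d (v : hom (edge_object k M) (Xall k n)) : Hd_row d v -> Hd_row d.+1 (Up ** v).
Proof.
move=> h N; rewrite entry_cmp; apply: Hd_sum => L; rewrite /Up.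
by case: ifP => _; [apply: Hd_mv | rewrite cmp0m; apply: Hd0].
Qed.

Lemma Hd_dn M d (v : hom (edge_object k M) (Xall k n)) : Hd_row d v -> Hd_row d.+1 (Dn ** v).
Proof.
move=> h N; rewrite entry_cmp; apply: Hd_sum => L; rewrite /Dn.
by case: ifP => _; [apply: Hd_mv | rewrite cmp0m; apply: Hd0].
Qed.

Lemma Hd_ups M d f (v : hom (edge_object k M) (Xall k n)) : Hd_row d v -> Hd_row (f + d) (ups f v).
Proof. by move=> h; elim: f => [//|f IH]; rewrite addSn; apply: Hd_up. Qed.

Lemma Hd_dns M d f (v : hom (edge_object k M) (Xall k n)) : Hd_row d v -> Hd_row (f + d) (dns f v).
Proof. by move=> h; elim: f => [//|f IH]; rewrite addSn; apply: Hd_dn. Qed.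

Lemma Hd_Zt M d t (v : hom (edge_object k M) (Xall k n)) : Hd_row d v -> Hd_row d (Zt t v).
Proof. by move=> h N; rewrite entryZt; case: ifP => _ //; apply: Hd0. Qed.

Lemma Hd_basic M N : compat M N -> (0 < rot M N)%N -> Hd (rot M N) (basic k M N).
Proof.
rewrite /compat /rot /basic /wrow; set o := off _ _.
have := Hd_unit M; set e := unit_row M => he.
have [dM|dM] := boolP (degenerate M); have [dN|dN] := boolP (degenerate N) => /=.
- case: ifP => // _ _ _; rewrite (_ : o.*2 = (o + (o + 0))%N); last by lia.
  by apply/Hd_ups/Hd_dns.
- rewrite (elen_deg dM); move: (elen_arc (negbTE dN)) => lN _.
  case: eqP => o0; first by lia.
  case: eqP => e1; last by [].
  rewrite (_ : (n.+1 - elen N)%N = (o + 0)%N); last by lia.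
  by move=> _; apply/Hd_dns.
- rewrite (elen_deg dN); move: (elen_arc (negbTE dM)) => lM _.
  case: eqP => o0; first by move=> _; rewrite -[X in Hd X _]addn0; apply/Hd_ups.
  case: eqP => e1; first by lia.
  by case: eqP => e2; first by lia.
- move: (elen_arc (negbTE dM)) (elen_arc (negbTE dN)) => lM lN _.
  case: eqP => o0; first by move=> _; rewrite -[X in Hd X _]addn0; apply/Hd_ups.
  case: eqP => e1; first by move=> _; rewrite (_ : (_ - _)%N = (o + 0)%N); [apply/Hd_dns | lia].
  case: eqP => e2 // _.
  rewrite (_ : (_ - _)%N = (o + (n.+1 - elen M + 0))%N); last by lia.
  by apply/Hd_dns/Hd_Zt/Hd_ups; exact: he.
Qed.

Lemma basicMM M : basic k M M = idm (M : C0).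
Proof.
by rewrite /basic /wrow offxx /= subnn /=; case: (degenerate M) => /=; rewrite unit_rowE.
Qed.

Inductive Any M N : hom0 M N -> Prop :=
| Any_Hd d f : Hd d f -> Any f
| AnyD f g : Any f -> Any g -> Any (f + g).

Lemma AnyZ M N c (f : hom0 M N) : Any f -> Any (c *: f).
Proof.
elim=> {f} [d f h|f g _ hf _ hg]; first by apply: Any_Hd; apply: HdZ h.
by rewrite scalerDr; apply: AnyD.
Qed.

Lemma Any0 M N : Any (0 : hom0 M N).
Proof. exact: (Any_Hd (Hd0 M 0 N)). Qed.

Lemma Any_comp M L N (f : hom0 M L) (g : hom0 L N) : Any f -> Any g -> Any (g ** f).
Proof.
move=> hf; elim=> {g} [d g hg|g g' _ h _ h']; last by rewrite cmpDl; apply: AnyD.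
elim: hf => {f} [d' f hf|f f' _ h _ h']; last by rewrite cmpDr; apply: AnyD.
exact: Any_Hd (Hd_comp hf hg).
Qed.

Lemma Any_term M N (t : term k (@move_gen n) M N) : Any (tclass (@mesh_rel n k) t : hom0 M N).
Proof.
elim: t => {M N} [M|M N u|M L N s hs t ht|M N|M N s hs t ht|M N c s hs].
- exact: (Any_Hd (Hd_id M)).
- have -> : tclass (@mesh_rel n k) (tgen u) = mv M N ** idm (M : C0).
    rewrite cmpm1 /mv /move_term; case: {-}_ / idP => [u'|h]; last by case: h.
    by rewrite (bool_irrelevance u u').
  exact: Any_Hd (Hd_mv N (Hd_id M)).
- by have := Any_comp ht hs; rewrite /cmp /= phom_cmpE.
- by rewrite tclass0; apply: Any0.
- by rewrite tclassD; apply: AnyD.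
- by rewrite tclassZ; apply: AnyZ.
Qed.

Lemma Any_hom M N (f : hom0 M N) : Any f.
Proof. by rewrite -(treprK f); apply: Any_term. Qed.

Lemma hom_basic M N (f : hom0 M N) : compat M N ->
  f = 0 \/ (M == N) || (0 < rot M N)%N /\ exists c, f = c *: basic k M N.
Proof.
move=> MN; elim: {f}(Any_hom f) => [d f h|f g _ hf _ hg].
  have [->|[/andP[_ h1] h2]] := Sp_basic hn MN (Hd_Sp h); first by left.
  by right.
case: hf => [->|[h [c ->]]]; first by rewrite add0r.
case: hg => [->|[_ [c' ->]]]; first by rewrite addr0; right; split => //; exists c.
by right; split => //; exists (c + c'); rewrite scalerDl.
Qed.

(** The composition is homogeneous of degree the sum of the two, whereas morphisms from [M] to [N]
    live in degree [rot M N] alone. *)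
Lemma comp_basic M L N : compat M L -> compat L N -> compat M N ->
  (0 < rot M L)%N -> (0 < rot L N)%N -> rot M N <> (rot L N + rot M L)%N ->
  basic k L N ** basic k M L = 0.
Proof.
move=> ML LN MN r1 r2 ne.
have h := Hd_comp (Hd_basic ML r1) (Hd_basic LN r2).
have [//|[/andP[/eqP e _] _]] := Sp_basic hn MN (Hd_Sp h).
by case: ne.
Qed.

End Graded.

Section Scalars.
Variable k : fieldType.

Definition scalars : lincat k.
Proof.
refine (@LinCat k unit (fun _ _ => k^o : lmodType k) (fun _ => 1)
  (fun _ _ _ g f => (g : k) * f) _ _ _ _ _ _ _) => /=.
- by move=> _ _ f; rewrite mul1r.
- by move=> _ _ f; rewrite mulr1.
- by move=> *; rewrite mulrA.
- by move=> *; rewrite mulrDl.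
- by move=> *; rewrite mulrDr.
- by move=> *; rewrite scalerAl.
- by move=> *; rewrite scalerAr.
Defined.

End Scalars.

(** * Functors to the base field that detect non-zero words *)

Section Weights.
Variables (k : fieldType) (n : nat).
Hypothesis hn : (4 <= n)%N.
Local Notation edge := (tedge n).
Local Notation C0 := (presented (@mesh_rel n k)).
Local Notation hom0 := (@hom _ C0).
Local Notation Up := (@Up k n).
Local Notation Dn := (@Dn k n).
Local Notation mv := (@mv k n).
Local Notation unit_row M := (@unit_row k n M).
Local Notation ups f v := (iter f (cmp Up) v).
Local Notation dns f v := (iter f (cmp Dn) v).
Implicit Types L M N : edge.

Section Functor.
Variable c : edge -> edge -> k.

(* A solution c of the mesh relations is a functor to k, seen as a category with one object; such
   functors detect non-zero compositions. *)
Definition weight := (forall M N, ~~ elementary_move M N -> c M N = 0) /\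
  forall N, \sum_X c X N * c (edge_translate N) X = 0.

Hypothesis cw : weight.

Definition weight_gen M N (_ : @move_gen n M N) : @hom _ (scalars k) tt tt := (c M N : k^o).

Lemma interp_move M N : interp weight_gen (move_term k M N) = (c M N : k^o).
Proof.
rewrite /move_term; case: {-}_ / idP => [u //|h] /=.
by rewrite (proj1 cw) //; apply/negP.
Qed.

Lemma weight_rel M N (s t : term k (@move_gen n) M N) :
  mesh_rel s t -> interp weight_gen s = interp weight_gen t.
Proof.
case=> {M N s t} N /=; have := proj2 cw N; rewrite -big_enum /=.
elim: (enum _) => [|X s IH] //=; rewrite ?big_nil // big_cons => E.
rewrite !interp_move.
have h (s' : seq edge) : interp weight_gen (tsum s' (fun X0 : edge => tcmp (move_term k X0 N) (move_term k (edge_translate N) X0))) = \sum_(i <- s') c i N * c (edge_translate N) i.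
  by elim: s' => [|Y s' IH']; rewrite ?big_nil //= big_cons -IH' !interp_move.
by rewrite h.
Qed.

Definition weight_functor : functor C0 (scalars k) := presented_functor weight_rel.

Definition ev M N (f : hom0 M N) : k := fmap weight_functor f.

Lemma ev_mv M N : ev (mv M N) = c M N.
Proof.
by rewrite /ev /weight_functor /= (interp_homE weight_rel) interp_move.
Qed.

Lemma ev_cmp M L N (g : hom0 L N) (f : hom0 M L) : ev (g ** f) = ev g * ev f.
Proof. by rewrite /ev fmapM. Qed.

Lemma ev_id M : ev (idm (M : C0)) = 1.
Proof. exact: (fmap1 weight_functor). Qed.

Lemma ev0 M N : ev (0 : hom0 M N) = 0.
Proof. exact: linear0. Qed.

Lemma ev_sum M N (I : finType) (F : I -> hom0 M N) : ev (\sum_i F i) = \sum_i ev (F i).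
Proof. exact: linear_sum. Qed.

Lemma ev_up M L N (v : hom (edge_object k M) (Xall k n)) : rises L N ->
  (forall X, X != L -> rises X N -> entry v X = 0) ->
  ev (entry (Up ** v) N) = c L N * ev (entry v L).
Proof.
move=> LN h; rewrite entry_cmp ev_sum (bigD1 L) //= big1 ?addr0 => [|X XL].
  by rewrite /Up LN ev_cmp ev_mv.
rewrite /Up; case: ifP => XN; last by rewrite cmp0m ev0.
by rewrite h // cmpm0 ev0.
Qed.

Lemma ev_dn M L N (v : hom (edge_object k M) (Xall k n)) : falls L N ->
  (forall X, X != L -> falls X N -> entry v X = 0) ->
  ev (entry (Dn ** v) N) = c L N * ev (entry v L).
Proof.
move=> LN h; rewrite entry_cmp ev_sum (bigD1 L) //= big1 ?addr0 => [|X XL].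
  by rewrite /Dn LN ev_cmp ev_mv.
rewrite /Dn; case: ifP => XN; last by rewrite cmp0m ev0.
by rewrite h // cmpm0 ev0.
Qed.

End Functor.

Lemma ex_edge (a : 'I_n) l t : (3 <= l <= n.+1)%N ->
  exists N, [/\ start N = a, elen N = l & degenerate N -> tag N = t].
Proof.
move=> h; have [E|lt] := eqVneq l n.+1; first by exists (Deg a t); rewrite E.
have b_lt : ((a + l.-1) %% n < n)%N by rewrite ltn_mod; lia.
pose b := Ordinal b_lt.
have ob : off a b = l.-1.
  rewrite offE /=; case: a {b b_lt} => a ha /=.
  have [h1|h1] := ltnP (a + l.-1) n; first by rewrite modn_small //; case: ifP; lia.
  rewrite -(subnK h1) modnDr modn_small; last by lia.
  by case: ifP; lia.
have ok : ((a, b).1 != (a, b).2) && (3 <= delta_len (a, b).1 (a, b).2)%N.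
  by rewrite -off_eq0 delta_lenE /= ob; apply/andP; split; [apply/eqP | ]; lia.
exists (Arc (exist _ (a, b) ok)); split => //.
by rewrite /elen delta_lenE /= ob; lia.
Qed.

Lemma ex_off (a : 'I_n) d : (d < n)%N -> exists x, off x a = d.
Proof.
move=> dn; have x_lt : ((a + n - d) %% n < n)%N by rewrite ltn_mod; lia.
exists (Ordinal x_lt); rewrite offE /=; case: a {x_lt} => a ha /=.
have [h1|h1] := ltnP a d.
  by rewrite modn_small; [case: ifP; lia | lia].
rewrite -addnBAC // modnDr modn_small; last by lia.
by case: ifP; lia.
Qed.

Section Hammock.
Variables (x : 'I_n) (t : bool).

(** The support of the words [pi_word f g] with [f <= g <= n - 2] from the degenerate edge at [x]
    with tag [t]: [g] is the offset, and the second inequality says that [f], which is the offset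
    plus the length minus [n.+1], is non-negative. *)
Definition inK M := [&& off x (start M) <= n - 2, n < off x (start M) + elen M
  & degenerate M ==> (tag M == t)]%N.

(** The sign of a fall alternates with the length, so that the two ways around a mesh, whose falls
    start in lengths that differ by one, cancel. *)
Definition wK M N : k :=
  if inK M && inK N then
    if rises M N then 1 else if falls M N then (-1) ^+ elen M else 0
  else 0.

(** If both ends of a mesh lie in the hammock, then so do the rise and the fall between them, where
    a degenerate middle term counts with the tag [t] only, and the two contributions cancel. Two
    degenerate ends of a mesh have opposite tags and are never both in the hammock. *)
Lemma weightK : weight wK.
Proof.
split=> [M N h|N].
  by move: h; rewrite /wK elementary_moveE negb_or => /andP[/negbTE -> /negbTE ->]; rewrite if_same.
have := start_translate N; have := elen_translate N; have := degenerate_translate N.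
have := @tag_translate n N; move: (edge_translate N) => M tM dM lM sM.
have [/andP[KM KN]|h] := boolP (inK M && inK N); last first.
  by apply: big1 => X _; rewrite /wK; case/nandP: h => /negbTE ->;
    rewrite ?andbF /= ?mul0r ?mulr0.
have dN : degenerate N = false.
  apply/negP => d; move: KM KN; rewrite /inK tM // dM d /=.
  by case/and3P=> _ _ /eqP <- /and3P[_ _ /eqP]; case: (tag N).
have lN := elen_arc dN.
have eN : (elen N).-1.+1 = elen N by lia.
move: (KM) (KN) => /and3P[a1 a2 _] /and3P[b1 b2 _].
move: a1 a2; rewrite sM lM off_pred; case: eqP => [o0|/eqP o0] a1 a2; first by lia.
have e1 : (3 <= (elen M).+1 <= n.+1)%N by lia.
have e2 : (3 <= (elen N).-1 <= n.+1)%N by lia.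
have [X1 [s1 l1 t1]] := ex_edge (start M) t e1.
have [X2 [s2 l2 t2]] := ex_edge (start N) t e2.
have K1 : inK X1.
  apply/and3P; split; last by apply/implyP => /t1 ->.
    by rewrite s1 sM off_pred (negbTE o0).
  by rewrite s1 l1 sM off_pred (negbTE o0) lM; clear - a2; lia.
have K2 : inK X2.
  apply/and3P; split; last by apply/implyP => /t2 ->.
    by rewrite s2.
  by rewrite s2 l2; clear - a2 o0 lN; lia.
have sN : start N = ordS (start M) by rewrite sM ord_predK.
have nS : start N != start M.
  by rewrite sM -off_eq0 off_pred offxx /=; clear - hn; lia.
have X12 : X2 != X1.
  by apply/eqP => E; move: l1 l2; rewrite E lM => ->; clear; lia.
rewrite (bigD1 X1) //= (bigD1 X2) //= big1 ?addr0 => [|X /andP[XX1 XX2]].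
  rewrite /wK KM KN K1 K2 /=.
  rewrite /rises /falls s1 s2 l1 l2 sN eqxx -sN (eq_sym (start M)) (negbTE nS) /= lM !eqxx /=.
  rewrite eN eqxx mulr1 mul1r exprS mulN1r; apply/eqP; rewrite addrC subr_eq0.
  by rewrite eqxx.
rewrite /wK; case: (boolP (inK X)) => KX; last by rewrite mul0r.
rewrite KM KN /=.
have r1 : rises M X -> False.
  move=> /andP[/eqP sX /eqP lX]; move/eqP: XX1; apply.
  apply: edge_inj; rewrite ?sX ?s1 ?lX ?l1 //.
  have [d|d] := boolP (degenerate X); last first.
    by rewrite !tag_arc //; apply/negbTE => //; move: d; rewrite !degenerateE lX l1.
  rewrite t1; last by rewrite degenerateE l1 -lX -degenerateE.
  by move: KX => /and3P[_ _]; rewrite d => /eqP.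
have r2 : falls M X -> False.
  move=> /andP[/eqP sX /eqP lX]; move/eqP: XX2; apply.
  have dX : degenerate X = false.
    by rewrite degenerateE; apply/eqP; clear - lX lM lN; lia.
  apply: edge_inj; rewrite ?sX ?s2 ?l2 ?sN //; first by clear - lX lM; lia.
  rewrite !tag_arc // degenerateE l2; apply/eqP; clear - lN; lia.
by move/negP/negbTE: r1 => ->; move/negP/negbTE: r2 => ->; rewrite mulr0.
Qed.

Lemma inK_onl M b l N : (off x (start M) + b <= n - 2)%N ->
  (n < off x (start M) + b + l)%N -> onl M b l N -> (degenerate N -> tag N = t) -> inK N.
Proof.
move=> h1 h2 /andP[/eqP oN /eqP lN] tN; apply/and3P.
rewrite (off_triangle _ (start M)) oN lN ifT; last by clear - h1 hn; lia.
by split=> //; apply/implyP => /tN ->.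
Qed.

Lemma wK_neq0 M N : inK M -> inK N -> rises M N || falls M N -> wK M N != 0.
Proof.
rewrite /wK => -> ->; case: (rises M N) => /= [_|->]; first exact: oner_neq0.
by rewrite signr_eq0.
Qed.

Lemma evK_dns M b N : (off x (start M) + b <= n - 2)%N ->
  (n < off x (start M) + elen M)%N -> (degenerate M -> tag M = t) ->
  onl M b (elen M - b) N -> (degenerate N -> tag N = t) ->
  ev weightK (entry (dns b (unit_row M)) N) != 0.
Proof.
move=> + KM tM; elim: b N => [|b IH] N h1 oN tN.
  have -> : N = M.
    move: oN => /andP[/eqP oN /eqP lN]; apply: edge_inj.
    - by apply/esym/eqP; rewrite -off_eq0 oN.
    - by rewrite lN subn0.
    have [dN|dN] := boolP (degenerate N).
      by rewrite tN // tM // degenerateE; move: dN; rewrite degenerateE lN subn0.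
    by rewrite !tag_arc //; apply/negbTE => //; move: dN; rewrite !degenerateE lN subn0.
  by rewrite /= unit_rowE ev_id oner_neq0.
have lb := elen_max hn M.
have h1' : (off x (start M) + b <= n - 2)%N by clear - h1; lia.
move: (oN) => /andP[/eqP sN /eqP lN].
have lL : (3 <= (elen N).+1 <= n.+1)%N by clear - lN lb h1 KM; lia.
have [L [sL eL tL]] := ex_edge (ord_pred (start N)) t lL.
have oL : onl M b (elen M - b) L.
  rewrite /onl sL eL off_pred sN lN eqxx /=; apply/eqP.
  by clear - lb h1 KM; lia.
have LN : falls L N by rewrite /falls sL ord_predK eL !eqxx.
rewrite /= (@ev_dn _ weightK _ L) //.
  rewrite mulf_neq0 ?IH // wK_neq0 ?LN ?orbT //.
    by apply: inK_onl oL tL => //; clear - lb h1 KM; lia.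
  by apply: inK_onl oN tN => //; clear - lb h1 KM; lia.
move=> X XL /andP[/eqP sX /eqP lX].
have sXL : start X = start L by rewrite sL sX ordSK.
have lXL : elen X = elen L by rewrite eL lX.
have [dX|dX] := boolP (degenerate X); last first.
  case/eqP: XL; apply: edge_inj => //.
  by rewrite !tag_arc //; apply/negbTE => //; move: dX; rewrite !degenerateE lXL.
have b0 : b = 0%N.
  move: (elen_deg dX) oL => + /andP[_ /eqP]; rewrite lXL => ->.
  by clear - lb h1 KM; lia.
subst b; rewrite /= unit_row0 //; apply: contraNneq XL => E; apply/eqP/edge_inj => //.
rewrite tL; last by rewrite degenerateE -lXL -degenerateE.
by rewrite E tM // -E.
Qed.

Lemma evK_word M a b N : (off x (start M) + b <= n - 2)%N ->
  (n < off x (start M) + elen M)%N -> (degenerate M -> tag M = t) ->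
  (elen M + a <= n.+1 + b)%N ->
  onl M b (elen M - b + a) N -> (degenerate N -> tag N = t) ->
  ev weightK (entry (ups a (dns b (unit_row M))) N) != 0.
Proof.
move=> h1 KM tM; elim: a N => [|a IH] N ab oN tN.
  by apply: evK_dns => //; rewrite addn0 in oN.
have lb := elen_max hn M.
move: (oN) => /andP[/eqP sN /eqP lN].
have lL : (3 <= (elen N).-1 <= n.+1)%N by clear - lN lb h1 KM ab; lia.
have [L [sL eL tL]] := ex_edge (start N) t lL.
have oL : onl M b (elen M - b + a) L.
  rewrite /onl sL eL sN lN eqxx /=; apply/eqP.
  by clear - lb h1 KM ab; lia.
have LN : rises L N.
  by rewrite /rises sL eL eqxx /=; apply/eqP; clear - lL; lia.
have dL : degenerate L = false.
  by rewrite degenerateE eL lN; apply/eqP; clear - lb h1 KM ab; lia.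
rewrite /= (@ev_up _ weightK _ L) //.
  apply: mulf_neq0; last by apply: IH; rewrite ?dL //; clear - ab; lia.
  apply: wK_neq0; last by rewrite LN.
    by apply: inK_onl oL tL => //; clear - lb h1 KM ab; lia.
  by apply: inK_onl oN tN => //; clear - lb h1 KM ab; lia.
move=> X XL /andP[/eqP sX /eqP lX]; case/eqP: XL.
have lXL : elen X = elen L by rewrite eL lX.
apply: edge_inj => //; first by rewrite sL sX.
by rewrite !tag_arc // degenerateE lXL -degenerateE.
Qed.

End Hammock.

Section Star.
Variable a : 'I_n.

(** The edges that start in [a] and the arcs that end in [a]. They meet in the two degenerate edges
    at [a], so this region contains the words that turn around the puncture, which leave the
    hammocks. *)
Definition inL M := (start M == a) || ~~ degenerate M && ((off (start M) a).+1 == elen M).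

(** Opposite signs for the two tags: the only mesh with both ends in the region has the two
    degenerate edges at [a] as its middle terms in the region, and the signs make their sum zero. *)
Definition wL M N : k :=
  if [&& inL M, inL N & elementary_move M N] then
    if degenerate M && ~~ tag M then -1 else 1
  else 0.

Lemma weightL : weight wL.
Proof.
split=> [M N /negbTE h|N]; first by rewrite /wL h !andbF.
have := start_translate N; have := elen_translate N; have := degenerate_translate N.
move: (edge_translate N) => M dM lM sM.
have sN : start N = ordS (start M) by rewrite sM ord_predK.
have [/andP[LM LN]|h] := boolP (inL M && inL N); last first.
  by apply: big1 => X _; rewrite /wL; case/nandP: h => /negbTE ->;
    rewrite ?andbF /= ?mul0r ?mulr0.
have nS : start N != start M.
  by rewrite sM -off_eq0 off_pred offxx /=; clear - hn; lia.
have dN : degenerate N = false.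
  apply/negP => d; move: LM LN nS; rewrite /inL dM d !orbF => /eqP -> /eqP ->.
  by rewrite eqxx.
have la := elen_arc dN.
have oMN : off (start M) (start N) = 1%N.
  by rewrite sN off_ordS offxx; case: eqP => //; clear - hn; lia.
have [Ma Na] : start M = a /\ elen N = n.
  have o1 := off_lt (start M) a.
  move: LM LN; rewrite /inL dM dN /= sN lM => /orP[/eqP Ma|/eqP Ma].
    rewrite -Ma -sN (negbTE nS) /= => /eqP e; split=> //; move: e.
    by rewrite off_sym oMN /= => <-; clear - hn; lia.
  have oa : off (start M) a = (off (ordS (start M)) a).+1.
    have := off_triangle (start M) (start N) a; rewrite oMN -sN.
    have := off_lt (start N) a; move: Ma; case: ifP; clear - hn la; lia.
  case/orP=> [/eqP Sa|/eqP e]; last by move: oa Ma e; clear; lia.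
  by move: Ma; rewrite oa Sa offxx; clear - la; lia.
have e1 : (3 <= n.+1 <= n.+1)%N by clear - hn; lia.
pose X1 := Deg a true; pose X2 := Deg a false.
have mX : forall X, wL X N * wL M X != 0 -> (X == X1) || (X == X2).
  move=> X; rewrite mulf_eq0 negb_or => /andP[h1 h2].
  have /and3P[LX _ m1] : [&& inL X, inL N & elementary_move X N].
    by move: h1; rewrite /wL; case: ifP => //; rewrite eqxx.
  have /and3P[_ _ m2] : [&& inL M, inL X & elementary_move M X].
    by move: h2; rewrite /wL; case: ifP => //; rewrite eqxx.
  move: m2; rewrite elementary_moveE => /orP[|] /andP[/eqP sX /eqP lX].
    have dX : degenerate X by rewrite degenerateE lX lM Na.
    have : X = Deg a (tag X) by apply: edge_inj; rewrite // ?sX ?Ma // elen_deg.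
    by case: (tag X) => ->; rewrite eqxx ?orbT.
  move: LX; rewrite /inL sX -sN -Ma (negbTE nS) /= => /andP[_ /eqP].
  rewrite off_sym oMN /=.
  by move: lX; rewrite lM Na; clear - hn; lia.
have dne : X2 != X1 by apply/eqP; case.
rewrite (bigD1 X1) //= (bigD1 X2) //= big1 ?addr0 => [|X /andP[XX1 XX2]].
  have mv1 t : elementary_move (Deg a t) N.
    by rewrite elementary_moveE /rises /falls /= sN Ma Na !eqxx orbT.
  have mv2 t : elementary_move M (Deg a t).
    by rewrite elementary_moveE /rises /falls /= lM Ma Na !eqxx.
  rewrite /wL LM LN !mv1 !mv2 /inL /= eqxx /= dM dN /=.
  by rewrite !mul1r mulr1 subrr.
by apply/eqP/negPn/negP => /mX; rewrite (negbTE XX1) (negbTE XX2).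
Qed.

Lemma wL_neq0 M N : inL M -> inL N -> rises M N || falls M N -> wL M N != 0.
Proof.
rewrite /wL -elementary_moveE => -> -> -> /=.
by case: ifP => _; rewrite ?oppr_eq0 oner_neq0.
Qed.

Lemma evL_ups M j N : start M = a -> degenerate M = false -> (elen M + j <= n.+1)%N ->
  onl M 0 (elen M + j) N -> ev weightL (entry (ups j (unit_row M)) N) != 0.
Proof.
move=> Ma dM; elim: j N => [|j IH] N jn oN; move: (oN) => /andP[/eqP sN /eqP lN].
  have -> : N = M.
    apply: edge_inj; first by apply/esym/eqP; rewrite -off_eq0 sN.
      by rewrite lN addn0.
    by rewrite !tag_arc // degenerateE lN addn0 -degenerateE.
  by rewrite /= unit_rowE ev_id oner_neq0.
have lM := elen_arc dM.
have lL : (3 <= (elen N).-1 <= n.+1)%N by clear - lN lM jn; lia.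
have [L [sL eL _]] := ex_edge (start N) true lL.
have SN : start N = a by apply/esym/eqP; rewrite -off_eq0 -Ma sN.
have LN : rises L N.
  by rewrite /rises sL eL eqxx /=; apply/eqP; clear - lL; lia.
have dL : degenerate L = false.
  by rewrite degenerateE eL lN; apply/eqP; clear - lM jn; lia.
rewrite /= (@ev_up _ weightL _ L) //.
  apply: mulf_neq0.
    by apply: wL_neq0; rewrite ?LN // /inL ?sL ?SN eqxx.
  apply: IH; first by clear - jn; lia.
  by rewrite /onl sL eL sN lN eqxx /=; apply/eqP; clear - lM; lia.
move=> X XL /andP[/eqP sX /eqP lX]; case/eqP: XL.
have lXL : elen X = elen L by rewrite eL lX.
apply: edge_inj => //; first by rewrite sL sX.
by rewrite !tag_arc // degenerateE lXL -degenerateE.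
Qed.

Lemma inL_end M N j : inL M -> (degenerate M || (start M != a)) -> (0 < j)%N ->
  off (start M) (start N) = j -> (elen N + j = elen M)%N -> inL N.
Proof.
move=> LM Mn j0 sN lN; have lb := elen_max hn N; have lM := elen_max hn M.
have dN : degenerate N = false.
  by rewrite degenerateE; apply/eqP; clear - lN lM j0; lia.
rewrite /inL dN /=; apply/orP; right; apply/eqP.
have o1 := off_lt (start N) a; have := off_triangle (start M) (start N) a.
have [dM|dM] := boolP (degenerate M).
  move: LM; rewrite /inL dM orbF => /eqP Ma; rewrite Ma offxx -Ma sN.
  move: lN; rewrite (elen_deg dM) Ma; case: ifP; clear - o1 j0 lb hn; lia.
move: LM Mn; rewrite /inL (negbTE dM) /= => /orP[->|/eqP e] // _.
rewrite sN; move: e; rewrite -lN; case: ifP; clear - o1 j0 lb hn; lia.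
Qed.

Lemma evL_dns M0 (v : hom (edge_object k M0) (Xall k n)) M j N :
  supp v (pred1 M) -> inL M -> (degenerate M || (start M != a)) ->
  ev weightL (entry v M) != 0 ->
  off (start M) (start N) = j -> (elen N + j = elen M)%N -> (j = 0%N -> N = M) ->
  ev weightL (entry (dns j v) N) != 0.
Proof.
move=> vs LM Mn v0; elim: j N => [|j IH] N sN lN N0; first by rewrite N0.
have lb := elen_max hn N; have lM := elen_max hn M.
have {N0}LN : inL N by apply: (inL_end LM Mn _ sN lN).
have [L [sL eL LL L0]] : exists L, [/\ start L = ord_pred (start N), elen L = (elen N).+1,
    inL L & j = 0%N -> L = M].
  have [j0|j0] := eqVneq j 0%N.
    subst j; exists M; split=> //; last by rewrite -lN addn1.
    apply: (@off_inj _ (start M)); rewrite offxx off_pred sN //.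
  have lL : (3 <= (elen N).+1 <= n.+1)%N by clear - lN lM lb; lia.
  have [L [sL eL _]] := ex_edge (ord_pred (start N)) true lL.
  exists L; split=> //; last by move/eqP; rewrite (negbTE j0).
  apply: (@inL_end M L j LM Mn); first by rewrite lt0n.
    by rewrite sL off_pred sN.
  by rewrite eL -lN; clear; lia.
have LNf : falls L N by rewrite /falls sL ord_predK eL !eqxx.
rewrite /= (@ev_dn _ weightL _ L) //.
  apply: mulf_neq0; first by apply: wL_neq0; rewrite ?LNf ?orbT.
  apply: IH => //; first by rewrite sL off_pred sN.
  by rewrite eL -lN; clear; lia.
move=> X XL /andP[/eqP sX /eqP lX].
have sXL : start X = start L by rewrite sL sX ordSK.
have lXL : elen X = elen L by rewrite eL lX.
have [j0|j0] := eqVneq j 0%N.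
  by subst j; apply: vs; apply: contraNneq XL => E; rewrite E L0.
case/eqP: XL; apply: edge_inj => //.
have dL : degenerate L = false.
  rewrite degenerateE eL; apply/eqP; clear - lN lM j0; lia.
by rewrite !tag_arc // degenerateE lXL -degenerateE.
Qed.

End Star.
End Weights.

Definition finite_dim (k : fieldType) (V : lmodType k) :=
  exists (I : finType) (b : I -> V), forall v, exists c : I -> k, v = \sum_i c i *: b i.

(** * Non-vanishing of basic morphisms and of their compositions *)

Section Basic.
Variables (k : fieldType) (n : nat).
Hypothesis hn : (4 <= n)%N.
Local Notation edge := (tedge n).
Local Notation C0 := (presented (@mesh_rel n k)).
Local Notation hom0 := (@hom _ C0).
Local Notation Up := (@Up k n).
Local Notation Dn := (@Dn k n).
Local Notation unit_row M := (@unit_row k n M).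
Local Notation ups f v := (iter f (cmp Up) v).
Local Notation dns f v := (iter f (cmp Dn) v).
Implicit Types L M N : edge.

(** Geometrically: rotation about the puncture with the tag kept; lengthening at a common start;
    shortening at a common end, where a degenerate edge counts as a loop around the puncture; and
    passing from an arc over the puncture to an arc that ends where the first one starts. *)
Variant rot_spec M N : Prop :=
| RotDeg of degenerate M & degenerate N & tag M = tag N &
    (0 < off (start M) (start N) <= n - 2)%N & rot M N = (off (start M) (start N)).*2
| RotStart of degenerate M = false & off (start M) (start N) = 0%N &
    (elen M < elen N)%N & rot M N = (elen N - elen M)%N
| RotEnd of degenerate N = false & (0 < off (start M) (start N))%N &
    (off (start M) (start N) + elen N = elen M)%N & rot M N = (elen M - elen N)%N
| RotTurn of degenerate M = false & degenerate N = false &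
    (0 < off (start M) (start N))%N & (off (start M) (start N) + elen N = n.+1)%N &
    rot M N = ((n.+1).*2 - elen M - elen N)%N.

Lemma rotP M N : (0 < rot M N)%N -> rot_spec M N.
Proof.
have o_lt := off_lt (start M) (start N).
have lM := elen_max hn M; have lN := elen_max hn N.
have [dM|dM] := boolP (degenerate M); have [dN|dN] := boolP (degenerate N).
- move=> h; move: (h); rewrite {1}/rot dM dN /=; case: ifP => // /andP[/eqP t o] o0.
  apply: RotDeg => //; first by clear - o0 o; lia.
  by rewrite /rot dM dN t eqxx o.
- have {}lN := elen_arc (negbTE dN); have {}lM := elen_deg dM.
  move=> h; move: (h); rewrite {1}/rot dM (negbTE dN) /=.
  case: eqP => [|/eqP o0]; first by rewrite lM; clear - lN; lia.
  case: eqP => [e _|e]; last by case: eqP => // e2; rewrite lM in e.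
  apply: RotEnd => //; rewrite ?lt0n //; first exact: negbTE.
  by rewrite /rot dM (negbTE dN) /= (negbTE o0) e eqxx.
- have {}lM := elen_arc (negbTE dM); have {}lN := elen_deg dN.
  move=> h; move: (h); rewrite {1}/rot (negbTE dM) /=.
  case: eqP => [o0|/eqP o0].
    move=> _; apply: RotStart; rewrite ?lN //; [exact: negbTE | clear - lM; lia|].
    by rewrite /rot (negbTE dM) /= o0 eqxx lN.
  case: eqP => [|_]; first by rewrite lN; clear - lM; lia.
  by case: eqP => // ; rewrite lN; move/eqP: o0; clear; lia.
- have {}lN := elen_arc (negbTE dN); have {}lM := elen_arc (negbTE dM).
  move=> h; move: (h); rewrite {1}/rot (negbTE dM) /=.
  case: eqP => [o0|/eqP o0] h1.
    apply: RotStart => //; [exact: negbTE | clear - h1; lia |].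
    by rewrite /rot (negbTE dM) /= o0 eqxx.
  move: h1; case: eqP => [e _|e].
    apply: RotEnd => //; rewrite ?lt0n //; first exact: negbTE.
    by rewrite /rot (negbTE dM) /= (negbTE o0) e eqxx.
  case: eqP => // e2 _; apply: RotTurn; rewrite ?lt0n //; try exact: negbTE.
  by rewrite /rot (negbTE dM) /= (negbTE o0) (introF eqP e) e2 eqxx.
Qed.

Lemma onlE M b l N : off (start M) (start N) = b -> elen N = l -> onl M b l N.
Proof. by rewrite /onl => -> ->; rewrite !eqxx. Qed.

Lemma evK_deg x t M N : degenerate M -> degenerate N -> tag M = t -> tag N = t ->
  (off x (start M) + off (start M) (start N) <= n - 2)%N ->
  ev (weightK k hn x t) (basic k M N) != 0.
Proof.
move=> dM dN tM tN h; rewrite /basic /wrow dM dN; apply: evK_word => //.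
- by rewrite (elen_deg dM); clear; lia.
- by rewrite (elen_deg dM); clear; lia.
- by apply: onlE; rewrite // (elen_deg dM) (elen_deg dN); clear - h hn; lia.
Qed.

Lemma evK_end x t M N : degenerate N = false -> (degenerate M -> tag M = t) ->
  (0 < off (start M) (start N))%N -> (off (start M) (start N) + elen N = elen M)%N ->
  (off x (start M) + off (start M) (start N) <= n - 2)%N ->
  (n < off x (start M) + elen M)%N ->
  ev (weightK k hn x t) (basic k M N) != 0.
Proof.
move=> dN tM o0 e h h2; rewrite /basic /wrow dN e eqxx.
rewrite lt0n in o0; rewrite (negbTE o0) if_same.
apply: evK_dns => //; last by rewrite dN.
by apply: onlE; rewrite // -e; clear; lia.
Qed.

Lemma evK_start x t M N : degenerate M = false -> (degenerate N -> tag N = t) ->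
  off (start M) (start N) = 0%N -> (elen M <= elen N)%N ->
  (off x (start M) <= n - 2)%N -> (n < off x (start M) + elen M)%N ->
  ev (weightK k hn x t) (basic k M N) != 0.
Proof.
move=> dM tN o0 e h h2; rewrite /basic /wrow dM o0 /=.
have lN := elen_max hn N.
apply: (@evK_word _ _ hn x t M _ 0) => //.
- by rewrite addn0.
- by rewrite dM.
- by clear - e lN; lia.
- by apply: onlE; rewrite // subn0; clear - e; lia.
Qed.

Lemma evL_start M N : degenerate M = false -> off (start M) (start N) = 0%N ->
  (elen M <= elen N)%N -> ev (weightL k hn (start M)) (basic k M N) != 0.
Proof.
move=> dM o0 e; rewrite /basic /wrow dM o0 /=.
have lN := elen_max hn N.
apply: evL_ups => //; first by clear - e lN; lia.
by apply: onlE; rewrite //; clear - e; lia.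
Qed.

Lemma evL_turn M N : degenerate M = false -> degenerate N = false ->
  (0 < off (start M) (start N))%N -> (off (start M) (start N) + elen N = n.+1)%N ->
  ev (weightL k hn (start M)) (basic k M N) != 0.
Proof.
move=> dM dN o0 e; have lM := elen_arc dM.
rewrite lt0n in o0; rewrite /basic /wrow dM (negbTE o0) ifF; last first.
  by apply/eqP; rewrite e; clear - lM; lia.
apply: (@evL_dns _ _ hn (start M) M _ (Deg (start M) true)) => //=.
- apply: supp_imp (q0_supp k hn dM) => N' /andP[/andP[/eqP a /eqP b] /eqP c].
  by apply/eqP/edge_inj => //=; apply/esym/eqP; rewrite -off_eq0 a.
- by rewrite /inL eqxx.
- rewrite entryZt /= /p_word /=; apply: evL_ups => //.
    by clear - lM; lia.
  by apply: onlE; rewrite ?offxx //=; clear - lM; lia.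
- by rewrite addnC.
- by move=> E; rewrite E in o0.
Qed.

Lemma evL_end a M N : inL a M -> degenerate M || (start M != a) -> degenerate N = false ->
  (0 < off (start M) (start N))%N -> (off (start M) (start N) + elen N = elen M)%N ->
  ev (weightL k hn a) (basic k M N) != 0.
Proof.
move=> LM Mn dN o0 e; rewrite lt0n in o0.
rewrite /basic /wrow dN e eqxx (negbTE o0) if_same.
apply: (@evL_dns _ _ hn a M _ M) => //.
- exact: unit_supp.
- by rewrite unit_rowE ev_id oner_neq0.
- by rewrite addnC.
- by move=> E; rewrite E in o0.
Qed.

Lemma ev_neq0 (c : edge -> edge -> k) (cw : weight c) M N (f : hom0 M N) : ev cw f != 0 -> f <> 0.
Proof. by move=> h E; rewrite E ev0 eqxx in h. Qed.

Lemma basic_neq0 M N : (0 < rot M N)%N -> basic k M N <> 0.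
Proof.
move/rotP=> [dM dN t /andP[o0 o1] _|dM o0 lt _|dN o0 e _|dM dN o0 e _].
- by apply: ev_neq0 (@evK_deg (start M) (tag M) _ _ dM dN _ _ _); rewrite ?offxx.
- apply: ev_neq0 (evL_start dM o0 _); exact: ltnW.
- have lM := elen_max hn M; have lN := elen_max hn N.
  (* The smallest offset with [M] in the hammock, which leaves the most room for falls. *)
  have [x ox] := ex_off hn (start M) (d := n.+1 - elen M) ltac:(clear - lM hn; lia).
  apply: ev_neq0 (@evK_end x (tag M) _ _ dN _ o0 e _ _) => //; rewrite ox.
    by clear - lM lN e hn; lia.
  by clear - lM; lia.
- exact: ev_neq0 (evL_turn dM dN o0 e).
Qed.

(** [ev] is multiplicative with values in a field, so it is enough to find one weight that is
    non-zero on both factors. A hammock based at the start of [M] serves for a degenerate [M], a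
    hammock further back for two shortenings of an arc, and the region around the start of [M] for
    everything else; the remaining pairs of kinds contradict the degrees or the compatibility of [M]
    with [N]. *)
Lemma comp_basic_neq0 M L N : compat M N ->
  (0 < rot M L)%N -> (0 < rot L N)%N -> rot M N = (rot L N + rot M L)%N ->
  basic k L N ** basic k M L <> 0.
Proof.
move=> cMN r1 r2 E.
have r3 : (0 < rot M N)%N by rewrite E addn_gt0 r1 orbT.
have o1 := off_lt (start M) (start L); have o2 := off_lt (start L) (start N).
have o3 := off_lt (start M) (start N).
have tri := off_triangle (start M) (start L) (start N).
have lM := elen_max hn M; have lL := elen_max hn L; have lN := elen_max hn N.
suff [c [cw [h1 h2]]] : exists c (cw : @weight k n c),
    ev cw (basic k M L) != 0 /\ ev cw (basic k L N) != 0.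
  by apply: (@ev_neq0 _ cw); rewrite ev_cmp mulf_neq0.
have [dM|dM] := boolP (degenerate M).
  suff [h1 h2] : ev (weightK k hn (start M) (tag M)) (basic k M L) != 0 /\
     ev (weightK k hn (start M) (tag M)) (basic k L N) != 0 by do 2 eexists; split; eassumption.
  have eM := elen_deg dM.
  have [dL|dL] := boolP (degenerate L); have [dN|dN] := boolP (degenerate N).
  - case: (rotP r1); rewrite ?dM ?dL // => _ _ t1 p1 q1.
    case: (rotP r2); rewrite ?dN ?dL // => _ _ t2 p2 q2.
    case: (rotP r3); rewrite ?dN ?dM // => _ _ t3 p3 q3.
    move: E; rewrite q1 q2 q3 => E.
    split; apply: evK_deg => //; rewrite ?offxx //; clear - p1 p3 E; lia.
  - exfalso; have eL := elen_deg dL.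
    case: (rotP r1); rewrite ?dM ?dL // => _ _ t1 p1 q1.
    case: (rotP r2); rewrite ?(negbTE dN) ?dL // => _ p2 e2 q2.
    case: (rotP r3); rewrite ?(negbTE dN) ?dM // => _ p3 e3 q3.
    move: tri; case: ifP; clear - p1 e2 e3 eL eM o1 o2 o3; lia.
  - case: (rotP r1); rewrite ?(negbTE dL) ?dM // => _ p1 e1 q1.
    case: (rotP r2); rewrite ?(negbTE dL) ?dN // => _ p2 e2 q2.
    case: (rotP r3); rewrite ?dN ?dM // => _ _ t3 _ _.
    split.
      apply: evK_end => //; rewrite ?offxx ?(negbTE dL) //; clear - e1 eM lL; lia.
    apply: evK_start => //; rewrite ?(negbTE dL) //; clear - e1 eM lL e2; lia.
  - case: (rotP r1); rewrite ?(negbTE dL) ?dM // => _ p1 e1 q1.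
    case: (rotP r3); rewrite ?(negbTE dN) ?dM // => _ p3 e3 q3.
    have dLf := negbTE dL; have dNf := negbTE dN.
    have [aL aN] := (elen_arc dLf, elen_arc dNf).
    case: (rotP r2); rewrite ?dLf ?dNf //.
    + by move=> _ p2 e2 q2; exfalso; move: tri; case: ifP; clear - p2 e2 e1 e3 eM o1 o3; lia.
    + move=> _ p2 e2 q2; split.
        apply: evK_end => //; rewrite ?offxx //; clear - e1 eM lL; lia.
      apply: evK_end => //; rewrite ?dLf //; clear - e1 e2 eM lL lN; lia.
    + by move=> _ _ p2 e2 q2; exfalso; move: tri; case: ifP; clear - p1 p2 e2 e1 e3 eM o1 o2 o3; lia.
have dMf := negbTE dM; have aM := elen_arc dMf.
have [dL|dL] := boolP (degenerate L).
  have eL := elen_deg dL.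
  case: (rotP r1); rewrite ?dMf ?dL // => _ p1 e1 q1.
  have sL : start L = start M by apply/esym/eqP; rewrite -off_eq0 p1.
  have [dN|dN] := boolP (degenerate N).
    exfalso; case: (rotP r3); rewrite ?dMf ?dN // => _ p3 _ _.
    case: (rotP r2); rewrite ?dN ?dL // => _ _ _ p2 _.
    by move: p2; rewrite sL p3.
  case: (rotP r2); rewrite ?(negbTE dN) ?dL // => _ p2 e2 _.
  exists (wL k (start M)), (weightL k hn (start M)); split.
    by apply: evL_start => //; apply: ltnW.
  by apply: evL_end => //; rewrite ?dL ?(negbTE dN) // /inL sL eqxx.
have dLf := negbTE dL; have aL := elen_arc dLf.
have [dN|dN] := boolP (degenerate N).
  case: (rotP r3); rewrite ?dMf ?dN // => _ p3 e3 _.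
  case: (rotP r2); rewrite ?dLf ?dN // => _ p2 e3' _.
  have sL : start L = start M.
    by move/eqP: p2; move/eqP: p3; rewrite !off_eq0 => /eqP -> /eqP ->.
  exists (wL k (start M)), (weightL k hn (start M)); split.
    apply: evL_start => //; first by rewrite sL offxx.
    by case: (rotP r1); rewrite ?dMf ?dLf ?sL ?offxx //= => _ _ h _; apply: ltnW.
  by have := evL_start dLf p2 (ltnW e3'); rewrite sL.
have dNf := negbTE dN; have aN := elen_arc dNf.
move: cMN; rewrite /compat dMf dNf (off_sym (start M) (start N)).
case: (rotP r1); rewrite ?dMf ?dLf //.
- move=> _ p1 e1 q1.
  have sL : start L = start M by apply/esym/eqP; rewrite -off_eq0 p1.
  have f1 : ev (weightL k hn (start M)) (basic k M L) != 0.
    by apply: evL_start => //; apply: ltnW.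
  case: (rotP r2); rewrite ?dLf ?dNf //.
  + move=> _ p2 e2 q2 _; exists (wL k (start M)), (weightL k hn (start M)); split=> //.
    by have := evL_start dLf p2 (ltnW e2); rewrite sL.
  + move=> _ p2 e2 q2 _; exfalso; move: p2 e2; rewrite sL => p2 e2.
    case: (rotP r3); rewrite ?dMf ?dNf //.
    * by move=> _ p3; clear - p2 p3; lia.
    * by move=> _ _ e3 _; clear - e2 e3 e1; lia.
    * by move=> _ _ _ e3 _; clear - e2 e3 aL; lia.
  + move=> _ _ p2 e2 q2 _; exists (wL k (start M)), (weightL k hn (start M)); split=> //.
    by have := evL_turn dLf dNf p2 e2; rewrite sL.
- move=> _ p1 e1 q1; case: (rotP r2); rewrite ?dLf ?dNf //.
  + move=> _ p2 e2 q2 cMN; exfalso; move: cMN.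
    move: tri; rewrite p2 addn0 o1 => ->.
    case: eqP => [|_]; first by clear - p1; lia.
    by clear - p1 e1 e2 o1 aL aM aN; lia.
  + move=> _ p2 e2 q2 _.
    have [x ox] := ex_off hn (start M) (d := n.+1 - elen M) ltac:(clear - aM hn; lia).
    have oxL : off x (start L) = (n.+1 - elen L)%N.
      rewrite (off_triangle _ (start M)) ox ifT; clear - e1 aL aM hn; lia.
    exists (wK k x true), (weightK k hn x true); split.
      apply: evK_end => //; rewrite ?dMf ?ox //; clear - e1 aL aM hn; lia.
    apply: evK_end => //; rewrite ?dLf ?oxL //; clear - e2 aL aN hn; lia.
  + move=> _ _ p2 e2 q2 _; exfalso; case: (rotP r3); rewrite ?dMf ?dNf //.
    * move=> _ p3 e3 q3; clear - E q1 q2 q3 p1 e1 p3 e3 aM aL aN; lia.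
    * move=> _ p3 e3 q3; clear - E q1 q2 q3 p1 e1 p3 e3 aM aL aN; lia.
    * move=> _ _ p3 e3 q3; move: tri; case: ifP; clear - p1 p2 p3 e1 e2 e3 o1 o2 o3; lia.
- move=> _ _ p1 e1 q1.
  have f1 : ev (weightL k hn (start M)) (basic k M L) != 0 by apply: evL_turn.
  have LL : inL (start M) L.
    rewrite /inL dLf off_sym; apply/orP; right; rewrite /=.
    by rewrite -if_neg -lt0n p1; apply/eqP; clear - p1 e1 aL; lia.
  have sL : start L != start M by rewrite eq_sym -off_eq0; clear - p1; lia.
  case: (rotP r2); rewrite ?dLf ?dNf //.
  + move=> _ p2 e2 q2 _; exfalso; move: tri; rewrite p2 addn0 o1 => tri.
    case: (rotP r3); rewrite ?dMf ?dNf //; rewrite tri.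
    * by move=> _ p3; clear - p1 p3; lia.
    * by move=> _ _ e3 _; clear - e1 e2 e3 aM; lia.
    * by move=> _ _ _ e3 _; clear - e2 e3 e1; lia.
  + move=> _ p2 e2 q2 _; exists (wL k (start M)), (weightL k hn (start M)); split=> //.
    by apply: evL_end; rewrite ?sL ?orbT.
  + move=> _ _ p2 e2 q2 _; exfalso; case: (rotP r3); rewrite ?dMf ?dNf //.
    * move=> _ p3 e3 q3; clear - E q1 q2 q3 p1 e1 p3 e3 aM aL aN; lia.
    * move=> _ p3 e3 q3; clear - E q1 q2 q3 p1 e1 p3 e3 aM aL aN; lia.
    * move=> _ _ p3 e3 q3; clear - E q1 q2 q3 p1 e1 p3 e3 aM aL aN; lia.
Qed.

(** The translation steps back by one vertex. For degenerate edges with different tags it makes the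
    tags equal; for an [N] that starts strictly inside the arc [M] and leaves it, it gives an edge
    that a word from [M] reaches inside a hammock. *)
Lemma cross_half M N :
  (degenerate M && degenerate N && (tag M != tag N) && (start M != start N)) ||
  [&& ~~ degenerate M, 0 < off (start M) (start N), (off (start M) (start N)).+1 < elen M
    & elen M < off (start M) (start N) + elen N]%N ->
  exists f : hom0 M (edge_translate N), f <> 0.
Proof.
have lM := elen_max hn M; have lN := elen_max hn N; have o_lt := off_lt (start M) (start N).
have oT : (0 < off (start M) (start N))%N ->
    off (start M) (start (edge_translate N)) = (off (start M) (start N)).-1.
  by move=> o0; rewrite start_translate off_pred; rewrite lt0n in o0; rewrite (negbTE o0).
case/orP=> [/andP[/andP[/andP[dM dN] tMN] sMN]|/and4P[dM o0 h1 h2]].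
  have o0 : (0 < off (start M) (start N))%N by rewrite lt0n off_eq0.
  exists (basic k M (edge_translate N)).
  apply: ev_neq0 (@evK_deg (start M) (tag M) _ _ dM _ _ _ _) => //.
  - by rewrite degenerate_translate.
  - by rewrite tag_translate //; case: (tag M) (tag N) tMN => -[].
  - by rewrite offxx oT //; clear - o_lt o0; lia.
have dMf := negbTE dM; have aM := elen_arc dMf.
have [x ox] := ex_off hn (start M) (d := n.+1 - elen M) ltac:(clear - aM hn; lia).
(* The exponents of the word from [M] that ends in the translate of [N]: its start is one step
   before that of [N], its length is the same. *)
set b := (off (start M) (start N)).-1; set a := (elen N - (elen M - b))%N.
exists (entry (ups a (dns b (unit_row M))) (edge_translate N)).
apply: (@ev_neq0 _ (weightK k hn x (tag (edge_translate N)))).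
apply: evK_word; rewrite ?ox ?dMf //.
- by rewrite /b; clear - aM h1 o0; lia.
- by clear - aM; lia.
- by rewrite /a /b; clear - lN aM h1 h2 o0; lia.
- apply: onlE; first by rewrite oT.
  by rewrite elen_translate /a /b; clear - h1 h2 o0; lia.
Qed.

(** Of two crossing arcs, one starts strictly inside the other and ends outside it, which gives the
    direction of the morphism. *)
Lemma crossing_hom M N : ~~ compat M N ->
  (exists f : hom0 M (edge_translate N), f <> 0) \/
  (exists f : hom0 N (edge_translate M), f <> 0).
Proof.
have lM := elen_max hn M; have lN := elen_max hn N.
have o1 := off_lt (start M) (start N); have := off_sym (start M) (start N).
rewrite /compat; have [dM|dM] := boolP (degenerate M); have [dN|dN] := boolP (degenerate N); move=> osym.
- rewrite negb_or => /andP[h1 h2]; left; apply: cross_half.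
  by rewrite dM dN h2 -off_eq0 h1.
- move=> h; right; apply: cross_half; rewrite (negbTE dN) /=.
  rewrite (elen_deg dM); have := elen_arc (negbTE dN); have := off_lt (start N) (start M).
  by move: h; clear; lia.
- move=> h; left; apply: cross_half; rewrite (negbTE dM) /=.
  rewrite (elen_deg dN); have := elen_arc (negbTE dM).
  by move: h o1; clear; lia.
- have aM := elen_arc (negbTE dM); have aN := elen_arc (negbTE dN).
  move: osym; case: eqP => o0 osym h.
    by exfalso; move: h; rewrite osym o0; clear; lia.
  have [h2|h2] := ltnP (off (start M) (start N)).+1 (elen M).
    left; apply: cross_half; rewrite (negbTE dM) /=.
    by move: h h2 o0; clear; lia.
  right; apply: cross_half; rewrite (negbTE dN) /= osym.
  by move: h h2 o0 o1; rewrite osym; clear - aM aN; lia.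
Qed.

Lemma finite_dim_hom0 M N : finite_dim (hom0 M N).
Proof.
have lM := elen_max hn M.
(* A generous bound for the exponents of the non-zero normal forms. *)
pose I := (bool * 'I_(3 * n) * 'I_(3 * n))%type.
pose b (i : I) : hom0 M N :=
  if i.1.1 then entry (@p_word k n M i.1.2 i.2) N
  else entry (pi_word (@qrow k n M) i.1.2 i.2) N.
exists (Finite.clone I _), b => f.
elim: {f}(Any_hom f) => [d f /(Hd_Sp hn) h|f g _ [c ->] _ [c' ->]]; last first.
  by exists (fun i => c i + c' i); rewrite -big_split; apply: eq_bigr => i _; rewrite scalerDl.
elim: h => {f} [v h||f g _ [c ->] _ [c' ->]|a f _ [c ->]].
- have z : v = 0 -> exists c : I -> k, entry v N = \sum_i c i *: b i.
    by move=> ->; exists (fun=> 0); rewrite entry0 big1 // => i _; rewrite scale0r.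
  have one (i0 : I) : entry v N = b i0 -> exists c : I -> k, entry v N = \sum_i c i *: b i.
    move=> ->; exists (fun i => (i == i0)%:R); rewrite (bigD1 i0) //= big1 ?addr0 ?eqxx ?scale1r //.
    by move=> i /negbTE ->; rewrite scale0r.
  case: h z one => [a b0 dM ab _|f g fg _] z one.
    have [h|h] := leqP b0 (elen M - 3); last by apply: z; apply: p0.
    have h1 : (a < 3 * n)%N by clear - lM ab h hn; lia.
    have h2 : (b0 < 3 * n)%N by clear - lM h hn; lia.
    exact: (one (true, Ordinal h1, Ordinal h2)).
  have [h|h] := leqP g (n - 2); last by apply: z; exact: (pi0 hn (qrow_supp k hn (M0 := M)) f h).
  have h1 : (f < 3 * n)%N by clear - fg h hn; lia.
  have h2 : (g < 3 * n)%N by clear - h hn; lia.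
  exact: (one (false, Ordinal h1, Ordinal h2)).
- by exists (fun=> 0); rewrite big1 // => i _; rewrite scale0r.
- by exists (fun i => c i + c' i); rewrite -big_split; apply: eq_bigr => i _; rewrite scalerDl.
- by exists (fun i => a * c i); rewrite scaler_sumr; apply: eq_bigr => i _; rewrite scalerA.
Qed.

Lemma idm_neq0 M : idm (M : C0) <> 0.
Proof. by apply: (@ev_neq0 _ (weightL k hn (start M))); rewrite ev_id oner_neq0. Qed.

End Basic.

(** * The quiver of a set of non-crossing edges *)

(** Factorization is expressed by degrees alone: by [comp_basic] and [comp_basic_neq0] a composition
    of two basic morphisms between compatible edges is non-zero exactly when their degrees add
    up. *)
Definition arrowb n (Delta : {set tedge n}) (M N : tedge n) : bool :=
  (0 < rot M N)%N && ~~ [exists L in Delta, [&& (0 < rot M L)%N, (0 < rot L N)%N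
    & rot M N == (rot M L + rot L N)%N]].

Section QuiverOfDelta.
Variables (k : fieldType) (n : nat).
Hypothesis hn : (4 <= n)%N.
Local Notation edge := (tedge n).
Local Notation C0 := (presented (@mesh_rel n k)).
Local Notation hom0 := (@hom _ C0).
Variable Delta : {set edge}.
Hypothesis hD : {in Delta &, forall M N, compat M N}.
Local Notation V := (elements Delta).
Local Notation X := (edges_object k Delta).
Local Notation B := (hom X X).
Implicit Types (i j l : V) (x y z : B).

Definition ent x i j : hom0 (val i) (val j) := x i j.

Lemma entP x y : (forall i j, ent x i j = ent y i j) -> x = y.
Proof. by move=> h; apply: vfamP => i; apply: vfamP => j; apply: h. Qed.

Lemma ent_cmp x y i l : ent (y ** x) i l = \sum_j ent y j l ** ent x i j.
Proof. by []. Qed.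
Lemma entD x y i j : ent (x + y) i j = ent x i j + ent y i j. Proof. by []. Qed.
Lemma entN x i j : ent (- x) i j = - ent x i j. Proof. by []. Qed.
Lemma ent0 i j : ent 0 i j = 0. Proof. by []. Qed.
Lemma entZ a x i j : ent (a *: x) i j = a *: ent x i j. Proof. by []. Qed.
Lemma ent_sum (I : finType) (F : I -> B) i j : ent (\sum_m F m) i j = \sum_m ent (F m) i j.
Proof. by elim/big_ind2: _ => // x1 x2 y1 y2 <- <-; rewrite entD. Qed.

Lemma ent_cmp0r x y i j l : ent x i j = 0 -> ent y j l ** ent x i j = 0.
Proof. by move=> ->; apply: cmpm0. Qed.

Lemma ent_cmp0l x y i j l : ent y j l = 0 -> ent y j l ** ent x i j = 0.
Proof. by move=> ->; apply: cmp0m. Qed.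

Definition sid i : B := summand_idem (X := X) i.

Lemma ent_sid i : ent (sid i) i i = idm (val i : C0).
Proof. by rewrite /ent /sid /summand_idem eqxx; apply: (@diag_entry_refl _ C0 X). Qed.

Lemma ent_sid0 i j l : (j != i) || (l != i) -> ent (sid i) j l = 0.
Proof.
rewrite /ent /sid /summand_idem; case: eqVneq => //= [-> li].
by apply: (@diag_entry_neq _ C0 X); rewrite eq_sym.
Qed.

Lemma ent_id i : ent (idm X) i i = idm (val i : C0).
Proof. exact: (@diag_entry_refl _ C0 X). Qed.

Lemma ent_id0 i j : i != j -> ent (idm X) i j = 0.
Proof. exact: (@diag_entry_neq _ C0 X). Qed.

Lemma ent_sidl x i j : ent (sid j ** x) i j = ent x i j.
Proof.
rewrite ent_cmp (bigD1 j) //= big1 ?addr0 => [|l lj]; last by rewrite ent_sid0 ?lj ?cmp0m.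
by rewrite ent_sid cmp1m.
Qed.

Lemma ent_sidl0 x i j l : l != j -> ent (sid j ** x) i l = 0.
Proof. by move=> lj; rewrite ent_cmp big1 // => m _; rewrite ent_sid0 ?lj ?orbT ?cmp0m. Qed.

Lemma ent_sidr x i j : ent (x ** sid i) i j = ent x i j.
Proof.
rewrite ent_cmp (bigD1 i) //= big1 ?addr0 => [|l lj]; last by rewrite ent_sid0 ?lj ?orbT ?cmpm0.
by rewrite ent_sid cmpm1.
Qed.

Lemma ent_sidr0 x i j l : l != i -> ent (x ** sid i) l j = 0.
Proof. by move=> lj; rewrite ent_cmp big1 // => m _; rewrite ent_sid0 ?lj ?cmpm0. Qed.

Lemma compatV i j : compat (val i) (val j).
Proof. by apply: hD; apply: valP. Qed.

Lemma ent_basic x i j : ent x i j = 0 \/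
  (i == j) || (0 < rot (val i) (val j))%N /\ exists c, ent x i j = c *: basic k (val i) (val j).
Proof. exact: hom_basic (compatV i j). Qed.

Lemma ent_scalar x i : exists c, ent x i i = c *: idm (val i : C0).
Proof.
have [->|[_ [c ->]]] := ent_basic x i i; first by exists 0; rewrite scale0r.
by exists c; rewrite basicMM.
Qed.

Lemma ent_comp0 x y i j l : i != j -> j != l ->
  ~~ [&& (0 < rot (val i) (val j))%N, (0 < rot (val j) (val l))%N
    & rot (val i) (val l) == (rot (val i) (val j) + rot (val j) (val l))%N] ->
  ent y j l ** ent x i j = 0.
Proof.
move=> ij jl h.
have [->|[]] := ent_basic x i j; first by rewrite cmpm0.
rewrite (negbTE ij) /= => r1 [c ->].
have [->|[]] := ent_basic y j l; first by rewrite cmp0m.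
rewrite (negbTE jl) /= => r2 [c' ->].
rewrite cmpZl cmpZr comp_basic ?scaler0 //; try exact: compatV.
by move=> E; move: h; rewrite r1 r2 E addnC eqxx.
Qed.

Lemma ent_loop0 x y i j : i != j -> ent y j i ** ent x i j = 0.
Proof.
by move=> ij; apply: ent_comp0; rewrite // 1?eq_sym // rotMM negb_and -implybE; apply/implyP => r1; rewrite negb_and; apply/orP; right; apply/eqP; lia.
Qed.

(** A loop through another edge would have positive degree, but [rot M M] is zero. Hence taking
    diagonal entries is multiplicative, and it splits the algebra into scalars and a nilpotent
    part. *)
Lemma ent_diag x y i : ent (y ** x) i i = ent y i i ** ent x i i.
Proof.
rewrite ent_cmp (bigD1 i) //= big1 ?addr0 // => j ji.
by rewrite ent_loop0 // eq_sym.
Qed.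

Definition offdiag x := forall i, ent x i i = 0.

Lemma offdiagl x y : offdiag x -> offdiag (y ** x).
Proof. by move=> h i; rewrite ent_diag h cmpm0. Qed.

Lemma offdiagr x y : offdiag y -> offdiag (y ** x).
Proof. by move=> h i; rewrite ent_diag h cmp0m. Qed.

Lemma rot_max (M N : edge) : (rot M N <= 2 * n + 2)%N.
Proof.
have lM := elen_max hn M; have lN := elen_max hn N.
rewrite /rot; repeat (case: ifP => [?|?]); lia.
Qed.

(** Every factor without diagonal entries raises the degree by at least one. *)
Lemma offdiag_nilp x m : offdiag x -> forall i j,
  ent (iter m (cmp x) (idm X)) i j <> 0 -> (m <= rot (val i) (val j))%N.
Proof.
move=> hx; elim: m => [//|m IH] i j.
rewrite [iter _ _ _]/(x ** iter m (cmp x) (idm X)) ent_cmp => h.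
have [l hl] : exists l, ent x l j ** ent (iter m (cmp x) (idm X)) i l <> 0.
  apply: contrapT => h2; apply: h; apply: big1 => l _; apply: contrapT => h3.
  by apply: h2; exists l.
have lj : l != j by apply/eqP => E; apply: hl; rewrite E hx cmp0m.
have h1 : ent (iter m (cmp x) (idm X)) i l <> 0 by move=> E; apply: hl; rewrite E cmpm0.
have ml := IH _ _ h1.
have [E|il] := eqVneq i l.
  subst l; move: ml; rewrite rotMM leqn0 => /eqP ->.
  have [E|[]] := ent_basic x i j; first by case: hl; rewrite E cmp0m.
  by rewrite (negbTE lj).
have [/and3P[r1 r2 /eqP ->]|/ent_comp0 E] := boolP [&& (0 < rot (val i) (val l))%N,
   (0 < rot (val l) (val j))%N & rot (val i) (val j) == (rot (val i) (val l) + rot (val l) (val j))%N].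
  by clear - ml r2; lia.
by case: hl; apply: E.
Qed.

(** The exponent is one more than the bound for degrees in [rot_max]. *)
Lemma offdiag_nil x : offdiag x -> iter (2 * n + 3) (cmp x) (idm X) = 0.
Proof.
move=> hx; apply: entP => i j; apply: contrapT => h.
have := offdiag_nilp hx h; have := rot_max (val i) (val j); clear; lia.
Qed.

(** The inverse is the geometric series, which is finite by [offdiag_nil]. *)
Lemma offdiag_inv x : offdiag x -> exists b, (idm X - x) ** b = idm X.
Proof.
move=> hx; pose p m := iter m (cmp x) (idm X).
exists (\sum_(t < 2 * n + 3) p t).
suff E m : (idm X - x) ** (\sum_(t < m) p t) = idm X - p m.
  by rewrite E /p offdiag_nil // subr0.
elim: m => [|m IH]; first by rewrite big_ord0 cmpm0 /p /= subrr.
rewrite big_ord_recr /= cmpDr IH cmpDl cmp1m -scaleN1r cmpZl scaleN1r.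
by rewrite addrA addrNK.
Qed.

Local Notation mul := (@endop_mul _ _ X).

Lemma idm_val i : idm (val i : C0) <> 0.
Proof. exact: idm_neq0. Qed.

Lemma radicalP x : jacobson_radical (idm X) mul x <-> offdiag x.
Proof.
split=> [h i|h a]; last first.
  have [b E] := offdiag_inv (offdiagr a h).
  by exists b; rewrite /endop_mul.
have [c E] := ent_scalar x i.
have [c0|c0] := eqVneq c 0; first by rewrite E c0 scale0r.
(* With this multiplier the element that has to be invertible gets the diagonal entry 0 at [i]. *)
have [b] := h (c^-1 *: sid i); rewrite /endop_mul => Eb.
case: (@idm_val i); rewrite -ent_id -Eb ent_diag entD entN ent_id ent_diag E entZ ent_sid.
by rewrite cmpZr cmpZl scalerA mulVf // scale1r cmp1m subrr cmp0m.
Qed.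

Lemma radical2E x i j : jacobson_radical2 (idm X) mul x -> i != j ->
  ~~ [exists L in Delta, [&& (0 < rot (val i) L)%N, (0 < rot L (val j))%N
    & rot (val i) (val j) == (rot (val i) L + rot L (val j))%N]] -> ent x i j = 0.
Proof.
move=> [m [y [z [hy hz ->]]]] ij h; rewrite ent_sum big1 // => s _.
rewrite /endop_mul ent_cmp big1 // => l _.
have [->|il] := eqVneq i l; first by rewrite (proj1 (radicalP _) (hy s)) cmpm0.
have [->|lj] := eqVneq l j; first by rewrite (proj1 (radicalP _) (hz s)) cmp0m.
apply: ent_comp0 => //; apply: contra h => h.
by apply/existsP; exists (val l); rewrite h andbT; apply: valP.
Qed.

Definition basics : B := fun i j => basic k (val i) (val j).

Definition bel i j : B := sid j ** (basics ** sid i).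

Lemma ent_bel i j : ent (bel i j) i j = basic k (val i) (val j).
Proof. by rewrite ent_sidl ent_sidr. Qed.

Lemma ent_bel0 i j i' j' : (i' != i) || (j' != j) -> ent (bel i j) i' j' = 0.
Proof.
have [->|] := eqVneq j' j; last by move=> h _; rewrite ent_sidl0.
by rewrite orbF => h; rewrite ent_sidl ent_sidr0.
Qed.

Lemma bel_offdiag i j : i != j -> offdiag (bel i j).
Proof.
move=> ij l; apply: ent_bel0; have [->|//] := eqVneq l i; exact: ij.
Qed.

Lemma cornerP (P : B -> Prop) i j x : corner mul (sid i) (sid j) P x <->
  P x /\ forall i' j', (i' != i) || (j' != j) -> ent x i' j' = 0.
Proof.
rewrite /corner /endop_mul; split=> -[Px h]; split=> //.
  move=> i' j'; rewrite -h; have [->|] := eqVneq j' j; last by move=> h2 _; rewrite ent_sidl0.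
  by rewrite orbF => h2; rewrite ent_sidl ent_sidr0.
apply: entP => i' j'; have [->|nj] := eqVneq j' j; last by rewrite ent_sidl0 // h // nj orbT.
rewrite ent_sidl; have [->|ni] := eqVneq i' i; last by rewrite ent_sidr0 // h // ni.
by rewrite ent_sidr.
Qed.

(** The corner of the radical is at most one-dimensional, spanned by the basic morphism. It is
    contained in the square of the radical exactly when that morphism is zero or its degree splits
    over a third edge. *)
Lemma arrow_dim i j : quotient_dim (corner mul (sid i) (sid j) (jacobson_radical (idm X) mul))
  (corner mul (sid i) (sid j) (jacobson_radical2 (idm X) mul)) (arrowb Delta (val i) (val j)).
Proof.
have ext x y : (forall i' j', (i' != i) || (j' != j) -> ent x i' j' = ent y i' j') ->
    ent x i j = ent y i j -> x = y.
  move=> h e; apply: entP => i' j'.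
  have [->|ni] := eqVneq i' i; last by rewrite h // ni.
  by have [-> //|nj] := eqVneq j' j; rewrite h // nj orbT.
have [ar|nar] := boolP (arrowb Delta (val i) (val j)); rewrite /=.
  have ij : i != j by apply: contraTneq ar => ->; rewrite /arrowb rotMM.
  have rad_bel : jacobson_radical (idm X) mul (bel i j) by apply/radicalP/bel_offdiag.
  exists (fun=> bel i j); split=> [_|x /cornerP[_ hx]].
    by apply/cornerP; split=> // i' j' h; apply: ent_bel0.
  have [c xE] : exists c, x = c *: bel i j.
    have [E|[_ [c E]]] := ent_basic x i j.
      exists 0; apply: ext => [i' j' h|]; last by rewrite E scale0r ent0.
      by rewrite hx // scale0r ent0.
    exists c; apply: ext => [i' j' h|]; first by rewrite hx // entZ ent_bel0 // scaler0.
    by rewrite E entZ ent_bel.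
  exists [ffun=> c]; split.
    rewrite big_ord1 ffunE -xE subrr; apply/cornerP; split=> //.
    exists 0%N, (fun=> 0), (fun=> 0); split; try by case.
    by rewrite big_ord0.
  move=> c'; rewrite big_ord1 => /cornerP[h2 _]; apply/ffunP => s; rewrite ffunE.
  move: ar => /andP[r1 nar].
  have := radical2E h2 ij nar; rewrite xE -scalerBl entZ ent_bel => /eqP.
  rewrite scaler_eq0 subr_eq0 => /orP[/eqP ->|/eqP E]; first by rewrite (ord1 s).
  by case: (@basic_neq0 k n hn (val i) (val j)).
exists (fun=> 0); split=> [[]//|x /cornerP[/radicalP rx hx]].
exists [ffun=> 0]; split; last by move=> c' _; apply/ffunP; case.
rewrite big_ord0 subr0; apply/cornerP; split=> //.
have zero : ent x i j = 0 -> jacobson_radical2 (idm X) mul x.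
  move=> E; exists 0%N, (fun=> 0), (fun=> 0); split; try by case.
  rewrite big_ord0; apply: ext => [i' j' h|]; [by rewrite hx | by rewrite E].
have [|[h [c E]]] := ent_basic x i j; first exact: zero.
have [eij|ij] := eqVneq i j; first by subst j; apply: zero; apply: rx.
rewrite (negbTE ij) /= in h; move: nar; rewrite /arrowb h /= negbK.
case/existsP=> L /and4P[LD r1 r2 /eqP r3].
have [l lE] : exists l : V, val l = L by exists (exist _ L LD).
subst L.
have il : i != l by apply: contraTneq r1 => ->; rewrite rotMM.
have lj : l != j by apply: contraTneq r2 => <-; rewrite rotMM.
have [a [a0 aE]] : exists a, a != 0 /\ basic k (val l) (val j) ** basic k (val i) (val l) = a *: basic k (val i) (val j).
  have nz : basic k (val l) (val j) ** basic k (val i) (val l) <> 0.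
    by apply: comp_basic_neq0 => //; [exact: compatV | rewrite addnC].
  have [//|[_ [a aE]]] := hom_basic hn (basic k (val l) (val j) ** basic k (val i) (val l)) (compatV i j).
  by exists a; split=> //; apply/eqP => z; apply: nz; rewrite aE z scale0r.
have := ent_bel l j; have := @ent_bel0 l j; have := bel_offdiag lj.
have := ent_bel i l; have := @ent_bel0 i l; have := bel_offdiag il.
move: (bel i l) (bel l j) => y z yd y0 ye zd z0 ze.
(* The composition of the two basic morphisms is [a] times the basic one, and [x] is [c] times
   it. *)
exists 1%N, (fun=> (c / a) *: y), (fun=> z); split.
- by move=> _; apply/radicalP => m; rewrite entZ yd scaler0.
- by move=> _; apply/radicalP.
rewrite big_ord1 /endop_mul cmpZr; apply: ext => [i' j' h2|].
  rewrite hx // entZ ent_cmp big1 ?scaler0 // => m _; case/orP: h2 => h2.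
    by apply: ent_cmp0r; apply: y0; rewrite h2.
  by apply: ent_cmp0l; apply: z0; rewrite h2 orbT.
rewrite entZ ent_cmp (bigD1 l) //= big1 ?addr0 => [|m ml]; last first.
  by apply: ent_cmp0r; apply: y0; rewrite ml orbT.
by rewrite ye ze aE scalerA mulfVK.
Qed.

Lemma sid_mul i j : sid i ** sid j = if i == j then sid i else 0.
Proof.
apply: entP => a b; have [<-|ij] := eqVneq i j.
  have [->|bi] := eqVneq b i; first by rewrite ent_sidl.
  by rewrite ent_sidl0 // ent_sid0 ?bi ?orbT.
have [->|bi] := eqVneq b i; last by rewrite ent_sidl0.
by rewrite ent_sidl ent_sid0 ?ij ?orbT ?ent0.
Qed.

Lemma sid_sum : \sum_i sid i = idm X.
Proof.
apply: entP => a b; rewrite ent_sum.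
have [<-|ab] := eqVneq a b.
  rewrite (bigD1 a) //= big1 ?addr0 ?ent_sid ?ent_id // => m ma.
  by rewrite ent_sid0 // eq_sym ma.
rewrite ent_id0 // big1 // => m _; apply: ent_sid0.
by rewrite -negb_and; apply: contra ab => /andP[/eqP -> /eqP ->].
Qed.

Lemma sid_corner i x : exists c, sid i ** (x ** sid i) = c *: sid i.
Proof.
have [c E] := ent_scalar x i; exists c; apply: entP => a b; rewrite entZ.
have [->|bi] := eqVneq b i; last by rewrite ent_sidl0 // ent_sid0 ?bi ?orbT // scaler0.
have [->|ai] := eqVneq a i; last by rewrite ent_sidl ent_sidr0 // ent_sid0 ?ai // scaler0.
by rewrite ent_sidl ent_sidr E ent_sid.
Qed.

Lemma sid_neq0 i : sid i <> 0.
Proof. by move=> E; apply: (@idm_val i); rewrite -ent_sid E ent0. Qed.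

Lemma sid_primitive i : primitive_idempotent mul (sid i).
Proof.
split; [by rewrite /endop_mul sid_mul eqxx | exact: sid_neq0 |].
rewrite /endop_mul => f g ff gg fg gf E.
have fi : sid i ** f = f by rewrite E cmpDl ff fg addr0.
have if_ : f ** sid i = f by rewrite E cmpDr ff gf addr0.
have [c cE] := sid_corner i f; rewrite if_ fi in cE.
have : (c * c - c) *: sid i = 0.
  have := ff; rewrite cE cmpZl cmpZr sid_mul eqxx scalerA => h.
  by rewrite scalerBl h subrr.
move/eqP; rewrite scaler_eq0 => /orP[|/eqP/sid_neq0 //].
rewrite -{3}[c]mulr1 -mulrBr mulf_eq0 subr_eq0 => /orP[/eqP c0|/eqP c1].
  by left; rewrite cE c0 scale0r.
right; apply: (addrI f); rewrite addr0 -E cE c1 scale1r //.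
Qed.

Lemma sid_basic : basic_idempotents (idm X) mul sid.
Proof.
split; [exact: sid_primitive | | exact: sid_sum |].
  by move=> i j ij; rewrite /endop_mul sid_mul eq_sym (negbTE ij).
rewrite /endop_mul => i j ij [x [y [E1 E2]]].
have [c cE] := ent_scalar x i; have [d dE] := ent_scalar y i.
have := congr1 (fun z => ent z i i) E2; rewrite ent_diag ent_sid0 ?ij // => h2.
have := congr1 (fun z => ent z i i) E1; rewrite ent_diag ent_sid cE dE => h1.
move: h2; rewrite cE dE => h2; move: h1 h2; rewrite !cmpZl !cmpZr cmp1m !scalerA mulrC.
by move=> -> /idm_val.
Qed.

(** The order of the arguments of [arrowb] is reversed: since [endop_mul] is the opposite
    multiplication, the corner of [e j] and [e i] consists of the morphisms from the summand j to
    the summand i. *)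
Theorem quiver_of_Delta : has_quiver_at (idm X) mul sid
  (fun i j : V => arrowb Delta (val j) (val i) : nat).
Proof. by split; [exact: sid_basic | move=> i j; apply: arrow_dim]. Qed.

End QuiverOfDelta.

(** * Invariance of the quiver of an algebra *)

Section QuotientDim.
Variables (k : fieldType) (A B : lmodType k).

Lemma quotient_dim_transfer (U W : A -> Prop) (U' W' : B -> Prop)
    (F : {linear A -> B}) (G : {linear B -> A}) d :
  (forall x, U x -> U' (F x)) -> (forall y, U' y -> U (G y)) ->
  (forall x, U x -> G (F x) = x) -> (forall y, U' y -> F (G y) = y) ->
  (forall x, W x -> W' (F x)) -> (forall y, W' y -> W (G y)) ->
  quotient_dim U W d -> quotient_dim U' W' d.
Proof.
move=> UF UG GF FG WF WG [u [Uu h]]; exists (fun i => F (u i)).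
split=> [i|y Uy]; first exact: UF.
have [c [Wc uc]] := h _ (UG _ Uy); exists c; split.
  have -> : y - \sum_i c i *: F (u i) = F (G y - \sum_i c i *: u i).
    under eq_bigr do rewrite -linearZ /=.
    by rewrite -linear_sum -{1}(FG y Uy) -linearB.
  exact: WF.
move=> c' Wc'; apply: uc; have := WG _ Wc'; rewrite linearB linear_sum.
suff -> : \sum_i G (c' i *: F (u i)) = \sum_i c' i *: u i by [].
by apply: eq_bigr => i _; rewrite linearZ /= GF.
Qed.

(** The matrices that express each of the two bases modulo [W] in the other have the identity as
    product, which bounds the size of the first. *)
Lemma quotient_dim_le (U W : A -> Prop) d d' :
  W 0 -> (forall x y, W x -> W y -> W (x + y)) -> (forall a x, W x -> W (a *: x)) ->
  quotient_dim U W d -> quotient_dim U W d' -> (d <= d')%N.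
Proof.
move=> W0 WD WZ [u [Uu hu]] [v [Uv hv]].
have WS (I : finType) (F : I -> A) : (forall i, W (F i)) -> W (\sum_i F i).
  by move=> h; elim/big_ind: _.
have /choice[C hC] : forall i, exists c : {ffun 'I_d' -> k}, W (u i - \sum_j c j *: v j).
  by move=> i; have [c [? _]] := hv _ (Uu i); exists c.
have /choice[D hD] : forall j, exists c : {ffun 'I_d -> k}, W (v j - \sum_l c l *: u l).
  by move=> j; have [c [? _]] := hu _ (Uv j); exists c.
apply: (@mulmx1_min _ _ _ (\matrix_(i, j) C i j) (\matrix_(j, l) D j l)).
apply/matrixP => i l; rewrite !mxE.
(* Both a row of the identity and a row of the matrix product express [u i] modulo [W], so they
   agree by uniqueness. *)
have [c [_ uc]] := hu _ (Uu i).
have c1 : c = [ffun l => (i == l)%:R].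
  apply: uc; rewrite (bigD1 i) //= ffunE eqxx scale1r big1 ?addr0 ?subrr // => l' ll.
  by rewrite ffunE eq_sym (negbTE ll) scale0r.
have c2 : c = [ffun l => \sum_j C i j * D j l].
  apply: uc.
  have -> : u i - \sum_l [ffun l => \sum_j C i j * D j l] l *: u l =
      (u i - \sum_j C i j *: v j) + \sum_j C i j *: (v j - \sum_l D j l *: u l).
    rewrite -addrA; congr (_ + _).
    under [X in _ = _ + X]eq_bigr do rewrite scalerBr.
    rewrite big_split /= addrA addNr add0r sumrN; congr (- _).
    under eq_bigr do rewrite ffunE scaler_suml.
    rewrite exchange_big; apply: eq_bigr => j _; rewrite scaler_sumr.
    by apply: eq_bigr => l' _; rewrite scalerA.
  by apply: WD => //; apply: WS => j; apply: WZ.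
transitivity (c l); first by rewrite c2 ffunE; apply: eq_bigr => j _; rewrite !mxE.
by rewrite c1 ffunE.
Qed.

End QuotientDim.

Section Transport.
Variables (k : fieldType) (C C' : lincat k) (T : C) (T' : C').
Variables (F : {linear hom T T -> hom T' T'}) (G : {linear hom T' T' -> hom T T}).
Hypotheses (FK : cancel F G) (GK : cancel G F).
Hypotheses (F1 : F (idm T) = idm T') (FM : forall g f, F (g ** f) = F g ** F f).

Lemma transport_inv1 : G (idm T') = idm T.
Proof. by rewrite -F1 FK. Qed.

Lemma transport_invM g f : G (g ** f) = G g ** G f.
Proof. by apply: (can_inj FK); rewrite FM !GK. Qed.
End Transport.

Section TransportRadical.
Variables (k : fieldType) (C C' : lincat k) (T : C) (T' : C').
Local Notation rad T := (jacobson_radical (idm T) (@endop_mul _ _ T)).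
Local Notation rad2 T := (jacobson_radical2 (idm T) (@endop_mul _ _ T)).
Variables (F : {linear hom T T -> hom T' T'}) (G : {linear hom T' T' -> hom T T}).
Hypotheses (FK : cancel F G) (GK : cancel G F).
Hypotheses (F1 : F (idm T) = idm T') (FM : forall g f, F (g ** f) = F g ** F f).

Lemma transport_rad x : rad T x -> rad T' (F x).
Proof.
move=> h a; have [b E] := h (G a); exists (F b).
by have := congr1 F E; rewrite /endop_mul FM linearB FM F1 GK.
Qed.

Lemma transport_rad2 x : rad2 T x -> rad2 T' (F x).
Proof.
move=> [m [y [z [hy hz ->]]]]; exists m, (F \o y), (F \o z).
split; [by move=> i; apply: transport_rad | by move=> i; apply: transport_rad|].
by rewrite linear_sum; apply: eq_bigr => i _; rewrite /endop_mul FM.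
Qed.

Lemma transport_corner P P' e f x : (forall x, P x -> P' (F x)) ->
  corner (@endop_mul _ _ T) e f P x -> corner (@endop_mul _ _ T') (F e) (F f) P' (F x).
Proof.
move=> h [Px E]; split; first exact: h.
by move: E; rewrite /endop_mul -!FM => ->.
Qed.
End TransportRadical.

Lemma transport_quiver (k : fieldType) (C C' : lincat k) (T : C) (T' : C')
    (F : {linear hom T T -> hom T' T'}) (G : {linear hom T' T' -> hom T T})
    (I : finType) (e : I -> hom T T) (q : I -> I -> nat) :
  cancel F G -> cancel G F -> F (idm T) = idm T' ->
  (forall g f, F (g ** f) = F g ** F f) ->
  has_quiver_at (idm T) (@endop_mul _ _ T) e q ->
  has_quiver_at (idm T') (@endop_mul _ _ T') (F \o e) q.
Proof.
move=> FK GK F1 FM [[prim orth sum1 nis] dims].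
have G1 := transport_inv1 FK F1; have GM := transport_invM FK GK FM.
split; last first.
  move=> i j; apply: quotient_dim_transfer (dims i j); last 2 first.
  - by move=> x h; apply: (transport_corner FM _ h) => z; apply: (transport_rad2 GK F1 FM).
  - move=> y h; rewrite -(FK (e j)) -(FK (e i)); apply: (transport_corner GM _ h) => z.
    exact: (transport_rad2 FK G1 GM).
  - by move=> x h; apply: (transport_corner FM _ h) => z; apply: (transport_rad GK F1 FM).
  - move=> y h; rewrite -(FK (e j)) -(FK (e i)); apply: (transport_corner GM _ h) => z.
    exact: (transport_rad FK G1 GM).
  - by move=> x _; apply: FK.
  - by move=> x _; apply: GK.
split.
- move=> i; have [ee e0 ep] := prim i; split.
  + by move: ee; rewrite /endop_mul /= -FM => ->.
  + by move=> /= E; apply: e0; apply: (can_inj FK); rewrite E linear0.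
  + rewrite /endop_mul => f g ff gg fg gf /= E.
    have := ep (G f) (G g); rewrite /endop_mul -!GM ff gg fg gf linear0.
    case=> //; first by apply: (can_inj FK); rewrite E linearD !GK.
      by move=> h; left; rewrite -(GK f) h linear0.
    by move=> h; right; rewrite -(GK g) h linear0.
- by move=> i j /orth; rewrite /endop_mul /= -FM => ->; rewrite linear0.
- by rewrite -linear_sum sum1.
- move=> i j ij [x [y [E1 E2]]]; apply: (nis i j ij); exists (G x), (G y).
  move: E1 E2; rewrite /endop_mul -!GM => -> ->.
  by rewrite /= !FK.
Qed.

(** * Independence of the quiver from the idempotents *)

Section Unique.
Variables (k : fieldType) (n : nat).
Hypothesis hn : (4 <= n)%N.
Local Notation edge := (tedge n).
Variable Delta : {set edge}.
Hypothesis hD : {in Delta &, forall M N, compat M N}.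
Local Notation V := (elements Delta).
Local Notation X := (edges_object k Delta).
Local Notation B := (hom X X).
Local Notation mul := (@endop_mul _ _ X).
Local Notation sid := (@sid k n Delta).
Local Notation rad := (jacobson_radical (idm X) mul).
Local Notation rad2 := (jacobson_radical2 (idm X) mul).
Implicit Types (x y z : B) (M N : V).

Lemma mA x y z : x ** (y ** z) = (x ** y) ** z.
Proof. exact: cmpA. Qed.

Lemma radl x y : rad x -> rad (y ** x).
Proof. by rewrite !(radicalP hn hD); apply: offdiagl. Qed.

Lemma radr x y : rad y -> rad (y ** x).
Proof. by rewrite !(radicalP hn hD); apply: offdiagr. Qed.

Lemma rad2_mul x a b : rad2 x -> rad2 (b ** (x ** a)).
Proof.
move=> [m [y [z [hy hz ->]]]]; exists m, (fun i => y i ** a), (fun i => b ** z i).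
split; [by move=> i; apply: radr | by move=> i; apply: radl|].
by rewrite cmp_suml cmp_sumr; apply: eq_bigr => i _; rewrite /endop_mul !mA.
Qed.

Lemma rad2_0 : rad2 0.
Proof. by exists 0%N, (fun=> 0), (fun=> 0); split; try (by case); rewrite big_ord0. Qed.

Lemma rad2D x y : rad2 x -> rad2 y -> rad2 (x + y).
Proof.
move=> [m [x1 [x2 [h1 h2 ->]]]] [m' [y1 [y2 [h3 h4 ->]]]].
exists (m + m')%N, (fun i => match split i with inl j => x1 j | inr j => y1 j end),
  (fun i => match split i with inl j => x2 j | inr j => y2 j end); split.
- by move=> i; case: (split i).
- by move=> i; case: (split i).
rewrite big_split_ord /=; congr (_ + _); apply: eq_bigr => i _.
  by rewrite -[lshift _ _]/(unsplit (inl i)) unsplitK.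
by rewrite -[rshift _ _]/(unsplit (inr i)) unsplitK.
Qed.

Lemma rad2Z a x : rad2 x -> rad2 (a *: x).
Proof.
move=> h; have := rad2_mul (a *: idm X) (idm X) h.
by rewrite cmp1m cmpZr cmpm1.
Qed.

Section Idempotents.
Variables (I : finType) (e : I -> B) (q : I -> I -> nat).
Hypothesis he : has_quiver_at (idm X) mul e q.

Lemma idem_e i : e i ** e i = e i.
Proof. by have [[p _ _ _] _] := he; have [] := p i. Qed.

Lemma diag_e i M : ent (e i) M M = 0 \/ ent (e i) M M = idm (val M : presented (@mesh_rel n k)).
Proof.
have [c cE] := ent_scalar hn hD (e i) M.
have := congr1 (fun z => ent z M M) (idem_e i); rewrite /= (ent_diag hn hD) cE cmpZl cmpZr cmp1m scalerA => /eqP.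
rewrite -subr_eq0 -scalerBl scaler_eq0 => /orP[|/eqP/(idm_neq0 hn) //].
rewrite -{3}[c]mulr1 -mulrBr mulf_eq0 subr_eq0 => /orP[/eqP ->|/eqP ->].
  by left; rewrite scale0r.
by right; rewrite scale1r.
Qed.

Lemma e_neq0 i : e i <> 0.
Proof. by have [[p _ _ _] _] := he; have [] := p i. Qed.

(** Otherwise [e i] would be nilpotent, and a nilpotent idempotent is zero. *)
Lemma ex_diag i : exists M, ent (e i) M M <> 0.
Proof.
apply: contrapT => h; have od : offdiag (e i).
  by move=> M; apply: contrapT => h2; apply: h; exists M.
apply: (@e_neq0 i); rewrite -(offdiag_nil hn hD od).
suff E m : iter m.+1 (cmp (e i)) (idm X) = e i by rewrite addn3 E.
elim: m => [|m IH]; first by rewrite /= cmpm1.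
by rewrite iterS IH idem_e.
Qed.

Lemma sid_e_sid i M : ent (e i) M M <> 0 -> sid M ** (e i ** sid M) = sid M.
Proof.
move=> h; have E1 : ent (e i) M M = idm (val M : presented (@mesh_rel n k)).
  by case: (diag_e i M).
have [c cE] := sid_corner hn hD M (e i).
have := congr1 (fun z => ent z M M) cE; rewrite /= ent_sidl ent_sidr E1 entZ ent_sid => /eqP.
rewrite -subr_eq0 -{1}[idm _]scale1r -scalerBl scaler_eq0 => /orP[|/eqP/(idm_neq0 hn) //].
by rewrite subr_eq0 => /eqP c1; rewrite cE -c1 scale1r.
Qed.

Lemma sid_idem M : sid M ** sid M = sid M.
Proof. by rewrite sid_mul eqxx. Qed.

Lemma conj_idem x f f' : f' ** f' = f' -> x ** (f' ** x) = x -> f ** (x ** f) = f ->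
  (f ** (x ** f')) ** (f' ** (x ** f)) = f.
Proof.
move=> ff e2 d1; rewrite -(mA f) -(mA x) (mA f' f') ff (mA f').
by rewrite (mA x (f' ** x)) e2 d1.
Qed.

(** Two idempotents that absorb each other in this way are equivalent; the products in the two
    orders are the mutually inverse maps between them. *)
Lemma equiv_idem x f : x ** x = x -> f ** f = f -> x ** (f ** x) = x -> f ** (x ** f) = f ->
  exists a b : B, [/\ a ** b = x /\ b ** a = f, x ** a = a, a ** f = a, f ** b = b & b ** x = b].
Proof.
move=> xx ff xfx fxf; exists (x ** f), (f ** x); split.
- split; first by rewrite -(mA x) (mA f f) ff xfx.
  by rewrite -(mA f) (mA x x) xx fxf.
- by rewrite mA xx.
- by rewrite -mA ff.
- by rewrite mA ff.
- by rewrite -mA xx.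
Qed.

(** The left-hand side [g] is an idempotent below [e i], and it is non-zero because its corner at
    [M] is [sid M]. Since [e i] is primitive, it is all of [e i]. *)
Lemma e_corner i M : ent (e i) M M <> 0 -> e i ** (sid M ** e i) = e i.
Proof.
move=> h; have fef := sid_e_sid h.
set g := e i ** (sid M ** e i).
have ge : g ** e i = g by rewrite /g -!mA idem_e.
have eg : e i ** g = g by rewrite /g mA idem_e.
have ff : sid M ** sid M = sid M by rewrite sid_mul eqxx.
have h2 : (sid M ** e i) ** (sid M ** e i) = sid M ** e i.
  by rewrite mA -(mA (sid M) (e i) (sid M)) fef.
have gg : g ** g = g.
  rewrite /g -(mA (e i) (sid M ** e i) (e i ** (sid M ** e i))).
  by rewrite (mA (sid M ** e i) (e i) (sid M ** e i)) -(mA (sid M) (e i) (e i)) idem_e h2.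
have [[p _ _ _] _] := he; have [_ _ pr] := p i.
have [] := pr g (e i - g); rewrite /endop_mul.
- exact: gg.
- by rewrite cmpDl !cmpDr idem_e -!scaleN1r !cmpZl !cmpZr eg ge gg scalerA mulrNN mulr1 scale1r addrACA scaleN1r addNr addr0.
- by rewrite cmpDl -scaleN1r cmpZl eg gg scaleN1r subrr.
- by rewrite cmpDr -scaleN1r cmpZr ge gg scaleN1r subrr.
- by rewrite addrC subrK.
- move=> g0; case: (@sid_neq0 k n hn Delta M).
  have : sid M ** (g ** sid M) = sid M.
    rewrite /g -(mA (e i)) -(mA (sid M)) fef.
    by rewrite fef.
  by rewrite g0 cmp0m cmpm0.
- by move/eqP; rewrite subr_eq0 => /eqP.
Qed.

Lemma diag_mul i j M : i != j -> ent (e i) M M <> 0 -> ent (e j) M M = 0.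
Proof.
have [[_ orth _ _] _] := he; move=> /orth; rewrite /endop_mul => E h.
have h1 : ent (e i) M M = idm (val M : presented (@mesh_rel n k)).
  by case: (diag_e i M).
have := congr1 (fun z => ent z M M) E; rewrite /= (ent_diag hn hD) h1 cmpm1.
by [].
Qed.

(** Orthogonality lets two idempotents never share an edge, which makes [s] injective. For the
    cardinality, each edge has an idempotent with non-zero entry there; two edges with the same
    idempotent would give equivalent projections, which is impossible as the projections are
    basic. *)
Lemma idem_bijection : exists s : I -> V, bijective s /\ forall i, ent (e i) (s i) (s i) <> 0.
Proof.
have /choice[s hs] := ex_diag; exists s; split=> //; apply: inj_card_bij.
  move=> i j E; apply/eqP; apply: contraT => ij.
  by case: (hs j); rewrite -E; apply: diag_mul (hs i).
have [[_ _ sum1 _] _] := he.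
have hM M : exists i, ent (e i) M M <> 0.
  apply: contrapT => h; apply: (idm_neq0 hn (M := val M)).
  transitivity (ent (\sum_i e i) M M); first by rewrite sum1 ent_id.
  rewrite ent_sum big1 // => i _.
  by apply: contrapT => h2; apply: h; exists i.
have /choice[r hr] := hM.
have inj_r : injective r.
  move=> M M' E; apply/eqP; apply: contraT => MM.
  have e1 := e_corner (hr M); have := e_corner (hr M'); rewrite -E => e2.
  have [[_ _ _ nis]] := quiver_of_Delta k hn hD; case: (nis M M' MM).
  have d1 := sid_e_sid (hr M); have := sid_e_sid (hr M'); rewrite -E => d2.
  exists (sid M' ** (e (r M) ** sid M)), (sid M ** (e (r M) ** sid M')).
  rewrite /endop_mul; split; [exact: (conj_idem (sid_idem M') e2 d1) | exact: (conj_idem (sid_idem M) e1 d2)].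
exact: leq_card inj_r.
Qed.

(** Each [e l] is equivalent to the projection to the edge [s l]. The equivalences identify the
    corners of the radical and of its square, and hence the numbers of arrows. *)
Theorem quiver_unique : exists s : I -> V, bijective s /\
  forall i j, (arrowb Delta (val (s j)) (val (s i)) : nat) = q i j.
Proof.
have [s [bs hs]] := idem_bijection; exists s; split=> // i j.
have /choice[a /choice[b hab]] l : exists a b : B, [/\ a ** b = e l /\ b ** a = sid (s l),
    e l ** a = a, a ** sid (s l) = a, sid (s l) ** b = b & b ** e l = b].
  apply: equiv_idem; [exact: idem_e | exact: sid_idem | exact: e_corner | exact: sid_e_sid].
have ab l : a l ** b l = e l by case: (hab l) => -[].
have ba l : b l ** a l = sid (s l) by case: (hab l) => -[].
have ea l : e l ** a l = a l by case: (hab l).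
have as_ l : a l ** sid (s l) = a l by case: (hab l).
have sb l : sid (s l) ** b l = b l by case: (hab l).
have be l : b l ** e l = b l by case: (hab l).
have conj_lin (u v : B) : linear (fun x : B => u ** (x ** v)).
  by move=> c x y; rewrite cmpDl cmpDr cmpZl cmpZr.
pose F : {linear B -> B} := HB.pack (fun x : B => b i ** (x ** a j))
  (GRing.isLinear.Build _ _ _ _ (fun x : B => b i ** (x ** a j)) (conj_lin (b i) (a j))).
pose G : {linear B -> B} := HB.pack (fun x : B => a i ** (x ** b j))
  (GRing.isLinear.Build _ _ _ _ (fun x : B => a i ** (x ** b j)) (conj_lin (a i) (b j))).
have FE x : F x = b i ** (x ** a j) by [].
have GE x : G x = a i ** (x ** b j) by [].
have dim := proj2 he i j; have dim' := arrow_dim k hn hD (s j) (s i).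
have {}dim : quotient_dim (corner mul (sid (s j)) (sid (s i)) rad)
     (corner mul (sid (s j)) (sid (s i)) rad2) (q i j).
  have cF (P : B -> Prop) : (forall x, P x -> P (F x)) -> forall x,
      corner mul (e j) (e i) P x -> corner mul (sid (s j)) (sid (s i)) P (F x).
    move=> PF x [Px E]; split; first exact: PF.
    by rewrite /endop_mul FE -(mA (b i)) -(mA x) as_ (mA (sid _)) sb.
  have cG (P : B -> Prop) : (forall x, P x -> P (G x)) -> forall x,
      corner mul (sid (s j)) (sid (s i)) P x -> corner mul (e j) (e i) P (G x).
    move=> PG x [Px E]; split; first exact: PG.
    by rewrite /endop_mul GE -(mA (a i)) -(mA x) be (mA (e _)) ea.
  apply: (quotient_dim_transfer (F := F) (G := G)) dim.
  - by apply: cF => x h; rewrite FE; apply/radl/radr.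
  - by apply: cG => x h; rewrite GE; apply/radl/radr.
  - move=> x [_ E]; rewrite FE GE -(mA (b i)) -(mA x) ab (mA (a i)) ab; exact: E.
  - move=> x [_ E]; rewrite FE GE -(mA (a i)) -(mA x) ba (mA (b i)) ba; exact: E.
  - by apply: cF => x h; rewrite FE; apply: rad2_mul.
  - by apply: cG => x h; rewrite GE; apply: rad2_mul.
have W0 : corner mul (sid (s j)) (sid (s i)) rad2 0.
  by split; [exact: rad2_0 | rewrite /endop_mul cmp0m cmpm0].
have WD x y : corner mul (sid (s j)) (sid (s i)) rad2 x ->
    corner mul (sid (s j)) (sid (s i)) rad2 y -> corner mul (sid (s j)) (sid (s i)) rad2 (x + y).
  move=> [hx ex] [hy ey]; split; first exact: rad2D.
  by move: ex ey; rewrite /endop_mul cmpDl cmpDr => -> ->.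
have WZ c x : corner mul (sid (s j)) (sid (s i)) rad2 x ->
    corner mul (sid (s j)) (sid (s i)) rad2 (c *: x).
  move=> [hx ex]; split; first exact: rad2Z.
  by move: ex; rewrite /endop_mul cmpZl cmpZr => ->.
by apply/eqP; rewrite eqn_leq (quotient_dim_le W0 WD WZ dim' dim) (quotient_dim_le W0 WD WZ dim dim').
Qed.

End Idempotents.
End Unique.

(** * Tilting objects *)

Section FiniteDim.
Variable k : fieldType.

Lemma finite_dim_rank (V : lmodType k) : finite_dim V -> exists d, rank_le V d.
Proof.
move=> [I [b hb]]; exists #|I|; apply: (@span_rank _ _ _ (fun i => b (enum_val i))) => v.
have [c ->] := hb v; exists (fun i => c (enum_val i)).
apply: (@reindex _ _ _ _ _ (@enum_val I predT)); apply: onW_bij; apply: enum_val_bij.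
Qed.

Lemma finite_dim_surj (V W : lmodType k) (f : {linear V -> W}) :
  (forall w, exists v, f v = w) -> finite_dim V -> finite_dim W.
Proof.
move=> fs [I [b hb]]; exists I, (f \o b) => w; have [v <-] := fs w.
have [c ->] := hb v; exists c; rewrite linear_sum; apply: eq_bigr => i _.
by rewrite linearZ.
Qed.

Section Product.
Variables (I : finType) (V : I -> lmodType k).

Definition fam_single i (v : V i) : vfam V := fun j =>
  match i =P j with
  | ReflectT e => match e in _ = j' return V j' with erefl => v end
  | ReflectF _ => 0
  end.

Lemma fam_singleE i (v : V i) : fam_single v i = v.
Proof. by rewrite /fam_single; case: eqP => // e; rewrite (eq_irrelevance e erefl). Qed.

Lemma fam_single0 i j (v : V i) : i != j -> fam_single v j = 0.
Proof. by rewrite /fam_single; case: eqP. Qed.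

Lemma finite_dim_vfam : (forall i, finite_dim (V i)) -> finite_dim (vfam V).
Proof.
move=> h; pose J i := projT1 (cid (h i)).
pose b i : J i -> V i := projT1 (cid (projT2 (cid (h i)))).
have hb i v : exists c, v = \sum_j c j *: b i j := projT2 (cid (projT2 (cid (h i)))) v.
exists {i : I & J i}, (fun x : {i : I & J i} => fam_single (b (projT1 x) (projT2 x))) => v.
pose c i := projT1 (cid (hb i (v i))).
have hc i : v i = \sum_j c i j *: b i j := projT2 (cid (hb i (v i))).
exists (fun x : {i : I & J i} => c (projT1 x) (projT2 x)).
apply: vfamP => i.
have sumE (K : finType) (F : K -> vfam V) : (\sum_x F x) i = \sum_x F x i.
  by elim/big_ind2: _ => // x1 x2 y1 y2 <- <-; rewrite vfamD.
rewrite sumE -(@sig_big_dep _ _ _ I J xpredT (fun _ => xpredT)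
  (fun i' j => (c i' j *: fam_single (b i' j)) i)) /=.
rewrite (bigD1 i) //= [X in _ + X]big1 ?addr0 => [|i' ii].
  by rewrite {1}hc; apply: eq_bigr => j _; rewrite vfamZ fam_singleE.
by rewrite big1 // => j _; rewrite vfamZ fam_single0 // scaler0.
Qed.

End Product.
End FiniteDim.

(** * Direct sums and the additive hull *)

Section DirectSums.
Variable k : fieldType.
Implicit Types C D : lincat k.

Lemma direct_sum_iso C (X X' : C) (I J : finType) (Y : I -> C) (Y' : J -> C) (b : I -> J) :
  is_direct_sum X Y -> is_direct_sum X' Y' -> bijective b ->
  (forall i, isomorphic (Y i) (Y' (b i))) -> isomorphic X X'.
Proof.
move=> [inj [prj [h1 h2 h3]]] [inj' [prj' [h1' h2' h3']]] bb iso.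
have isoP i := (proj1 (isomorphicP _ _) (iso i)).
pose f i := projT1 (cid (isoP i)); have fP i := projT2 (cid (isoP i)).
pose g i := projT1 (cid (fP i)); have gP i := projT2 (cid (fP i)).
have gf i : g i ** f i = idm (Y i) by case: (gP i).
have fg i : f i ** g i = idm (Y' (b i)) by case: (gP i).
have bi : injective b := bij_inj bb.
apply/isomorphicP.
exists (\sum_i inj' (b i) ** (f i ** prj i)), (\sum_i inj i ** (g i ** prj' (b i))); split.
  rewrite cmp_suml -[RHS]h3; apply: eq_bigr => i _.
  rewrite cmp_sumr (bigD1 i) //= big1 ?addr0 => [|j ji].
    by rewrite -!cmpA (cmpA (prj' _)) h1' cmp1m (cmpA (g i)) gf cmp1m.
  by rewrite -!cmpA (cmpA (prj' _)) h2' ?cmp0m ?cmpm0 // (inj_eq bi).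
rewrite cmp_suml -[RHS]h3' (reindex b) /=; last exact: onW_bij.
apply: eq_bigr => i _.
rewrite cmp_sumr (bigD1 i) //= big1 ?addr0 => [|j ji].
  by rewrite -!cmpA (cmpA (prj _)) h1 cmp1m (cmpA (f i)) fg cmp1m.
by rewrite -!cmpA (cmpA (prj _)) h2 ?cmp0m ?cmpm0.
Qed.

Lemma functor_direct_sum C D (F : functor C D) X (I : finType) (Y : I -> C) :
  is_direct_sum X Y -> is_direct_sum (F X) (fun i => F (Y i)).
Proof.
move=> [inj [prj [h1 h2 h3]]]; exists (fun i => fmap F (inj i)), (fun i => fmap F (prj i)).
split=> [i|i j ij|]; rewrite -?fmapM ?h1 ?fmap1 //; first by rewrite h2 ?linear0.
by rewrite -fmap1 -h3 linear_sum; apply: eq_bigr => i _; rewrite fmapM.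
Qed.

Lemma iso_direct_sum C (X X' : C) (I : finType) (Y : I -> C) :
  isomorphic X X' -> is_direct_sum X Y -> is_direct_sum X' Y.
Proof.
move=> /isomorphicP[u [v [vu uv]]] [inj [prj [h1 h2 h3]]].
exists (fun i => u ** inj i), (fun i => prj i ** v); split=> [i|i j ij|].
- by rewrite -cmpA (cmpA v) vu cmp1m.
- by rewrite -cmpA (cmpA v) vu cmp1m h2.
transitivity (u ** (\sum_i inj i ** prj i) ** v); last by rewrite h3 cmpm1.
by rewrite cmp_sumr cmp_suml; apply: eq_bigr => i _; rewrite !cmpA.
Qed.

Section Hull.
Variable C : lincat k.
Implicit Types X Y : additive_hull C.

Lemma sum_diagl X Z (f : forall j : sidx X, hom Z (sterm j)) l :
  \sum_j diag_entry j l ** f j = f l.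
Proof.
rewrite (bigD1 l) //= big1 ?addr0 => [|j jl]; first by rewrite diag_entry_refl cmp1m.
by rewrite diag_entry_neq // cmp0m.
Qed.

Lemma hullP X Y (f g : hom X Y) :
  (forall (i : sidx X) (j : sidx Y), (f : sumhom X Y) i j = (g : sumhom X Y) i j) -> f = g.
Proof. by move=> h; apply: vfamP => i; apply: vfamP => j; apply: h. Qed.

Lemma hull_idE X (i j : sidx X) : (idm X : sumhom X X) i j = diag_entry i j.
Proof. by []. Qed.

Lemma hull_cmpE X Y Z (g : hom Y Z) (f : hom X Y) (i : sidx X) (l : sidx Z) :
  (g ** f : sumhom X Z) i l = \sum_j (g : sumhom Y Z) j l ** (f : sumhom X Y) i j.
Proof. by []. Qed.

Lemma hull_cmp1E X (M : C) Z (g : hom (sum1 M) Z) (f : hom X (sum1 M)) (i : sidx X) (l : sidx Z) :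
  (g ** f : sumhom X Z) i l = (g : sumhom (sum1 M) Z) tt l ** (f : sumhom X (sum1 M)) i tt.
Proof. by rewrite hull_cmpE (bigD1 tt) //= big1 ?addr0 // => -[]. Qed.

Lemma hull_sumE X Y (I : finType) (F : I -> hom X Y) (i : sidx X) (j : sidx Y) :
  (\sum_x F x : sumhom X Y) i j = \sum_x (F x : sumhom X Y) i j.
Proof. by elim/big_ind2: _ => // x1 x2 y1 y2 <- <-; rewrite !vfamD. Qed.

Lemma hull_direct_sum X : is_direct_sum X (fun i : sidx X => sum1 (sterm i)).
Proof.
exists (fun i => (fun _ j => diag_entry i j) : sumhom (sum1 (sterm i)) X),
  (fun i => (fun j _ => diag_entry j i) : sumhom X (sum1 (sterm i))).
split=> [i|i j ij|].
- apply: hullP => -[] []; rewrite hull_cmpE (sum_diagl (fun j => diag_entry i j)).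
  by rewrite hull_idE [RHS]diag_entry_refl diag_entry_refl.
- apply: hullP => -[] []; rewrite hull_cmpE (sum_diagl (fun j => diag_entry i j)).
  by rewrite diag_entry_neq.
apply: hullP => j l; rewrite hull_sumE.
transitivity (\sum_i diag_entry i l ** diag_entry j i).
  by apply: eq_bigr => i _; rewrite hull_cmp1E.
by rewrite (sum_diagl (fun i => diag_entry j i)).
Qed.

Definition hull_rest X (i0 : sidx X) : additive_hull C :=
  @SumOb _ C {i : sidx X | i \in predC1 i0} (fun a => sterm (val a)).

Definition hull_pieces X (i0 : sidx X) (b : bool) : additive_hull C :=
  if b then sum1 (sterm i0) else hull_rest i0.

Lemma hull_split X (i0 : sidx X) : is_direct_sum X (hull_pieces i0).
Proof.
pose inj1 : hom (sum1 (sterm i0)) X := (fun _ j => diag_entry i0 j) : sumhom (sum1 (sterm i0)) X.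
pose prj1 : hom X (sum1 (sterm i0)) := (fun j _ => diag_entry j i0) : sumhom X (sum1 (sterm i0)).
pose inj2 : hom (hull_rest i0) X := (fun a j => diag_entry (val a) j) : sumhom (hull_rest i0) X.
pose prj2 : hom X (hull_rest i0) := (fun j a => diag_entry j (val a)) : sumhom X (hull_rest i0).
exists (fun b => if b return hom (hull_pieces i0 b) X then inj1 else inj2),
  (fun b => if b return hom X (hull_pieces i0 b) then prj1 else prj2).
split.
- case; apply: hullP.
    move=> [] []; rewrite hull_cmpE (sum_diagl (fun j => diag_entry i0 j)).
    by rewrite hull_idE [RHS]diag_entry_refl diag_entry_refl.
  move=> a a'; rewrite hull_cmpE (sum_diagl (fun j => diag_entry (val a) j)).
  rewrite hull_idE; have [<-|aa] := eqVneq a a'; first by rewrite !diag_entry_refl.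
  by rewrite !diag_entry_neq.
- case; case=> // _; apply: hullP.
    move=> [] a; rewrite hull_cmpE (sum_diagl (fun j => diag_entry i0 j)).
    by rewrite diag_entry_neq // eq_sym; apply: (valP a).
  move=> a []; rewrite hull_cmpE (sum_diagl (fun j => diag_entry (val a) j)).
  by rewrite diag_entry_neq //; apply: (valP a).
apply: hullP => j l; rewrite hull_sumE big_bool /= hull_cmp1E hull_cmpE.
rewrite -[RHS](sum_diagl (fun i => diag_entry j i)) (bigD1 i0) //=; congr (_ + _).
have := big_sub_cond (predC1 i0) xpredT (fun i => diag_entry i l ** diag_entry j i).
by move=> <-; apply: eq_bigl => i; rewrite !inE andbT.
Qed.

End Hull.

Lemma iso_zero_rest C (X : C) (Y : bool -> C) b : is_direct_sum X Y ->
  idm (Y (~~ b)) = 0 -> isomorphic X (Y b).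
Proof.
move=> [inj [prj [h1 h2 h3]]] z; apply/isomorphicP; exists (prj b), (inj b); split=> //.
rewrite -[RHS]h3 big_bool /=.
have E : inj (~~ b) ** prj (~~ b) = 0.
  by rewrite -[prj _]cmp1m z cmp0m cmpm0.
by case: b E {z} => /= ->; rewrite ?addr0 ?add0r.
Qed.

End DirectSums.

Section Loops.
Variables (k : fieldType) (n : nat).
Hypothesis hn : (4 <= n)%N.
Local Notation edge := (tedge n).
Local Notation C0 := (presented (@mesh_rel n k)).
Local Notation hom1 M N := (@hom _ C0 M N).

Lemma Hd_degree0 (M N : edge) d (f : hom1 M N) : Hd d f -> d = 0%N -> M != N -> f = 0.
Proof.
elim=> [|//|//|e L x y _ hx _ hy e0 ML|e L c x _ hx e0 ML].
- by rewrite eqxx.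
- by rewrite hx // hy // addr0.
- by rewrite hx // scaler0.
Qed.

Lemma Hd_loop0 (M : edge) d (f : hom1 M M) : Hd d f -> (0 < d)%N -> f = 0.
Proof.
move=> /(Hd_Sp hn) /(Sp_basic hn (compatMM M))[//|[h _]] d0.
by move: h; rewrite /basic_degree eqxx rotMM /= => /orP[]; lia.
Qed.

(** No compatibility of [M] and [N] is assumed: morphisms between distinct edges have positive
    degree, and an endomorphism of [M] of positive degree is zero because [M] is compatible with
    itself. *)
Lemma loop0 (M N : edge) (f : hom1 M N) (g : hom1 N M) : M != N -> g ** f = 0.
Proof.
move=> MN; elim: (Any_hom f) g => [d x hx g|x y _ hx _ hy g]; last first.
  by rewrite cmpDr hx hy addr0.
elim: (Any_hom g) => [d' y hy|y z _ hy _ hz]; last by rewrite cmpDl hy hz addr0.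
case: d hx => [|d] hx; first by rewrite (Hd_degree0 hx) // cmpm0.
by apply: (Hd_loop0 (Hd_comp hx hy)); rewrite addnS.
Qed.

Lemma finite_dim_tagged (P P' : tagged_edges n k) : finite_dim (hom P P').
Proof.
apply: finite_dim_vfam => i; apply: finite_dim_vfam => j; exact: finite_dim_hom0.
Qed.

Lemma idm_edge_neq0 (M : edge) : idm (edge_object k M) <> 0.
Proof.
move=> h; apply: (@idm_neq0 k n hn M).
have := f_equal (fun f : sumhom (edge_object k M) (edge_object k M) => f tt tt) h.
by rewrite hull_idE diag_entry_refl.
Qed.

Lemma edge_hom (M N : edge) (f : hom1 M N) : f <> 0 ->
  exists g : hom (edge_object k M) (edge_object k N), g <> 0.
Proof.
move=> f0; exists ((fun _ _ => f) : sumhom (edge_object k M) (edge_object k N)) => h.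
by apply: f0; apply: (f_equal (fun u : sumhom (edge_object k M) (edge_object k N) => u tt tt) h).
Qed.

(** This takes the place of the Krull-Schmidt theorem. If [M] were missing in [D'], then the
    identity of [M] would be a sum of loops through other edges, all of which are zero. *)
Lemma edges_retract_subset (D D' : {set edge}) :
  isomorphic (edges_object k D) (edges_object k D') -> D \subset D'.
Proof.
move=> /isomorphicP[u [v [vu _]]]; apply/subsetP => M MD; apply/negPn/negP => MD'.
apply: (@idm_neq0 k n hn M).
pose i : elements D := exist _ M MD.
have := f_equal (fun f : sumhom (edges_object k D) (edges_object k D) => f i i) vu.
rewrite hull_idE diag_entry_refl hull_cmpE => <-.
apply: big1 => j _; apply: loop0; apply/eqP => /= e.
by move: MD'; rewrite /i /= in e *; rewrite e (valP j).
Qed.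

End Loops.

(** * Tilting objects as sets of compatible edges *)

Section Tilting.
Variables (k : fieldType) (n : nat).
Hypothesis hn : (4 <= n)%N.
Variables (H : algType k) (c : cluster_data H).
Local Notation CH := (cluster_category c).
Local Notation edge := (tedge n).
Local Notation EO := (edge_object k).
Variable phi : functor (tagged_edges n k) CH.
Hypothesis phi_eq : is_equivalence phi.
Hypothesis phi_tau : forall M : edge,
  isomorphic (phi (EO (edge_translate M))) (cl_translate (phi (EO M))).

Lemma phi_inj P P' : injective (@fmap _ _ _ phi P P').
Proof. exact: bij_inj (phi_eq.1 P P'). Qed.

Lemma phi_surj P P' (g : hom (phi P) (phi P')) : exists f, fmap phi f = g.
Proof. by have [f' _ fK] := phi_eq.1 P P'; exists (f' g). Qed.

Lemma phi_reflects_iso P P' : isomorphic (phi P) (phi P') -> isomorphic P P'.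
Proof.
move=> /isomorphicP[u [v [vu uv]]]; apply/isomorphicP.
have [f fE] := phi_surj u; have [g gE] := phi_surj v.
by exists f, g; split; apply: phi_inj; rewrite fmapM fmap1 fE gE.
Qed.

Lemma cluster_finite_dim (X Y : CH) : exists d, rank_le (hom X Y) d.
Proof.
apply: finite_dim_rank; have [P hP] := phi_eq.2 X; have [P' hP'] := phi_eq.2 Y.
have [u [u' [u'u uu']]] := (isomorphicP _ _).1 hP.
have [v [v' [v'v vv']]] := (isomorphicP _ _).1 hP'.
have lin : linear (fun g : hom P P' => v ** fmap phi g ** u').
  by move=> a x y; rewrite linearP /= cmpDr cmpDl cmpZr cmpZl.
pose f : {linear hom P P' -> hom X Y} := HB.pack (fun g : hom P P' => v ** fmap phi g ** u')
  (GRing.isLinear.Build _ _ _ _ (fun g : hom P P' => v ** fmap phi g ** u') lin).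
apply: (finite_dim_surj (f := f)); last exact: finite_dim_tagged.
move=> w; have [g gE] := phi_surj (v' ** w ** u); exists g.
by rewrite /f /= gE -!cmpA uu' cmpm1 !cmpA vv' cmp1m.
Qed.

(** The object is the image of a finite sum of edges. Splitting off one edge leaves a complement
    that must be zero, since the edge is not. *)
Lemma indecomposable_edge (S : CH) : indecomposable S -> exists M, isomorphic S (phi (EO M)).
Proof.
move=> [S0 Sdec]; have [P hP] := phi_eq.2 S.
have [i0|noi] := pickP (@predT (sidx P)); last first.
  case: S0; have [u [u' [u'u uu']]] := (isomorphicP _ _).1 hP.
  rewrite -uu' (_ : u = u ** fmap phi (idm P)); last by rewrite fmap1 cmpm1.
  rewrite (_ : idm P = 0) ?linear0 ?cmpm0 ?cmp0m //.
  by apply: hullP => i; have := noi i.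
move=> _.
have hs : is_direct_sum S (fun b => phi (hull_pieces i0 b)).
  by apply: (iso_direct_sum hP); apply: functor_direct_sum; apply: hull_split.
have [z|z] := Sdec _ hs; last first.
  by exists (sterm i0); apply: (iso_zero_rest (b := true) hs z).
case: (@idm_edge_neq0 k n hn (sterm i0)); apply: phi_inj.
by rewrite fmap1 linear0.
Qed.

(** If two of the edges crossed, [crossing_hom] would give a non-zero morphism from one to the
    translate of the other, against [ext_summands]. *)
Theorem tilting_edges (T : CH) : basic_tilting n T -> exists D : {set edge},
  [/\ #|D| = n, isomorphic T (phi (edges_object k D)) & {in D &, forall M N, compat M N}].
Proof.
move=> [[S [Sind Siso Ssum]] ext0].
have /choice[m mP] : forall i, exists M, isomorphic (S i) (phi (EO M)).
  by move=> i; apply: indecomposable_edge.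
have minj : injective m.
  move=> i j e; apply/eqP/negPn/negP => /Siso; apply.
  by apply: iso_trans (mP i) _; rewrite e; apply: iso_sym.
exists [set m i | i in 'I_n]; split.
- by rewrite card_imset // card_ord.
- set D := [set _ | _ in _].
  pose b (i : 'I_n) : elements D := exist _ (m i) (imset_f m (erefl true)).
  apply: (direct_sum_iso (b := b) Ssum _ _ mP).
    exact: functor_direct_sum (hull_direct_sum (edges_object k D)).
  apply: inj_surj_bij; first by move=> i j [/minj].
  by move=> [M MD]; have /imsetP[i _ Mi] := MD; exists i; apply: val_inj.
move=> _ _ /imsetP[i _ ->] /imsetP[j _ ->].
have rS i' : retract (phi (EO (m i'))) T := iso_retract (iso_sym (mP i')) (sum_retract i' Ssum).
have main i' j' : forall f : hom (EO (m i')) (EO (edge_translate (m j'))), f = 0.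
  move=> f; apply: phi_inj; rewrite linear0.
  have h := ext_summands cluster_finite_dim ext0 (rS j') (rS i').
  exact: (hom0_iso (iso_refl _) (iso_sym (phi_tau _)) h).
by apply/negPn/negP => /(crossing_hom k hn)[] [f /edge_hom[g]]; apply; apply: main.
Qed.

(** The tilting object is also the image of a set of [n] edges, and that set contains [D]. *)
Lemma tilting_card (D : {set edge}) : basic_tilting n (phi (edges_object k D)) -> (#|D| <= n)%N.
Proof.
move=> /tilting_edges[D' [cD /phi_reflects_iso /(edges_retract_subset hn) /subset_leq_card h _]].
by rewrite -[leqRHS]cD.
Qed.

End Tilting.

(** * Curves in the punctured polygon *)

Section Geometry.
Import boolp classical_sets functions cardinality fsbigop topology normedtype trigo.
Import numFieldNormedType.Exports.
Local Open Scope classical_set_scope.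
Variables (R : realType) (n : nat).
Hypothesis hn : (4 <= n)%N.
Local Notation plane := (R * R)%type.

Let n0 : 0 < n%:R :> R. Proof. by rewrite ltr0n; lia. Qed.

Definition angle (x : R) : R := 2 * pi * x / n%:R.
Definition polar (x r : R) : plane := (r * cos (angle x), r * sin (angle x)).

(** By the half-angle formula [sin (u / 2)] vanishes, and [u / 2] lies strictly between -pi and
    pi. *)
Lemma cos_eq1 (u : R) : `|u| < 2 * pi -> cos u = 1 -> u = 0.
Proof.
move=> uB cu; have : sin (u / 2) ^+ 2 = 0.
  have e : (u / 2) *+ 2 = u by rewrite -mulr_natr divfK ?pnatr_eq0.
  by have := cos_mulr2n (u / 2); rewrite e cu sin2cos2 -mulr_natr; lra.
move=> /eqP; rewrite expf_eq0 /= => /eqP s0.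
have [u0|u0|//] := ltgtP u 0.
  have : 0 < sin (- (u / 2)).
    by apply: sin_gt0_pi; move: uB; rewrite ltr_norml => /andP[h1 h2]; apply/andP; split; lra.
  by rewrite sinN s0 oppr0 ltxx.
have : 0 < sin (u / 2).
  by apply: sin_gt0_pi; move: uB; rewrite ltr_norml => /andP[h1 h2]; apply/andP; split; lra.
by rewrite s0 ltxx.
Qed.

Lemma polar_inj x y r r' : 0 < r -> 0 < r' -> `|x - y| < n%:R -> polar x r = polar y r' ->
  x = y /\ r = r'.
Proof.
move=> r0 r'0 xy [ec es].
have rr : r = r'.
  have e : r ^+ 2 = r' ^+ 2.
    have h1 := cos2Dsin2 (angle x); have h2 := cos2Dsin2 (angle y).
    rewrite -[LHS]mulr1 -[RHS]mulr1 -{1}h1 -h2 !mulrDr -!exprMn ec es //.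
  by move/eqP: e; rewrite eqf_sqr => /orP[/eqP//|/eqP]; move: r0 r'0; lra.
split => //; rewrite -{}rr in ec es.
have rn : r != 0 by rewrite gt_eqF.
move: ec es => /(mulfI rn) ec /(mulfI rn) es.
have : cos (angle x - angle y) = 1.
  by rewrite cosB ec es -!expr2 cos2Dsin2.
move=> /cos_eq1 h; have : angle x - angle y = 0.
  apply: h; rewrite /angle -mulrBl -mulrBr normrM normfV (gtr0_norm n0) ltr_pdivrMr //.
  rewrite normrM (@gtr0_norm _ (2 * pi)) ?ltr_pM2l // mulr_gt0 ?pi_gt0 //.
rewrite /angle -mulrBl -mulrBr => /eqP; rewrite !mulf_eq0 invr_eq0 (gt_eqF n0) orbF.
by rewrite pnatr_eq0 (gt_eqF (pi_gt0 R)) /= subr_eq0 => /eqP.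
Qed.

Lemma polarDn x r : polar (x + n%:R) r = polar x r.
Proof.
rewrite /polar; have -> : angle (x + n%:R) = angle x + pi *+ 2.
  by rewrite /angle mulrDr mulrDl mulfK ?gt_eqF // -[pi *+ 2]mulr_natr [2 * pi]mulrC.
by rewrite cosD2pi sinD2pi.
Qed.

(** [off] counts steps modulo [n], and one full turn is [n] steps. This lets curves with different
    starts be compared in the coordinates of one of them. *)
Lemma polar_off (a c : 'I_n) x r : polar (c%:R + x) r = polar (a%:R + ((off a c)%:R + x)) r.
Proof.
have [h|h] : ((c : nat) = a + off a c)%N \/ ((c + n)%N = a + off a c)%N.
  have ha := ltn_ord a; have hc := ltn_ord c; rewrite offE; case: leqP => ac; [left|right]; clear - ha hc ac; lia.
  by rewrite addrA -natrD -h.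
by rewrite addrA -natrD -h natrD addrAC polarDn.
Qed.

Lemma norm_polar x r : (polar x r).1 ^+ 2 + (polar x r).2 ^+ 2 = r ^+ 2.
Proof. by rewrite /polar /= !exprMn -mulrDr cos2Dsin2 mulr1. Qed.

Lemma polar_boundary x : polar x 1 = boundary_point n x.
Proof. by rewrite /polar !mul1r. Qed.

(* The radius makes the nested arcs with one common end disjoint. *)
Definition arc_radius (l x : R) : R := 1 - x * (l - x) / n%:R ^+ 2.

Definition arc_curve (a : 'I_n) (l : R) (t : R) : plane :=
  polar (a%:R + t * l) (arc_radius l (t * l)).

Lemma arc_radius_bounds l x : 0 <= x <= l -> l <= n%:R -> 0 < arc_radius l x <= 1.
Proof.
move=> /andP[x0 xl] ln; rewrite /arc_radius; have nn : 0 < n%:R ^+ 2 :> R by rewrite exprn_gt0.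
apply/andP; split; last by rewrite gerBl divr_ge0 ?mulr_ge0 ?subr_ge0 // ltW.
rewrite subr_gt0 ltr_pdivrMr // mul1r.
(* The maximum of x (l - x), attained halfway, is less than n^2 as l <= n. *)
apply: (@le_lt_trans _ _ (l * l / 4)); first by have := sqr_ge0 (l - 2 * x); rewrite expr2; nra.
move: n0 x0 xl ln; rewrite expr2; nra.
Qed.

Lemma arc_radius_lt1 l x : 0 < x < l -> arc_radius l x < 1.
Proof.
move=> /andP[x0 xl]; rewrite /arc_radius gtrBl divr_gt0 ?mulr_gt0 ?subr_gt0 //.
Qed.

Lemma continuous_polar (T : topologicalType) (f g : T -> R) :
  continuous f -> continuous g -> continuous (fun t => polar (f t) (g t)).
Proof.
move=> cf cg t; have ca : {for t, continuous (fun t => angle (f t))}.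
  rewrite /angle; apply: cvgM; last exact: cvg_cst.
  by apply: cvgM; [exact: cvg_cst|exact: cf].
have c1 : (fun u => g u * cos (angle (f u))) @ t --> g t * cos (angle (f t)).
  apply: cvgM; [exact: cg|exact: (continuous_comp ca (@continuous_cos _ _))].
have c2 : (fun u => g u * sin (angle (f u))) @ t --> g t * sin (angle (f t)).
  apply: cvgM; [exact: cg|exact: (continuous_comp ca (@continuous_sin _ _))].
exact: (cvg_pair c1 c2).
Qed.

Lemma delta_end (a b : 'I_n) (r : R) : polar (a%:R + (off a b)%:R) r = polar b%:R r.
Proof. by have := polar_off a b 0 r; rewrite !addr0. Qed.

Section Arc.
Variables (a b : 'I_n).
Hypothesis ab : (3 <= delta_len a b)%N.
Local Notation l := ((delta_len a b).-1%:R : R).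

Let l0 : 0 < l. Proof. by rewrite ltr0n; move: ab; lia. Qed.
Let lln : l < n%:R. Proof. by rewrite ltr_nat delta_lenE /=; apply: off_lt. Qed.

Lemma in01 (t : R) : t \in `[0, 1] -> 0 <= t * l <= l.
Proof.
by rewrite inE /= in_itv /= => /andP[t0 t1]; rewrite mulr_ge0 ?(ltW l0) //= -[leRHS]mul1r ler_wpM2r // ltW.
Qed.

(** At every time the curve has the same angle as [delta_path], so the homotopy only moves the
    radius. *)
Lemma arc_curve_represents : represents_arc a b (arc_curve a l).
Proof.
have rb t : t \in `[0, 1] -> 0 < arc_radius l (t * l) <= 1.
  by move=> /in01 h; apply: arc_radius_bounds h (ltW lln).
have cont_pt : continuous (fun t : R => a%:R + t * l : R).
  by move=> t; apply: cvgD; [exact: cvg_cst|apply: cvgM; [exact: cvg_id|exact: cvg_cst]].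
have cont_rad : continuous (fun t : R => arc_radius l (t * l)).
  move=> t; rewrite /arc_radius; apply: cvgB; first exact: cvg_cst.
  apply: cvgM; last exact: cvg_cst.
  have c : (fun t : R => t * l) @ t --> t * l by apply: cvgM; [exact: cvg_id|exact: cvg_cst].
  by apply: cvgM; [exact: c|apply: cvgB; [exact: cvg_cst|exact: c]].
have f0 : arc_curve a l 0 = vertex_point R a.
  by rewrite /arc_curve /arc_radius !mul0r addr0 subr0 polar_boundary.
have f1 : arc_curve a l 1 = vertex_point R b.
  rewrite /arc_curve /arc_radius !mul1r subrr mulr0 mul0r subr0 delta_lenE /= delta_end.
  exact: polar_boundary.
split.
- by apply: continuous_subspaceT; apply: continuous_polar.
- by split.
- move=> t t' ti t'i /polar_inj; have /andP[r1 _] := rb t ti; have /andP[r2 _] := rb t' t'i.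
  move=> h; have [|/addrI/(mulIf _)-> //] := h r1 r2 _; last by rewrite gt_eqF.
  have /andP[] := in01 ti; have /andP[] := in01 t'i; move: lln.
  by rewrite ltr_norml => *; apply/andP; split; lra.
- move=> t; rewrite inE /= in_itv /= => /andP[t0 t1]; rewrite /polygon_interior /= norm_polar.
  have /andP[r1 _] : 0 < arc_radius l (t * l) <= 1 by apply: rb; rewrite inE /= in_itv /= !ltW.
  have r2 : arc_radius l (t * l) < 1.
    by apply: arc_radius_lt1; rewrite mulr_gt0 //= -[ltRHS]mul1r ltr_pM2r.
  by rewrite exprn_gt0 //= expr_lt1 // ltW.
(* Linear interpolation between the radius of the curve and the boundary radius 1; it stays positive
   and so avoids the puncture. *)
pose rad (p : plane) := (1 - p.1) * arc_radius l (p.2 * l) + p.1.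
exists (fun p : plane => polar (a%:R + p.2 * l) (rad p)); split.
- apply: continuous_subspaceT; apply: continuous_polar.
    move=> p; apply: (continuous_comp (f := snd) (g := fun t : R => a%:R + t * l)); last exact: cont_pt.
    exact: cvg_snd.
  move=> p; rewrite /rad.
  have cfst : (fun q : plane => q.1) @ p --> p.1 by exact: cvg_fst.
  apply: cvgD; last exact: cfst.
  apply: cvgM; first by apply: cvgB; [exact: cvg_cst|exact: cfst].
  apply: (continuous_comp (f := snd) (g := fun t : R => arc_radius l (t * l))); last exact: cont_rad.
  exact: cvg_snd.
- move=> s t; rewrite inE /= in_itv /= => /andP[s0 s1] /rb /andP[r1 r2].
  rewrite /punctured_polygon /= norm_polar /rad /=.
  have h1 : 0 < (1 - s) * arc_radius l (t * l) + s by nra.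
  have h2 : (1 - s) * arc_radius l (t * l) + s <= 1 by nra.
  by rewrite exprn_gt0 //= expr_le1 // ltW.
- move=> t ti; rewrite /rad /= subr0 mul1r addr0 subrr mul0r add0r; split => //.
  by rewrite polar_boundary.
move=> s si; rewrite f0 f1 /rad /arc_radius /= !mul0r !mul1r addr0 !subr0 subrr mulr0 mul0r subr0.
rewrite mulr1 subrK polar_boundary; split => //.
by rewrite -/(off a b) delta_end polar_boundary.
Qed.

End Arc.

Lemma polar_neq (a c : 'I_n) x y r r' (o := (off a c)%:R : R) : 0 < r -> 0 < r' ->
  `|x - (o + y)| < n%:R -> polar (a%:R + x) r = polar (c%:R + y) r' -> x = o + y /\ r = r'.
Proof.
move=> r0 r'0 h; rewrite (polar_off a c y) => /polar_inj[] //.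
  by rewrite (_ : _ - _ = x - (o + y)) //; rewrite /o; ring.
by move=> /addrI -> ->.
Qed.

Definition strand (M : tedge n) : set plane :=
  if degenerate M then @puncture_line R n (start M) @` `]0, 1[
  else arc_curve (start M) (elen M).-1%:R @` `]0, 1[.

Lemma strandP M : strands M (strand M).
Proof.
rewrite /strand; case: M => [[[a b] /= h]|a e] //=.
exists (arc_curve a (delta_len a b).-1%:R) => //.
by apply: arc_curve_represents; case/andP: h.
Qed.

Lemma strand_point M p : strand M p -> exists x r, [/\ p = polar ((start M)%:R + x) r, 0 < r < 1 &
  if degenerate M then x = 0 else 0 < x < (elen M).-1%:R /\ r = arc_radius (elen M).-1%:R x].
Proof.
rewrite /strand; have [dM|/negbTE dM] := boolP (degenerate M); rewrite ?dM.
  move=> [t]; rewrite /= in_itv /= => /andP[t0 t1] <-; exists 0, (1 - t); split=> //.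
    by rewrite addr0 /polar /puncture_line.
  by rewrite subr_gt0 t1 /= gtrBl.
have := elen_arc dM => /andP[l3 ln].
move=> [t]; rewrite /= in_itv /= => /andP[t0 t1] <-.
set l := (elen M).-1%:R; have l0 : 0 < l by rewrite ltr0n; clear - l3; lia.
have lln : l <= n%:R by rewrite ler_nat; clear - ln; lia.
have tl : 0 < t * l < l by rewrite mulr_gt0 //= -[ltRHS]mul1r ltr_pM2r.
exists (t * l), (arc_radius l (t * l)); split=> //.
rewrite arc_radius_lt1 // andbT.
have h : 0 <= t * l <= l by case/andP: tl => h1 h2; rewrite !ltW.
by have /andP[] := arc_radius_bounds h lln.
Qed.

Lemma nested_disjoint M N : degenerate M = false -> degenerate N = false -> M != N ->
  (off (start M) (start N) + elen N <= elen M)%N -> strand M `&` strand N = set0.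
Proof.
move=> dM dN ne h; rewrite -subset0 => p [].
move=> /strand_point[x [r [-> /andP[r0 _]]]]; rewrite dM => -[/andP[x0 xl] rE].
move=> /strand_point[y [r' [+ /andP[r'0 _]]]]; rewrite dN => e -[/andP[y0 yl] r'E].
have /andP[M3 Mn] := elen_arc dM; have /andP[N3 Nn] := elen_arc dN.
set o := off _ _ in h; set l := (elen M).-1 in xl rE; set m := (elen N).-1 in yl r'E.
have om : o%:R + m%:R <= l%:R :> R by rewrite -natrD ler_nat /m /l; clear - h M3 N3; lia.
have ln : l%:R < n%:R :> R by rewrite ltr_nat /l; clear - M3 Mn; lia.
have o0 : 0 <= o%:R :> R by [].
have [|xE rr] := polar_neq r0 r'0 _ e.
  by rewrite -/o ltr_norml; apply/andP; split; lra.
rewrite -/o in xE; move: rr; rewrite rE r'E /arc_radius => /addrI/oppr_inj.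
have nn : (n%:R ^+ 2)^-1 != 0 :> R by rewrite invr_neq0 // gt_eqF // exprn_gt0.
move=> /(mulIf nn) E.
have [o1 lm] : o%:R = 0 :> R /\ l%:R = m%:R :> R.
  rewrite xE in E; clear - E om o0 y0 yl.
  move: (o%:R) (l%:R) (m%:R) => {}o {}l {}m in E om o0 yl *.
  (* With x = o + y the equality of the radii becomes o (l - o - y) + y (l - o - m) = 0, a sum of
     non-negative terms because o + m <= l. *)
  have d0 : 0 <= l - o - m by lra.
  have my : 0 < m - y by lra.
  have p1 := mulr_ge0 o0 d0; have p2 := mulr_ge0 o0 (ltW my); have p3 := mulr_ge0 (ltW y0) d0.
  have /eqP : o * (m - y) = 0 by lra.
  rewrite mulf_eq0 (gt_eqF my) orbF => /eqP o1; split=> //.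
  have /eqP : y * (l - o - m) = 0 by lra.
  by rewrite mulf_eq0 (gt_eqF y0) /= => /eqP; lra.
case/eqP: ne; apply: edge_inj.
  by apply/eqP; rewrite -off_eq0 -/o; move/eqP: o1; rewrite pnatr_eq0.
by move/eqP: lm; rewrite eqr_nat => /eqP; rewrite /l /m; clear - M3 N3; lia.
by clear - dM dN; move: dM dN; case: M; case: N.
Qed.

(** The angles of the two curves lie in disjoint intervals, and together they spread over less than
    one full turn, so no two of them agree modulo a turn. *)
Lemma apart_disjoint M N : degenerate M = false ->
  (if degenerate N then (off (start M) (start N) == 0) || (elen M <= (off (start M) (start N)).+1)
   else (elen M <= (off (start M) (start N)).+1) && (off (start M) (start N) + elen N <= n.+1))%N ->
  strand M `&` strand N = set0.
Proof.
move=> dM h; rewrite -subset0 => p [].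
move=> /strand_point[x [r [-> /andP[r0 _]]]]; rewrite dM => -[/andP[x0 xl] _].
move=> /strand_point[y [r' [e /andP[r'0 _] yE]]].
have /andP[M3 Mn] := elen_arc dM.
set o := off _ _ in h; set l := (elen M).-1 in xl.
have on : o%:R < n%:R :> R by rewrite ltr_nat; apply: off_lt.
have ln : l%:R < n%:R :> R by rewrite ltr_nat /l; clear - M3 Mn; lia.
have o0 : 0 <= o%:R :> R by [].
have lo : (elen M <= o.+1)%N -> l%:R <= o%:R :> R.
  by rewrite ler_nat /l => Mo; clear - M3 Mo; lia.
have [|xE _] := polar_neq r0 r'0 _ e.
  rewrite -/o ltr_norml; move: h yE; case: (degenerate N) => [h ->|/andP[h1 h2] [/andP[y0 yl] _]].
    by apply/andP; split; lra.
  have := lo h1; have : o%:R + (elen N).-1%:R <= n%:R :> R.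
    by rewrite -natrD ler_nat; have := off_lt (start M) (start N); rewrite -/o => oN; clear - h2 oN; lia.
  by move=> *; apply/andP; split; lra.
rewrite -/o in xE; move: h yE; case: (degenerate N) => [/orP[/eqP h|/lo h] yE|/andP[/lo h _] [/andP[y0 yl] _]].
- by move: x0; rewrite xE yE h addr0 ltxx.
- by clear - xE yE h xl; lra.
by clear - xE y0 h xl; lra.
Qed.

Lemma compat_disjoint M N : compat M N -> M != N -> ~~ (degenerate M && degenerate N) ->
  strand M `&` strand N = set0.
Proof.
rewrite /compat; case dM: (degenerate M); case dN: (degenerate N) => //= h ne _.
- by rewrite setIC; apply: apart_disjoint; rewrite ?dM.
- by apply: apart_disjoint; rewrite ?dN.
case/or3P: h => h; [exact: nested_disjoint| |by apply: apart_disjoint; rewrite ?dN].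
by rewrite setIC; apply: nested_disjoint; rewrite // eq_sym.
Qed.

Lemma compat_crossing0 (M N : tedge n) : compat M N -> crossing_number R M N 0.
Proof.
move=> MN; rewrite /crossing_number; case: eqVneq => // ne.
have key : ~~ (degenerate M && degenerate N) -> min_intersections R M N 0.
  move=> h; split; last by [].
  exists (strand M), (strand N); split; try exact: strandP.
  by rewrite compat_disjoint // II0 card_eq0.
case: M N MN ne key => [p|a e] [q|b e'] MN ne key; try exact: key.
move: MN; rewrite /compat /= off_eq0; case: (a == b) => //= /eqP ->.
by rewrite eqxx.
Qed.

End Geometry.

Local Close Scope ring_scope.

(** * Sets of [n] compatible edges are triangulations *)

Section Triangulation.
Variables (R : realType) (k : fieldType) (n : nat) (H : algType k) (c : cluster_data H).
Hypothesis hn : (4 <= n)%N.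
Variable phi : functor (tagged_edges n k) (cluster_category c).
Hypothesis hphi : is_schiffler_equivalence R phi.
Implicit Types (D : {set tedge n}) (M N : tedge n).

Lemma triangulation_extend D : noncrossing_set R D ->
  exists2 D', triangulation R D' & D \subset D'.
Proof.
move=> hD; have /asboolP hD' := hD.
have [B /maxsetP[/asboolP hB maxB] DB] := maxset_exists (P := fun D => `[< noncrossing_set R D >]) hD'.
by exists B => //; split=> // D' /asboolP; apply: maxB.
Qed.

(** A triangulation around [D] has a tilting object as its image, to which [tilting_card]
    applies. *)
Lemma noncrossing_card D : noncrossing_set R D -> (#|D| <= n)%N.
Proof.
move=> /triangulation_extend[D' tD' /subset_leq_card DD'].
apply: leq_trans DD' _; have [e1 e2 e3] := hphi; exact: (tilting_card hn e1 e2 (e3 _ tD')).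
Qed.

Lemma compat_noncrossing D : {in D &, forall M N, compat M N} -> noncrossing_set R D.
Proof. by move=> hD M N MD ND; apply: compat_crossing0 => //; apply: hD. Qed.

Lemma compat_triangulation D : {in D &, forall M N, compat M N} -> #|D| = n -> triangulation R D.
Proof.
move=> hD cD; split; first exact: compat_noncrossing.
move=> D' hD' DD'; apply/esym/eqP; rewrite eqEcard DD' /= [leqRHS]cD; exact: noncrossing_card.
Qed.

(** The form in which maximality is used later: an edge is shown to be in the triangulation by
    checking compatibility alone. *)
Lemma compat_maximal D M : {in D &, forall M N, compat M N} -> #|D| = n ->
  {in D, forall N, compat M N} -> M \in D.
Proof.
move=> hD cD hM; apply: contraT => MD.
have /noncrossing_card : noncrossing_set R (M |: D).
  apply: compat_noncrossing => L N; rewrite !inE => /orP[/eqP ->|LD] /orP[/eqP ->|ND].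
  - exact: compatMM.
  - exact: hM.
  - by rewrite compat_sym; apply: hM.
  - exact: hD.
by rewrite cardsU1 MD cD add1n ltnn.
Qed.

End Triangulation.

(** * Mutation *)

Section Mutation.
Variable V : finType.
Implicit Types (f g : V -> V -> nat) (s : seq (bool * V)) (i j v x y : V).

Lemma qext f g : (forall i j, f i j = g i j) -> f = g.
Proof. by move=> h; apply/funext => i; apply/funext => j. Qed.

Definition qadd f g i j := (f i j + g i j)%N.
Local Notation "f +q g" := (qadd f g) (at level 50, left associativity).

Definition arr x y : V -> V -> nat := fun i j => (i == x) && (j == y) : nat.

Definition edge_arr (b : bool) x y := if b then arr x y else arr y x.

(** The case [i = j] excludes loops as well as 2-cycles. *)
Definition acyc2 f := forall i j, f i j = 0%N \/ f j i = 0%N.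

Definition supported (S : {set V}) f := forall i j, f i j != 0%N -> (i \in S) && (j \in S).

Lemma qaddC f g : f +q g = g +q f.
Proof. by apply: qext => i j; apply: addnC. Qed.

Lemma qaddA f g h : f +q (g +q h) = f +q g +q h.
Proof. by apply: qext => i j; apply: addnA. Qed.

Lemma acyc2_mutation f v : acyc2 f -> acyc2 (mutation f v).
Proof.
move=> hf i j; rewrite /mutation orbC; case: ifP => _; first exact: hf.
lia.
Qed.

Lemma acyc2_loop f i : acyc2 f -> f i i = 0%N.
Proof. by move=> /(_ i i)[]. Qed.

Lemma mutationK f v : acyc2 f -> mutation (mutation f v) v = f.
Proof.
move=> hf; apply: qext => i j; rewrite /mutation.
have [->|iv] := eqVneq i v; first by rewrite eqxx ?orbT.
have [->|jv] := eqVneq j v; first by rewrite eqxx ?orbT.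
rewrite /= eqxx ?orbT /=; have := hf i j.
move: (f i j) (f j i) => a b; nia.
Qed.

Lemma acyc2_edge b x y : x != y -> acyc2 (edge_arr b x y).
Proof.
move=> xy i j; rewrite /edge_arr; case: b; rewrite /arr;
  by have [->|_] := eqVneq i x; have [->|_] := eqVneq j y; rewrite ?(negbTE xy) ?andbF ?eqxx /=;
  rewrite 1?(eq_sym y) ?(negbTE xy) ?andbF; auto.
Qed.

Inductive reach (U : {set V}) f f' : Prop :=
| reach0 of f = f'
| reachS v of v \in U & reach U (mutation f v) f'.

Lemma reach_trans U f f' f'' : reach U f f' -> reach U f' f'' -> reach U f f''.
Proof. by elim=> [_ _ ->//|g g' v vU _ h /h]; apply: reachS. Qed.

Lemma reach_sub (U U' : {set V}) f f' : U \subset U' -> reach U f f' -> reach U' f f'.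
Proof.
move=> /subsetP UU'; elim=> [g g' ->|g g' v /UU' vU _]; first exact: reach0.
exact: reachS.
Qed.

Lemma supported_sub (S S' : {set V}) f : S \subset S' -> supported S f -> supported S' f.
Proof. by move=> /subsetP SS' hf i j /hf /andP[/SS' -> /SS' ->]. Qed.

Lemma supported_mutation (S : {set V}) f v : supported S f -> supported S (mutation f v).
Proof.
move=> hf i j; rewrite /mutation; case: ifP => _; first by move=> /hf /andP[-> ->].
move=> h; have [|ij] := eqVneq (f i j) 0%N; last exact: hf ij.
move=> e; have {}h : (f i v * f v j != 0)%N by apply: contraNneq h; lia.
move: h; rewrite muln_eq0 negb_or => /andP[/hf /andP[-> _]].
by move=> /hf /andP[_ ->].
Qed.

(* In the sum f + g, mutating inside the part U of the support of f that g does not touch only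
   changes f. *)
Lemma mutation_add (S U : {set V}) f g v : v \in U -> supported S f -> U \subset S -> acyc2 g ->
  {in S &, forall i j, g i j = 0%N} -> {in U, forall i j, g i j = 0%N /\ g j i = 0%N} ->
  mutation (f +q g) v = mutation f v +q g.
Proof.
move=> vU fS /subsetP US ga gS gU; apply: qext => i j; rewrite /mutation /qadd.
have gv u : g v u = 0%N /\ g u v = 0%N by apply: gU.
have [->|iv] /= := eqVneq i v; first by rewrite !(proj1 (gv _)) !(proj2 (gv _)).
have [->|jv] /= := eqVneq j v; first by rewrite !(proj1 (gv _)) !(proj2 (gv _)).
rewrite !(proj1 (gv _)) !(proj2 (gv _)) !addn0.
have f0 a b : ~~ ((a \in S) && (b \in S)) -> f a b = 0%N.
  by move=> h; apply/eqP; apply: contraNT h; apply: fS.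
case: (boolP ((i \in S) && (j \in S))) => [/andP[iS jS]|h].
  by rewrite !gS // !addn0.
rewrite (f0 i j) // (f0 j i); last by rewrite andbC.
have -> : (f i v * f v j = 0)%N.
  by move: h; rewrite negb_and => /orP[h|h];
    [rewrite (f0 i v)|rewrite (f0 v j) ?muln0] => //; rewrite negb_and h ?orbT.
have -> : (f j v * f v i = 0)%N.
  by move: h; rewrite negb_and => /orP[h|h];
    [rewrite (f0 v i) ?muln0|rewrite (f0 j v)] => //; rewrite negb_and h ?orbT.
by have := ga i j; lia.
Qed.

Lemma reach_add (S U : {set V}) f f' g : reach U f f' -> supported S f -> U \subset S -> acyc2 g ->
  {in S &, forall i j, g i j = 0%N} -> {in U, forall i j, g i j = 0%N /\ g j i = 0%N} ->
  reach U (f +q g) (f' +q g).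
Proof.
elim=> {f f'} [f f' <- *|f f' v vU _ h fS US ga gS gU]; first exact: reach0.
apply: (reachS vU); rewrite (mutation_add vU fS) //; apply: h => //.
exact: supported_mutation.
Qed.

(** A path beginning in [x] with an arbitrary orientation, given by the booleans. No orientation has
    to be normalized, because all orientations of the Dynkin diagram are allowed as representatives
    of type A. *)
Fixpoint chain x s : V -> V -> nat :=
  if s is (b, y) :: s' then edge_arr b x y +q chain y s' else fun _ _ => 0%N.

Definition verts s : seq V := map snd s.

Lemma chain_supported x s : supported [set u in x :: verts s] (chain x s).
Proof.
elim: s x => [|[b y] s IH] x i j //=; rewrite /qadd addn_eq0 negb_and => /orP[|/IH].
  by case: b; rewrite /= eqb0 negbK => /andP[/eqP -> /eqP ->]; rewrite !inE !eqxx ?orbT.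
by rewrite !inE => /andP[-> ->]; rewrite !orbT.
Qed.

Lemma chain_out x s i j : (i \notin x :: verts s) || (j \notin x :: verts s) -> chain x s i j = 0%N.
Proof.
move=> h; apply/eqP; apply: contraTT h => /chain_supported.
by rewrite !inE => /andP[-> ->].
Qed.

Lemma chain_acyc2 x s : uniq (x :: verts s) -> acyc2 (chain x s).
Proof.
elim: s x => [|[b y] s IH] x; first by left.
move=> /= /andP[xs us] i j; have {IH} := IH y us; rewrite /qadd => IH.
have hx u : (chain y s x u = 0%N) * (chain y s u x = 0%N).
  by split; apply: chain_out; rewrite xs ?orbT.
have xy : x != y by apply: contraNneq xs => ->; rewrite mem_head.
have [->|ix] := eqVneq i x.
  by rewrite !hx !addn0; apply: acyc2_edge.
have [->|jx] := eqVneq j x.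
  by rewrite !hx !addn0; apply: acyc2_edge.
have e0 : edge_arr b x y i j = 0%N by case: (b); rewrite /edge_arr /arr (negbTE ix, negbTE jx) ?andbF.
have e1 : edge_arr b x y j i = 0%N by case: (b); rewrite /edge_arr /arr (negbTE ix, negbTE jx) ?andbF.
by rewrite e0 e1 !add0n.
Qed.

Definition triangle v x y := arr v x +q arr x y +q arr y v.

Lemma mutation_triangle v x y : uniq [:: v; x; y] ->
  mutation (triangle v x y) x = arr x v +q arr y x.
Proof.
rewrite /= !inE negb_or !andbT => /andP[/andP[vx vy] xy].
have vx' : x != v by rewrite eq_sym. have vy' : y != v by rewrite eq_sym.
have xy' : y != x by rewrite eq_sym.
apply: qext => i j; rewrite /mutation /triangle /arr /qadd !eqxx.
have N := (negbTE vx, negbTE vy, negbTE xy, negbTE vx', negbTE vy', negbTE xy').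
have H u : ((u == v) + (u == x) + (u == y) <= 1)%N.
  case: (eqVneq u v) => [->|_]; rewrite ?N //; case: (eqVneq u x) => [->|_]; rewrite ?N //.
  exact: leq_b1.
rewrite !N /=; move: (H i) (H j).
case: (i == v); case: (i == x); case: (i == y) => //= _;
by case: (j == v); case: (j == x); case: (j == y).
Qed.

(** The 3-cycle moves one step towards [z] and keeps [v], while [y] stays attached to [x] by one
    arrow. *)
Lemma mutation_triangle_out v x y z : uniq [:: v; x; y; z] ->
  mutation (triangle v x y +q arr x z) x = triangle v z x +q arr y x.
Proof.
rewrite /= !inE !negb_or !andbT => /and3P[/and3P[vx vy vz] /andP[xy xz] yz].
have vx' : x != v by rewrite eq_sym. have vy' : y != v by rewrite eq_sym.
have xy' : y != x by rewrite eq_sym. have vz' : z != v by rewrite eq_sym.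
have xz' : z != x by rewrite eq_sym. have yz' : z != y by rewrite eq_sym.
apply: qext => i j; rewrite /mutation /triangle /arr /qadd !eqxx.
have N := (negbTE vx, negbTE vy, negbTE xy, negbTE vx', negbTE vy', negbTE xy',
  negbTE vz, negbTE vz', negbTE xz, negbTE xz', negbTE yz, negbTE yz').
have H u : ((u == v) + (u == x) + (u == y) + (u == z) <= 1)%N.
  case: (eqVneq u v) => [->|_]; rewrite ?N //; case: (eqVneq u x) => [->|_]; rewrite ?N //.
  case: (eqVneq u y) => [->|_]; rewrite ?N //; exact: leq_b1.
rewrite !N /=; move: (H i) (H j).
case: (i == v); case: (i == x); case: (i == y); case: (i == z) => //= _;
by case: (j == v); case: (j == x); case: (j == y); case: (j == z).
Qed.

(** The 3-cycle moves one step towards [z] and keeps [y], while [v] stays attached to [x] by one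
    arrow. *)
Lemma mutation_triangle_in v x y z : uniq [:: v; x; y; z] ->
  mutation (triangle v x y +q arr z x) x = arr x v +q triangle x z y.
Proof.
rewrite /= !inE !negb_or !andbT => /and3P[/and3P[vx vy vz] /andP[xy xz] yz].
have vx' : x != v by rewrite eq_sym. have vy' : y != v by rewrite eq_sym.
have xy' : y != x by rewrite eq_sym. have vz' : z != v by rewrite eq_sym.
have xz' : z != x by rewrite eq_sym. have yz' : z != y by rewrite eq_sym.
apply: qext => i j; rewrite /mutation /triangle /arr /qadd !eqxx.
have N := (negbTE vx, negbTE vy, negbTE xy, negbTE vx', negbTE vy', negbTE xy',
  negbTE vz, negbTE vz', negbTE xz, negbTE xz', negbTE yz, negbTE yz').
have H u : ((u == v) + (u == x) + (u == y) + (u == z) <= 1)%N.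
  case: (eqVneq u v) => [->|_]; rewrite ?N //; case: (eqVneq u x) => [->|_]; rewrite ?N //.
  case: (eqVneq u y) => [->|_]; rewrite ?N //; exact: leq_b1.
rewrite !N /=; move: (H i) (H j).
case: (i == v); case: (i == x); case: (i == y); case: (i == z) => //= _;
by case: (j == v); case: (j == x); case: (j == y); case: (j == z).
Qed.

End Mutation.

(** * Straightening quivers glued along a 3-cycle *)

Section Glue.
Variable V : finType.
Implicit Types (f g : V -> V -> nat) (s : seq (bool * V)) (i j v x y : V).
Local Notation "f +q g" := (qadd f g) (at level 50, left associativity).

Lemma acyc2_add (S : {set V}) f g : supported S f -> {in S &, forall i j, g i j = 0%N} ->
  acyc2 f -> acyc2 g -> acyc2 (f +q g).
Proof.
move=> fS gS fa ga i j; rewrite /qadd.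
case: (boolP ((i \in S) && (j \in S))) => [/andP[iS jS]|h].
  by rewrite !gS // !addn0.
have f0 a b : ~~ ((a \in S) && (b \in S)) -> f a b = 0%N.
  by move=> h'; apply/eqP; apply: contraNT h'; apply: fS.
by rewrite (f0 i j) // (f0 j i) 1?andbC //; apply: ga.
Qed.

Lemma supported_add (S : {set V}) f g : supported S f -> supported S g -> supported S (f +q g).
Proof.
by move=> fS gS i j; rewrite /qadd addn_eq0 negb_and => /orP[/fS|/gS].
Qed.

Lemma supported_arr (S : {set V}) x y : x \in S -> y \in S -> supported S (arr x y).
Proof. by move=> xS yS i j; rewrite /arr eqb0 negbK => /andP[/eqP -> /eqP ->]; rewrite xS. Qed.

Lemma supported_triangle (S : {set V}) x y z : x \in S -> y \in S -> z \in S ->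
  supported S (triangle x y z).
Proof. by move=> *; do 2?apply: supported_add; apply: supported_arr. Qed.

Lemma chain_in0 (S : {set V}) x s : uniq (x :: verts s) -> {in verts s, forall u, u \notin S} ->
  {in S &, forall i j, chain x s i j = 0%N}.
Proof.
move=> us sS i j iS jS.
have S0 u : u \in S -> u \notin verts s by apply: contraL => /sS.
have [ix|ix] := eqVneq i x; last by apply: chain_out; rewrite inE negb_or ix S0.
have [jx|jx] := eqVneq j x; last by apply: chain_out; rewrite !inE !negb_or jx (S0 j) // orbT.
by rewrite ix jx; apply/acyc2_loop/chain_acyc2.
Qed.

Lemma chain_off0 x s u j : u \notin x :: verts s -> chain x s u j = 0%N /\ chain x s j u = 0%N.
Proof. by move=> h; split; apply: chain_out; rewrite h ?orbT. Qed.

Lemma notin_neq (s : seq V) x u : x \notin s -> u \in s -> (u == x) = false.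
Proof. by move=> xs us; apply: contraNF xs => /eqP <-. Qed.

(* f is a quiver on S that mutations at the vertices of S other than w turn into a linear one that
   ends in w. *)
Definition rooted f (S : {set V}) w := [/\ supported S f, acyc2 f &
  exists s, [/\ uniq (w :: verts s), S =i w :: verts s & reach (S :\ w) f (chain w s)]].

Lemma chains_off (s1 s2 : seq (bool * V)) x y : uniq (x :: verts s1 ++ y :: verts s2) ->
  {in [set u in x :: verts s1] &, forall i j, chain y s2 i j = 0%N}.
Proof.
rewrite /= mem_cat negb_or cat_uniq => /andP[/andP[_ xs2] /and3P[_ h us2]].
apply: chain_in0 => // u us; rewrite !inE.
have us' : u \in y :: verts s2 by rewrite inE us orbT.
rewrite (notin_neq xs2 us') /=; apply: contra h => us1; apply/hasP; exists u => //.
Qed.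

(** Induction on the chain attached to [x], each time mutating at [x]. If its first arrow leaves
    [x], the cycle becomes v, z, x and [y] joins the second chain, which now begins in [x]. If the
    arrow enters [x], then [v] hangs on [x] by a single arrow, and the cycle x, z, y is straightened
    with root [x]. Once the chain is used up, the mutation opens the cycle. None of the mutations is
    at [v]. *)
Lemma reach_triangle (s1 s2 : seq (bool * V)) v x y : uniq (v :: x :: verts s1 ++ y :: verts s2) ->
  exists s, perm_eq (verts s) (x :: verts s1 ++ y :: verts s2) /\
    reach [set u in x :: verts s1 ++ y :: verts s2]
      (triangle v x y +q (chain x s1 +q chain y s2)) (chain v s).
Proof.
elim: s1 s2 v x y => [|[b z] s1 IH] s2 v x y U.
  move: (U); rewrite /= !inE !negb_or -!andbA => /and5P[vx vy vs2 xy /and3P[xs2 ys2 us2]].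
  exists [:: (false, x), (false, y) & s2]; split => //.
  apply: (reachS (v := x)); first by rewrite !inE eqxx.
  have -> : chain x [::] +q chain y s2 = chain y s2 by apply: qext => i j.
  rewrite (@mutation_add _ [set v; x; y] [set x]) ?set11 //.
  - apply: reach0; rewrite mutation_triangle; last by rewrite /= !inE negb_or vx vy xy.
    by rewrite -qaddA.
  - by apply: supported_triangle; rewrite !inE eqxx ?orbT.
  - by apply/subsetP => u; rewrite !inE => ->; rewrite orbT.
  - by apply: chain_acyc2; rewrite /= ys2.
  - apply: chain_in0; first by rewrite /= ys2.
    by move=> u us; rewrite !inE (notin_neq vs2 us) (notin_neq xs2 us) (notin_neq ys2 us).
  - by move=> u; rewrite !inE => /eqP -> j; apply: chain_off0; rewrite !inE negb_or xy.
have Uz : uniq (z :: verts s1 ++ y :: verts s2) by case/and3P: U.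
move: (U); rewrite /= !inE !mem_cat !inE !negb_or -!andbA => /and5P[vx vz vs1 vy /andP[vs2 /and5P[xz xs1 xy xs2 /and4P[zs1 zy zs2]]]].
rewrite cat_uniq => /and3P[us1 ns us2].
have ys1 : y \notin verts s1 by apply: contra ns => ys1; apply/hasP; exists y; rewrite ?mem_head.
have ys2 : y \notin verts s2 by case/andP: us2.
pose g := chain z s1 +q chain y s2.
have ga : acyc2 g.
  apply: (acyc2_add (@chain_supported _ z s1)); [exact: chains_off| |]; apply: chain_acyc2 => //=.
  by rewrite zs1.
have g0 : {in [set v; x; y; z] &, forall i j, g i j = 0%N}.
  move=> i j iS jS; rewrite /g /qadd !(@chain_in0 [set v; x; y; z]) //=.
  - move=> u us; rewrite !inE (notin_neq vs2 us) (notin_neq xs2 us) (notin_neq ys2 us).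
    by rewrite (notin_neq zs2 us).
  - by rewrite zs1.
  - move=> u us; rewrite !inE (notin_neq vs1 us) (notin_neq xs1 us) (notin_neq ys1 us).
    by rewrite (notin_neq zs1 us).
have gx : {in [set x], forall i j, g i j = 0%N /\ g j i = 0%N}.
  move=> u; rewrite !inE => /eqP -> j; rewrite /g /qadd.
  have h1 : x \notin z :: verts s1 by rewrite inE negb_or xz.
  have h2 : x \notin y :: verts s2 by rewrite inE negb_or xy.
  by have [-> ->] := chain_off0 j h1; have [-> ->] := chain_off0 j h2.
have sub : [set x] \subset [set v; x; y; z].
  by apply/subsetP => u; rewrite !inE => ->; rewrite orbT.
have -> : triangle v x y +q (chain x ((b, z) :: s1) +q chain y s2) =
    triangle v x y +q edge_arr b x z +q g.
  by rewrite /= -!qaddA.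
have supp : supported [set v; x; y; z] (triangle v x y +q edge_arr b x z).
  apply: supported_add; first by apply: supported_triangle; rewrite !inE eqxx ?orbT.
  by case: (b); apply: supported_arr; rewrite !inE eqxx ?orbT.
have U4 : uniq [:: v; x; y; z].
  by rewrite /= !inE !negb_or vx vy vz xy xz (eq_sym y) zy.
have P : perm_eq (z :: verts s1 ++ x :: y :: verts s2) (x :: z :: verts s1 ++ y :: verts s2).
  exact/permPl/(perm_catCA (z :: verts s1) [:: x] (y :: verts s2)).
case: b supp U => supp U.
  have [|s [ps hs]] := IH ((false, y) :: s2) v z x.
    by rewrite (perm_uniq (s2 := v :: x :: z :: verts s1 ++ y :: verts s2)) // perm_cons.
  exists s; split; first exact: perm_trans ps P.
  apply: (reachS (v := x)); first by rewrite !inE eqxx.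
  rewrite (mutation_add (set11 x) supp) // mutation_triangle_out // /g.
  have -> : triangle v z x +q arr y x +q (chain z s1 +q chain y s2) =
     triangle v z x +q (chain z s1 +q chain x ((false, y) :: s2)).
    by clear; apply: qext => i j; rewrite /= /qadd /edge_arr; lia.
  apply: reach_sub hs; apply/subsetP => u; rewrite !inE !mem_cat !inE.
  by move=> /or4P[->|->|->|/orP[->|->]]; rewrite ?orbT.
have Ux : uniq (x :: z :: verts s1 ++ y :: verts s2) by case/andP: U.
have [s [ps hs]] := IH s2 x z y Ux.
exists ((false, x) :: s); split; first by rewrite /= perm_cons.
apply: (reachS (v := x)); first by rewrite !inE eqxx.
rewrite (mutation_add (set11 x) supp) // mutation_triangle_in //.
have -> : arr x v +q triangle x z y +q g = triangle x z y +q g +q arr x v.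
  by clear; apply: qext => i j; rewrite /qadd; lia.
rewrite /= [X in reach _ _ X]qaddC.
apply: (reach_sub (U := [set u in z :: verts s1 ++ y :: verts s2])).
  by apply/subsetP => u; rewrite !inE => ->; rewrite orbT.
apply: (reach_add (S := [set u in x :: z :: verts s1 ++ y :: verts s2]) hs).
- apply: supported_add; first by apply: supported_triangle; rewrite !inE ?mem_cat ?inE ?eqxx ?orbT.
  apply: supported_add; [move: (@chain_supported _ z s1)|move: (@chain_supported _ y s2)];
    apply: supported_sub; apply/subsetP => u; rewrite !inE ?mem_cat ?inE.
    by move=> /orP[->|->]; rewrite ?orbT.
  by move=> /orP[->|->]; rewrite ?orbT.
- by apply/subsetP => u; rewrite !inE => ->; rewrite orbT.
- by apply: (@acyc2_edge _ true); rewrite eq_sym.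
- move=> i j; rewrite /arr => _; case: (eqVneq j v) => [->|]; rewrite ?andbF //.
  by move: U; rewrite /= => /andP[/negbTE]; rewrite inE => ->.
move=> u; rewrite inE => uS j; rewrite /arr.
have [] : u <> x /\ u <> v.
  move: U uS => /andP[h1 /andP[h2 _]] uS; split=> e; first by case/negP: h2; rewrite -e.
  by case/negP: h1; rewrite -e inE; apply/orP; right.
by move=> /eqP/negbTE -> /eqP/negbTE ->; rewrite andbF.
Qed.

End Glue.

Section Glue.
Variable V : finType.
Implicit Types (f g : V -> V -> nat) (s : seq (bool * V)) (i j v x y : V) (S : {set V}).
Local Notation "f +q g" := (qadd f g) (at level 50, left associativity).

Lemma supported0 S f i j : supported S f -> (i \notin S) || (j \notin S) -> f i j = 0%N.
Proof. by move=> fS h; apply/eqP; apply: contraTT h => /fS /andP[-> ->]. Qed.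

Lemma rooted_root f S w : rooted f S w -> w \in S.
Proof. by case=> _ _ [s [_ -> _]]; rewrite inE eqxx. Qed.

Lemma rooted0 w : rooted (fun _ _ : V => 0%N) [set w] w.
Proof.
split=> //; first by left.
by exists [::]; split=> //; [move=> u; rewrite !inE | apply: reach0].
Qed.

Lemma acyc2_triangle x y z : uniq [:: x; y; z] -> acyc2 (triangle x y z).
Proof.
rewrite /= !inE negb_or andbT => /andP[/andP[/negbTE xy /negbTE xz] /negbTE yz] i j.
have H u : ((u == x) + (u == y) + (u == z) <= 1)%N.
  case: (eqVneq u x) => [->|_]; rewrite ?xy ?xz //; case: (eqVneq u y) => [->|_]; rewrite ?yz //.
  exact: leq_b1.
rewrite /triangle /qadd /arr; move: (H i) (H j).
case: (i == x); case: (i == y); case: (i == z) => //= _;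
by case: (j == x); case: (j == y); case: (j == z) => // _; auto.
Qed.

Lemma supported_chain_set S x s : S =i x :: verts s -> supported S (chain x s).
Proof. by move=> SE i j /chain_supported; rewrite !SE !in_set. Qed.

(** The mutations that straighten [f] avoid [x], the only vertex of [S] that the new arrow
    touches. *)
Lemma rooted1 b f S w x : rooted f S x -> w \notin S -> rooted (edge_arr b w x +q f) (w |: S) w.
Proof.
move=> h wS; have xS := rooted_root h; have [fS fa [s [us SE hs]]] := h.
have wx : w != x by apply: contraNneq wS => ->.
have e0 : {in S &, forall i j, edge_arr b w x i j = 0%N}.
  move=> i j iS jS; have iw : i != w by apply: contraNneq wS => <-.
  have jw : j != w by apply: contraNneq wS => <-.
  by rewrite /edge_arr /arr; case: (b); rewrite ?(negbTE iw) ?(negbTE jw) ?andbF.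
split.
- apply: supported_add; last by apply: supported_sub fS; apply: subsetUr.
  by rewrite /edge_arr; case: (b); apply: supported_arr; rewrite !inE ?eqxx ?xS ?orbT.
- by rewrite qaddC; apply: (acyc2_add fS e0 fa); apply: acyc2_edge.
exists ((b, x) :: s); split.
- by rewrite [uniq _]/= -/(uniq _) -SE wS.
- by move=> u; rewrite !inE SE inE.
rewrite /= qaddC [X in reach _ _ X]qaddC.
apply: (@reach_sub _ (S :\ x)).
  by apply/subsetP => u; rewrite !inE => /andP[_ uS]; rewrite uS orbT andbT; apply: contraNneq wS => <-.
apply: (reach_add hs fS) => //; first exact: subD1set.
  exact: acyc2_edge.
move=> u; rewrite !inE => /andP[ux uS] j.
have uw : u != w by apply: contraNneq wS => <-.
by rewrite /edge_arr /arr; case: (b); rewrite (negbTE ux) (negbTE uw) ?andbF.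
Qed.

(** The two parts are straightened one after the other without a mutation at [x] or [y], so the
    3-cycle is untouched. What is left is the situation of [reach_triangle]. *)
Lemma rooted2 f1 f2 S1 S2 w x y : rooted f1 S1 x -> rooted f2 S2 y -> [disjoint S1 & S2] ->
  w \notin S1 -> w \notin S2 -> rooted (triangle w x y +q (f1 +q f2)) (w |: (S1 :|: S2)) w.
Proof.
move=> h1 h2 dis wS1 wS2; have xS1 := rooted_root h1; have yS2 := rooted_root h2.
have [f1S f1a [s1 [us1 S1E hs1]]] := h1; have [f2S f2a [s2 [us2 S2E hs2]]] := h2.
have d12 u : u \in S1 -> u \notin S2 by move=> uS; rewrite (disjointFr dis).
have d21 u : u \in S2 -> u \notin S1 by move=> uS; rewrite (disjointFl dis).
have wx : w != x by apply: contraNneq wS1 => ->.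
have wy : w != y by apply: contraNneq wS2 => ->.
have xy : x != y by apply: contraNneq (d12 _ xS1) => ->.
have ta : acyc2 (triangle w x y) by apply: acyc2_triangle; rewrite /= !inE negb_or wx wy xy.
have n1 u : u \in S1 -> (u == w = false) * (u == y = false).
  move=> uS; split; first by apply: contraNF wS1 => /eqP <-.
  by apply: contraNF (d21 _ yS2) => /eqP <-.
have n2 u : u \in S2 -> (u == w = false) * (u == x = false).
  move=> uS; split; first by apply: contraNF wS2 => /eqP <-.
  by apply: contraNF (d12 _ xS1) => /eqP <-.
have tS1 : {in S1 &, forall i j, triangle w x y i j = 0%N}.
  by move=> i j /n1 iS /n1 jS; rewrite /triangle /qadd /arr !iS !jS !andbF.
have tS2 : {in S2 &, forall i j, triangle w x y i j = 0%N}.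
  by move=> i j /n2 iS /n2 jS; rewrite /triangle /qadd /arr !iS !jS !andbF.
have tU1 : {in S1 :\ x, forall i j, triangle w x y i j = 0%N /\ triangle w x y j i = 0%N}.
  move=> i; rewrite !inE => /andP[/negbTE ix /n1 iS] j.
  by rewrite /triangle /qadd /arr !iS !ix !andbF.
have tU2 : {in S2 :\ y, forall i j, triangle w x y i j = 0%N /\ triangle w x y j i = 0%N}.
  move=> i; rewrite !inE => /andP[/negbTE ix /n2 iS] j.
  by rewrite /triangle /qadd /arr !iS !ix !andbF.
have f10 u j : u \in S2 -> f1 u j = 0%N /\ f1 j u = 0%N.
  by move=> /d21 uS; split; apply: (supported0 f1S); rewrite uS ?orbT.
have f20 u j : u \in S1 -> f2 u j = 0%N /\ f2 j u = 0%N.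
  by move=> /d12 uS; split; apply: (supported0 f2S); rewrite uS ?orbT.
have c1S := supported_chain_set S1E.
have c10 u j : u \in S2 -> chain x s1 u j = 0%N /\ chain x s1 j u = 0%N.
  by move=> /d21 uS; split; apply: (supported0 c1S); rewrite uS ?orbT.
have g2a : acyc2 (f2 +q triangle w x y) := acyc2_add f2S tS2 f2a ta.
have g20 : {in S1 &, forall i j, (f2 +q triangle w x y) i j = 0%N}.
  by move=> i j iS jS; rewrite /qadd tS1 // (proj1 (f20 _ _ iS)).
split.
- apply: supported_add; first by apply: supported_triangle; rewrite !inE ?eqxx ?xS1 ?yS2 ?orbT.
  apply: supported_add; [apply: supported_sub f1S|apply: supported_sub f2S];
  by apply/subsetP => u; rewrite !inE => ->; rewrite ?orbT.
- have -> : triangle w x y +q (f1 +q f2) = f1 +q (f2 +q triangle w x y).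
    by rewrite qaddC qaddA.
  exact: (acyc2_add f1S g20 f1a g2a).
have U : uniq (w :: x :: verts s1 ++ y :: verts s2).
  rewrite cons_uniq -cat_cons mem_cat -S1E -S2E negb_or wS1 wS2 cat_uniq us1 us2 !(andTb, andbT).
  by apply/hasPn => u; rewrite -S2E => /d21; rewrite S1E.
have [s [ps hs]] := reach_triangle U.
exists s; split.
- by rewrite -(perm_uniq (s1 := w :: x :: verts s1 ++ y :: verts s2)) // perm_cons perm_sym.
- move=> u; rewrite !in_setU in_set1 inE S1E S2E (perm_mem ps).
  by rewrite -cat_cons mem_cat.
have w1 : S1 \subset (w |: (S1 :|: S2)) :\ w.
  by apply/subsetP => u uS; rewrite !inE (n1 _ uS) uS orbT.
have w2 : S2 \subset (w |: (S1 :|: S2)) :\ w.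
  by apply/subsetP => u uS; rewrite !inE (n2 _ uS) uS !orbT.
have -> : triangle w x y +q (f1 +q f2) = f1 +q (f2 +q triangle w x y).
  by rewrite qaddC qaddA.
apply: (reach_trans (f' := chain x s1 +q (f2 +q triangle w x y))).
  apply: (@reach_sub _ (S1 :\ x)); first exact: subset_trans (subD1set _ _) w1.
  apply: (reach_add hs1 f1S) => //; first exact: subD1set.
  move=> u uS j; have [t1 t2] := tU1 u uS j.
  by have [e1 e2] := f20 u j (subsetP (subD1set _ _) _ uS); rewrite /qadd t1 t2 e1 e2.
have -> : chain x s1 +q (f2 +q triangle w x y) = f2 +q (chain x s1 +q triangle w x y).
  by rewrite qaddA [chain x s1 +q f2]qaddC -qaddA.
apply: (reach_trans (f' := chain y s2 +q (chain x s1 +q triangle w x y))).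
  apply: (@reach_sub _ (S2 :\ y)); first exact: subset_trans (subD1set _ _) w2.
  apply: (reach_add hs2 f2S) => //; first exact: subD1set.
  - by apply: (acyc2_add c1S tS1) => //; apply: chain_acyc2.
  - by move=> i j iS jS; rewrite /qadd tS2 // (proj1 (c10 _ _ iS)).
  move=> u uS j; have [t1 t2] := tU2 u uS j.
  by have [e1 e2] := c10 u j (subsetP (subD1set _ _) _ uS); rewrite /qadd t1 t2 e1 e2.
have -> : chain y s2 +q (chain x s1 +q triangle w x y) =
    triangle w x y +q (chain x s1 +q chain y s2).
  by rewrite qaddA qaddC [chain y s2 +q _]qaddC.
apply: reach_sub hs; apply/subsetP => u; rewrite in_set -cat_cons mem_cat -S1E -S2E.
by move=> /orP[/(subsetP w1)|/(subsetP w2)].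
Qed.

Lemma mutation_comp (I : eqType) (e : I -> V) f (v : I) : injective e ->
  (fun i j : I => mutation f (e v) (e i) (e j)) = mutation (fun i j : I => f (e i) (e j)) v.
Proof.
by move=> ei; apply/funext => i; apply/funext => j; rewrite /mutation !(inj_eq ei).
Qed.

(** [in_MA] starts from the linear quiver, so the mutations are undone in the opposite order; each
    is an involution by [mutationK]. *)
Lemma reach_mutation_equiv (I : eqType) (e : I -> V) S f f' : injective e ->
  (forall u, u \in S -> exists i : I, u = e i) -> reach S f f' -> acyc2 f ->
  mutation_equiv (fun i j : I => f' (e i) (e j)) (fun i j : I => f (e i) (e j)).
Proof.
move=> ei eS; elim=> {f f'} [f f' -> _|f f' v vS _ IH fa]; first exact: mutation_refl.
have [u vE] := eS v vS.
apply: (mutation_step (v := u) (IH (acyc2_mutation v fa))) => i j.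
have := f_equal (fun g : I -> I -> nat => g i j) (mutation_comp (mutation f v) u ei).
by move=> /= <-; rewrite -vE mutationK.
Qed.

Lemma edge_arr_sym b x y i j : x != y ->
  (edge_arr b x y i j + edge_arr b x y j i)%N = ((i == x) && (j == y) || (i == y) && (j == x)).
Proof.
move=> /negbTE xy; rewrite /edge_arr /arr; case: b; rewrite [(j == _) && (i == _)]andbC;
case: (eqVneq i x) => [->|_]; rewrite ?xy ?(eq_sym y) ?xy //= ?addn0 ?orbF //;
by rewrite ?orbF.
Qed.

Lemma chain_nth d x s (i j : nat) : uniq (x :: verts s) -> (i <= size s)%N -> (j <= size s)%N ->
  (chain x s (nth d (x :: verts s) i) (nth d (x :: verts s) j) +
   chain x s (nth d (x :: verts s) j) (nth d (x :: verts s) i))%N =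
  ((j == i.+1) || (i == j.+1)).
Proof.
elim: s x i j => [|[b y] s IH] x i j; first by case: i => // _; case: j.
move=> U; have /= /andP[xs us] := U.
have xy : x != y by apply: contraNneq xs => ->; rewrite mem_head.
have yx : y != x by rewrite eq_sym.
have c0 u : chain y s x u = 0%N /\ chain y s u x = 0%N by apply: chain_off0.
have nx m : (m <= size s)%N -> nth d (y :: verts s) m != x.
  move=> ms; apply: contraNneq xs => <-; rewrite mem_nth //= size_map //.
have ny m : (m <= size s)%N -> (nth d (y :: verts s) m == y) = (m == 0%N).
  move=> ms; rewrite -[X in _ == X]/(nth d (y :: verts s) 0) nth_uniq //= size_map //.
rewrite /qadd addnACA edge_arr_sym //.
case: i j => [|i] [|j] /= hi hj.
- by rewrite !(proj1 (c0 _)) eqxx (negbTE xy) andbF.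
- by rewrite (proj1 (c0 _)) (proj2 (c0 _)) eqxx ny // (negbTE xy) eqSS; case: (j == 0%N).
- by rewrite (proj1 (c0 _)) (proj2 (c0 _)) eqxx ny // (negbTE xy) eqSS; case: (i == 0%N); rewrite ?andbF.
rewrite !(negbTE (nx _ _)) // andbF /= add0n !eqSS; exact: IH.
Qed.

Lemma rooted_in_MA f S w (q : V -> V -> nat) : rooted f S w -> {in S &, forall i j, q i j = f i j} ->
  in_MA (@full_subquiver (Quiver q) S).
Proof.
move=> [fS fa [s [us SE hs]]] qf.
pose m := (size s).+1.
have sm : size (w :: verts s) = m by rewrite /= size_map.
pose e (i : 'I_m) := nth w (w :: verts s) i.
have ei : injective e.
  move=> i j /eqP; rewrite nth_uniq ?sm ?ltn_ord // => /eqP; apply: val_inj.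
have eS (i : 'I_m) : e i \in S by rewrite SE mem_nth // sm.
have Se u : u \in S -> exists i : 'I_m, u = e i.
  rewrite SE => us'; have lt : (index u (w :: verts s) < m)%N by rewrite -sm index_mem.
  by exists (Ordinal lt); rewrite /e /= nth_index.
exists m, (fun i j : 'I_m => chain w s (e i) (e j)), (fun i j : 'I_m => f (e i) (e j)); split => //.
- by move=> i j; rewrite /e chain_nth //; rewrite -ltnS; apply: ltn_ord.
- apply: (reach_mutation_equiv ei _ hs fa) => u; rewrite !inE => /andP[_]; exact: Se.
have idx_lt (u : {v : V | v \in S}) : (index (val u) (w :: verts s) < m)%N.
  by rewrite -sm index_mem -SE (valP u).
exists (fun u : {v : V | v \in S} => Ordinal (idx_lt u) : Quiver (fun i j : 'I_m => f (e i) (e j))).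
  exists (fun i : 'I_m => exist _ (e i) (eS i)).
    by move=> u; apply: val_inj; rewrite /= /e /= nth_index // -SE (valP u).
  by move=> i; apply: val_inj; apply: index_uniq => //; rewrite sm.
move=> i j /=; rewrite /e /= !nth_index -?SE ?(valP i) ?(valP j) //.
by rewrite qf //; [apply: (valP i)|apply: (valP j)].
Qed.

End Glue.

(** * Arrows between non-crossing edges *)

Section Facts.
Variable n : nat.
Local Notation edge := (tedge n).
Implicit Types (a b c : 'I_n) (M N X Y w : edge).

(** This relation and [rot_rel], [compat_rel] below restate offsets, degrees and compatibility for
    bare numbers. After generalization over the edges each later case analysis is a problem of
    linear arithmetic. *)
Definition off_rel (o o' : nat) : Prop :=
  (o < n /\ o' < n /\ ((o = 0 /\ o' = 0) \/ (0 < o /\ o + o' = n)))%N.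

Lemma off_relP a b : off_rel (off a b) (off b a).
Proof.
split; [exact: off_lt|split; first exact: off_lt]; rewrite [off b a]off_sym; have := off_lt a b.
by case: eqP => o0 lt; [left|right]; split; lia.
Qed.

Lemma off_tri a b c : (off a b + off b c = off a c \/ off a b + off b c = off a c + n)%N.
Proof.
rewrite (off_triangle a b c); have := off_lt a b; have := off_lt b c.
by move=> h1 h2; case: ltnP => h; [left|right; lia].
Qed.

Hypothesis hn : (4 <= n)%N.

Definition rot_rel (l m o r : nat) (t : bool) : Prop :=
  ((l = n.+1 /\ m = n.+1 /\ ((t = true /\ o <= n - 2 /\ r = o + o) \/
                             ((t = false \/ n - 2 < o) /\ r = 0)))
   \/ ((l <= n \/ m <= n) /\ ((o = 0 /\ r = m - l) \/ (0 < o /\ ((o + m = l /\ r = l - m) \/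
       (o + m <> l /\ ((o + m = n + 1 /\ r = n + n + 2 - l - m) \/ (o + m <> n + 1 /\ r = 0))))))))%N.

Lemma elen_bounds M : (degenerate M /\ elen M = n.+1) \/ (degenerate M = false /\ 3 <= elen M <= n)%N.
Proof.
case dM: (degenerate M); [left|right; split => //; exact: elen_arc].
by split => //; apply: elen_deg.
Qed.

Lemma rotF M N : rot_rel (elen M) (elen N) (off (start M) (start N)) (rot M N) (tag M == tag N).
Proof.
rewrite /rot_rel /rot.
have [[dM lM]|[dM lM]] := elen_bounds M; have [[dN lN]|[dN lN]] := elen_bounds N;
rewrite dM dN /=.
- left; do 2!split => //; case: (tag M == tag N) => /=; last by right; split => //; left.
  by case: leqP => h; [left; do 2!split => //; lia|right; split => //; right].
all: right; split; first by lia.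
all: case: eqP => [->|o0]; first by [left].
all: right; split; first by lia.
all: case: eqP => [h|h]; first by left.
all: right; split => //; case: eqP => [h'|h']; [left|right]; split => //; lia.
Qed.

Definition compat_rel (l m o o' : nat) (t : bool) : Prop :=
  ((l = n.+1 /\ m = n.+1 /\ (o = 0 \/ t = true)) \/
   (l <= n /\ m = n.+1 /\ (o = 0 \/ l <= o + 1)) \/
   (l = n.+1 /\ m <= n /\ (o' = 0 \/ m <= o' + 1)) \/
   (l <= n /\ m <= n /\ (o + m <= l \/ o' + l <= m \/ (l <= o + 1 /\ o + m <= n + 1))))%N.

Lemma compatF M N : compat M N <->
  compat_rel (elen M) (elen N) (off (start M) (start N)) (off (start N) (start M)) (tag M == tag N).
Proof.
rewrite /compat_rel /compat; move: (tag M == tag N) => t.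
have [[dM lM]|[dM lM]] := elen_bounds M; have [[dN lN]|[dN lN]] := elen_bounds N;
rewrite dM dN /=; move: lM lN; clear -hn;
move: (elen M) (elen N) (off _ _) (off _ _) => l m o o' lM lN; case: t; split; lia.
Qed.

Lemma edge_eqP M N : off (start M) (start N) = 0%N -> elen M = elen N -> tag M = tag N -> M = N.
Proof. by move=> /eqP; rewrite off_eq0 => /eqP; apply: edge_inj. Qed.

Lemma arc_eqP M N : degenerate M = false -> off (start M) (start N) = 0%N -> elen M = elen N -> M = N.
Proof.
move=> dM o l; apply: edge_eqP => //.
have dN : degenerate N = false by rewrite degenerateE -l -degenerateE.
by move: dM dN; clear; case: M; case: N.
Qed.

End Facts.

Section Arrows.
Variable n : nat.
Hypothesis hn : (4 <= n)%N.
Local Notation edge := (tedge n).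
Implicit Types (a b c : 'I_n) (M N X Y w : edge).
Local Notation offe M N := (off (start M) (start N)).

Lemma arrowbP (D : {set edge}) M N : arrowb D M N <-> (0 < rot M N)%N /\
  {in D, forall X, (0 < rot M X)%N -> (0 < rot X N)%N -> rot M N <> (rot M X + rot X N)%N}.
Proof.
rewrite /arrowb; split=> [/andP[-> /existsPn h]|[-> h]].
  split=> // X XD m1 m2 e; have := h X; rewrite XD m1 m2 e eqxx //.
by apply/existsPn => X; apply/negP => /and4P[XD m1 m2 /eqP]; apply: h.
Qed.

Lemma no_arrow (D : {set edge}) M N X : X \in D -> rot M N = 0%N \/
  [/\ 0 < rot M X, 0 < rot X N & rot M N = rot M X + rot X N]%N -> arrowb D M N = false.
Proof.
move=> XD h; apply/negP => /arrowbP[r0 /(_ X XD) hX].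
by case: h => [r|[r1 r2 r]]; [move: r0; rewrite r|apply: hX].
Qed.

Lemma rot0_no_arrow (D : {set edge}) M N : rot M N = 0%N -> arrowb D M N = false.
Proof. by move=> r; apply/negP => /arrowbP[]; rewrite r. Qed.

Definition nested X w := ~~ degenerate X && (offe w X + elen X <= elen w)%N.

Lemma nestedP X w : nested X w <-> degenerate X = false /\ (offe w X + elen X <= elen w)%N.
Proof. by rewrite /nested; split=> [/andP[/negbTE]|[-> ]]. Qed.

Lemma elen_ge3 X : (3 <= elen X <= n.+1)%N.
Proof. have [[_ ->]|[_ /andP[-> h]]] := elen_bounds X; [clear -hn; lia|apply: leq_trans h (leqnSn n)]. Qed.

Lemma rot_start M N : (offe M N = 0 -> elen M < elen N -> rot M N = elen N - elen M)%N.
Proof.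
move=> o l; have := rotF hn M N; have := elen_ge3 N; rewrite /rot_rel o; move: l; clear.
move: (elen M) (elen N) (rot M N) => a b r; lia.
Qed.

Lemma rot_end M N : (0 < offe M N -> offe M N + elen N = elen M -> rot M N = elen M - elen N)%N.
Proof.
move=> o l; have := rotF hn M N; have := elen_ge3 M; rewrite /rot_rel; move: o l; clear.
move: (elen M) (elen N) (rot M N) (offe M N) => a b r o; lia.
Qed.

Lemma rot_turn M N : (0 < offe M N -> offe M N + elen N = n.+1 -> elen M <= n ->
  rot M N = n + n + 2 - elen M - elen N)%N.
Proof.
move=> o l h; have := rotF hn M N; have := elen_ge3 M; rewrite /rot_rel; move: o l h; clear.
move: (elen M) (elen N) (rot M N) (offe M N) => a b r o; lia.
Qed.

(** The possible positions of an edge that is compatible with [w] and not under it: degenerate, an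
    arc over [w], or an arc beside [w]. *)
Definition outside (w Y : edge) : Prop :=
  ((elen Y = n.+1 /\ (offe w Y = 0 \/ elen w <= offe w Y + 1)) \/
   (elen Y <= n /\ ((offe Y w + elen w <= elen Y /\ (0 < offe w Y \/ elen w < elen Y)) \/
     (elen w <= offe w Y + 1 /\ offe w Y + elen Y <= n + 1))))%N.

Lemma outsideP w Y : degenerate w = false -> ~ nested Y w -> compat w Y -> outside w Y.
Proof.
move=> dw nY /(compatF hn); have lw := elen_arc dw.
have {}nY : (elen Y = n.+1 \/ elen Y <= n /\ elen w < offe w Y + elen Y)%N.
  have [[dY lY]|[dY lY]] := elen_bounds Y; [by left|right; split; first by case/andP: lY].
  by rewrite ltnNge; apply/negP => h; apply: nY; apply/nestedP.
have [_ [_]] := off_relP (start w) (start Y).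
move: lw nY; rewrite /outside /compat_rel; clear.
move: (elen w) (elen Y) (offe w Y) (offe Y w) => a b c d; lia.
Qed.

Section Isolated.
Variables w X Y : edge.
Hypotheses (dw : degenerate w = false) (nX : nested X w) (Xw : X <> w) (nY : ~ nested Y w)
  (cwY : compat w Y).

Let o1 := off_relP (start w) (start X).
Let o2 := off_relP (start w) (start Y).
Let o3 := off_relP (start X) (start Y).
Let t := off_tri (start w) (start X) (start Y).
Let out := outsideP dw nY cwY.
Let lw := elen_arc dw.
Let lX := elen_arc (proj1 (proj1 (nestedP X w) nX)).
Let nX2 := (proj2 (proj1 (nestedP X w) nX)).
Let X_w : (offe w X <> 0 \/ elen X < elen w)%N.
Proof.
have [o|o] := eqVneq (offe w X) 0%N; last by left; apply/eqP.
right; rewrite ltn_neqAle; have := nX2; rewrite o add0n => ->; rewrite andbT.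
by apply/eqP => l; apply: Xw; apply/esym/arc_eqP.
Qed.

Ltac facts := have := o1; have := o2; have := o3; have := t; have := out; have := lw; have := lX;
  have := nX2; have := X_w; rewrite /off_rel /outside;
  generalize (elen X) (elen Y) (elen w) (offe w X) (offe X w) (offe w Y) (offe Y w) (offe X Y) (offe Y X);
  clear; intros; lia.

(** Leaving the region under [w] means first to grow to [w], keeping the start. In degrees this is a
    factorization through [w], so that [w] alone can have arrows to the outside. *)
Lemma isolated_out :
  rot X Y = 0%N \/ [/\ 0 < rot X w, 0 < rot w Y & rot X Y = rot X w + rot w Y]%N.
Proof.
case: (posnP (rot X Y)) => [->|/(rotP hn)[dX _ _ _ _|_ o l ->|dY o l _|_ dY o l ->]];
  first by left.
- by have [] := proj1 (nestedP X w) nX; rewrite dX.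
- right; have [h1 h2 h3 h4] : [/\ offe X w = 0, offe w Y = 0, elen X < elen w & elen w < elen Y]%N.
    by split; move: o l; facts.
  rewrite (rot_start h1 h3) (rot_start h2 h4).
  by move: l h3 h4; clear; move: (elen X) (elen Y) (elen w) => u v z; split; lia.
- have lY := elen_arc dY; case: nY; apply/nestedP; split=> //; move: o l lY; facts.
- have lY := elen_arc dY.
  right; have [h1 h3] : (offe X w = 0 /\ elen X < elen w)%N by split; move: o l; facts.
  have [h2 h4] : (0 < offe w Y /\ offe w Y + elen Y = n.+1)%N by split; move: o l; facts.
  have h5 : (elen w <= n)%N by case/andP: lw.
  rewrite (rot_start h1 h3) (rot_turn h2 h4 h5).
  move: o l lX lY lw h2 h4 h3; clear; move: (elen X) (elen Y) (elen w) (offe X Y) (offe w Y) => u v z o o'.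
  by split; lia.
Qed.

(** Dually, entering the region under [w] means shrinking from [w] with the end kept. *)
Lemma isolated_in :
  rot Y X = 0%N \/ [/\ 0 < rot Y w, 0 < rot w X & rot Y X = rot Y w + rot w X]%N.
Proof.
have dX : degenerate X = false by have [] := proj1 (nestedP X w) nX.
have lY := elen_ge3 Y.
case: (posnP (rot Y X)) => [->|/(rotP hn)[_|dY o l ->|_ o l ->|dY _ o l ->]]; first by left.
- by rewrite dX.
- by exfalso; move: o l lY; facts.
- right; have [h1 h2] : (0 < offe Y w /\ offe Y w + elen w = elen Y)%N by split; move: o l lY; facts.
  have [h3 h4] : (0 < offe w X /\ offe w X + elen X = elen w)%N by split; move: o l lY; facts.
  rewrite (rot_end h1 h2) (rot_end h3 h4).
  move: h1 h2 h3 h4; clear; move: (elen X) (elen Y) (elen w) (offe Y w) (offe w X) => u v z o o'.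
  by split; lia.
have {}lY := elen_arc dY.
right; have [h1 h2] : (0 < offe Y w /\ offe Y w + elen w = n.+1)%N by split; move: o l lY; facts.
have [h3 h4] : (0 < offe w X /\ offe w X + elen X = elen w)%N by split; move: o l lY; facts.
have h5 : (elen Y <= n)%N by case/andP: lY.
rewrite (rot_turn h1 h2 h5) (rot_end h3 h4).
move: o l lX lY lw h1 h2 h3 h4; clear; move: (elen X) (elen Y) (elen w) (offe Y X) (offe Y w) (offe w X) => u v z o o' o''.
by split; lia.
Qed.

End Isolated.

(** [nested] under a base that need not be an edge. For [L = n] the region is the whole polygon cut
    open at [a]. *)
Definition inside a L X := ~~ degenerate X && (off a (start X) + elen X <= L.+1)%N.

Lemma nested_inside X w : nested X w = inside (start w) (elen w).-1 X.
Proof. by rewrite /inside /nested; have /andP[h _] := elen_ge3 w; rewrite prednK //; lia. Qed.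

Lemma ex_at a m l : (m < n)%N -> (3 <= l <= n)%N ->
  exists X, [/\ degenerate X = false, off a (start X) = m & elen X = l].
Proof.
move=> mn ln; have [x xE] : exists x, off a x = m.
  have [->|m0] := eqVneq m 0%N; first by exists a; rewrite offxx.
  have [|x xE] := @ex_off n hn a (n - m); first by clear -m0 mn; lia.
  by exists x; rewrite off_sym xE; clear -m0 mn; case: eqP; lia.
have [|X [sX lX _]] := @ex_edge n hn x l true; first by clear -ln; lia.
exists X; split => //; last by rewrite sX.
by rewrite degenerateE lX; apply/negP => /eqP; clear -ln; lia.
Qed.

End Arrows.

(** * The triangle on the inner side of an arc *)

Section Triangles.
Variable n : nat.
Hypothesis hn : (4 <= n)%N.
Local Notation edge := (tedge n).
Implicit Types (a b c : 'I_n) (M N X Y w : edge).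
Local Notation offe M N := (off (start M) (start N)).
Variable D : {set edge}.
Hypothesis hD : {in D &, forall M N, compat M N}.
Hypothesis hmax : forall M, {in D, forall N, compat M N} -> M \in D.

Lemma insideP a L X : inside a L X <-> degenerate X = false /\ (off a (start X) + elen X <= L.+1)%N.
Proof. by rewrite /inside; split=> [/andP[/negbTE]|[-> ]]. Qed.

(* The third vertex m of the triangle of the triangulation that lies on the inner side of the
   arc from a of length L + 1; here m and L count the steps from a. *)
Definition third_vertex a L m :=
  [/\ (0 < m < L)%N,
      m = 1%N \/ exists2 c1, c1 \in D & [/\ degenerate c1 = false, start c1 = a & elen c1 = m.+1],
      m.+1 = L \/ exists2 c2, c2 \in D &
        [/\ degenerate c2 = false, off a (start c2) = m & elen c2 = (L - m).+1]
    & {in D, forall X, inside a L X -> [\/ off a (start X) = 0%N /\ elen X = L.+1,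
         (off a (start X) + elen X <= m.+1)%N | (m <= off a (start X))%N]}].

(** Let [m] be the farthest vertex that a side from [a], shorter than the base, reaches. An inner
    edge that starts at [a] ends by [m] or is the base, and one that starts between [a] and [m]
    cannot cross the side. So the arc from [m] to the far end of the base is compatible with all of
    [D], hence in [D]. *)
Lemma ex_third_vertex a L : (2 <= L <= n)%N ->
  {in D, forall X, inside a L X \/ forall Y, inside a L Y -> compat X Y} ->
  exists m, third_vertex a L m.
Proof.
move=> /andP[L2 Ln] hW.
(* The case [m == 1] stands for a side that is a boundary step and not a tagged edge. *)
pose P m := (m < L)%N && ((m == 1%N) ||
  [exists X in D, [&& ~~ degenerate X, start X == a & elen X == m.+1]]).
have P1 : P 1%N by rewrite /P L2.
have [|m Pm mmax] := ex_maxnP (ex_intro _ 1%N P1) (m := L).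
  by move=> i /andP[/ltnW].
have m0 : (0 < m)%N by apply: mmax.
have mL : (m < L)%N by case/andP: Pm.
have c1P : m = 1%N \/ exists2 c1, c1 \in D & [/\ degenerate c1 = false, start c1 = a & elen c1 = m.+1].
  case/andP: Pm => _ /orP[/eqP|/existsP[X /and4P[XD /negbTE dX /eqP sX /eqP lX]]]; first by left.
  by right; exists X.
have tri : {in D, forall X, inside a L X -> [\/ off a (start X) = 0%N /\ elen X = L.+1,
         (off a (start X) + elen X <= m.+1)%N | (m <= off a (start X))%N]}.
  move=> X XD /insideP[dX iX]; have lX := elen_arc dX.
  have [o|o] := eqVneq (off a (start X)) 0%N.
    have [l|l] := eqVneq (elen X) L.+1; first by constructor 1.
    constructor 2; rewrite o add0n; have h : P (elen X).-1.
      rewrite /P; apply/andP; split; first by move: iX lX l; rewrite o; clear; move: (elen X); lia.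
      apply/orP; right; apply/existsP; exists X; rewrite XD dX /=.
      move/eqP: o; rewrite off_eq0 eq_sym => -> /=.
      by rewrite prednK //; case/andP: lX; clear; lia.
    by have := mmax _ h; move: lX; clear; lia.
  have [h|h] := leqP m (off a (start X)); first by constructor 3.
  constructor 2; case: c1P => [m1|[c1 c1D [d1 s1 l1]]]; first by move: h o; rewrite m1; clear; lia.
  have /(compatF hn) := hD XD c1D; have := off_relP a (start X); rewrite s1 l1 /off_rel /compat_rel.
  move: iX lX o h mL Ln; clear; move: (elen X) (off a (start X)) (off (start X) a) => u v z; lia.
exists m; split => //; first by rewrite m0.
have [->|Lm] := eqVneq m.+1 L; [by left|right].
have [||c2 [d2 s2 l2]] := @ex_at n hn a m (L - m).+1.
- by apply: leq_trans mL Ln.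
- by move: Lm m0 mL Ln; clear; lia.
exists c2 => //; apply: hmax => X XD; rewrite compat_sym.
have i2 : inside a L c2 by apply/insideP; split=> //; rewrite s2 l2; move: mL; clear; lia.
case: (hW X XD) => [iX|]; last by apply.
have := tri X XD iX; case/insideP: iX => dX iX tX.
apply/(compatF hn); have lX := elen_arc dX.
have o1 := off_relP a (start X); have o2 := off_relP a (start c2).
have o3 := off_relP (start X) (start c2); have t := off_tri a (start X) (start c2).
have {}tX : ((off a (start X) = 0 /\ elen X = L.+1) \/ (off a (start X) + elen X <= m.+1) \/
   (m <= off a (start X)))%N by case: tX; auto.
move: o1 o2 o3 t lX iX tX mL m0 Lm Ln; rewrite s2 l2 /off_rel /compat_rel; clear.
move: (elen X) (off a (start X)) (off (start X) a) (off (start c2) a) (offe X c2) (offe c2 X) (tag X == tag c2).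
clear; intros; lia.
Qed.

Lemma arc_region w : w \in D -> degenerate w = false ->
  {in D, forall X, inside (start w) (elen w).-1 X \/
    forall Y, inside (start w) (elen w).-1 Y -> compat X Y}.
Proof.
move=> wD dw X XD; rewrite -(nested_inside hn); have [nX|nX] := boolP (nested X w); [by left|right].
move=> Y; rewrite -(nested_inside hn) => /nestedP[dY nY].
have out := outsideP hn dw (fun h => negP nX h) (hD wD XD).
apply/(compatF hn); move: out (off_relP (start w) (start X)) (off_relP (start w) (start Y)).
move: (off_relP (start X) (start Y)) (off_tri (start w) (start X) (start Y)).
move: (elen_arc dw) (elen_arc dY) nY (elen_ge3 hn X); rewrite /off_rel /outside /compat_rel; clear.
move: (elen X) (elen Y) (elen w) (offe w X) (offe X w) (offe w Y) (offe Y w) (offe X Y) (offe Y X) (tag X == tag Y).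
clear; intros; lia.
Qed.

End Triangles.

Section Split.
Variable V : finType.
Variable q : V -> V -> nat.
Implicit Types (S : {set V}) (x y w : V).
Local Notation "f +q g" := (qadd f g) (at level 50, left associativity).

Definition restr S i j := if (i \in S) && (j \in S) then q i j else 0%N.

(** [x] is the only vertex through which [S] is connected with the rest. *)
Definition isolated S x := forall u v, u \in S -> u != x -> v \notin S -> q u v = 0%N /\ q v u = 0%N.

Lemma restr_glue1 (b : bool) S x w : x \in S -> w \notin S -> q w w = 0%N -> isolated S x ->
  q w x = b :> nat -> q x w = ~~ b :> nat -> restr (w |: S) = edge_arr b w x +q restr S.
Proof.
move=> xS wS qw iso qwx qxw; have wx : w != x by apply: contraNneq wS => ->.
have k u : u \in S -> u != x -> q u w = 0%N /\ q w u = 0%N by move=> uS ux; apply: iso.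
have n u : u \in S -> (u == w) = false by move=> uS; apply/eqP => e; rewrite e (negbTE wS) in uS.
apply: qext => i j; rewrite /qadd.
have [/andP[iS jS]|h1] := boolP ((i \in S) && (j \in S)).
  rewrite /restr !inE iS jS !orbT /=.
  by rewrite /edge_arr /arr; case: (b); rewrite ?(n _ iS) ?(n _ jS) ?andbF.
rewrite /restr (negbTE h1) addn0 !inE.
have [/andP[/eqP -> /eqP ->]|T1] := boolP ((i == w) && (j == x)).
  by rewrite eqxx xS orbT /= qwx /edge_arr /arr; case: (b); rewrite ?eqxx // (negbTE wx).
have [/andP[/eqP -> /eqP ->]|T2] := boolP ((i == x) && (j == w)).
  by rewrite eqxx xS orbT /= qxw /edge_arr /arr; case: (b); rewrite ?eqxx // eq_sym (negbTE wx).
have -> : edge_arr b w x i j = 0%N.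
  by rewrite /edge_arr /arr; case: (b); [rewrite (negbTE T1)|rewrite (negbTE T2)].
case: ifP => // /andP[/orP[/eqP iw|iS] /orP[/eqP jw|jS]].
- by rewrite iw jw.
- rewrite iw; have [e|jx] := eqVneq j x; last exact: proj2 (k _ jS jx).
  by rewrite iw e !eqxx in T1.
- rewrite jw; have [e|ix] := eqVneq i x; last exact: proj1 (k _ iS ix).
  by rewrite jw e !eqxx in T2.
by rewrite iS jS in h1.
Qed.

Lemma restr_glue2 S1 S2 x y w : x \in S1 -> y \in S2 -> w \notin S1 -> w \notin S2 ->
  [disjoint S1 & S2] -> q w w = 0%N -> isolated S1 x -> isolated S2 y ->
  q w x = 1%N -> q x w = 0%N -> q x y = 1%N -> q y x = 0%N -> q y w = 1%N -> q w y = 0%N ->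
  restr (w |: (S1 :|: S2)) = triangle w x y +q (restr S1 +q restr S2).
Proof.
move=> xS1 yS2 wS1 wS2 dis qw iso1 iso2 qwx qxw qxy qyx qyw qwy.
have wx : w != x by apply: contraNneq wS1 => ->.
have wy : w != y by apply: contraNneq wS2 => ->.
have d12 u : u \in S1 -> u \in S2 = false by move=> uS; rewrite (disjointFr dis).
have d21 u : u \in S2 -> u \in S1 = false by move=> uS; rewrite (disjointFl dis).
have xy : x != y by apply/eqP => e; have := d12 _ xS1; rewrite e yS2.
have k1 u : u \in S1 -> u != x -> q u w = 0%N /\ q w u = 0%N by move=> uS ux; apply: iso1.
have k2 u : u \in S2 -> u != y -> q u w = 0%N /\ q w u = 0%N by move=> uS ux; apply: iso2.
have k3 u v : u \in S1 -> v \in S2 -> (u == x) && (v == y) = false -> q u v = 0%N /\ q v u = 0%N.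
  move=> uS vS; have [->|ux] := eqVneq u x; last by move=> _; apply: iso1; rewrite ?(d21 _ vS).
  by move=> /negbT vy; have [-> ->] := iso2 v x vS vy (negbT (d12 _ xS1)).
have n1 u : u \in S1 -> (u == w = false) * (u == y = false).
  by move=> uS; split; apply/eqP => e; rewrite e ?(negbTE wS1) ?(d21 _ yS2) in uS.
have n2 u : u \in S2 -> (u == w = false) * (u == x = false).
  by move=> uS; split; apply/eqP => e; rewrite e ?(negbTE wS2) ?(d12 _ xS1) in uS.
apply: qext => i j; rewrite /qadd.
have [/andP[iS jS]|h1] := boolP ((i \in S1) && (j \in S1)).
  rewrite /restr !inE iS jS (d12 _ iS) /= !orbT /= addn0.
  by rewrite /triangle /qadd /arr !(n1 _ iS) !(n1 _ jS) !andbF.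
have [/andP[iS jS]|h2] := boolP ((i \in S2) && (j \in S2)).
  rewrite /restr !inE iS jS (d21 _ iS) /= !orbT /=.
  by rewrite /triangle /qadd /arr !(n2 _ iS) !(n2 _ jS) !andbF.
rewrite /restr (negbTE h1) (negbTE h2) !addn0 !inE.
have [T|T] := boolP [|| (i == w) && (j == x), (i == x) && (j == y) | (i == y) && (j == w)].
  have N : (w == x = false) * (w == y = false) * (x == y = false).
    by rewrite (negbTE wx) (negbTE wy) (negbTE xy).
  have N' : (x == w = false) * (y == w = false) * (y == x = false) by rewrite (eq_sym x w) (eq_sym y w) (eq_sym y x) !N.
  by case/or3P: T => /andP[/eqP -> /eqP ->]; rewrite ?eqxx ?xS1 ?yS2 ?orbT /= ?(qwx, qxy, qyw);
    rewrite /triangle /qadd /arr !eqxx ?(N, N') /= ?(N, N').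
have -> : triangle w x y i j = 0%N.
  by move: T; rewrite /triangle /qadd /arr; do 3!case: (_ && _).
case: ifP => // /andP[/or3P[/eqP iw|iS|iS] /or3P[/eqP jw|jS|jS]].
- by rewrite iw jw.
- rewrite iw; have [e|jx] := eqVneq j x; last exact: proj2 (k1 _ jS jx).
  by rewrite iw e !eqxx in T.
- rewrite iw; have [e|jy] := eqVneq j y; last exact: proj2 (k2 _ jS jy).
  by rewrite e qwy.
- rewrite jw; have [e|ix] := eqVneq i x; last exact: proj1 (k1 _ iS ix).
  by rewrite e qxw.
- by rewrite iS jS in h1.
- apply: (proj1 (k3 _ _ iS jS _)); apply/negbTE; apply: contraNN T => ->; by rewrite orbT.
- rewrite jw; have [e|iy] := eqVneq i y; last exact: proj1 (k2 _ iS iy).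
  by rewrite jw e !eqxx !orbT in T.
- have [e|e] := boolP ((j == x) && (i == y)); last exact: (proj2 (k3 _ _ jS iS (negbTE e))).
  by case/andP: e => /eqP -> /eqP ->; rewrite qyx.
by rewrite iS jS in h2.
Qed.

End Split.

(** * Criteria for arrows *)

Section IrreducibleArrows.
Variable n : nat.
Hypothesis hn : (4 <= n)%N.
Local Notation edge := (tedge n).
Implicit Types (a b c : 'I_n) (M N X Y w : edge).
Local Notation offe M N := (off (start M) (start N)).
Variable D : {set edge}.

Ltac abstract_lia M X N :=
  move: (off_relP (start M) (start X)) (off_relP (start X) (start N)) (off_relP (start M) (start N))
    (off_tri (start M) (start X) (start N)) (elen_ge3 hn M) (elen_ge3 hn X) (elen_ge3 hn N);
  rewrite ?degenerateE; rewrite /off_rel;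
  generalize (elen M) (elen X) (elen N) (offe M X) (offe X M) (offe X N) (offe N X) (offe M N) (offe N M);
  clear; intros; lia.

(** Of the edges that could divide a lengthening, only those with the same start and a length in
    between have degrees that add up; all other kinds contradict the arithmetic of [rot]. *)
Lemma start_arrow M N : offe M N = 0%N -> (elen M < elen N)%N ->
  {in D, forall X, offe M X = 0%N -> ~ (elen M < elen X < elen N)%N} -> arrowb D M N.
Proof.
move=> o l h; have r := rot_start hn o l; apply/arrowbP; rewrite r subn_gt0; split=> // X XD.
have lM : (elen M <= n)%N by have := elen_ge3 hn N; move: l; clear; move: (elen M) (elen N); lia.
case/(rotP hn) => [dM _ _ _ _|_ o1 l1 ->|dX o1 l1 ->|dM dX o1 l1 ->].
- by move: dM; rewrite degenerateE => /eqP e; move: lM; rewrite e ltnn.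
- case/(rotP hn) => [dX dN _ o2 ->|_ o2 l2 ->|dN o2 l2 ->|dX dN o2 l2 ->] e.
  + by move: (elen_deg dX) (elen_deg dN) o2 e o1 l1 o l; abstract_lia M X N.
  + by apply: (h X XD o1); rewrite l1 l2.
  + by move: o1 l1 o l o2 l2 e; abstract_lia M X N.
  + by move: o1 l1 o l o2 l2 e; abstract_lia M X N.
- case/(rotP hn) => [dX' _ _ _ _|_ o2 l2 ->|dN o2 l2 ->|_ dN o2 l2 ->] e.
  + by rewrite dX' in dX.
  + by move: o1 l1 o l o2 l2 e lM; abstract_lia M X N.
  + by move: o1 l1 o l o2 l2 e lM; abstract_lia M X N.
  + by move: o1 l1 o l o2 l2 e lM; abstract_lia M X N.
case/(rotP hn) => [dX' _ _ _ _|_ o2 l2 ->|dN o2 l2 ->|_ dN o2 l2 ->] e.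
- by rewrite dX' in dX.
- by move: o1 l1 o l o2 l2 e lM (elen_arc dX); abstract_lia M X N.
- by move: o1 l1 o l o2 l2 e lM (elen_arc dX); abstract_lia M X N.
by move: o1 l1 o l o2 l2 e lM (elen_arc dX); abstract_lia M X N.
Qed.

Lemma end_arrow M N : (0 < offe M N)%N -> (offe M N + elen N = elen M)%N ->
  {in D, forall X, (0 < offe M X)%N -> (offe M X + elen X = elen M)%N -> ~ (elen N < elen X)%N} ->
  arrowb D M N.
Proof.
move=> o l h; have r := rot_end hn o l; apply/arrowbP; rewrite r subn_gt0; split; first by lia.
move=> X XD.
have lN : (elen N <= n)%N by have := elen_ge3 hn M; move: l o; clear; move: (elen M) (elen N) (offe M N); lia.
case/(rotP hn) => [dM dX _ o1 ->|dM o1 l1 ->|dX o1 l1 ->|dM dX o1 l1 ->].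
- case/(rotP hn) => [_ dN _ o2 ->|dX' o2 l2 ->|dN o2 l2 ->|dX' dN o2 l2 ->] e.
  + by move: lN; rewrite (elen_deg dN) ltnn.
  + by rewrite dX in dX'.
  + by move: (elen_deg dX) (elen_deg dM) o1 l o l2 e; abstract_lia M X N.
  + by rewrite dX in dX'.
- have lM := elen_arc dM.
  case/(rotP hn) => [dX dN _ o2 ->|dX o2 l2 ->|dN o2 l2 ->|dX dN o2 l2 ->] e.
  + by move: lN; rewrite (elen_deg dN) ltnn.
  + by move: o1 l1 o l o2 l2 e lM; abstract_lia M X N.
  + by move: o1 l1 o l o2 l2 e lM; abstract_lia M X N.
  + by move: o1 l1 o l o2 l2 e lM; abstract_lia M X N.
- case/(rotP hn) => [dX' _ _ _ _|_ o2 l2 ->|dN o2 l2 ->|_ dN o2 l2 ->] e.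
  + by rewrite dX' in dX.
  + by move: o1 l1 o l o2 l2 e; abstract_lia M X N.
  + apply: (h X XD o1 l1); move: o1 l1 o l o2 l2 e; abstract_lia M X N.
  + by move: o1 l1 o l o2 l2 e (elen_arc dX); abstract_lia M X N.
have lM := elen_arc dM.
case/(rotP hn) => [dX' _ _ _ _|_ o2 l2 ->|dN o2 l2 ->|_ dN o2 l2 ->] e.
- by rewrite dX' in dX.
- by move: o1 l1 o l o2 l2 e lM (elen_arc dX); abstract_lia M X N.
- by move: o1 l1 o l o2 l2 e lM (elen_arc dX); abstract_lia M X N.
by move: o1 l1 o l o2 l2 e lM (elen_arc dX); abstract_lia M X N.
Qed.

(** The degrees add up only over a longer edge with the start of [M] or a longer edge with the end
    of [N]; degenerate edges are included in both, and the two hypotheses on [D] exclude them. *)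
Lemma turn_arrow M N : (0 < offe M N)%N -> (offe M N + elen N = n.+1)%N -> (elen M <= n)%N ->
  compat M N ->
  {in D, forall X, offe M X = 0%N -> ~ (elen M < elen X)%N} ->
  {in D, forall X, (0 < offe X N)%N -> (offe X N + elen N = elen X)%N -> False} ->
  arrowb D M N.
Proof.
move=> o l lM /(compatF hn) c h1 h2; have r := rot_turn hn o l lM; apply/arrowbP; rewrite r; split.
  by move: o l lM; clear; move: (elen M) (elen N) (offe M N); lia.
move=> X XD.
have lN : (elen N <= n)%N by move: l o; clear; move: (elen N) (offe M N); lia.
case/(rotP hn) => [dM _ _ _ _|dM o1 l1 ->|dX o1 l1 ->|dM dX o1 l1 ->].
- by move: lM; rewrite (elen_deg dM) ltnn.
- by have := h1 X XD o1.
- case/(rotP hn) => [dX' _ _ _ _|_ o2 l2 ->|dN o2 l2 ->|_ dN o2 l2 ->] e.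
  + by rewrite dX' in dX.
  + move: o1 l1 o l o2 l2 e lM lN c; rewrite /compat_rel; move: (tag M == tag N) => tg; abstract_lia M X N.
  + exact: (h2 X XD o2 l2).
  + by move: o1 l1 o l o2 l2 e lM lN; abstract_lia M X N.
case/(rotP hn) => [dX' _ _ _ _|_ o2 l2 ->|dN o2 l2 ->|_ dN o2 l2 ->] e.
- by rewrite dX' in dX.
- by move: o1 l1 o l o2 l2 e lM lN (elen_arc dX); abstract_lia M X N.
- exact: (h2 X XD o2 l2).
by move: o1 l1 o l o2 l2 e lM lN (elen_arc dX); abstract_lia M X N.
Qed.

End IrreducibleArrows.

(** * The part of the triangulation under an arc is of type A *)

Section Pieces.
Variable n : nat.
Hypothesis hn : (4 <= n)%N.
Local Notation edge := (tedge n).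
Implicit Types (a b c : 'I_n) (M N X Y : edge).
Local Notation offe M N := (off (start M) (start N)).
Variable D : {set edge}.
Hypothesis hD : {in D &, forall M N, compat M N}.
Hypothesis hmax : forall M, {in D, forall N, compat M N} -> M \in D.
Local Notation V := (elements D).
Implicit Types (u v w x y : V).

(** The arguments are exchanged as in [quiver_of_Delta]: an arrow of the quiver runs against the
    morphism. *)
Definition arrows (u v : V) : nat := arrowb D (val v) (val u).

Definition piece w : {set V} := [set u | nested (val u) (val w)].

Lemma elt_compat u v : compat (val u) (val v).
Proof. by apply: hD; apply: valP. Qed.

Lemma piece_root w : degenerate (val w) = false -> w \in piece w.
Proof. by move=> dw; rewrite inE /nested dw offxx add0n leqnn. Qed.

Lemma arrows_loop u : arrows u u = 0%N.
Proof. by rewrite /arrows rot0_no_arrow // rotMM. Qed.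

Lemma piece_isolated w : degenerate (val w) = false -> isolated arrows (piece w) w.
Proof.
move=> dw u v; rewrite !inE => nu uw /negP nv.
have neq : val u <> val w by move=> e; case/eqP: uw; apply: val_inj.
have c := elt_compat w v; rewrite /arrows.
split; rewrite (no_arrow (valP w)) //; [exact: (isolated_in hn dw nu)|exact: (isolated_out hn dw nu)].
Qed.

(** Induction on the length of [w]. The triangle under [w] has sides [c1] and [c2], whose pieces are
    isolated, and the arrows along the triangle form the 3-cycle w, c1, c2. *)
Theorem rooted_arc w : degenerate (val w) = false ->
  rooted (restr arrows (piece w)) (piece w) w.
Proof.
move: {2}(elen _) (leqnn (elen (val w))) => l; elim: l w => [|l IH] w wl dw.
  by have := elen_arc dw; move: wl; rewrite leqn0 => /eqP ->.
have wD := valP w; have /andP[l3 ln] := elen_arc dw.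
set L := (elen (val w)).-1.
have LE : elen (val w) = L.+1 by rewrite /L prednK //; apply: leq_trans l3.
have [|m [/andP[m0 mL] c1P c2P tri]] := ex_third_vertex hn hD hmax (a := start (val w)) (L := L) _
   (arc_region hn hD wD dw).
  by move: LE l3 ln; clear; move: (elen _); lia.
have insE X : inside (start (val w)) L X = nested X (val w) by rewrite (nested_inside hn).
have loop := arrows_loop w.
have out X : X \in D -> ~~ nested X (val w) -> outside (val w) X.
  by move=> XD /negP nX; apply: outsideP => //; apply: hD.
have triN u : u \in piece w -> [\/ u = w, (offe (val w) (val u) + elen (val u) <= m.+1)%N |
    (m <= offe (val w) (val u))%N].
  rewrite inE -insE => iu; have [[o e]|e|e] := tri _ (valP u) iu; [|by constructor 2|by constructor 3].
  constructor 1; apply: val_inj; apply/esym/arc_eqP => //; by rewrite e LE.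
have c1_step : m != 1%N -> exists c1 : V, [/\ degenerate (val c1) = false, rooted (restr arrows (piece c1)) (piece c1) c1,
   forall u, u \in piece c1 = (u \in piece w) && (offe (val w) (val u) + elen (val u) <= m.+1)%N &
   arrows w c1 = 1%N /\ arrows c1 w = 0%N /\ start (val c1) = start (val w) /\ elen (val c1) = m.+1].
  move=> m1; case: c1P => [e|[c c1D [d1 s1 l1]]]; first by rewrite e eqxx in m1.
  pose c1 : V := exist _ c c1D; exists c1.
  have l1L : (elen c <= l)%N by rewrite l1 -ltnS; apply: leq_trans wl; rewrite LE.
  split => //; first exact: IH.
    move=> u; rewrite !inE /nested /= s1 l1; case: (degenerate _) => //=.
    by rewrite LE andb_idl // => h; apply: leq_trans h _; apply: ltnW.
  split; last split => //.
    rewrite /arrows start_arrow //= ?s1 ?offxx ?l1 ?LE // => X XD o.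
    move=> lX; have iX : nested X (val w).
      apply/nestedP; rewrite o LE; split; last by case/andP: lX => _ /ltnW.
      by rewrite degenerateE; apply/eqP => e; move: lX ln LE; rewrite e; clear; lia.
    rewrite -insE in iX; have [[_ e]|e|e] := tri _ XD iX; move: lX; rewrite ?e.
    - by rewrite ltnn andbF.
    - by move: e; rewrite o; clear; move: (elen X); lia.
    by move: e; rewrite o leqn0 => /eqP e; move: m0; rewrite e.
  rewrite /arrows rot0_no_arrow // /rot d1 dw /= s1 offxx eqxx l1 LE; apply/eqP; rewrite subn_eq0.
  exact: ltnW.
have c2_step : m.+1 != L -> exists c2 : V, [/\ degenerate (val c2) = false, rooted (restr arrows (piece c2)) (piece c2) c2,
   forall u, u \in piece c2 = (u \in piece w) && (m <= offe (val w) (val u))%N &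
   arrows w c2 = 0%N /\ arrows c2 w = 1%N /\ offe (val w) (val c2) = m /\ elen (val c2) = (L - m).+1].
  move=> mL1; case: c2P => [e|[c c2D [d2 s2 l2]]]; first by rewrite e eqxx in mL1.
  pose c2 : V := exist _ c c2D; exists c2.
  have l2L : (elen c <= l)%N by rewrite l2 -ltnS; apply: leq_trans wl; rewrite LE; move: m0 mL; clear; lia.
  split => //; first exact: IH.
    move=> u; rewrite !inE /nested /=; case dX: (degenerate _) => //=.
    move: (off_relP (start (val w)) (start c)) (off_relP (start c) (start (val u)))
      (off_relP (start (val w)) (start (val u))) (off_tri (start (val w)) (start c) (start (val u))) (elen_arc dX) ln.
    rewrite s2 l2 LE /off_rel; move: m0 mL; clear.
    move: (elen (val u)) (offe (val w) (val u)) (off (start c) (start (val u))) (off (start c) (start (val w)))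
     (off (start (val u)) (start c)) (offe (val u) (val w)) => p1 p2 p3 p4 p5 p6; clear; intros.
    by apply/idP/andP => [?|[? ?]]; [split|]; lia.
  split; last split => //.
    rewrite /arrows rot0_no_arrow //=; have := rotF hn c (val w).
    move: (off_relP (start (val w)) (start c)); rewrite s2 l2 LE /off_rel /rot_rel; move: ln LE m0 mL; clear.
    by move: (elen _) (rot _ _) (off _ _) (tag c == _); clear; intros; lia.
  rewrite /arrows /= (end_arrow hn) ?s2 //; first by rewrite l2 LE; move: mL; clear; lia.
  move=> X XD o1 o2; rewrite l2; have iX : nested X (val w).
    apply/nestedP; rewrite o2 leqnn; split=> //.
    rewrite degenerateE; apply/eqP => e; have : (n.+1 <= n)%N by rewrite -{1}e; apply: leq_trans ln; rewrite -o2 leq_addl.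
    by rewrite ltnn.
  rewrite -insE in iX; move: o1 o2; rewrite LE.
  have [[e _]|e|e] := tri _ XD iX.
  - by rewrite e.
  - by move: e mL; clear; move: (elen X) (offe (val w) X); lia.
  by move: e mL; clear; move: (elen X) (offe (val w) X); lia.
have wE : w \in piece w := piece_root dw.
have w_in1 (c1 : V) : (forall u, u \in piece c1 = (u \in piece w) && (offe (val w) (val u) + elen (val u) <= m.+1)%N) -> w \notin piece c1.
  by move=> h; rewrite h wE offxx LE /= -ltnNge.
have w_in2 (c2 : V) : (forall u, u \in piece c2 = (u \in piece w) && (m <= offe (val w) (val u))%N) -> w \notin piece c2.
  by move=> h; rewrite h wE offxx /= -ltnNge.
have elen3 u : u \in piece w -> (3 <= elen (val u))%N.
  by rewrite inE => /nestedP[/elen_arc/andP[]].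
(* Each of the two sides may be a boundary step, which leaves a single vertex, a piece prolonged by
   one arrow (twice, with opposite directions), or two pieces on a 3-cycle. *)
have [m1|m1] := eqVneq m 1%N; have [mL1|mL1] := eqVneq m.+1 L.
- have -> : piece w = [set w].
    apply/setP => u; rewrite in_set1; apply/idP/eqP => [uw|->//].
    have := elen3 u uw; have [//|e|e] := triN u uw; move: e; rewrite m1; last first.
      by move: uw; rewrite inE => /nestedP[_]; rewrite LE -mL1 m1; clear; move: (elen _) (offe _ _); lia.
    by clear; move: (elen _) (offe _ _); lia.
  have -> : restr arrows [set w] = fun _ _ => 0%N.
    by apply: qext => i j; rewrite /restr !inE; case: eqP => // ->; case: eqP => // ->.
  exact: rooted0.
- have [c2 [d2 r2 p2 [a1 [a2 [s2 l2]]]]] := c2_step mL1.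
  have -> : piece w = w |: piece c2.
    apply/setP => u; rewrite in_setU1 p2; apply/idP/orP => [uw|[/eqP ->//|/andP[]//]].
    have := elen3 u uw; have [->|e|e] := triN u uw; [by rewrite eqxx; left| |by right; rewrite uw].
    by move: e; rewrite m1; clear; move: (elen _) (offe _ _); lia.
  rewrite (restr_glue1 (b := false) (x := c2)) ?(piece_root d2) ?w_in2 //; last exact: piece_isolated.
  by apply: rooted1 => //; apply: w_in2.
- have [c1 [d1 r1 p1 [a1 [a2 [s1 l1]]]]] := c1_step m1.
  have -> : piece w = w |: piece c1.
    apply/setP => u; rewrite in_setU1 p1; apply/idP/orP => [uw|[/eqP ->//|/andP[]//]].
    have := elen3 u uw; have [->|e|e] := triN u uw; [by rewrite eqxx; left|by right; rewrite uw|].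
    by move: e uw; rewrite inE => e /nestedP[_]; rewrite LE -mL1; move: e; clear; move: (elen _) (offe _ _); lia.
  rewrite (restr_glue1 (b := true) (x := c1)) ?(piece_root d1) ?w_in1 //; last exact: piece_isolated.
  by apply: rooted1 => //; apply: w_in1.
have [c1 [d1 r1 p1 [a1 [a2 [s1 l1]]]]] := c1_step m1.
have [c2 [d2 r2 p2 [b1 [b2 [s2 l2]]]]] := c2_step mL1.
have -> : piece w = w |: (piece c1 :|: piece c2).
  apply/setP => u; rewrite in_setU1 in_setU p1 p2; apply/idP/or3P => [uw|[/eqP ->//|/andP[]//|/andP[]//]].
  rewrite uw; have [->|e|e] := triN u uw; [by rewrite eqxx; constructor 1|by constructor 2|by constructor 3].
have dis : [disjoint piece c1 & piece c2].
  apply/pred0P => u /=; rewrite p1 p2; apply/negP => /andP[/andP[uw h1] /andP[_ h2]].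
  by move: (elen3 u uw) h1 h2; clear; move: (elen _) (offe _ _); lia.
have o12 : offe (val c1) (val c2) = m by rewrite s1.
have o21 : offe (val c2) (val c1) = (n - m)%N.
  by rewrite off_sym o12; case: eqP m0 => // ->.
have lLn : (L < n)%N by rewrite -LE.
have x1 : arrows c1 c2 = 1%N.
  rewrite /arrows (turn_arrow hn) //; first by rewrite o21 subn_gt0; apply: ltn_trans mL lLn.
  - by rewrite o21 l1 addnS subnK // ltnW // (ltn_trans mL lLn).
  - by case/andP: (elen_arc d2).
  - exact: elt_compat.
  - move=> X XD o lX; have o' : offe (val w) X = m.
      by move/eqP: o; rewrite off_eq0 => /eqP <-.
    have [iX|iX] := boolP (nested X (val w)).
      by case/nestedP: iX => _; rewrite o' LE; move: lX mL; rewrite l2; clear; move: (elen X); lia.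
    have := out X XD iX; rewrite /outside o' LE; have := off_relP (start (val w)) (start X).
    rewrite o' /off_rel; move: m0 mL lLn; clear; move: (elen X) (offe X (val w)); lia.
  move=> X XD; rewrite s1 => o lX; have := off_relP (start (val w)) (start X).
  have [iX|iX] := boolP (nested X (val w)).
    case/nestedP: iX => _; rewrite LE -lX l1 /off_rel; move: o mL lLn; clear.
    by move: (offe X (val w)) (offe (val w) X); lia.
  have := out X XD iX; rewrite /outside LE -lX l1 /off_rel; move: o m0 mL lLn; clear.
  by move: (offe X (val w)) (offe (val w) X); lia.
have x2 : arrows c2 c1 = 0%N.
  rewrite /arrows rot0_no_arrow //; have := rotF hn (val c1) (val c2).
  rewrite o12 l1 l2 /rot_rel; move: m0 mL lLn; clear; move: (rot _ _) (tag _ == _); clear; intros; lia.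
have nw1 := w_in1 c1 p1; have nw2 := w_in2 c2 p2.
rewrite (restr_glue2 (x := c1) (y := c2)) ?(piece_root d1) ?(piece_root d2) ?nw1 ?nw2 //; try exact: piece_isolated.
exact: rooted2.
Qed.

Lemma piece_in_MA w : degenerate (val w) = false -> in_MA (@full_subquiver (Quiver arrows) (piece w)).
Proof.
move=> dw; apply: (rooted_in_MA (rooted_arc dw)) => i j iS jS.
by rewrite /restr iS jS.
Qed.

End Pieces.

(** * The four types *)

Section Degenerate.
Variable n : nat.
Hypothesis hn : (4 <= n)%N.
Local Notation edge := (tedge n).
Implicit Types (a b c : 'I_n) (M N X Y w : edge) (e : bool).
Local Notation offe M N := (off (start M) (start N)).
Variable D : {set edge}.
Hypothesis hD : {in D &, forall M N, compat M N}.
Hypothesis hmax : forall M, {in D, forall N, compat M N} -> M \in D.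

Lemma degP X : degenerate X -> X = Deg (start X) (tag X).
Proof. by case: X. Qed.

Lemma deg_arc_compat a e X : degenerate X = false -> compat (Deg a e) X ->
  off (start X) a = 0%N \/ (elen X <= off (start X) a + 1)%N.
Proof.
move=> dX; rewrite /compat dX /= addn1 => /orP[/eqP|]; auto.
Qed.

Lemma arc_deg_compat a e X : degenerate X = false ->
  off (start X) a = 0%N \/ (elen X <= off (start X) a + 1)%N -> compat (Deg a e) X.
Proof. by move=> dX; rewrite /compat dX /= addn1 => -[->|->]; rewrite ?orbT. Qed.

(** The tag matters only for degenerate edges at another vertex, so the flipped edge is compatible
    with [D]. *)
Lemma deg_flip a e : Deg a e \in D -> (forall b t, Deg b t \in D -> b = a) -> Deg a (~~ e) \in D.
Proof.
move=> aD h; apply: hmax => X XD; case dX: (degenerate X).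
  move: XD; rewrite (degP dX) => /h sX; rewrite /compat /= sX offxx eqxx //.
exact: (arc_deg_compat _ dX (deg_arc_compat dX (hD aD XD))).
Qed.

(** Otherwise all edges are arcs, and the start of a longest one is not strictly under any of them;
    a degenerate edge there is compatible with everything. *)
Lemma ex_deg : exists a e, Deg a e \in D.
Proof.
have [[b [e bD]]|nodeg] := EM (exists b e, Deg b e \in D); first by exists b, e.
have arcs X : X \in D -> degenerate X = false.
  by move=> XD; apply/negP => dX; case: nodeg; exists (start X), (tag X); rewrite -degP.
have [X0 X0D|D0] := pickP [in D]; last first.
  have lt : (0 < n)%N by apply: leq_trans hn.
  exists (Ordinal lt), true; apply: hmax => X XD.
  by have := D0 X; rewrite /= XD.
case: (@arg_maxnP _ X0 (fun X => X \in D) (fun X : edge => elen X) X0D) => M MD Mmax.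
exists (start M), true; apply: hmax => X XD; have dX := arcs X XD.
apply: (arc_deg_compat _ dX); have /(compatF hn) := hD MD XD; have := Mmax X XD.
have := off_relP (start M) (start X); move: (elen_arc dX) (elen_arc (arcs M MD)).
rewrite /off_rel /compat_rel /=; generalize (elen X) (elen M) (offe M X) (offe X M); clear; lia.
Qed.

Definition deg_points e := [set a | Deg a e \in D].

(** Both tags together force all degenerate edges to one vertex. With one tag only, a single
    degenerate edge could be flipped by [deg_flip], so there are at least two. *)
Lemma deg_double_or_same :
  (exists a, [/\ Deg a true \in D, Deg a false \in D & forall b t, Deg b t \in D -> b = a]) \/
  (exists e, (2 <= #|deg_points e|)%N /\ forall b t, Deg b t \in D -> t = e).
Proof.
have [a [e aD]] := ex_deg.
have [/existsP[b bD]|/existsPn no] := boolP [exists b, Deg b (~~ e) \in D].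
  left; have ab : b = a.
    by have := hD aD bD; rewrite /compat /= off_eq0; case: (eqVneq a b) => //= _; case: (e).
  rewrite {b}ab in bD.
  have [aT aF] : Deg a true \in D /\ Deg a false \in D by case: (e) aD bD.
  exists a; split => // b t bD'; apply/esym/eqP; rewrite -off_eq0.
  have := hD aT bD'; have := hD aF bD'; rewrite /compat /=.
  by case: (off a b == 0)%N => //=; case: t {bD'}.
right; exists e; have tE b t : Deg b t \in D -> t = e.
  by move=> bD; have := no b; case: (e) (t) bD => -[] // ->.
split => //; rewrite ltnNge; apply/negP => h.
have /negP[] := no a; apply: deg_flip => // b t bD; have te := tE b t bD; rewrite te in bD.
have /card_le1_eqP := h; apply; by rewrite inE.
Qed.

(** The arc from [x] to [y] is compatible with all of [D]: the hypothesis keeps degenerate edges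
    away from its inside, and an arc that crosses it would also cross the degenerate edge at [x] or
    at [y]. *)
Lemma ex_deg_arc x y e e' : Deg x e \in D -> Deg y e' \in D -> x <> y ->
  (forall z t, Deg z t \in D -> ~ (0 < off x z < off x y)%N) ->
  off x y = 1%N \/ exists2 w, w \in D & [/\ degenerate w = false, start w = x & elen w = (off x y).+1].
Proof.
move=> xD yD xy h; have L0 : (0 < off x y)%N.
  by rewrite lt0n off_eq0; apply/eqP.
have Ln := off_lt x y.
have [->|L1] := eqVneq (off x y) 1%N; [by left|right].
have [||w [dw sw lw]] := @ex_at n hn x 0 (off x y).+1.
- by apply: leq_trans hn.
- by move: L0 L1 Ln; clear; lia.
have {}sw : start w = x by apply/esym/eqP; rewrite -off_eq0 sw.
exists w => //; apply: hmax => X XD; case dX: (degenerate X).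
  have XE := degP dX; rewrite XE compat_sym; apply: arc_deg_compat => //.
  have := h (start X) (tag X); rewrite -XE sw lw => /(_ XD).
  by clear; move: (off x (start X)) (off x y); lia.
have c1 := deg_arc_compat dX (hD xD XD); have c2 := deg_arc_compat dX (hD yD XD).
apply/(compatF hn); rewrite sw lw.
move: (off_relP x (start X)) (off_relP y (start X)) (off_relP x y) (off_tri x y (start X)) (elen_arc dX) c1 c2.
rewrite /off_rel /compat_rel; move: L0 L1 Ln; move: (off x (start X)) (off (start X) x) (off y (start X))
  (off (start X) y) (off x y) (off y x) (elen X) (tag w == tag X); clear; intros; lia.
Qed.

Lemma rot_arc_deg w z e : degenerate w = false -> start w <> z -> rot w (Deg z e) = 0%N.
Proof.
move=> dw sz; have := rotF hn w (Deg z e); have := elen_arc dw.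
have : off (start w) z <> 0%N by move=> /eqP; rewrite off_eq0 => /eqP.
rewrite /rot_rel /=; move: (elen w) (off _ _) (rot _ _) (tag w == e); clear; intros; lia.
Qed.

Lemma rot_deg_arc w z e : degenerate w = false -> (off z (start w) + elen w <> n.+1)%N ->
  rot (Deg z e) w = 0%N.
Proof.
move=> dw sz; have := rotF hn (Deg z e) w; have := elen_arc dw; move: sz.
rewrite /rot_rel /=; move: (elen w) (off _ _) (rot _ _) (e == tag w); clear; intros; lia.
Qed.

(** The morphism passes from [w] to the degenerate edge at its start and from there to [w'], so it
    factors as soon as this edge is present. *)
Lemma turn_no_arrow w w' e : Deg (start w) e \in D -> degenerate w = false -> degenerate w' = false ->
  (off (start w) (start w') + elen w' = n.+1)%N -> arrowb D w w' = false.
Proof.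
move=> xD dw dw' h; apply: (no_arrow xD); right.
have lw := elen_arc dw; have lw' := elen_arc dw'.
have o0 : (0 < offe w w')%N by move: h lw'; clear; move: (elen w') (offe w w'); lia.
have lwn : (elen w <= n)%N by case/andP: lw.
have r1 := rot_turn hn o0 h lwn.
have r2 : rot w (Deg (start w) e) = (n.+1 - elen w)%N by rewrite (rot_start hn) //= offxx.
have r3 : rot (Deg (start w) e) w' = (n.+1 - elen w')%N by rewrite (rot_end hn).
rewrite r1 r2 r3; move: lw lw' h o0; clear.
by move: (elen w) (elen w') (offe w w'); split; lia.
Qed.

(* Degenerate edges at both ends of w keep the longer arcs that share an end with w out of the
   triangulation. *)
Lemma deg_arc_arrows w y e e' : w \in D -> degenerate w = false -> Deg (start w) e \in D ->
  Deg y e' \in D -> (off y (start w) + elen w = n.+1)%N ->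
  arrowb D (Deg y e') w /\ arrowb D w (Deg (start w) e).
Proof.
move=> wD dw xD yD h; have lw := elen_arc dw.
have oy := off_relP y (start w); have o0 : (0 < off y (start w))%N by move: h lw; clear; move: (elen w) (off _ _); lia.
split.
  apply: (end_arrow hn) => //= X XD o l lX.
  have dX : degenerate X = false.
    by rewrite degenerateE; apply/eqP => lE; move: l o; rewrite lE; clear; move: (off _ _); lia.
  have := deg_arc_compat dX (hD xD XD); have := off_relP (start w) (start X).
  have := off_relP y (start X); have := off_tri y (start X) (start w); move: oy o l lX h lw.
  rewrite /off_rel; move: (off y (start X)) (off y (start w)) (off (start X) y) (off (start w) y)
    (offe X w) (offe w X) (elen X) (elen w); clear; intros; lia.
apply: (start_arrow hn) => //=; rewrite ?offxx //; first by case/andP: lw.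
move=> X XD o /andP[lX lX'].
have dX : degenerate X = false by rewrite degenerateE; apply/eqP => lE; rewrite lE ltnn in lX'.
have sX : start X = start w by apply/esym/eqP; rewrite -off_eq0 o.
have := deg_arc_compat dX (hD yD XD); rewrite sX; move: oy h lw lX lX' o0.
rewrite /off_rel; move: (off y (start w)) (off (start w) y) (elen X) (elen w); clear; intros; lia.
Qed.

Lemma rot1_arrow M N : rot M N = 1%N -> arrowb D M N.
Proof. by move=> r; apply/arrowbP; rewrite r; split=> // X _; lia. Qed.

End Degenerate.

Section Types.
Variable n : nat.
Hypothesis hn : (4 <= n)%N.
Local Notation edge := (tedge n).
Implicit Types (a b : 'I_n) (M N X Y : edge) (e : bool).
Local Notation offe M N := (off (start M) (start N)).
Variable D : {set edge}.
Hypothesis hD : {in D &, forall M N, compat M N}.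
Hypothesis hmax : forall M, {in D, forall N, compat M N} -> M \in D.
Local Notation V := (elements D).
Implicit Types (u v w x y : V) (S : {set V}).
Local Notation q := (@arrows n D).

Definition elt X (XD : X \in D) : V := @exist edge (fun M => M \in D) X XD.

Lemma is_arcP X a b : degenerate X = false -> start X = a -> elen X = (off a b).+1 -> is_arc X a b.
Proof.
case: X => [[[c d] /= h]|//] _ /= ->; rewrite delta_lenE => -[] /off_inj ->.
by rewrite eqxx.
Qed.

(** Apart from [v1], [v2], [x], [y] every vertex lies in an isolated piece and has no arrows to its
    outside, so only a table with sixteen entries has to be checked. *)
Lemma additional_table S1 S2 v1 v2 x y (s : seq (V * V)) : isolated q S1 v1 -> isolated q S2 v2 ->
  vertex_partition S1 S2 x y -> v1 \in S1 -> v2 \in S2 ->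
  all (fun p => (p.1 \in [:: v1; v2; x; y]) && (p.2 \in [:: v1; v2; x; y])) s ->
  {in [:: v1; v2; x; y] &, forall i j, q i j = ((i, j) \in s)} -> additional_arrows q S1 S2 s.
Proof.
move=> iso1 iso2 [part _ _ _] v1S v2S /allP sP tab i j h1 h2.
have cov u : u \notin [:: v1; v2; x; y] -> (u \in S1) && (u != v1) || (u \in S2) && (u != v2).
  rewrite !inE !negb_or => /and4P[u1 u2 ux uy]; rewrite u1 u2 !andbT.
  by have := in_setT u; rewrite -part !inE (negbTE ux) (negbTE uy) !orbF.
have [i4|i4] := boolP (i \in [:: v1; v2; x; y]); last first.
  rewrite (_ : (i, j) \in s = false); last by apply: contraNF i4 => /sP /andP[].
  case/orP: (cov i i4) => /andP[iS ne].
    by have [] := iso1 i j iS ne _; first by apply: contraNN h1 => ->; rewrite iS.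
  by have [] := iso2 i j iS ne _; first by apply: contraNN h2 => ->; rewrite iS.
have [j4|j4] := boolP (j \in [:: v1; v2; x; y]); first exact: tab.
rewrite (_ : (i, j) \in s = false); last by apply: contraNF j4 => /sP /andP[].
case/orP: (cov j j4) => /andP[jS ne].
  by have [] := iso1 j i jS ne _; first by apply: contraNN h1 => ->; rewrite jS.
by have [] := iso2 j i jS ne _; first by apply: contraNN h2 => ->; rewrite jS.
Qed.

Lemma opposite_disjoint M N X : degenerate M = false -> degenerate N = false ->
  offe M N = (elen M).-1 -> offe N M = (elen N).-1 -> nested X M -> ~ nested X N.
Proof.
move=> d1 d2 o12 o21 /nestedP[du h1] /nestedP[_ h2].
have := elen_arc du; have := elen_arc d1; have := elen_arc d2.
have := off_relP (start M) (start N).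
have := off_relP (start M) (start X); have := off_relP (start N) (start X).
have := off_tri (start M) (start N) (start X); move: h1 h2; rewrite o12 o21 /off_rel.
generalize (elen X) (elen M) (elen N) (offe M X) (offe N X) (offe X M) (offe X N).
by clear; intros; lia.
Qed.

Lemma pieces_partition v1 v2 x y : degenerate (val v1) = false -> degenerate (val v2) = false ->
  degenerate (val x) -> degenerate (val y) ->
  (forall u, degenerate (val u) = (u == x) || (u == y)) ->
  (forall u, degenerate (val u) = false -> nested (val u) (val v1) || nested (val u) (val v2)) ->
  off (start (val v1)) (start (val v2)) = (elen (val v1)).-1 ->
  off (start (val v2)) (start (val v1)) = (elen (val v2)).-1 ->
  vertex_partition (piece v1) (piece v2) x y.
Proof.
move=> d1 d2 dx dy deg cov o12 o21; split.
- apply/setP => u; rewrite !inE; case du: (degenerate (val u)); first by rewrite -deg du !orbT.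
  by rewrite cov.
- rewrite disjoints_subset; apply/subsetP => u; rewrite !inE => n1; apply/negP.
  exact: (opposite_disjoint d1 d2 o12 o21 n1).
- by apply/pred0P => u /=; rewrite !inE -deg /nested; case: (degenerate _); rewrite /= ?andbF.
by apply/pred0P => u /=; rewrite !inE -deg /nested; case: (degenerate _); rewrite /= ?andbF.
Qed.

(** An arc of length [n] leaves room for degenerate edges at its two ends only, and every other arc
    lies under it. The two degenerate edges are a double at one end, or of the same tag at different
    ends. *)
Lemma type1P M : M \in D -> degenerate M = false -> elen M = n -> type1 q.
Proof.
move=> MD dM lM; pose m := elt MD.
have arcs X : X \in D -> degenerate X = false -> nested X M.
  move=> XD dX; apply/nestedP; split => //; have /(compatF hn) := hD MD XD.
  have := off_relP (start M) (start X); have := elen_arc dX; rewrite lM /off_rel /compat_rel.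
  by move: (elen X) (offe M X) (offe X M); clear -hn; lia.
have degs z e : Deg z e \in D -> off (start M) z = 0%N \/ off (start M) z = n.-1.
  move=> zD; have := deg_arc_compat dM (hD zD MD); have := off_lt (start M) z; rewrite lM.
  by clear -hn; move: (off _ _); lia.
have [N [L [NL degE]]] : exists N L : V, N != L /\ forall u, degenerate (val u) = (u == N) || (u == L).
  have [[a [aT aF tE]]|[e [P2 tE]]] := deg_double_or_same hn hD hmax.
    exists (elt aT), (elt aF); split; first by apply/eqP => /(f_equal val).
    move=> [X XD]; rewrite -!val_eqE /=; case dX: (degenerate X); last first.
      by apply/esym/negP => /orP[] /eqP XE; rewrite XE in dX.
    have XE := degP dX; rewrite XE in XD *; rewrite (tE _ _ XD).
    by case: (tag X); rewrite eqxx ?orbT.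
  have /card_gt1P[a [b [aP bP ab]]] := P2; rewrite !inE in aP bP.
  exists (elt aP), (elt bP); split.
    by apply/eqP => /(f_equal val) [] /eqP; rewrite (negbTE ab).
  move=> [X XD]; rewrite -!val_eqE /=; case dX: (degenerate X); last first.
    by apply/esym/negP => /orP[] /eqP XE; rewrite XE in dX.
  have XE := degP dX; rewrite XE in XD *; have te := tE _ _ XD; rewrite te in XD *.
  apply/esym/orP; have ab0 : off (start M) a <> off (start M) b by move=> /off_inj /eqP; rewrite (negbTE ab).
  have [oa|oa] := degs _ _ aP; have [ob|ob] := degs _ _ bP; have [ox|ox] := degs _ _ XD;
    try (by case: ab0; rewrite oa ob);
    by [left; rewrite (off_inj (etrans ox (esym oa))) | right; rewrite (off_inj (etrans ox (esym ob)))].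
have dN : degenerate (val N) by rewrite degE eqxx.
have dL : degenerate (val L) by rewrite degE eqxx orbT.
have inNL v : (v \in [:: N; L]) = degenerate (val v) by rewrite degE !inE.
have rot_M z e : Deg z e \in D -> off (start M) z = 0%N -> rot M (Deg z e) = 1%N /\ rot (Deg z e) M = 0%N.
  move=> zD o; rewrite (rot_start hn) ?lM //; split; first by rewrite /= subSnn.
  apply: (rot_deg_arc hn) => //; have -> : z = start M by apply/esym/eqP; rewrite -off_eq0 o.
  by rewrite offxx lM; clear; lia.
have rot_M' z e : Deg z e \in D -> off (start M) z = n.-1 -> rot M (Deg z e) = 0%N /\ rot (Deg z e) M = 1%N.
  move=> zD o; split.
    apply: (rot_arc_deg hn) => // e0; move: o; rewrite e0 offxx; clear -hn; lia.
  have o' : off z (start M) = 1%N.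
    by have := off_relP (start M) z; rewrite o /off_rel; clear -hn; move: (off z _); lia.
  have r := @rot_end n hn (Deg z e) M; rewrite /= o' lM in r; by rewrite r // subSnn.
exists m, N, L; split.
- by move: dM lM; rewrite /m /=; case: (M) => [[[c d] /= h]|//] _ l; exists c, d; rewrite eqxx.
- by split.
- move=> v; rewrite inNL => dv; have vE := degP dv; have vD := valP v; rewrite vE in vD.
  rewrite /arrows /= vE; have [o|o] := degs _ _ vD.
    have [r1 r2] := rot_M _ _ vD o; rewrite (rot1_arrow hn _ r1) rot0_no_arrow //.
  have [r1 r2] := rot_M' _ _ vD o; rewrite (rot1_arrow hn _ r2) rot0_no_arrow //.
- move=> v u; rewrite inNL => dv um; case du: (degenerate (val u)); last first.
    have uP : u \in piece m by rewrite inE /=; apply: arcs => //; apply: valP.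
    have vP : v \notin piece m by rewrite inE /nested dv.
    by have [-> ->] := @piece_isolated n hn D hD m dM u v uP um vP.
  (* Between degenerate edges at the ends of [M] the degree is 0, or it is 2 and splits over [M]. *)
  have no X Y : X \in D -> Y \in D -> degenerate X -> degenerate Y -> arrowb D X Y = false.
    move=> XD YD dX dY; have XE := degP dX; have YE := degP dY; rewrite XE in XD *; rewrite YE in YD *.
    set x := start X in XD *; set y := start Y in YD *.
    apply: (no_arrow MD); have rXY := rotF hn (Deg x (tag X)) (Deg y (tag Y)).
    have o3 := off_relP x y; have t := off_tri (start M) x y.
    have o1 := off_relP (start M) x; have o2 := off_relP (start M) y.
    have [ox|ox] := degs _ _ XD; have [oy|oy] := degs _ _ YD.
    + left; move: rXY t o3; rewrite /rot_rel /= ox oy /off_rel; clear -hn.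
      by move: (rot _ _) (off x y) (off y x) (tag X == tag Y); clear -hn; intros; lia.
    + left; move: rXY t o3; rewrite /rot_rel /= ox oy /off_rel; clear -hn.
      by move: (rot _ _) (off x y) (off y x) (tag X == tag Y); clear -hn; intros; lia.
    + have [_ r1] := rot_M' _ _ XD ox; have [r2 _] := rot_M _ _ YD oy.
      suff : (rot (Deg x (tag X)) (Deg y (tag Y)) = 0 \/ rot (Deg x (tag X)) (Deg y (tag Y)) = 2)%N.
        by rewrite r1 r2; case; auto; right.
      move: rXY t o3; rewrite /rot_rel /= ox oy /off_rel; clear -hn.
      by move: (rot _ _) (off x y) (off y x) (tag X == tag Y); clear -hn; intros; lia.
    left; move: rXY t o3; rewrite /rot_rel /= ox oy /off_rel; clear -hn.
    by move: (rot _ _) (off x y) (off y x) (tag X == tag Y); clear -hn; intros; lia.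
  by rewrite /arrows !no //; apply: valP.
have -> : ~: [set N; L] = piece m.
  apply/setP => u; rewrite !inE -degE; case du: (degenerate _); first by rewrite /nested du.
  by rewrite arcs //; apply: valP.
exact: (@piece_in_MA n hn D hD hmax m dM).
Qed.

End Types.

Section Types23.
Variable n : nat.
Hypothesis hn : (4 <= n)%N.
Local Notation edge := (tedge n).
Implicit Types (a b : 'I_n) (M N X Y : edge) (e : bool).
Local Notation offe M N := (off (start M) (start N)).
Variable D : {set edge}.
Hypothesis hD : {in D &, forall M N, compat M N}.
Hypothesis hmax : forall M, {in D, forall N, compat M N} -> M \in D.
Hypothesis short : {in D, forall M, degenerate M = false -> elen M <> n}.
Local Notation V := (elements D).
Implicit Types (u v w x y : V) (S : {set V}).
Local Notation q := (@arrows n D).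

Lemma short_no_edge : no_edge_of_length_n D.
Proof.
move=> M a b; have := @short (val M) (valP M); case: (val M) => [[[c d] /= h]|//] sh /eqP[<- <-].
by apply/eqP; apply: sh.
Qed.

Lemma distinct_table (v1 v2 x y : V) : degenerate (val v1) = false -> degenerate (val v2) = false ->
  degenerate (val x) -> degenerate (val y) -> x != y -> v1 != v2 ->
  ((v1 == v2 = false) * (v1 == x = false) * (v1 == y = false) * (v2 == v1 = false) *
   (v2 == x = false) * (v2 == y = false) * (x == v1 = false) * (x == v2 = false) *
   (x == y = false) * (y == v1 = false) * (y == v2 = false) * (y == x = false))%type.
Proof.
move=> d1 d2 dx dy /negbTE xy /negbTE v12.
have ne u v : degenerate (val u) = false -> degenerate (val v) -> (u == v = false) * (v == u = false).
  by move=> du dv; split; apply/eqP => e; move: du; [rewrite e dv|rewrite -e dv].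
by rewrite (eq_sym v2 v1) (eq_sym y x) v12 xy !(ne _ _ d1 dx) !(ne _ _ d1 dy) !(ne _ _ d2 dx) !(ne _ _ d2 dy).
Qed.

(** The polygon is cut open at [a], which turns it into a region of [n] steps without a base edge.
    The third vertex of its triangle is the vertex [b] of the double. *)
Lemma type2P a : Deg a true \in D -> Deg a false \in D -> (forall b t, Deg b t \in D -> b = a) ->
  type2 q.
Proof.
move=> aT aF tE; split; first exact: short_no_edge.
have region : {in D, forall X, inside a n X \/ forall Y, inside a n Y -> compat X Y}.
  move=> X XD; case dX: (degenerate X).
    right=> Y /insideP[dY iY]; have XE := degP dX; rewrite XE in XD *; rewrite (tE _ _ XD).
    apply: arc_deg_compat => //; have := off_relP a (start Y); have := elen_arc dY; move: iY; rewrite /off_rel; clear.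
    by move: (off a (start Y)) (off (start Y) a) (elen Y) => p1 p2 p3; lia.
  left; apply/insideP; split=> //; have := deg_arc_compat dX (hD aT XD).
  have := off_relP a (start X); have := elen_arc dX; rewrite /off_rel; clear.
  by move: (off a (start X)) (off (start X) a) (elen X) => p1 p2 p3; lia.
have [|m [/andP[m0 mn] c1P c2P tri]] := ex_third_vertex hn hD hmax (a := a) (L := n) _ region.
  by rewrite leqnn andbT; apply: leq_trans hn.
(* If one side were a boundary step, the other would have length [n], which [short] excludes. *)
have [c1 c1D [d1 s1 l1]] : exists2 c1, c1 \in D & [/\ degenerate c1 = false, start c1 = a & elen c1 = m.+1].
  case: c1P => // m1; case: c2P => [mn1|[c cD [dc sc lc]]].
    by exfalso; move: hn; rewrite -mn1 m1.
  by case: (short cD dc); rewrite lc m1 subn1 prednK //; apply: leq_trans hn.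
have [c2 c2D [d2 s2 l2]] : exists2 c2, c2 \in D & [/\ degenerate c2 = false, off a (start c2) = m & elen c2 = (n - m).+1].
  by case: c2P => // mn1; case: (short c1D d1); rewrite l1 mn1.
have inX X : X \in D -> degenerate X = false -> inside a n X.
  move=> XD dX; apply/insideP; split=> //; have := deg_arc_compat dX (hD aT XD).
  have := off_relP a (start X); have := elen_arc dX; rewrite /off_rel; clear.
  by move: (off a (start X)) (off (start X) a) (elen X) => p1 p2 p3; lia.
have triD X : X \in D -> degenerate X = false -> (off a (start X) + elen X <= m.+1 \/
    m <= off a (start X) /\ off a (start X) + elen X <= n.+1)%N.
  move=> XD dX; have iX := inX X XD dX; have [[_ l]|h|h] := tri X XD iX; [|by left|].
    by have := elen_arc dX; rewrite l ltnn andbF.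
  by right; split => //; case/insideP: iX.
pose v1 := elt c2D; pose v2 := elt c1D; pose x := elt aT; pose y := elt aF.
have o12 : offe c1 c2 = m by rewrite s1.
have o21 : offe c2 c1 = (n - m)%N by rewrite off_sym o12; case: eqP m0 => // ->.
have degE u : degenerate (val u) = (u == x) || (u == y).
  rewrite -!val_eqE /=; case du: (degenerate _); last first.
    by apply/esym/negP => /orP[] /eqP uE; rewrite uE in du.
  have uE := degP du; have uD : Deg (start (val u)) (tag (val u)) \in D by rewrite -uE; apply: valP.
  rewrite uE (tE _ _ uD).
  by case: (tag _); rewrite eqxx ?orbT.
have xy : x != y by apply/eqP => /(f_equal val).
have v12 : v1 != v2.
  by apply/eqP => /(f_equal (fun u : V => off a (start (val u)))) /=; rewrite s2 s1 offxx => e; rewrite e in m0.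
have part : vertex_partition (piece v1) (piece v2) x y.
  apply: pieces_partition => //=.
  - move=> u du; have lu := elen_arc du; have := triD _ (valP u) du; rewrite /nested du /= s1 l1 l2.
    case=> [->|[h1 h2]]; first by rewrite orbT.
    apply/orP; left; have := off_tri a (start c2) (start (val u)); rewrite s2.
    have := off_lt (start c2) (start (val u)); move: h1 h2 mn lu; clear.
    by move: (off a _) (off (start c2) _) (elen _) => p1 p2 p3; lia.
  - by rewrite o21 l2.
  by rewrite o12 l1.
exists a, (start c2), (piece v1), (piece v2), v1, v2, x, y.
have iso1 := @piece_isolated n hn D hD v1 d2; have iso2 := @piece_isolated n hn D hD v2 d1.
have r1 : v1 \in piece v1 by apply: piece_root. have r2 : v2 \in piece v2 by apply: piece_root.
split.
- by apply/eqP => e; move: s2; rewrite -e offxx => e0; rewrite -e0 in m0.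
- by split => //; split.
- right; split; apply: is_arcP => //=.
    by rewrite l2 off_sym s2; case: eqP m0 => // ->.
  by rewrite l1 s2.
- by split => //; [exact: (@piece_in_MA n hn D hD hmax v1 d2)|exact: (@piece_in_MA n hn D hD hmax v2 d1)].
have N := distinct_table (v1 := v1) (v2 := v2) (x := x) (y := y) d2 d1 erefl erefl xy v12.
apply: (additional_table iso1 iso2 part r1 r2); first by rewrite /= !inE !eqxx ?orbT.
have A1 e : Deg a e \in D -> arrowb D (Deg a e) c2 = true.
  move=> aD; apply: (end_arrow hn) => /=; rewrite ?s2 ?l2 //; first by rewrite addnS subnKC // ltnW.
  move=> X XD o l lX; have dX : degenerate X = false.
    by rewrite degenerateE; apply/eqP => lE; move: l o; rewrite lE; clear; move: (off _ _); lia.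
  by have := triD X XD dX; move: o l lX mn; clear; move: (off _ _) (elen X) => p1 p2; lia.
have A2 e : Deg a e \in D -> arrowb D c1 (Deg a e) = true.
  move=> aD; apply: (start_arrow hn) => /=; rewrite ?s1 ?offxx ?l1 //; try by (move: mn; clear; lia).
  move=> X XD o /andP[lX lX']; have dX : degenerate X = false by rewrite degenerateE; apply/eqP => lE; rewrite lE ltnn in lX'.
  have := triD X XD dX; rewrite o; move: lX m0; clear; move: (elen X) => p1; lia.
have A3 : arrowb D c2 c1 = true.
  apply: (turn_arrow hn); rewrite ?o21 ?l1 ?l2 ?subn_gt0 //.
  - by rewrite addnS subnK // ltnW.
  - by move: m0 mn; clear; lia.
  - exact: hD.
  - move=> X XD o lX; have sX : start X = start c2 by apply/esym/eqP; rewrite -off_eq0 o.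
    case dX: (degenerate X).
      have XE := degP dX; rewrite XE in XD; have e := tE _ _ XD; move: s2; rewrite -sX e offxx => e0.
      by rewrite -e0 in m0.
    have := triD X XD dX; rewrite sX s2; move: lX mn (elen_arc dX); clear; move: (elen X) => p; lia.
  move=> X XD; rewrite s1 => o lX; case dX: (degenerate X).
    by have XE := degP dX; rewrite XE in XD; have e := tE _ _ XD; rewrite e offxx in o.
  have := triD X XD dX; have := off_relP a (start X); move: o lX mn m0 (elen_arc dX); rewrite /off_rel; clear.
  by move: (off _ _) (off _ _) (elen X) => p1 p2 p; lia.
have B1 e : arrowb D c2 (Deg a e) = false.
  apply: rot0_no_arrow; apply: (rot_arc_deg hn) => // e0; move: s2; rewrite e0 offxx => e1; by rewrite -e1 in m0.
have B2 e : arrowb D (Deg a e) c1 = false.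
  by apply: rot0_no_arrow; apply: (rot_deg_arc hn) => //; rewrite s1 offxx l1; move: mn; clear; lia.
have B3 : arrowb D c1 c2 = false.
  apply: (turn_no_arrow hn (e := true)) => //; first by rewrite s1.
  by rewrite o12 l2 addnS subnKC // ltnW.
have B4 e e' : arrowb D (Deg a e) (Deg a e') = false.
  by apply: rot0_no_arrow; rewrite /rot /= offxx; case: ifP.
have B5 X : arrowb D X X = false by apply: rot0_no_arrow; apply: rotMM.
by move=> i j; rewrite !inE => /or4P[] /eqP-> /or4P[] /eqP->;
  rewrite !xpair_eqE ?eqxx ?N /arrows /v1 /v2 /x /y /= ?A1 ?A2 ?A3 ?B1 ?B2 ?B3 ?B4 ?B5.
Qed.

(** If this morphism is non-zero, it factors through the arc [w] from [y] to [x]: shortening at the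
    end [x], then lengthening at the start [y]. *)
Lemma deg_deg_no_arrow (x y : 'I_n) e (w : edge) : w \in D -> degenerate w = false -> start w = y ->
  elen w = (off y x).+1 -> arrowb D (Deg x e) (Deg y e) = false.
Proof.
move=> wD dw sw lw; apply: (no_arrow wD); have lw3 := elen_arc dw.
have oo := off_relP y x.
have r1 := @rot_end n hn (Deg x e) w; have r2 := @rot_start n hn w (Deg y e).
have := rotF hn (Deg x e) (Deg y e); rewrite /= sw lw offxx in r1 r2 lw3 *.
have {}r2 : rot w (Deg y e) = (n - off y x)%N.
  by rewrite r2 //; move: oo lw3; rewrite /off_rel; clear; move: (off _ _) (off _ _); lia.
have {}r1 : rot (Deg x e) w = (n - off y x)%N.
  by rewrite r1 //; move: oo lw3; rewrite /off_rel; clear; move: (off _ _) (off _ _); lia.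
rewrite r1 r2; have [->|r0] := posnP (rot (Deg x e) (Deg y e)); first by left.
move=> r; right; move: oo lw3 r0 r; rewrite /off_rel /rot_rel; clear.
by move: (rot _ _) (off y x) (off x y) (e == e) => p1 p2 p3 p4; clear; intros; split; lia.
Qed.

Lemma type3P e : #|deg_points D e| = 2%N -> (forall b t, Deg b t \in D -> t = e) -> type3 q.
Proof.
move=> P2 tE; split; first exact: short_no_edge.
have /cards2P[a [b [ab Pab]]] : #|deg_points D e| == 2%N by rewrite P2.
have aD : Deg a e \in D by have := set21 a b; rewrite -Pab inE.
have bD : Deg b e \in D by have := set22 a b; rewrite -Pab inE.
have degs z t : Deg z t \in D -> z = a \/ z = b.
  move=> zD; have te := tE _ _ zD; rewrite te in zD.
  have : z \in deg_points D e by rewrite inE.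
  by rewrite Pab !inE => /orP[]/eqP; auto.
have ba : b != a by rewrite eq_sym.
have oo := off_relP a b; have o0 : off a b <> 0%N by move/eqP; rewrite off_eq0 (negbTE ab).
have oab : (off a b + off b a = n)%N by move: oo o0; rewrite /off_rel; clear; lia.
have nob z t : Deg z t \in D -> ~ (0 < off a z < off a b)%N.
  by case/degs=> ->; rewrite ?offxx ?ltnn ?andbF.
have noa z t : Deg z t \in D -> ~ (0 < off b z < off b a)%N.
  by case/degs=> ->; rewrite ?offxx ?ltnn ?andbF.
have arc_ab := ex_deg_arc hn hD hmax aD bD (elimN eqP ab) nob.
have arc_ba := ex_deg_arc hn hD hmax bD aD (elimN eqP ba) noa.
(* If [a] and [b] were neighbors, the arc on the other side would have length [n], which [short]
   excludes. *)
have [o1|[w2 w2D [d2 s2 l2]]] := arc_ab.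
  have [o1'|[w wD [d s l]]] := arc_ba; first by exfalso; move: hn; move: oab; rewrite o1 o1'; clear; lia.
  by case: (short wD d); rewrite l; move: oab; rewrite o1 add1n.
have [o1'|[w1 w1D [d1 s1 l1]]] := arc_ba; first by case: (short w2D d2); rewrite l2; move: oab; rewrite o1' addn1.
pose v1 := elt w1D; pose v2 := elt w2D; pose x := elt aD; pose y := elt bD.
have degE u : degenerate (val u) = (u == x) || (u == y).
  rewrite -!val_eqE /=; case du: (degenerate _); last first.
    by apply/esym/negP => /orP[] /eqP uE; rewrite uE in du.
  have uE := degP du; have uD : Deg (start (val u)) (tag (val u)) \in D by rewrite -uE; apply: valP.
  by rewrite uE (tE _ _ uD); have [->|->] := degs _ _ uD; rewrite eqxx ?orbT.
have xy : x != y by apply/eqP => /(f_equal val) [] /eqP; rewrite (negbTE ab).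
have v12 : v1 != v2.
  by apply/eqP => /(f_equal (fun u : V => start (val u))) /=; rewrite s1 s2 => /eqP; rewrite (negbTE ba).
have part : vertex_partition (piece v1) (piece v2) x y.
  apply: pieces_partition => //=.
  - move=> u du; have lu := elen_arc du; have uD := valP u.
    have ca := deg_arc_compat du (hD aD uD); have cb := deg_arc_compat du (hD bD uD).
    rewrite /nested du /= s1 s2 l1 l2; move: ca cb lu oab (off_relP a (start (val u))) (off_relP b (start (val u))) (off_tri a b (start (val u))).
    rewrite /off_rel; move: (start _) (elen _) => z l; move: (off a b) (off b a) (off a z) (off z a) (off b z) (off z b); clear.
    by intros; lia.
  - by rewrite s1 s2 l1.
  by rewrite s1 s2 l2.
exists a, b, e, (piece v1), (piece v2), v1, v2, x, y.
have iso1 := @piece_isolated n hn D hD v1 d1; have iso2 := @piece_isolated n hn D hD v2 d2.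
have r1 : v1 \in piece v1 by apply: piece_root. have r2 : v2 \in piece v2 by apply: piece_root.
split.
- split=> //; rewrite /neighbors delta_lenE; apply/negP => /orP[/eqP h|/eqP h].
    by have := elen_arc d2; rewrite l2 h.
  have := elen_arc d1; rewrite l1; move: oab h; clear; lia.
- by split => //; split.
- by right; split; apply: is_arcP.
- by split => //; [exact: (@piece_in_MA n hn D hD hmax v1 d1)|exact: (@piece_in_MA n hn D hD hmax v2 d2)].
have N := distinct_table (v1 := v1) (v2 := v2) (x := x) (y := y) d1 d2 erefl erefl xy v12.
apply: (additional_table iso1 iso2 part r1 r2); first by rewrite /= !inE !eqxx ?orbT.
have [A1 A2] : arrowb D (Deg a e) w1 /\ arrowb D w1 (Deg b e).
  have := @deg_arc_arrows n hn D hD w1 a e e w1D d1; rewrite s1; apply => //.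
  by rewrite l1 addnS oab.
have [A3 A4] : arrowb D (Deg b e) w2 /\ arrowb D w2 (Deg a e).
  have := @deg_arc_arrows n hn D hD w2 b e e w2D d2; rewrite s2; apply => //.
  by rewrite l2 addnS addnC oab.
have B1 : arrowb D w1 (Deg a e) = false.
  by apply: rot0_no_arrow; apply: (rot_arc_deg hn) => //; rewrite s1; apply/eqP.
have B2 : arrowb D w2 (Deg b e) = false.
  by apply: rot0_no_arrow; apply: (rot_arc_deg hn) => //; rewrite s2; apply/eqP.
have lts := (off_lt a b, off_lt b a).
have B3 : arrowb D (Deg a e) w2 = false.
  by apply: rot0_no_arrow; apply: (rot_deg_arc hn) => //; rewrite s2 offxx l2 add0n => -[h]; have := off_lt a b; rewrite h ltnn.
have B4 : arrowb D (Deg b e) w1 = false.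
  by apply: rot0_no_arrow; apply: (rot_deg_arc hn) => //; rewrite s1 offxx l1 add0n => -[h]; have := off_lt b a; rewrite h ltnn.
have B5 : arrowb D w1 w2 = false.
  apply: (turn_no_arrow hn (e := e)) => //; first by rewrite s1.
  by rewrite s1 s2 l2 addnS addnC oab.
have B6 : arrowb D w2 w1 = false.
  apply: (turn_no_arrow hn (e := e)) => //; first by rewrite s2.
  by rewrite s1 s2 l1 addnS oab.
have B7 : arrowb D (Deg a e) (Deg b e) = false by apply: (deg_deg_no_arrow e w1D).
have B8 : arrowb D (Deg b e) (Deg a e) = false by apply: (deg_deg_no_arrow e w2D).
have B9 X : arrowb D X X = false by apply: rot0_no_arrow; apply: rotMM.
by move=> i j; rewrite !inE => /or4P[] /eqP-> /or4P[] /eqP->;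
  rewrite !xpair_eqE ?eqxx ?N /arrows /v1 /v2 /x /y /= ?A1 ?A2 ?A3 ?A4 ?(B1, B2, B3, B4, B5, B6, B7, B8, B9).
Qed.

End Types23.

Lemma enum_val_ltn n (A : {set 'I_n}) (i j : 'I_#|A|) : (enum_val i < enum_val j)%N = (i < j)%N.
Proof.
pose r (x y : 'I_n) := (x < y)%N.
have s : sorted r (enum A).
  rewrite {1}/enum_mem; apply: sorted_filter; first by move=> x y z; apply: ltn_trans.
  have := iota_ltn_sorted 0 n; rewrite -val_enum_ord sorted_map enumT; exact: sub_sorted.
have mono (i' j' : 'I_#|A|) : (i' < j')%N -> (enum_val i' < enum_val j')%N.
  move=> ij; have x0 := enum_val i'; rewrite !(enum_val_nth x0).
  apply: (sorted_ltn_nth (leT := r)) => //; first by move=> x y z; apply: ltn_trans.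
  - by rewrite inE -cardE ltn_ord.
  - by rewrite inE -cardE ltn_ord.
apply/idP/idP => [h|]; last exact: mono.
rewrite ltnNge; apply/negP; rewrite leq_eqVlt => /orP[/eqP/val_inj e|/mono h'].
  by rewrite e ltnn in h.
by move: h h'; clear; lia.
Qed.

(** * Three or more degenerate edges *)

Section Type4.
Variable n : nat.
Hypothesis hn : (4 <= n)%N.
Local Notation edge := (tedge n).
Implicit Types (a b x y z : 'I_n) (M N X Y : edge) (e : bool).
Local Notation offe M N := (off (start M) (start N)).
Variable D : {set edge}.
Hypothesis hD : {in D &, forall M N, compat M N}.
Hypothesis hmax : forall M, {in D, forall N, compat M N} -> M \in D.
Local Notation V := (elements D).
Local Notation q := (@arrows n D).
Variable e : bool.
Local Notation P := (deg_points D e).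
Hypothesis tE : forall b t, Deg b t \in D -> t = e.

Definition consecutive x y := [/\ x \in P, y \in P, x != y &
  {in P, forall z, z != x -> z != y -> (off x y < off x z)%N}].

Hypothesis P3 : (3 <= #|P|)%N.

Lemma third_point x y : exists z, [/\ z \in P, z != x & z != y].
Proof.
have : (0 < #|P :\: [set x; y]|)%N.
  rewrite cardsD subn_gt0; apply: leq_ltn_trans (subset_leq_card (subsetIr _ _)) _.
  by rewrite cards2; apply: leq_trans P3; case: (_ != _).
by move=> /card_gt0P[z]; rewrite !inE negb_or => /andP[/andP[zx zy] zP]; exists z; rewrite inE.
Qed.

(** The third point lies beyond [y], which makes the rotation from [x] to [y] short enough to be
    non-zero. *)
Lemma consecutive_off x y : consecutive x y -> (0 < off x y <= n - 2)%N.
Proof.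
move=> [_ _ xy h]; have [z [zP zx zy]] := third_point x y.
have := h z zP zx zy; have := off_lt x z; have : off x y <> 0%N by move/eqP; rewrite off_eq0 (negbTE xy).
by clear; move: (off x y) (off x z); lia.
Qed.

Lemma consecutive_arrow x y : consecutive x y -> arrowb D (Deg x e) (Deg y e).
Proof.
move=> c; have /andP[L0 L2] := consecutive_off c; have [xP yP xy h] := c.
have r : rot (Deg x e) (Deg y e) = (off x y).*2 by rewrite /rot /= eqxx L2.
apply/arrowbP; rewrite r double_gt0; split=> // X XD.
case/(rotP hn) => [_ dX _ /= o1 ->|//|dX /= o1 l1 ->|//].
  case/(rotP hn) => [_ _ _ /= o2 ->|dX'|//|dX']; try by rewrite dX' in dX.
  have XE := degP dX; rewrite XE in XD; have te := tE XD; rewrite te in XD.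
  have sP : start X \in P by rewrite inE.
  move=> r2; have sx : start X != x by apply: contraTneq o1 => ->; rewrite offxx.
  have sy : start X != y by apply: contraTneq o2 => ->; rewrite offxx.
  by have := h _ sP sx sy; move: o2 r2; clear; move: (off _ _) (off _ _) (off _ _); lia.
case/(rotP hn) => [dX'|_ /= o2 l2 ->|//|//]; first by rewrite dX' in dX.
have sX : start X = y by apply/eqP; rewrite -off_eq0 o2.
move=> r2; have [z [zP zx zy]] := third_point x y; rewrite inE in zP.
have := deg_arc_compat dX (hD zP XD); have hz : (off x y < off x z)%N by apply: h; rewrite ?inE.
have o0 : off y z <> 0%N by move/eqP; rewrite off_eq0 eq_sym (negbTE zy).
rewrite sX in o1 l1 *; have := off_tri x y z; have := off_lt x z; have := off_lt y z; move: l1 hz o0; clear.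
by move: (off x y) (off x z) (off y z) (elen X); lia.
Qed.

(** A rotation from [x] beyond the next point [y] passes through [y], and the degrees of rotations
    add up. *)
Lemma not_consecutive_arrow x y z : consecutive x y -> z \in P -> z != y ->
  arrowb D (Deg x e) (Deg z e) = false.
Proof.
move=> c zP zy; have /andP[L0 L2] := consecutive_off c; have [xP yP xy h] := c.
have [->|zx] := eqVneq z x; first by apply: rot0_no_arrow; rewrite /rot /= offxx; case: ifP.
rewrite inE in yP; apply: (no_arrow yP); have hz := h z zP zx zy.
have o : (off y z + off x y = off x z)%N.
  by have := off_tri x y z; have := off_lt x z; have := off_lt y z; move: hz; clear; lia.
have [le|gt] := leqP (off x z) (n - 2); last by left; rewrite /rot /= eqxx leqNgt gt.
right; rewrite /rot /= eqxx /= le L2 (_ : off y z <= n - 2)%N; last by move: o le; clear; lia.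
by split; move: o hz L0; clear; lia.
Qed.

Lemma consecutive_inj x x' y : consecutive x y -> consecutive x' y -> x = x'.
Proof.
move=> c c'; have [xP yP xy h] := c; have [xP' _ xy' h'] := c'.
apply/eqP/negPn/negP => xx; have x'x : x' != x by rewrite eq_sym.
have := h x' xP' x'x xy'; have := h' x xP xx xy.
have := off_relP x x'; have := off_tri x x' y; have := off_tri x' x y; have := off_lt x y; have := off_lt x' y.
by rewrite /off_rel; clear; move: (off x x') (off x' x) (off x y) (off x' y); intros; lia.
Qed.

Lemma regions_disjoint x y x' y' X : consecutive x y -> consecutive x' y' -> x != x' ->
  inside x (off x y) X -> ~ inside x' (off x' y') X.
Proof.
move=> [xP yP xy h] [xP' yP' xy' h'] xx /insideP[dX i1] /insideP[_ i2].
have x'x : x' != x by rewrite eq_sym.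
have h1 : (off x y <= off x x')%N.
  by have [->//|ne] := eqVneq x' y; apply: ltnW; apply: h.
have h2 : (off x' y' <= off x' x)%N.
  by have [->//|ne] := eqVneq x y'; apply: ltnW; apply: h'.
have := off_relP x x'; have := off_tri x x' (start X); have := off_lt x (start X); have := off_lt x' (start X).
move: i1 i2 h1 h2 (elen_arc dX); rewrite /off_rel; clear.
by move: (off x x') (off x' x) (off x y) (off x' y') (off x (start X)) (off x' (start X)) (elen X); intros; lia.
Qed.

Lemma region_cover X : X \in D -> degenerate X = false -> (forall x, x \in P -> exists y, consecutive x y) ->
  exists x y, consecutive x y /\ inside x (off x y) X.
Proof.
move=> XD dX nxt; have [x0 x0P] : exists x, x \in P.
  by have /card_gt0P[x xP] : (0 < #|P|)%N by [apply: leq_trans P3]; exists x.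
(* The last point of [P] at or before the start of [X]; the degenerate edge at the next point stops
   [X] from reaching further. *)
case: (@arg_minnP _ x0 (fun x => x \in P) (fun x => off x (start X)) x0P) => x xP xmin.
have [y c] := nxt x xP; exists x, y; split => //; have [_ yP xy h] := c.
apply/insideP; split => //; have := xmin y yP; rewrite inE in yP.
have := deg_arc_compat dX (hD yP XD); have := consecutive_off c; have := elen_arc dX.
have := off_tri x y (start X); have := off_relP y (start X); have := off_lt x (start X).
rewrite /off_rel; clear; move: (off x y) (off x (start X)) (off y (start X)) (off (start X) y) (elen X).
by intros; lia.
Qed.

(** The points are numbered clockwise, because the arrows of the quiver run against the
    counterclockwise rotations. In this numbering the central cycle runs from i to i + 1. *)
Definition base (i : 'I_#|P|) : 'I_n := enum_val (rev_ord i).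

Lemma baseP i : Deg (base i) e \in D.
Proof. by have := enum_valP (rev_ord i); rewrite inE. Qed.

Lemma base_inP i : base i \in P. Proof. exact: enum_valP. Qed.

Lemma base_inj : injective base.
Proof. by move=> i j /enum_val_inj /rev_ord_inj. Qed.

Lemma base_onto x : x \in P -> exists i, x = base i.
Proof.
move=> xP; exists (rev_ord (enum_rank_in xP x)).
by rewrite /base rev_ordK enum_rankK_in.
Qed.

Lemma base_consecutive i : consecutive (base (ordS i)) (base i).
Proof.
have t3 := P3; have io := ltn_ord i; have ioS := ltn_ord (ordS i).
have SE := ordSE i.
have ne : ordS i != i.
  apply/eqP => h; move: SE; rewrite h; case: eqP => h'; move: h' io t3; clear; lia.
split; [exact: base_inP|exact: base_inP|by rewrite (inj_eq base_inj)|].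
move=> z /base_onto[j ->]; rewrite !(inj_eq base_inj) => ji jS.
have jo := ltn_ord j; rewrite !offE.
have aux (t k l : nat) : (k < t -> l < t -> (t - k.+1 < t - l.+1) = (l < k))%N.
  by clear; lia.
have lt k l : (base k < base l)%N = (l < k)%N.
  by rewrite /base enum_val_ltn /=; apply: aux; apply: ltn_ord.
have le k l : (base k <= base l)%N = (l <= k)%N by rewrite leqNgt lt -leqNgt.
have ji' : (j : nat) <> ordS i by move=> /val_inj h; rewrite h eqxx in ji.
have jS' : (j : nat) <> i by move=> /val_inj h; rewrite h eqxx in jS.
have b1 := lt j i; have b2 := lt i j; have b3 := lt j (ordS i); have b4 := lt (ordS i) j.
rewrite !le; have := ltn_ord (base i); have := ltn_ord (base j); have := ltn_ord (base (ordS i)).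
move: SE b1 b2 b3 b4 ji' jS' jo io; clear; move: (base i) (base j) (base (ordS i)) => bi bj bs.
by move: (ordS i) => si; do 3!case: ifP; lia.
Qed.

End Type4.

Section Type4.
Variable n : nat.
Hypothesis hn : (4 <= n)%N.
Local Notation edge := (tedge n).
Implicit Types (a b x y z : 'I_n) (M N X Y : edge) (e : bool).
Local Notation offe M N := (off (start M) (start N)).
Variable D : {set edge}.
Hypothesis hD : {in D &, forall M N, compat M N}.
Hypothesis hmax : forall M, {in D, forall N, compat M N} -> M \in D.
Local Notation V := (elements D).
Local Notation q := (@arrows n D).

Section SameTag.
Variable e : bool.
Local Notation P := (deg_points D e).
Hypothesis tE : forall b t, Deg b t \in D -> t = e.
Hypothesis P3 : (3 <= #|P|)%N.
Local Notation base := (@base n D e).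
Local Notation consecutive := (@consecutive n D e).

Definition region_set (i : 'I_#|P|) : {set V} :=
  [set u | inside (base (ordS i)) (off (base (ordS i)) (base i)) (val u)].

(** A region that contains an arc spans at least two steps, so its base is not a boundary step and
    [ex_deg_arc] gives the base arc. *)
Lemma region_root i (u : V) : u \in region_set i -> exists w : V, [/\ degenerate (val w) = false,
  start (val w) = base (ordS i), elen (val w) = (off (base (ordS i)) (base i)).+1 & region_set i = piece w].
Proof.
have c := base_consecutive P3 i; have [xP yP xy h] := c.
move: xy => /eqP xy; rewrite inE => /insideP[du iu].
have nob z t : Deg z t \in D -> ~ (0 < off (base (ordS i)) z < off (base (ordS i)) (base i))%N.
  move=> zD; have te := tE zD; rewrite te in zD; have zP : z \in P by rewrite inE.
  have [->|zx] := eqVneq z (base (ordS i)); first by rewrite offxx.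
  have [->|zy] := eqVneq z (base i); first by rewrite ltnn andbF.
  by have := h z zP zx zy; clear; lia.
have [o1|[w wD [dw sw lw]]] := ex_deg_arc hn hD hmax (baseP _) (baseP _) xy nob.
  by exfalso; move: iu (elen_arc du); rewrite o1; clear; move: (off _ _) (elen _); lia.
exists (elt wD); split => //; apply/setP => u'; rewrite !inE (nested_inside hn) /= sw lw //.
Qed.

Theorem type4P : type4 q.
Proof.
pose v (i : 'I_#|P|) : V := elt (baseP i).
have cons := base_consecutive P3.
have dv i : degenerate (val (v i)) by [].
have ordS_pred (j : 'I_#|P|) : ordS (ord_pred j) = j by apply: ord_predK.
have degE (M : V) : degenerate (val M) -> exists i, M = v i.
  move=> dM; have ME := degP dM; have MD : Deg (start (val M)) (tag (val M)) \in D by rewrite -ME; apply: valP.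
  have te := tE MD; rewrite te in MD ME; have sP : start (val M) \in P by rewrite inE.
  have [i iE] := base_onto sP; exists i; apply: val_inj; rewrite /= ME iE //.
have v_notin i j : v j \notin region_set i by rewrite inE /inside.
have disj i j u : i != j -> u \in region_set i -> u \notin region_set j.
  move=> ij; rewrite !inE => ui; apply/negP; apply: (regions_disjoint (cons i) (cons j) _ ui).
  by rewrite (inj_eq (@base_inj n D e)) (inj_eq (can_inj (@fintype.ordSK _))).
exists #|P|, v, base, region_set; split.
- by split => // i j /(f_equal val) [] /base_inj.
- split.
  + by move=> i; exists e.
  + exact: degE.
  move=> i j; rewrite /arrows /=; case: eqVneq => [->|ji]; first by rewrite consecutive_arrow.
  have cj := cons (ord_pred j); rewrite ordS_pred in cj.
  rewrite (not_consecutive_arrow P3 cj) ?base_inP //.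
  by rewrite (inj_eq (@base_inj n D e)); apply: contra ji => /eqP ->; rewrite ordS_pred.
- split.
  + move=> i j ij; rewrite disjoints_subset; apply/subsetP => u ui; rewrite inE; exact: (disj i j u).
  + exact: v_notin.
  move=> M; case dM: (degenerate (val M)); [left; exact: degE|right].
  have nxt x : x \in P -> exists y, consecutive x y.
    by move=> /base_onto[j ->]; exists (base (ord_pred j)); have := cons (ord_pred j); rewrite ordS_pred.
  have [x [y [c ins]]] := region_cover hD P3 (valP M) dM nxt.
  have [xP yP _ _] := c; have [i yi] := base_onto yP; exists i; rewrite inE.
  have ci := cons i; rewrite -yi in ci.
  by rewrite -yi -(consecutive_inj c ci).
- move=> i; have c := cons i; have /andP[L0 L2] := consecutive_off P3 c.
  have oo := off_relP (base (ordS i)) (base i).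
  case: ifP => [nb|nb].
    apply/setP => u; rewrite !inE; apply/negP => /insideP[du iu].
    move: nb; rewrite /neighbors !delta_lenE => nb; move: (elen_arc du) iu nb oo L0 L2.
    rewrite /off_rel; clear; move: (off (base (ordS i)) (base i)) (off (base i) (base (ordS i))) (off _ _) (elen _).
    by move=> p1 p2 p3 p4; lia.
  have o1 : off (base (ordS i)) (base i) <> 1%N.
    move=> h; move: nb oo; rewrite /neighbors !delta_lenE h /off_rel; clear; move: (off _ _) => p; lia.
  have [xP yP xy h] := c; move: (xy) => /eqP xy'; rewrite !inE in xP yP.
  have nob z t : Deg z t \in D -> ~ (0 < off (base (ordS i)) z < off (base (ordS i)) (base i))%N.
    move=> zD; have te := tE zD; rewrite te in zD; have zP : z \in P by rewrite inE.
    have [->|zx] := eqVneq z (base (ordS i)); first by rewrite offxx.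
    have [->|zy] := eqVneq z (base i); first by rewrite ltnn andbF.
    by have := h z zP zx zy; clear; lia.
  have [//|[w0 w0D [d0 s0 l0]]] := ex_deg_arc hn hD hmax xP yP xy' nob.
  have w0in : elt w0D \in region_set i by rewrite inE; apply/insideP; rewrite /= s0 offxx l0.
  have [w [dw sw lw pw]] := region_root w0in.
  have iso := @piece_isolated n hn D hD w dw; have wS := piece_root dw; rewrite -pw in iso wS.
  have pm := @piece_in_MA n hn D hD hmax w dw; rewrite -pw in pm.
  exists w; split => //; first by right; apply: is_arcP.
  have sum : (off (base i) (start (val w)) + elen (val w) = n.+1)%N.
    rewrite sw lw; move: oo L0; rewrite /off_rel; clear; move: (off _ _) (off _ _); lia.
  have [A1 A2] : arrowb D (Deg (base i) e) (val w) /\ arrowb D (val w) (Deg (base (ordS i)) e).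
    have := @deg_arc_arrows n hn D hD (val w) (base i) e e (valP w) dw; rewrite sw; apply => //.
    by rewrite -sw.
  move=> u j uS; have [->|uw] := eqVneq u w; last first.
    by have [-> ->] := iso u (v j) uS uw (v_notin i j).
  split; rewrite /arrows /=.
    have [->|ji] := eqVneq j i; first by rewrite A1.
    rewrite rot0_no_arrow //; apply: (rot_deg_arc hn) => // h'; case/negP: ji.
    apply/eqP; apply: (@base_inj n D e); have : off (start (val w)) (base j) = off (start (val w)) (base i).
      move: h' sum (off_relP (base j) (start (val w))) (off_relP (base i) (start (val w))); rewrite /off_rel; clear.
      by move: (off (base j) _) (off _ (base j)) (off (base i) _) (off _ (base i)) (elen _); intros; lia.
    exact: off_inj.
  have [->|ji] := eqVneq j (ordS i); first by rewrite A2.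
  rewrite rot0_no_arrow //; apply: (rot_arc_deg hn) => //; rewrite sw => /base_inj h'.
  by rewrite h' eqxx in ji.
move=> i j u w ij ui wj.
have [wi [di si li pi]] := region_root ui; have [wj0 [dj sj lj pj]] := region_root wj.
have isoi := @piece_isolated n hn D hD wi di; have isoj := @piece_isolated n hn D hD wj0 dj.
rewrite -pi in isoi; rewrite -pj in isoj.
have ji : j != i by rewrite eq_sym.
have [uE|ne] := eqVneq u wi; last by have [] := isoi u w ui ne (disj _ _ _ ji wj).
have [wE|ne] := eqVneq w wj0; last by have [] := isoj w u wj ne (disj _ _ _ ij ui).
rewrite uE wE /arrows; have [h|h] := eqVneq (offe (val wj0) (val wi) + elen (val wi))%N n.+1.
  by rewrite (turn_no_arrow hn (e := e)) // sj; apply: baseP.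
have ci := cons i; have cj := cons j; have [_ _ _ hj] := cj.
have /andP[Li _] := consecutive_off P3 ci.
have ne : base (ordS i) != base (ordS j) by rewrite (inj_eq (@base_inj n D e)) (inj_eq (can_inj (@fintype.ordSK _))).
have le : (off (base (ordS j)) (base j) <= off (base (ordS j)) (base (ordS i)))%N.
  have [->//|ne'] := eqVneq (base (ordS i)) (base j); apply: ltnW; apply: hj => //; exact: base_inP.
rewrite rot0_no_arrow //; have := rotF hn (val wj0) (val wi); have := elen_arc di; have := elen_arc dj.
rewrite sj si in h *; rewrite lj li in h *; move: h le Li.
have : off (base (ordS j)) (base (ordS i)) <> 0%N by move/eqP; rewrite off_eq0 eq_sym (negbTE ne).
rewrite /rot_rel; clear.
by move: (rot _ _) (off (base (ordS i)) _) (off (base (ordS j)) (base j)) (off _ _) (tag _ == tag _); clear; intros; lia.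
Qed.

End SameTag.

Theorem triangulation_types : [\/ type1 q, type2 q, type3 q | type4 q].
Proof.
have [[M [MD dM lM]]|no] := EM (exists M, [/\ M \in D, degenerate M = false & elen M = n]).
  by constructor 1; apply: (type1P hn hD hmax MD dM lM).
have short : {in D, forall M, degenerate M = false -> elen M <> n}.
  by move=> M MD dM lM; apply: no; exists M.
have [[a [aT aF tE]]|[e [P2 tE]]] := deg_double_or_same hn hD hmax.
  by constructor 2; apply: (type2P hn hD hmax short aT aF tE).
have [P2'|P2'] := eqVneq #|deg_points D e| 2%N.
  by constructor 3; apply: (type3P hn hD hmax short P2' tE).
constructor 4; apply: (type4P tE); by rewrite ltn_neqAle eq_sym P2'.
Qed.

End Type4.

Local Open Scope ring_scope.

(** * Transport of quivers to the cluster category and conclusion *)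

Lemma linear_inverse (k : fieldType) (U W : lmodType k) (f : {linear U -> W}) : bijective f ->
  exists g : {linear W -> U}, cancel f g /\ cancel g f.
Proof.
move=> [g fK gK]; have lin : linear g.
  by move=> a x y; apply: (can_inj fK); rewrite linearP !gK.
by exists (HB.pack g (GRing.isLinear.Build _ _ _ _ g lin) : {linear W -> U}).
Qed.

Lemma conjugation (k : fieldType) (C : lincat k) (X Y : C) (u : hom X Y) (v : hom Y X) :
  exists F : {linear hom X X -> hom Y Y}, forall f, F f = u ** f ** v.
Proof.
have lin : linear (fun f : hom X X => u ** f ** v).
  by move=> a x y; rewrite cmpDr cmpDl cmpZr cmpZl.
by exists (HB.pack (fun f : hom X X => u ** f ** v)
  (GRing.isLinear.Build _ _ _ _ (fun f : hom X X => u ** f ** v) lin) : {linear hom X X -> hom Y Y}).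
Qed.

Lemma iso_quiver (k : fieldType) (C : lincat k) (X Y : C) (I : finType) (e : I -> hom X X) q :
  isomorphic X Y -> has_quiver_at (idm X) (@endop_mul _ _ X) e q ->
  exists e', has_quiver_at (idm Y) (@endop_mul _ _ Y) (I := I) e' q.
Proof.
move=> /isomorphicP[u [v [vu uv]]].
have [F FE] := conjugation u v; have [G GE] := conjugation v u.
have FG : cancel F G by move=> f; rewrite GE FE !cmpA vu cmp1m -cmpA vu cmpm1.
have GF : cancel G F by move=> f; rewrite GE FE !cmpA uv cmp1m -cmpA uv cmpm1.
move=> h; exists (F \o e); apply: (transport_quiver FG GF _ _ h).
  by rewrite FE cmpm1 uv.
by move=> g f; rewrite !FE !cmpA -(cmpA (u ** g) v u) vu cmpm1.
Qed.

Lemma functor_quiver (k : fieldType) (C C' : lincat k) (phi : functor C C') (X : C) (I : finType)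
    (e : I -> hom X X) q : bijective (@fmap _ _ _ phi X X) ->
  has_quiver_at (idm X) (@endop_mul _ _ X) e q ->
  has_quiver_at (idm (phi X)) (@endop_mul _ _ (phi X)) (fun i => fmap phi (e i)) q.
Proof.
move=> /linear_inverse[G [FG GF]] h.
by apply: (transport_quiver FG GF _ _ h); [apply: fmap1|move=> g f; apply: fmapM].
Qed.

Lemma functor_quiverV (k : fieldType) (C C' : lincat k) (phi : functor C C') (X : C) (I : finType)
    (e : I -> hom (phi X) (phi X)) q : bijective (@fmap _ _ _ phi X X) ->
  has_quiver_at (idm (phi X)) (@endop_mul _ _ (phi X)) e q ->
  exists e', has_quiver_at (idm X) (@endop_mul _ _ X) (I := I) e' q.
Proof.
move=> bij h; have [G [FG GF]] := linear_inverse bij; exists (G \o e).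
apply: (transport_quiver GF FG _ _ h); first by rewrite -(fmap1 phi) FG.
by move=> g f; apply: (bij_inj bij); rewrite fmapM !GF.
Qed.

Theorem theorem3p5 (R : realType) (k : fieldType) (n : nat) (hn : (4 <= n)%N)
    (H : algType k) (hH : hereditary_of_type_D n H) (c : cluster_data H)
    (phi : functor (tagged_edges n k) (cluster_category c))
    (hphi : is_schiffler_equivalence R phi)
    (T : cluster_category c) (hT : basic_tilting n T)
    (Q : quiver) (hQ : has_quiver (idm T) (@endop_mul _ _ T) Q) :
  [\/ belongs_to (@type1 n) R phi Q, belongs_to (@type2 n) R phi Q,
      belongs_to (@type3 n) R phi Q | belongs_to (@type4 n) R phi Q].
Proof.
have [phi_eq phi_tau _] := hphi.
have [D [cD iso hD]] := tilting_edges hn phi_eq phi_tau hT.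
have bij := phi_eq.1 (edges_object k D) (edges_object k D).
(* The idempotents of T are carried to the endomorphisms of the sum of the edges of [D], where
   [quiver_unique] compares them with the projections. *)
have [e /(iso_quiver iso)[e1 /(functor_quiverV bij)[e2 /(quiver_unique hn hD)[s [sb sE]]]]] := hQ.
have QD : is_quiver_of_triangulation phi (@arrows n D).
  exact: (functor_quiver bij (quiver_of_Delta k hn hD)).
have tD : triangulation R D := compat_triangulation hn hphi hD cD.
have isoQ : quiver_iso Q (Quiver (@arrows n D)) by exists s.
have := triangulation_types hn hD (fun M => compat_maximal hn hphi hD cD).
by case=> t; [constructor 1|constructor 2|constructor 3|constructor 4]; exists D, (@arrows n D).
Qed.
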